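(* Let $k\ge n-1$. (1) There are canonical bijections $$\mathbb S_{(-\infty,0)}(t_0)\longleftrightarrow\mathbb S_0(t_0)\longleftrightarrow\mathbb S_{(0,1)}(t_0).$$ (2) There is a canonical bijection $$\mathbb S_{(1,\infty)}(t_0)\longleftrightarrow\mathbb H_0(t_0).$$ Here $\mathbb S_I(t_0)$ (resp. $\mathbb S_0(t_0)$, $\mathbb H_0(t_0)$) denotes the set of germs at $t_0$ of families of constant curvature $c\in I$ (resp. curvature zero) maps with flat normal bundle into the sphere $\mathbb S^{n+k}$ (resp. $\mathbb S^{n+k}$, hyperbolic space $\mathbb H^{n+k}$).
   Context: Setting. $U$ is a contractible open subset of $\mathbb R^n$ with basepoint $t_0$. $\{e_i\}$ is the standard basis of $\mathbb R^{n+k+1}$. $J=\mathrm{diag}(I_{n},-1,I_{k})$, $P=\mathrm{diag}(I_n,-I_{k+1})$, $Q=\mathrm{diag}(I_{n+1},-I_k)$, $T=\mathrm{diag}(iI_n,1,iI_k)$. $G=SO(n+k+1,\mathbb C)$, $H=SO_{-1}(n+k+1,\mathbb C)=\{X: X^TJX=J,\ \det X=1\}$. Constant curvature maps. An adapted frame for $f:U\to\mathbb S^{n+k}$ is $F:U\to SO(n+k+1,\mathbb R)$ whose $(n+1)$'st column is $f$ and such that $\mathrm df$ has no component in the directions of the last $k+1$ columns. Write $F^{-1}\mathrm dF=\begin{pmatrix}\omega&\hat\beta\\-\hat\beta^T&\eta\end{pmatrix}$ with $\omega$ $n\times n$, $\hat\beta=[\theta\ \beta]$, $\theta$ an $n\times1$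 column. $f$ is a constant curvature $c$ map with flat normal bundle if it has an adapted frame with $\mathrm d\omega+\omega\wedge\omega=c\,\theta\wedge\theta^T$ and $\mathrm d\eta+\eta\wedge\eta=0$ (immersivity is not required). Maps into $\mathbb H^{n+k}$ are treated analogously, replacing $SO(n+k+1)$ by $SO_{-1}(n+k+1)$. Loop group description. For $K=G$ or $H$, $\Lambda K$ is the group of loops $X:\mathbb S^1\to K$ with absolutely convergent Fourier series. Define the involutions $(\sigma X)(\lambda)=PX(-\lambda)P^{-1}$, $(\tau X)(\lambda)=QX(1/\lambda)Q^{-1}$, and the reality conditions $\mathbf R_j$, meaning invariance under $\rho_j$, with $(\rho_1X)(\lambda)=\overline{X(-\bar\lambda)}$, $(\rho_2X)(\lambda)=\overline{X(\bar\lambda)}$, $(\rho_{-1}X)(\lambda)=\overline{X(1/\bar\lambda)}$ (i.e. $X(\lambda)$ real for $\lambda$ in $i\mathbb R^*$, $\mathbb R^*$, $\mathbb S^1$ respectively). Subscripts $\sigma,\tau$ and superscript $\mathbf R_j$ denote fixed-point subgroups; $\mathcal H^\circ$ is the subgroup of constant loops of $\mathcal H$. $\mathcal H(U)_a^b$ is the set of smooth $F:U\to\mathcal H$ with $F^{-1}\mathrm dF=\sum_{i=a}^bA_i\lambda^i$; $\frac{\mathcal H}{\mathcal H^\circ}(U)_{-1}^1$ is the set of maps to the quotient (cosets under right multiplication) with local lifts in $\mathcal H(W)_{-1}^1$; based at $t_0$ means equal to (the class of) $I$ at $t_0$. Put $I_1=(-\infty,0)$, $I_2=(0,1)$, $I_{-1}=(1,\infty)$.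 $\mathbb S_{I_j}(U,t_0)$ is the set of families of constant curvature $c\in I_j$ maps $f:U\to\mathbb S^{n+k}$ with flat normal bundle with $f(t_0)=e_{n+1}$, and $\mathbb S_0(U,t_0)$ the analogous set for flat ($c=0$) maps. These sets are identified with loop group valued maps by taking $f^\lambda$ to be the $(n+1)$'st column of $F$: $\mathbb S_0(U,t_0)$ with the elements of $\Lambda G_\sigma^{\mathbf R_j}(U)_1^1$ based at $t_0$ (for either choice $j=1,2$; the two descriptions are related by replacing $\lambda$ by $i\lambda$), and $\mathbb S_{I_j}(U,t_0)$ with the elements of $\frac{\mathcal H}{\mathcal H^\circ}(U)_{-1}^1$ based at $t_0$, $\mathcal H=\Lambda G_{\sigma\tau}^{\mathbf R_j}$, $j=1,2,-1$, where $f^\lambda$ has curvature $c^\lambda=4/(\lambda+\lambda^{-1})^2$. Likewise $\mathbb H_0(U,t_0)$ (flat maps into $\mathbb H^{n+k}$) is identified with the elements of $\Lambda H_\sigma^{\mathbf R_j}(U)_1^1$ based at $t_0$, $j=1,2$. Germs. $\mathbb S_0(t_0):=\big(\bigcup_U\mathbb S_0(U,t_0)\big)/\sim$, the union over all neighbourhoods $U$ of $t_0$, two maps being equivalent if they agree on some neighbourhood of $t_0$; $\mathbb S_{I_j}(t_0)$ and $\mathbb H_0(t_0)$ are defined in the same way. Canonical. The canonical bijections are those induced by the right Birkhoff splitting of a based frame near $t_0$: $F=F_+F_-$, with $F_+$ (resp. $F_-$) extending holomorphically in $\lambda$ to the unit disc (resp. to the complement in the Riemann sphere of the closed unit disc)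 and $F_+|_{\lambda=0}=I$. One sends the class $[F]$ to $F_+$ (in part (1), $F_+\in\Lambda G_\sigma^{\mathbf R_j}(W)_1^1$), followed in part (2) by $F_+\mapsto TF_+T^{-1}\in\Lambda H_\sigma^{\mathbf R_1}(W)_1^1$. *)

(* Defs.v *)
From HB Require Import structures.
From mathcomp Require Import all_boot all_order all_algebra.
From mathcomp Require Import complex.
From mathcomp Require Import all_classical all_reals all_analysis.
Import Order.TTheory GRing.Theory Num.Theory.
Import numFieldNormedType.Exports.

Set Implicit Arguments.
Unset Strict Implicit.
Unset Printing Implicit Defensive.

Local Open Scope classical_set_scope.
Local Open Scope ring_scope.
Local Open Scope complex_scope.

(* [R[i]] as a [numClosedFieldType], the structure through which it carries its
   topology. *)
Notation cplx R := (complex_complex__canonical__Num_ClosedField R).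

Section L1.
Variables (R : realType) (V : normedModType R).
Implicit Types a b : int -> V.

Definition l1_norme a : \bar R := \esum_(m in [set: int]) (`|a m|)%:E.

Definition l1_pred : {pred (int -> V)} := fun a => `[< (l1_norme a < +oo)%E >].

Lemma l1_norme_ge0 a : (0 <= l1_norme a)%E.
Proof. by apply: esum_ge0 => m _; rewrite lee_fin. Qed.

Lemma l1_norme_le a b : (forall m, `|a m| <= `|b m|) ->
  (l1_norme a <= l1_norme b)%E.
Proof. by move=> ab; apply: le_esum => m _; rewrite lee_fin. Qed.

Lemma l1_norme0 : l1_norme (fun=> 0) = 0%E.
Proof. by apply: esum1 => m _; rewrite normr0. Qed.

Lemma l1_normeD a b :
  (l1_norme (fun m => a m + b m)%R <= l1_norme a + l1_norme b)%E.
Proof.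
rewrite /l1_norme -esumD => [|? _|? _]; rewrite ?lee_fin//.
by apply: le_esum => m _; rewrite -EFinD lee_fin ler_normD.
Qed.

Lemma l1_normeZ_le (c : R) a : c != 0 ->
  (l1_norme (fun m => c *: a m)%R <= `|c|%:E * l1_norme a)%E.
Proof.
move=> c0; apply: ge_ereal_sup => _ [A [finA _] <-].
rewrite (eq_fsbigr (fun m => `|c|%:E * `|a m|%:E)%E); last first.
  by move=> m _; rewrite normrZ EFinM.
rewrite -ge0_mule_fsumr; last by move=> m; rewrite lee_fin.
by apply: lee_wpmul2l; [rewrite lee_fin|apply: ereal_sup_ubound; exists A].
Qed.

Lemma l1_normeZ (c : R) a :
  l1_norme (fun m => c *: a m) = (`|c|%:E * l1_norme a)%E.
Proof.
have [->|c0] := eqVneq c 0.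
  rewrite normr0 mul0e -[RHS]l1_norme0; congr l1_norme.
  by apply/funext => m; rewrite scale0r.
apply/eqP; rewrite eq_le l1_normeZ_le//=.
have c'0 : c^-1 != 0 by rewrite invr_eq0.
have := l1_normeZ_le (fun m => c *: a m) c'0.
under [X in l1_norme X]eq_fun do rewrite scalerA mulVf// scale1r.
move=> h; apply: (le_trans (lee_wpmul2l _ h)); first by rewrite lee_fin.
by rewrite muleA -EFinM -normrM mulfV// normr1 mul1e.
Qed.

Lemma l1_submod_closed : submod_closed l1_pred.
Proof.
split=> [|c a b /asboolP fa /asboolP fb]; apply/asboolP.
  by rewrite l1_norme0 ltry.
apply: le_lt_trans (l1_normeD _ _) _.
by rewrite l1_normeZ lte_add_pinfty// lte_mul_pinfty// lee_fin.
Qed.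

HB.instance Definition _ := GRing.isSubmodClosed.Build R (int -> V) l1_pred
  l1_submod_closed.

Record l1 := L1 { l1_val :> int -> V; l1_valP : l1_val \in l1_pred }.

HB.instance Definition _ := [isSub for l1_val].
HB.instance Definition _ := [Choice of l1 by <:].
HB.instance Definition _ := [SubChoice_isSubLmodule of l1 by <:].

Definition l1_norm (a : l1) : R := fine (l1_norme a).

Lemma l1_normE (a : l1) : (l1_norm a)%:E = l1_norme a.
Proof.
rewrite /l1_norm fineK// ge0_fin_numE ?l1_norme_ge0//.
by have /asboolP := l1_valP a.
Qed.

Lemma ler_l1_normD (a b : l1) : l1_norm (a + b) <= l1_norm a + l1_norm b.
Proof. by rewrite -lee_fin EFinD !l1_normE; exact: l1_normeD. Qed.

Lemma l1_normZ (c : R) (a : l1) : l1_norm (c *: a) = `|c| * l1_norm a.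
Proof. by apply: EFin_inj; rewrite EFinM !l1_normE; exact: l1_normeZ. Qed.

Lemma l1_norm0_eq0 (a : l1) : l1_norm a = 0 -> a = 0.
Proof.
move=> a0; apply/val_inj/funext => m /=; apply/normr0_eq0/eqP.
rewrite eq_le normr_ge0 andbT -lee_fin -[leRHS](congr1 EFin a0) l1_normE.
by rewrite -(@esum_set1 _ _ m (fun m => `|a m|%:E)) ?lee_fin//;
  apply: esum_ge; exists [set m] => //; rewrite esum_set1 ?lee_fin// fsbig_set1.
Qed.

HB.instance Definition _ := Lmodule_isNormed.Build R l1
  ler_l1_normD l1_normZ l1_norm0_eq0.

End L1.
Arguments l1 {R} V.

Section Smooth.
Variables (R : realType) (n : nat) (V : normedModType R).
Implicit Types (U : set 'rV[R]_n) (f : 'rV[R]_n -> V).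

Fixpoint Cr (r : nat) U f : Prop :=
  (forall t, U t -> {for t, continuous f}) /\
  (if r is r'.+1 then
     forall v : 'rV[R]_n,
       (forall t, U t -> derivable f t v) /\ Cr r' U (fun t => 'D_v f t)
   else True).

Definition smooth U f := forall r, Cr r U f.

End Smooth.

Definition contractible (R : realType) (n : nat) (U : set 'rV[R]_n) :=
  exists (h : R * 'rV[R]_n -> 'rV[R]_n) (t1 : 'rV[R]_n),
  [/\ U t1,
      {within [set p | 0 <= p.1 <= 1 /\ U p.2], continuous h} &
      forall t, U t -> [/\ h (0, t) = t, h (1, t) = t1 &
        forall s : R, 0 <= s <= 1 -> U (h (s, t))]].

Definition based_domain (R : realType) (n : nat) (t0 : 'rV[R]_n) : set (set 'rV[R]_n) :=
  [set U | [/\ open U, contractible U & U t0]].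

(* The germ of [f] at [t0], as an equivalence class of total functions: the
   values of [f] away from [t0] are irrelevant. *)
Definition germ (R : realType) (n : nat) (T : Type) (t0 : 'rV[R]_n)
    (f : 'rV[R]_n -> T) : set ('rV[R]_n -> T) :=
  [set g | \forall t \near t0, g t = f t].

Definition germs (R : realType) (n : nat) (T : Type) (t0 : 'rV[R]_n)
    (S : set 'rV[R]_n -> set ('rV[R]_n -> T)) : set (set ('rV[R]_n -> T)) :=
  [set g | exists U f, S U f /\ g = germ t0 f].

Inductive space := Sphere | Hyperbolic.

(* The reality conditions R_1, R_2 and R_{-1}. *)
Inductive reality := R1 | R2 | Rm1.

Section BlockMatrices.
Variables (F : nzRingType) (n k : nat).

Definition Jmx : 'M[F]_(n + (1 + k)) :=
  block_mx 1%:M 0 0 (block_mx (-1)%:M 0 0 1%:M).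
Definition Pmx : 'M[F]_(n + (1 + k)) := block_mx 1%:M 0 0 (-1)%:M.
Definition Qmx : 'M[F]_(n + (1 + k)) :=
  block_mx 1%:M 0 0 (block_mx 1%:M 0 0 (-1)%:M).

Definition form (s : space) : 'M[F]_(n + (1 + k)) :=
  if s is Sphere then 1%:M else Jmx.

(* The index of the (n+1)'st column. *)
Definition mid : 'I_(n + (1 + k)) := rshift n (lshift k ord0).

Definition base_point : 'cV[F]_(n + (1 + k)) := delta_mx mid 0.

End BlockMatrices.
Arguments Jmx F n k : clear implicits.
Arguments Pmx F n k : clear implicits.
Arguments Qmx F n k : clear implicits.
Arguments form F n k : clear implicits.
Arguments mid n k : clear implicits.
Arguments base_point F n k : clear implicits.

Definition Tmx (R : realType) (n k : nat) : 'M[cplx R]_(n + (1 + k)) :=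
  block_mx ('i)%:M 0 0 (block_mx 1%:M 0 0 ('i)%:M).

(* SO(n+k+1, F) and SO_{-1}(n+k+1, F). *)
Definition SO (F : comUnitRingType) (n k : nat) (s : space) :
    set 'M[F]_(n + (1 + k)) :=
  [set X | X^T *m form F n k s *m X = form F n k s /\ \det X = 1].

Section ConstantCurvature.
Variables (R : realType) (n k : nat).
Implicit Types (s : space) (c : R) (U : set 'rV[R]_n).
Local Notation M := 'M[R]_(n + (1 + k)).

Definition model s : set 'cV[R]_(n + (1 + k)) :=
  if s is Sphere then [set x | x^T *m x = 1%:M]
  else [set x | x^T *m Jmx R n k *m x = (-1)%:M /\ 0 < x (mid n k) 0].

(* F^{-1} dF at the point t, applied to the tangent vector v; a matrix-valued
   1-form is a function of a point and a tangent vector. *)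
Definition maurer_cartan (F : 'rV[R]_n -> M) (t v : 'rV[R]_n) : M :=
  invmx (F t) *m 'D_v F t.

Definition omega F t v : 'M[R]_n := ulsubmx (maurer_cartan F t v).
Definition beta_hat F t v : 'M[R]_(n, 1 + k) := ursubmx (maurer_cartan F t v).
Definition theta F t v : 'cV[R]_n := lsubmx (beta_hat F t v).
Definition eta F t v : 'M[R]_(1 + k) := drsubmx (maurer_cartan F t v).

Definition ext_d (p q : nat) (a : 'rV[R]_n -> 'rV[R]_n -> 'M[R]_(p, q))
    (t u v : 'rV[R]_n) : 'M[R]_(p, q) :=
  'D_u (fun x => a x v) t - 'D_v (fun x => a x u) t.

Definition wedge (p q r : nat) (a : 'rV[R]_n -> 'rV[R]_n -> 'M[R]_(p, q))
    (b : 'rV[R]_n -> 'rV[R]_n -> 'M[R]_(q, r))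
    (t u v : 'rV[R]_n) : 'M[R]_(p, r) :=
  a t u *m b t v - a t v *m b t u.

Definition adapted_frame s U (f : 'rV[R]_n -> 'cV[R]_(n + (1 + k)))
    (F : 'rV[R]_n -> M) :=
  [/\ smooth U F,
      forall t, U t -> SO s (F t),
      forall t, U t -> col (mid n k) (F t) = f t &
      forall t v, U t -> dsubmx (invmx (F t) *m 'D_v f t) = 0].

Definition const_curvature s c U (f : 'rV[R]_n -> 'cV[R]_(n + (1 + k))) :=
  (forall t, U t -> model s (f t)) /\
  exists F, [/\ adapted_frame s U f F,
    forall t u v, U t ->
      ext_d (omega F) t u v + wedge (omega F) (omega F) t u v =
      c *: wedge (theta F) (fun x w => (theta F x w)^T) t u v &
    forall t u v, U t ->
      ext_d (eta F) t u v + wedge (eta F) (eta F) t u v = 0].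

End ConstantCurvature.

Section Loops.
Variables (R : realType) (n k : nat).
Local Notation C := (cplx R).
Local Notation M := 'M[C]_(n + (1 + k)).

(* A loop with absolutely convergent Fourier series is represented by the
   sequence of its Fourier coefficients, each stored as the pair of its real
   and imaginary parts; the l^1 norm is the norm of the Wiener algebra. *)
Definition wiener : normedModType R :=
  l1 ('M[R]_(n + (1 + k)) * 'M[R]_(n + (1 + k)))%type.

Definition fcoef (X : wiener) (m : int) : M :=
  \matrix_(i, j) (((X : l1 _) m).1 i j +i* ((X : l1 _) m).2 i j).

(* The sum of the Fourier series of [X] at [z]. For [z] off the unit circle
   this is the value at [z] of the analytic continuation of the loop, provided
   the Laurent series converges. *)
Definition ev (X : wiener) (z : C) : M :=
  \matrix_(i, j)
    (limn (series (fun m => fcoef X m%:Z i j * z ^+ m : C)) +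
     limn (series (fun m => fcoef X (- m.+1%:Z) i j * z ^- m.+1 : C))).

Implicit Types (g : C -> M) (X : wiener) (H : set wiener) (j : reality)
  (U W : set 'rV[R]_n).

Definition circ_eq g1 g2 := forall z : C, `|z| = 1 -> g1 z = g2 z.

Definition sigma g : C -> M :=
  fun z => Pmx C n k *m g (- z) *m invmx (Pmx C n k).

Definition tau g : C -> M :=
  fun z => Qmx C n k *m g z^-1 *m invmx (Qmx C n k).

Definition conj_mx (A : M) : M := map_mx (@conjc R) A.

Definition rho j g : C -> M :=
  match j with
  | R1 => fun z => conj_mx (g (- conjc z))
  | R2 => fun z => conj_mx (g (conjc z))
  | Rm1 => fun z => conj_mx (g (conjc z)^-1)
  end.

Definition loop_group (s : space) : set wiener :=
  [set X | forall z : C, `|z| = 1 -> SO s (ev X z)].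

Definition loops_sigma s j : set wiener :=
  [set X | [/\ loop_group s X, circ_eq (sigma (ev X)) (ev X) &
              circ_eq (rho j (ev X)) (ev X)]].

Definition loops_sigma_tau s j : set wiener :=
  loops_sigma s j `&` [set X | circ_eq (tau (ev X)) (ev X)].

Definition constant_loops H : set wiener :=
  H `&` [set X | exists A, circ_eq (ev X) (fun=> A)].

Definition coset H X : set wiener :=
  [set Y | exists2 K, constant_loops H K &
             circ_eq (ev Y) (fun z => ev X z *m ev K z)].

(* The smooth maps F : U -> H such that F^{-1} dF is a Laurent polynomial in
   the loop parameter, with exponents from a to b. *)
Definition frames H (a b : int) U : set ('rV[R]_n -> wiener) :=
  [set F | [/\ smooth U F, forall t, U t -> H (F t) &
    forall t v, U t -> exists A : nat -> M,
      circ_eq (fun z => invmx (ev (F t) z) *m ev ('D_v F t) z)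
        (fun z => \sum_(m < `|b - a|.+1) z ^ (a + m%:Z) *: A m)]].

Definition quotient_frames H (a b : int) U : set ('rV[R]_n -> set wiener) :=
  [set Phi | forall t, U t -> exists W F,
    [/\ open W, W t, W `<=` U, frames H a b W F &
        forall s, W s -> Phi s = coset H (F s)]].

Definition based t0 : set ('rV[R]_n -> wiener) :=
  [set F | circ_eq (ev (F t0)) (fun=> 1%:M)].

(* The class of the identity is the subgroup of constant loops. *)
Definition quotient_based H t0 : set ('rV[R]_n -> set wiener) :=
  [set Phi | Phi t0 = constant_loops H].

(* The points at which the elements of a loop group with reality condition
   R_j take real values. *)
Definition real_locus j : set C :=
  match j with
  | R1 => [set z : C | complex.Re z = 0 /\ z != 0]
  | R2 => [set z : C | complex.Im z = 0 /\ z != 0]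
  | Rm1 => [set z : C | `|z| = 1]
  end.

Definition curvature (z : C) : R := complex.Re (4%:R / (z + z^-1) ^+ 2).

Definition curvature_range j : set R :=
  match j with
  | R1 => [set c | c < 0]
  | R2 => [set c | 0 < c < 1]
  | Rm1 => [set c | 1 < c]
  end.

(* The family f^z is the (n+1)'st column of X at z. *)
Definition column_at X (z : C) (x : 'cV[R]_(n + (1 + k))) :=
  col (mid n k) (ev X z) = map_mx (real_complex R) x.

(* Germ representatives for S_0 (s = Sphere) and H_0 (s = Hyperbolic), in
   their description with reality condition R_j. The frame is part of the data:
   the frame of a map which is not an immersion is not unique. *)
Definition flat_family s j t0 U : set ('rV[R]_n -> wiener) :=
  [set F | [/\ based_domain t0 U, frames (loops_sigma s j) 1 1 U F, based t0 F &
    exists f : C -> 'rV[R]_n -> 'cV[R]_(n + (1 + k)),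
      forall z, real_locus j z ->
      [/\ const_curvature s 0 U (f z), f z t0 = base_point R n k &
          forall t, U t -> column_at (F t) z (f z t)]]].

(* At values of z where z + z^-1 = 0, [curvature] is the junk value 0, which
   lies in none of the ranges. The constant loops in H have an entry 1 or -1 in
   the middle, so the column of a representative is determined by its class up
   to a sign, which is fixed by continuity and the value at t0; whence the
   choice of a representative X for each t. *)
Definition curved_family j t0 U : set ('rV[R]_n -> set wiener) :=
  [set Phi | let H := loops_sigma_tau Sphere j in
   [/\ based_domain t0 U, quotient_frames H (-1) 1 U Phi, quotient_based H t0 Phi &
    exists f : C -> 'rV[R]_n -> 'cV[R]_(n + (1 + k)),
      (forall z, real_locus j z -> curvature_range j (curvature z) ->
         const_curvature Sphere (curvature z) U (f z) /\
         f z t0 = base_point R n k) /\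
      (forall t, U t -> exists2 X, Phi t X &
         forall z, real_locus j z -> curvature_range j (curvature z) ->
           column_at X z (f z t))]].

(* The function G is a holomorphic extension of the boundary values g. *)
Definition extends_to_disc g (G : C -> M) :=
  [/\ {within [set z : C | `|z| <= 1], continuous G},
      forall z : C, `|z| < 1 -> derivable G z 1 &
      circ_eq G g].

Definition right_birkhoff (F Fp Fm : wiener) :=
  [/\ loop_group Sphere Fp /\ loop_group Sphere Fm,
      circ_eq (ev F) (fun z => ev Fp z *m ev Fm z),
      exists2 G, extends_to_disc (ev Fp) G & G 0 = 1%:M &
      (* the coordinate 1/z maps the complement of the disc to the disc *)
      exists G, extends_to_disc (fun z => ev Fm z^-1) G].

Definition birkhoff_plus j (t0 : 'rV[R]_n) (Phi : 'rV[R]_n -> set wiener) W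
    (Fp : 'rV[R]_n -> wiener) :=
  let H := loops_sigma_tau Sphere j in
  exists F Fm, [/\ frames H (-1) 1 W F, based t0 F,
    forall t, W t -> Phi t = coset H (F t) &
    forall t, W t -> right_birkhoff (F t) (Fp t) (Fm t)].

(* The description of a flat map with reality condition R_1 is turned into the
   one with reality condition R_2 by the substitution z -> i z. *)
Definition to_R2 j g : C -> M :=
  if j is R1 then fun z => g ('i * z) else g.

Definition canonical_flat j t0
    (B : set ('rV[R]_n -> set wiener) -> set ('rV[R]_n -> wiener)) :=
  forall U Phi, curved_family j t0 U Phi ->
  exists W Fp F0,
    [/\ birkhoff_plus j t0 Phi W Fp,
        frames (loops_sigma Sphere j) 1 1 W Fp,
        flat_family Sphere R2 t0 W F0,
        forall t, W t -> circ_eq (ev (F0 t)) (to_R2 j (ev (Fp t))) &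
        B (germ t0 Phi) = germ t0 F0].

Definition canonical_hyperbolic t0
    (B : set ('rV[R]_n -> set wiener) -> set ('rV[R]_n -> wiener)) :=
  forall U Phi, curved_family Rm1 t0 U Phi ->
  exists W Fp F0,
    [/\ birkhoff_plus Rm1 t0 Phi W Fp,
        flat_family Hyperbolic R1 t0 W F0,
        forall t, W t -> circ_eq (ev (F0 t))
          (fun z => Tmx R n k *m ev (Fp t) z *m invmx (Tmx R n k)) &
        B (germ t0 Phi) = germ t0 F0].

End Loops.

Arguments flat_family {R n} k s j t0 U.
Arguments curved_family {R n} k j t0 U.
Arguments canonical_flat {R n k} j t0 B.
Arguments canonical_hyperbolic {R n k} t0 B.

(* Main.v *)
(** A loop is an element of the Wiener algebra, and everything happens near [t0],
    where frames are close to [1]. With [G = Fm^T], the right Birkhoff splitting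
    [F = Fp Fm] is the linear equation [G = 1 - pi ((F - 1) G)], where [pi]
    projects onto the nonpositive frequencies; it is solved by contraction, and
    orthogonality gives uniqueness of the factors.
    The Maurer-Cartan form of [Fp] has positive frequencies only and, computed
    through [F], none above [1], so it is homogeneous of degree one. Conversely,
    given [Fp], split [tau(Fp)^T Fp = Zp Zm]; then [D = Zm tau(Zp)] is a constant
    loop, and if [E] is its square root near [1], [F = Fp tau(Zp) E^T] is
    [tau]-invariant with plus part [Fp].
    Frames in the same coset have the same plus part by uniqueness; if the plus
    parts of [F] and [F'] agree, [F^T F' = Fm^T Fm'] has nonpositive frequencies
    and is [tau]-invariant, hence constant.
    The Fourier coefficients of [Fp] are iterated integrals of the coefficient of
    its Maurer-Cartan form, so [Fp] is entire in the loop parameter and can be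
    evaluated at all of the real locus; comparing frequencies in the
    Maurer-Cartan equation gives the curvature conditions. *)

From HB Require Import structures.
Require Import Defs.
From mathcomp Require Import all_boot all_order all_algebra.
From mathcomp Require Import complex ring lra zify.
From mathcomp Require Import all_classical all_reals all_analysis.
Import Order.TTheory GRing.Theory Num.Theory.
Import numFieldNormedType.Exports.

Set Implicit Arguments.
Unset Strict Implicit.
Unset Printing Implicit Defensive.

Local Open Scope classical_set_scope.
Local Open Scope ring_scope.
Local Open Scope complex_scope.

(** * The Wiener algebra *)

(** Birkhoff factors inherit a symmetry only if it preserves each half of the frequencies. The
    twisting and the conditions R_1, R_2 do, but R_{-1} exchanges the halves; composed with [tau] it
    preserves them, so the plus part of a family with c > 1 satisfies a reality condition twisted by
    Q. Conjugation by T, with the help of [sigma], turns this condition into R_1 and the orthogonal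
    form into the Lorentzian one: this is how hyperbolic space appears. The three cases run through
    one argument with parameter [j] and differ only in [kap j] and [conv_flat j]. The other
    difficulty is that the Wiener algebra sees only the unit circle, while the curvature must be
    checked at parameters of any modulus. Loops are therefore rescaled, X(z) to X(r z), and
    smoothness in t of the rescaled map has to be proved anew from factorial bounds on the
    coefficients; for curved frames the symmetry [tau] reduces r < 1 to r > 1. Determinants, and the
    sheet of the hyperboloid, are settled by continuity from the base point. *)

Section BoundedLinear.
Context {R : realType}.
Implicit Types U V W : normedModType R.

(** A predicate on bare functions, so that operators built from series or coefficientwise can be
    shown linear and bounded afterwards. *)
Definition blin {V W} (f : V -> W) :=
  linear f /\ exists C : R, forall v, `|f v| <= C * `|v|.

Definition bbil {U V W} (f : U -> V -> W) :=
  [/\ forall v, linear (f^~ v), forall u, linear (f u) &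
      exists C : R, forall u v, `|f u v| <= C * `|u| * `|v|].

Lemma blin_bound {V W} (f : V -> W) : blin f ->
  exists2 C : R, 0 < C & forall v, `|f v| <= C * `|v|.
Proof.
move=> [_ [C fC]]; exists (`|C| + 1); first by rewrite ltr_wpDl.
move=> v; apply: (le_trans (fC v)); apply: ler_wpM2r => //.
by rewrite (le_trans (ler_norm _))// lerDl.
Qed.

Lemma bbil_bound {U V W} (f : U -> V -> W) : bbil f ->
  exists2 C : R, 0 < C & forall u v, `|f u v| <= C * `|u| * `|v|.
Proof.
move=> [_ _ [C fC]]; exists (`|C| + 1); first by rewrite ltr_wpDl.
move=> u v; apply: (le_trans (fC u v)); do 2!apply: ler_wpM2r => //.
by rewrite (le_trans (ler_norm _))// lerDl.
Qed.

Section lin.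
Context {V W} (f : V -> W) (lf : linear f).
Let F : {linear V -> W} :=
  HB.pack f (GRing.isLinear.Build R V W *:%R f lf).
Lemma linD u v : f (u + v) = f u + f v. Proof. exact: (linearD F). Qed.
Lemma linB u v : f (u - v) = f u - f v. Proof. exact: (linearB F). Qed.
Lemma linN u : f (- u) = - f u. Proof. exact: (linearN F). Qed.
Lemma lin0 : f 0 = 0. Proof. exact: (linear0 F). Qed.
Lemma linZ a u : f (a *: u) = a *: f u. Proof. exact: (linearZZ F). Qed.
Lemma lin_sum I (r : seq I) (g : I -> V) :
  f (\sum_(i <- r) g i) = \sum_(i <- r) f (g i).
Proof. exact: (linear_sum F). Qed.
End lin.

Lemma blin_cvg {V W} (f : V -> W) (T : Type) (F : set_system T)
    (x : T -> V) (l : V) : Filter F -> blin f ->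
  x @ F --> l -> f \o x @ F --> f l.
Proof.
move=> FF bf xl; have [C C0 fC] := blin_bound bf.
apply/cvgrPdist_le => e e0.
have /cvgrPdist_le/(_ (e / C)) := xl; rewrite divr_gt0// => /(_ isT).
apply: filterS => t h; rewrite -(linB bf.1) (le_trans (fC _))//.
by rewrite mulrC -ler_pdivlMr.
Qed.

Lemma bbil_cvg {U V W} (f : U -> V -> W) (T : Type) (F : set_system T)
    (x : T -> U) (y : T -> V) (a : U) (b : V) : Filter F -> bbil f ->
  x @ F --> a -> y @ F --> b -> f (x t) (y t) @[t --> F] --> f a b.
Proof.
move=> FF bf xa yb; have [C C0 fC] := bbil_bound bf.
have [fl fr _] := bf.
have xy0 : `|x t - a| * (`|y t - b| + `|b|) + `|a| * `|y t - b| @[t --> F] -->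
    `|a - a| * (`|b - b| + `|b|) + `|a| * `|b - b|.
  by apply: cvgD; [apply: cvgM; [|apply: cvgD; [|exact: cvg_cst]]|
    apply: cvgM; [exact: cvg_cst|]]; apply: cvg_norm; apply: cvgB => //;
    exact: cvg_cst.
rewrite !subrr !normr0 mul0r mulr0 addr0 in xy0.
apply/cvgrPdist_le => e e0.
have /cvgrPdist_le/(_ (e / C)) := xy0; rewrite divr_gt0// => /(_ isT).
apply: filterS => t; rewrite sub0r normrN ger0_norm; last first.
  by rewrite addr_ge0// mulr_ge0// addr_ge0.
rewrite ler_pdivlMr// => h; apply: le_trans h.
have -> : f a b - f (x t) (y t) = - (f (x t - a) (y t) + f a (y t - b)).
  by rewrite (linB (fl _)) (linB (fr _)) addrA subrK opprB.
rewrite normrN (le_trans (ler_normD _ _))// mulrDl.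
apply: lerD; rewrite (le_trans (fC _ _))// -mulrA mulrC.
  rewrite ler_wpM2r ?(ltW C0)// ler_wpM2l// -{1}(subrK b (y t)).
  by rewrite ler_normD.
by [].
Qed.

Lemma blin_bbil_comp {U V W} {Z : normedModType R} (g : W -> Z) (f : U -> V -> W) :
  blin g -> bbil f -> bbil (fun u v => g (f u v)).
Proof.
move=> bg bf; have [C C0 fC] := bbil_bound bf; have [D D0 gD] := blin_bound bg.
have [fl fr _] := bf; split.
- by move=> v a u u' /=; rewrite (fl v a u u') bg.1.
- by move=> u a v v' /=; rewrite (fr u a v v') bg.1.
exists (D * C) => u v; rewrite (le_trans (gD _))// -!mulrA ler_wpM2l ?(ltW D0)//.
by rewrite mulrA.
Qed.

Lemma blinD {V W} (f g : V -> W) : blin f -> blin g -> blin (fun v => f v + g v).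
Proof.
move=> bf bg; have [C C0 fC] := blin_bound bf; have [D D0 gD] := blin_bound bg.
split=> [a u v|]; first by rewrite bf.1 bg.1 scalerDr addrACA.
by exists (C + D) => v; rewrite mulrDl (le_trans (ler_normD _ _))// lerD.
Qed.

Lemma blinZ {V W} (c : R) (f : V -> W) : blin f -> blin (fun v => c *: f v).
Proof.
move=> bf; have [C C0 fC] := blin_bound bf.
split=> [a u v|]; first by rewrite bf.1 scalerDr !scalerA [c * a]mulrC.
by exists (`|c| * C) => v; rewrite normrZ -mulrA ler_wpM2l.
Qed.

Lemma blinN {V W} (f : V -> W) : blin f -> blin (fun v => - f v).
Proof.
move=> bf; have -> : (fun v => - f v) = (fun v => (-1) *: f v).
  by apply/funext => v; rewrite scaleN1r.
exact: blinZ.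
Qed.

Lemma blin_id {V} : blin (@id V).
Proof. by split=> //; exists 1 => v; rewrite mul1r. Qed.

Lemma bbil_blinl {U V W} (f : U -> V -> W) v : bbil f -> blin (f^~ v).
Proof.
move=> bf; have [C C0 fC] := bbil_bound bf; have [fl _ _] := bf.
by split; [exact: fl|exists (C * `|v|) => u; rewrite mulrAC].
Qed.

Lemma bbil_blinr {U V W} (f : U -> V -> W) u : bbil f -> blin (f u).
Proof.
move=> bf; have [C C0 fC] := bbil_bound bf; have [_ fr _] := bf.
by split; [exact: fr|exists (C * `|u|) => v].
Qed.

Lemma blin_comp {V W} {Z : normedModType R} (g : W -> Z) (f : V -> W) :
  blin g -> blin f -> blin (g \o f).
Proof.
move=> bg bf; have [C C0 fC] := blin_bound bf; have [D D0 gD] := blin_bound bg.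
split; first by move=> a u v /=; rewrite bf.1 bg.1.
exists (D * C) => v /=; rewrite (le_trans (gD _))// -mulrA ler_wpM2l ?(ltW D0)//.
Qed.

Lemma sum_cvg {V} (T I : Type) (F : set_system T) (r : seq I)
    (x : I -> T -> V) (l : I -> V) : Filter F ->
  (forall i, x i @ F --> l i) ->
  \sum_(i <- r) x i t @[t --> F] --> \sum_(i <- r) l i.
Proof.
move=> FF xl; elim: r => [|i r ih].
  by rewrite big_nil; under eq_fun do rewrite big_nil; exact: cvg_cst.
rewrite big_cons; under eq_fun do rewrite big_cons.
exact: cvgD.
Qed.

(** For a normed space this is completeness. In this form it passes from [V] to [l1 V] through
    finite partial sums, and it is what the series and fixed points below use. *)
Definition abs_complete V := forall (u : nat -> V) (B : R),
  (forall N, \sum_(i < N) `|u i| <= B) -> cvgn (series u).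

(** A partial sum within e of the supremum leaves at most e for every later block. *)
Lemma tail_small (x : nat -> R) (B : R) : (forall i, 0 <= x i) ->
  (forall N, \sum_(i < N) x i <= B) ->
  forall e, 0 < e -> exists N, forall M P, (N <= M)%N ->
    \sum_(M <= i < P) x i <= e.
Proof.
move=> x0 xB e e0; set S := [set \sum_(i < N) x i | N in [set: nat]].
have supS : has_sup S.
  by split; [exists (\sum_(i < 0) x i), 0%N|exists B => _ [N _ <-]].
have [_ [N _ <-] hN] := sup_adherent e0 supS.
exists N => M P NM; have [PM|MP] := leqP P M.
  by rewrite big_geq// ltW.
have : \sum_(i < P) x i <= sup S by apply: sup_upper_bound => //; exists P.
rewrite -(big_mkord xpredT x) (@big_cat_nat _ _ _ M) ?(ltnW MP)//=.
have : \sum_(i < N) x i <= \sum_(0 <= i < M) x i.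
  rewrite -(big_mkord xpredT x) [leRHS](@big_cat_nat _ _ _ N)//=.
  by rewrite lerDl sumr_ge0.
lra.
Qed.

Lemma lim_series_le V (u : nat -> V) (B : R) : cvgn (series u) ->
  (forall N, \sum_(i < N) `|u i| <= B) -> `|limn (series u)| <= B.
Proof.
move=> cu uB; apply: (cvgr_to_le (cvg_norm cu)).
apply: nearW => N; rewrite /series/= big_mkord.
exact: le_trans (ler_norm_sum _ _ _) (uB N).
Qed.

Lemma abs_complete_R : abs_complete R^o.
Proof.
move=> u B uB; apply: normed_cvg; apply: nondecreasing_is_cvgn.
  by apply: nondecreasing_series => i _ _; exact: normr_ge0.
exists B => _ [N _ <-]. rewrite /= seriesEord; exact: uB.
Qed.

End BoundedLinear.

(** * Summable families indexed by the integers *)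

Section L1Space.
Context {R : realType} {V : normedModType R}.
Implicit Types (a b : int -> V) (X Y : l1 V) (s : seq int) (B : R).

Lemma l1_norme_le_seq a B :
  (forall s, uniq s -> \sum_(m <- s) `|a m| <= B) -> (l1_norme a <= B%:E)%E.
Proof.
move=> h; apply: ge_ereal_sup => _ [A [finA _] <-].
by rewrite fsbig_finite//= sumEFin lee_fin h// finmap.fset_uniq.
Qed.

Lemma l1_sum_le X s : uniq s -> \sum_(m <- s) `|X m| <= `|X|.
Proof.
move=> us; rewrite -lee_fin [X in (_ <= X)%E]l1_normE -sumEFin.
apply: esum_ge; exists [set` s]; last by rewrite fsbig_seq.
by split => //; exact: finite_seq.
Qed.

Lemma l1_coef_le X m : `|X m| <= `|X|.
Proof. by have := @l1_sum_le X [:: m] isT; rewrite big_seq1. Qed.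

Lemma l1_norm_le X B :
  (forall s, uniq s -> \sum_(m <- s) `|X m| <= B) -> `|X| <= B.
Proof. by move=> h; rewrite -lee_fin [X in (X <= _)%E]l1_normE l1_norme_le_seq. Qed.

(* Opaque, like the operations below, so that unification never unfolds it. *)
Fact l1_of_subproof : {f : (int -> V) -> l1 V | f = insubd 0}.
Proof. by exists (insubd 0). Qed.

Definition l1_of a : l1 V := sval l1_of_subproof a.

(** For a family that is not summable [l1_of] returns the default 0, so every coefficient formula
    below goes through such a bound. *)
Lemma l1_ofE a B : (forall s, uniq s -> \sum_(m <- s) `|a m| <= B) ->
  l1_of a = a :> (int -> V).
Proof.
move=> h; rewrite /l1_of (svalP l1_of_subproof); apply: (@insubdK _ _ (l1 V)); apply/asboolP.
exact: le_lt_trans (l1_norme_le_seq h) (ltry _).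
Qed.

Lemma l1P X Y : (forall m, X m = Y m) -> X = Y.
Proof. by move=> h; apply/val_inj/funext. Qed.

Lemma l1D (X Y : (l1 V : normedModType R)) m : (X + Y) m = X m + Y m. Proof. by []. Qed.
Lemma l1N (X : (l1 V : normedModType R)) m : (- X) m = - X m. Proof. by []. Qed.
Lemma l1B (X Y : (l1 V : normedModType R)) m : (X - Y) m = X m - Y m. Proof. by []. Qed.
Lemma l1Z c (X : (l1 V : normedModType R)) m : (c *: X) m = c *: X m. Proof. by []. Qed.
Lemma l10 m : (0 : (l1 V : normedModType R)) m = 0. Proof. by []. Qed.
Lemma l1_sumE I (r : seq I) (F : I -> (l1 V : normedModType R)) m :
  (\sum_(i <- r) F i) m = \sum_(i <- r) F i m.
Proof. by elim/big_rec2: _ => // i y1 y2 _ <-. Qed.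

Lemma coef_blin m : blin (fun X : l1 V => X m).
Proof. by split => [c X Y//|]; exists 1 => X; rewrite mul1r l1_coef_le. Qed.

(** The monomial loop with value v z^m at z. *)
Definition delta (m : int) (v : V) : l1 V := l1_of (fun k => if k == m then v else 0).

Lemma delta_sum_le m v s : uniq s ->
  \sum_(k <- s) `|if k == m then v else 0 : V| <= `|v|.
Proof.
move=> us; have [ms|ms] := boolP (m \in s); last first.
  rewrite big_seq big1// => k ks; case: eqP => [km|]; last by rewrite normr0.
  by rewrite -km ks in ms.
rewrite (bigD1_seq m)//= eqxx big1 ?addr0// => k /negPf ->.
by rewrite normr0.
Qed.

Lemma deltaE m v k : delta m v k = if k == m then v else 0.
Proof. by rewrite /delta (l1_ofE (@delta_sum_le m v)). Qed.

Lemma delta_norm m v : `|delta m v| <= `|v|.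
Proof.
apply: l1_norm_le => s us; under eq_bigr do rewrite deltaE.
exact: delta_sum_le.
Qed.

Lemma delta_blin m : blin (delta m).
Proof.
split => [c u v|]; last by exists 1 => v; rewrite mul1r delta_norm.
apply: l1P => k; rewrite l1D l1Z !deltaE; case: ifP => // _.
by rewrite scaler0 addr0.
Qed.

Lemma truncE X s m : uniq s ->
  (\sum_(k <- s) delta k (X k)) m = if m \in s then X m else 0.
Proof.
move=> us; rewrite l1_sumE; under eq_bigr do rewrite deltaE.
case: ifPn => ms.
  rewrite (bigD1_seq m)//= eqxx big1 ?addr0// => k.
  by rewrite eq_sym => /negPf ->.
rewrite big_seq big1// => k ks; case: eqP => // mk.
by rewrite mk ks in ms.
Qed.

(** An unordered sum is the supremum of its finite partial sums; a finite set that comes within e of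
    it leaves at most e outside. *)
Lemma sum_sup_small (b : int -> R) B : (forall m, 0 <= b m) ->
  (forall s, uniq s -> \sum_(m <- s) b m <= B) ->
  forall e, 0 < e -> exists2 s, uniq s & forall s', uniq s' ->
    \sum_(m <- s' | m \notin s) b m <= e.
Proof.
move=> b0 bB e e0; set S := [set \sum_(i <- s) b i | s in [set s : seq int | uniq s]].
have supS : has_sup S.
  by split; [exists (\sum_(i <- [::]) b i), [::]|exists B => _ [s us <-]; exact: bB].
have [_ [s us <-] hs] := sup_adherent e0 supS.
exists s => // s' us'.
have /ubP h := sup_upper_bound supS.
have u2 : uniq (s ++ [seq m <- s' | m \notin s]).
  rewrite cat_uniq us filter_uniq// andbT; apply/hasPn => m.
  by rewrite mem_filter => /andP[].
have : \sum_(i <- s ++ [seq m <- s' | m \notin s]) b i <= sup S.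
  by apply: h; exists (s ++ [seq m <- s' | m \notin s]).
by rewrite big_cat/= big_filter; lra.
Qed.

(** Density of trigonometric polynomials; it reduces identities between bounded operators to
    monomials. *)
Lemma l1_density X e : 0 < e ->
  exists2 s, uniq s & `|X - \sum_(k <- s) delta k (X k)| <= e.
Proof.
move=> e0.
have [//||s us hs] := @sum_sup_small (fun m => `|X m|) `|X| _ _ e e0.
  exact: l1_sum_le.
exists s => //; apply: l1_norm_le => s' us'.
apply: le_trans (hs _ us'); rewrite [leRHS]big_mkcond/=.
apply: ler_sum => m _. rewrite [X in `|X|](l1B X _ m) truncE//; case: ifP => _ /=.
  by rewrite subrr normr0.
by rewrite subr0.
Qed.

(** Dominated convergence for series: finitely many indices carry all but e / 2 of the majorant, and
    on those the coefficients converge. Limits under the Fourier sum are taken this way, for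
    rescaled frames and for power series in the disc. *)
Lemma tannery (T : Type) (F : set_system T) (x : T -> l1 V) (b : int -> R) B :
  Filter F -> (forall m, 0 <= b m) ->
  (forall s, uniq s -> \sum_(m <- s) b m <= B) ->
  (\forall t \near F, forall m, `|x t m| <= b m) ->
  (forall m, (fun t => x t m) @ F --> 0) ->
  x @ F --> 0.
Proof.
move=> FF b0 bB xb x0; apply/cvgrPdist_le => e e0.
have e2 : 0 < e / 2 by rewrite divr_gt0.
have [s us hs] := sum_sup_small b0 bB e2.
have : \sum_(m <- s) `|x t m| @[t --> F] --> \sum_(m <- s) `|0 : V|.
  by apply: sum_cvg => m; exact: cvg_norm.
rewrite big1 => [|m _]; last by rewrite normr0.
move=> /cvgrPdist_le/(_ _ e2) h.
near=> t; rewrite sub0r normrN; apply: l1_norm_le => s' us'.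
rewrite (bigID (fun m => m \in s))/= (splitr e) lerD//.
  have -> : \sum_(m <- s' | m \in s) `|x t m| = \sum_(m <- s | m \in s') `|x t m|.
    rewrite -big_filter -[RHS]big_filter; apply: perm_big; apply: uniq_perm; rewrite ?filter_uniq//.
    by move=> m; rewrite !mem_filter andbC.
  apply: (@le_trans _ _ (\sum_(m <- s) `|x t m|)).
    by rewrite big_mkcond/= ler_sum// => m _; case: ifP.
  rewrite -[leLHS]ger0_norm ?sumr_ge0// -normrN -[X in `|X|]sub0r.
  by near: t; exact: h.
apply: le_trans (hs _ us'); apply: ler_sum => m _.
by move: m; near: t.
Unshelve. all: by end_near. Qed.

Lemma blin_eq {W : normedModType R} (f g : l1 V -> W) : blin f -> blin g ->
  (forall m v, f (delta m v) = g (delta m v)) -> forall X, f X = g X.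
Proof.
move=> bf bg fg X; have [C C0 fC] := blin_bound bf; have [D D0 gD] := blin_bound bg.
apply/eqP; rewrite -subr_eq0 -normr_le0; apply/ler_addgt0Pl => e e0; rewrite addr0.
have CD : 0 < e / (C + D) by rewrite divr_gt0// addr_gt0.
have [s us hs] := l1_density X CD.
set Y := \sum_(k <- s) delta k (X k) in hs.
have fgY : f Y = g Y by rewrite /Y (lin_sum bf.1) (lin_sum bg.1); apply: eq_bigr.
have -> : f X - g X = f (X - Y) - g (X - Y).
  by rewrite (linB bf.1) (linB bg.1) fgY opprB addrA subrK.
rewrite (le_trans (ler_normB _ _))// (le_trans (lerD (fC _) (gD _)))//.
by rewrite -mulrDl mulrC -ler_pdivlMr// addr_gt0.
Qed.

End L1Space.

Lemma abs_complete_l1 {R : realType} {V : normedModType R} :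
  abs_complete V -> abs_complete (l1 V).
Proof.
move=> cV u B uB.
have uBm m : forall N, \sum_(i < N) `|u i m| <= B.
  by move=> N; apply: le_trans (uB N); apply: ler_sum => i _; exact: l1_coef_le.
have cm m : cvgn (series (fun i => u i m)) by apply: cV (uBm m).
pose a m := limn (series (fun i => u i m)).
(* The tail estimate is proved on finite sets of indices, where the sum commutes with the limit that
   defines [a]. With N = 0 it bounds [a], with N large it gives convergence in norm. *)
have tl N e s : (forall P, \sum_(N <= i < P) `|u i| <= e) -> uniq s ->
    \sum_(m <- s) `|a m - \sum_(i < N) u i m| <= e.
  move=> ue us.
  have ccst m : (fun=> \sum_(i < N) u i m) @ \oo --> \sum_(i < N) u i m.
    by exact: cvg_cst.
  have : \sum_(m <- s) `|series (fun i => u i m) P - \sum_(i < N) u i m| @[P --> \oo]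
     --> \sum_(m <- s) `|a m - \sum_(i < N) u i m|.
    apply: sum_cvg => m; apply: cvg_norm; apply: cvgB; last exact: ccst.
    exact: cm.
  move=> /cvgr_to_le; apply; near=> P.
  have NP : (N <= P)%N by near: P; exact: nbhs_infty_ge.
  apply: le_trans (ue P).
  have h m : series (fun i => u i m) P - \sum_(i < N) u i m =
      (\sum_(N <= i < P) u i) m.
    rewrite l1_sumE/= /series/= (@big_cat_nat _ _ _ N 0 P)//= big_mkord.
    by rewrite addrAC subrr add0r.
  under eq_bigr do rewrite h.
  by apply: (le_trans (l1_sum_le _ us)); exact: ler_norm_sum.
have aB : forall s, uniq s -> \sum_(m <- s) `|a m| <= B.
  move=> s us; have := @tl 0%N B s _ us; under eq_bigr do rewrite big_ord0 subr0.
  by apply=> P; rewrite big_mkord; exact: uB.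
apply: (cvgP (l1_of a)); apply/cvgrPdist_le => e e0.
have [//|//|N hN] := @tail_small _ (fun i => `|u i|) B _ _ e e0.
near=> M; have NM : (N <= M)%N by near: M; exact: nbhs_infty_ge.
apply: l1_norm_le => s us.
rewrite (eq_bigr (fun m => `|a m - \sum_(i < M) u i m|)).
  by apply: tl => // P; exact: hN.
move=> m _; rewrite l1B (l1_ofE aB) /series/= l1_sumE big_mkord.
by [].
Unshelve. all: by end_near. Qed.

(** * Operators determined by their values on monomials *)

Section Lift.
Context {R : realType} {V W : normedModType R}.

Lemma series_single (f : nat -> W) j : (forall i, i != j -> f i = 0) ->
  limn (series f) = f j.
Proof.
move=> f0; apply: lim_near_cst => //; near=> N.
have jN : (j < N)%N by near: N; exact: nbhs_infty_gt.
rewrite seriesEord/= (bigD1 (Ordinal jN))//= big1 ?addr0// => i ij.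
exact: f0.
Unshelve. all: by end_near. Qed.

Lemma series_zero (f : nat -> W) : (forall i, f i = 0) -> limn (series f) = 0.
Proof. by move=> f0; rewrite (@series_single f 0%N)// => i _; exact: f0. Qed.

Variables (T : int -> V -> W) (C : R).
Hypotheses (cW : abs_complete W) (lT : forall m, linear (T m)) (C0 : 0 <= C)
  (TC : forall m v, `|T m v| <= C * `|v|).

(** The bounded operator with value [T m v] on the monomial of degree m. The sum is split at 0 into
    two one-sided series exactly as in [ev], which makes the comparison in [ev_evM] termwise. *)
Fact l1lift_subproof : {f : l1 V -> W | forall X, f X =
  limn (series (fun i => T i%:Z (X i%:Z))) +
  limn (series (fun i => T (- i.+1%:Z) (X (- i.+1%:Z))))}.
Proof.
by exists (fun X => limn (series (fun i => T i%:Z (X i%:Z))) +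
  limn (series (fun i => T (- i.+1%:Z) (X (- i.+1%:Z))))).
Qed.

Definition l1lift (X : l1 V) : W := sval l1lift_subproof X.

Lemma l1liftE X : l1lift X = limn (series (fun i => T i%:Z (X i%:Z))) +
  limn (series (fun i => T (- i.+1%:Z) (X (- i.+1%:Z)))).
Proof. by rewrite /l1lift (svalP l1lift_subproof). Qed.

Let bnd (e : nat -> int) (X : l1 V) N : injective e ->
  \sum_(i < N) `|T (e i) (X (e i))| <= C * `|X|.
Proof.
move=> ie; apply: (@le_trans _ _ (\sum_(i < N) C * `|X (e i)|)).
  by apply: ler_sum => i _; exact: TC.
rewrite -mulr_sumr ler_wpM2l// -(big_mkord xpredT (fun i => `|X (e i)|)).
rewrite /index_iota subn0 -(big_map e xpredT (fun m => `|X m|)).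
by apply: l1_sum_le; rewrite map_inj_uniq// iota_uniq.
Qed.

Let inj1 : injective (fun i : nat => i%:Z). Proof. by move=> i j []. Qed.
Let inj2 : injective (fun i : nat => - i.+1%:Z).
Proof. by move=> i j /oppr_inj[]. Qed.

Lemma l1lift_cvg1 (X : l1 V) : cvgn (series (fun i => T i%:Z (X i%:Z))).
Proof. by apply: (cW (B := C * `|X|)) => N; exact: (@bnd (fun i : nat => i%:Z)). Qed.

Lemma l1lift_cvg2 (X : l1 V) : cvgn (series (fun i => T (- i.+1%:Z) (X (- i.+1%:Z)))).
Proof. by apply: (cW (B := C * `|X|)) => N; exact: (@bnd (fun i : nat => - i.+1%:Z)). Qed.

Lemma l1lift_norm X : `|l1lift X| <= (C + C) * `|X|.
Proof.
rewrite l1liftE mulrDl (le_trans (ler_normD _ _))//; apply: lerD.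
  by apply: lim_series_le; [exact: l1lift_cvg1|move=> N; exact: (@bnd (fun i : nat => i%:Z))].
by apply: lim_series_le; [exact: l1lift_cvg2|move=> N; exact: (@bnd (fun i : nat => - i.+1%:Z))].
Qed.

Lemma l1lift_blin : blin l1lift.
Proof.
split=> [c X Y|]; last by exists (C + C) => X; exact: l1lift_norm.
rewrite !l1liftE scalerDr addrACA; congr (_ + _).
  apply/cvg_lim => //.
  have -> : series (fun i => T i%:Z ((c *: X + Y) i%:Z)) =
      (fun N => c *: series (fun i => T i%:Z (X i%:Z)) N + series (fun i => T i%:Z (Y i%:Z)) N).
    apply/funext => N; rewrite !seriesEord/= scaler_sumr -big_split/=.
    by apply: eq_bigr => i _; rewrite -lT.
  by apply: cvgD; [apply: cvgZr; exact: l1lift_cvg1|exact: l1lift_cvg1].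
apply/cvg_lim => //.
have -> : series (fun i => T (- i.+1%:Z) ((c *: X + Y) (- i.+1%:Z))) =
    (fun N => c *: series (fun i => T (- i.+1%:Z) (X (- i.+1%:Z))) N +
       series (fun i => T (- i.+1%:Z) (Y (- i.+1%:Z))) N).
  apply/funext => N; rewrite !seriesEord/= scaler_sumr -big_split/=.
  by apply: eq_bigr => i _; rewrite -lT.
by apply: cvgD; [apply: cvgZr; exact: l1lift_cvg2|exact: l1lift_cvg2].
Qed.

Lemma l1lift_delta m v : l1lift (delta m v) = T m v.
Proof.
have T0 k : T k 0 = 0 by exact: lin0.
rewrite !l1liftE; case: m => [j|j].
  rewrite (@series_single _ j) => [|i ij]; last first.
    by rewrite deltaE eqz_nat (negPf ij).
  rewrite series_zero ?addr0 => [|i]; last by rewrite deltaE.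
  by rewrite deltaE eqxx.
rewrite series_zero ?add0r => [|i]; last by rewrite deltaE.
rewrite (@series_single _ j) => [|i ij]; last first.
  by rewrite deltaE NegzE eqr_opp eqz_nat eqSS (negPf ij).
by rewrite deltaE NegzE eqxx.
Qed.

End Lift.

(** * Complex matrices as pairs of real matrices *)

Section PairMatrices.
Context {R : realType} {p q : nat}.
Local Notation V := ('M[R]_(p, q) * 'M[R]_(p, q))%type.
Local Notation C := (cplx R).
Implicit Types (u v : V) (A : 'M[C]_(p, q)).

Definition toM v : 'M[C]_(p, q) := \matrix_(i, j) (v.1 i j +i* v.2 i j).
Definition ofM A : V := (map_mx (@complex.Re R) A, map_mx (@complex.Im R) A).

Lemma toMK : cancel toM ofM.
Proof. by move=> [a b]; congr (_, _); apply/matrixP => i j; rewrite !mxE. Qed.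

Lemma ofMK : cancel ofM toM.
Proof. by move=> A; apply/matrixP => i j; rewrite !mxE/=; case: (A i j). Qed.

Lemma toM_inj : injective toM. Proof. exact: can_inj toMK. Qed.

Lemma toMD u v : toM (u + v) = toM u + toM v.
Proof. by apply/matrixP => i j; rewrite !mxE. Qed.

Lemma toMN u : toM (- u) = - toM u.
Proof. by apply/matrixP => i j; rewrite !mxE. Qed.

Lemma toM0 : toM 0 = 0.
Proof. by apply/matrixP => i j; rewrite !mxE. Qed.

Lemma toMZ (a : R) u : toM (a *: u) = a%:C *: toM u.
Proof.
apply/matrixP => i j; rewrite !mxE; apply/eqP; rewrite eq_complex/=.
by rewrite !mul0r subr0 addr0 !eqxx.
Qed.

Lemma pair_norm_le v (B : R) : 0 <= B ->
  (forall i j, `|v.1 i j| <= B /\ `|v.2 i j| <= B) -> `|v| <= B.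
Proof.
move=> B0 h; rewrite prod_normE ge_max; apply/andP; split.
  rewrite [leLHS]/Num.Def.normr/= mx_normrE; apply: bigmax_le => // -[i j] _.
  by have [] := h i j.
rewrite [leLHS]/Num.Def.normr/= mx_normrE; apply: bigmax_le => // -[i j] _.
by have [] := h i j.
Qed.

Lemma mx_entry_le (M : 'M[R]_(p, q)) i j : `|M i j| <= `|M|.
Proof.
rewrite [leRHS]/Num.Def.normr/= mx_normrE.
exact: (le_bigmax _ (fun ij : 'I_p * 'I_q => `|M ij.1 ij.2|) (i, j)).
Qed.

Lemma pair_entry_le v i j : `|v.1 i j| <= `|v| /\ `|v.2 i j| <= `|v|.
Proof.
by rewrite prod_normE; split; rewrite (le_trans (mx_entry_le _ _ _))// le_max lexx ?orbT.
Qed.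

Lemma pair_cvg (T : Type) (F : set_system T) (x : T -> V) (l : V) : Filter F ->
  (forall i j, (fun t => (x t).1 i j) @ F --> l.1 i j /\
               (fun t => (x t).2 i j) @ F --> l.2 i j) -> x @ F --> l.
Proof.
move=> FF h; apply/cvgrPdist_le => e e0.
have h1 : \forall t \near F, forall i j, `|l.1 i j - (x t).1 i j| <= e.
  apply: filter_forall => i; apply: filter_forall => j.
  by have [/cvgrPdist_le/(_ _ e0)] := h i j.
have h2 : \forall t \near F, forall i j, `|l.2 i j - (x t).2 i j| <= e.
  apply: filter_forall => i; apply: filter_forall => j.
  by have [_ /cvgrPdist_le/(_ _ e0)] := h i j.
near=> t.
apply: pair_norm_le => [|i j]; first exact: ltW.
rewrite !mxE; split; first by move: i j; near: t.
by move: i j; near: t.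
Unshelve. all: by end_near. Qed.

Lemma pair_abs_complete : abs_complete (V : normedModType R).
Proof.
move=> u B uB.
have c1 i j : cvgn (series (fun m => (u m).1 i j : R^o)).
  apply: (abs_complete_R (B := B)) => N; apply: le_trans (uB N).
  by apply: ler_sum => m _; have [] := pair_entry_le (u m) i j.
have c2 i j : cvgn (series (fun m => (u m).2 i j : R^o)).
  apply: (abs_complete_R (B := B)) => N; apply: le_trans (uB N).
  by apply: ler_sum => m _; have [] := pair_entry_le (u m) i j.
pose l : V := (\matrix_(i, j) limn (series (fun m => (u m).1 i j : R^o)),
  \matrix_(i, j) limn (series (fun m => (u m).2 i j : R^o))).
apply/cvg_ex; exists l.
apply: pair_cvg => i j; rewrite !mxE/=.
have E1 N : (series u N).1 i j = series (fun m => (u m).1 i j : R^o) N.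
  rewrite !seriesEord/=; elim/big_rec2: _ => [|m x y _ <-]; by rewrite mxE.
have E2 N : (series u N).2 i j = series (fun m => (u m).2 i j : R^o) N.
  rewrite !seriesEord/=; elim/big_rec2: _ => [|m x y _ <-]; by rewrite mxE.
split; [under eq_fun do rewrite E1|under eq_fun do rewrite E2].
  exact: c1.
exact: c2.
Qed.

Lemma Re_le_norm (z : C) (r : R) : `|z| <= r%:C -> `|complex.Re z| <= r.
Proof.
by move=> zr; have := le_trans (normc_ge_Re z) zr; rewrite lecE => /andP[].
Qed.

Lemma Im_le_norm (z : C) (r : R) : `|z| <= r%:C -> `|complex.Im z| <= r.
Proof.
rewrite normc_def lecE => /andP[_/= zr]; apply: le_trans zr.
by rewrite -sqrtr_sqr ler_sqrt ?addr_ge0 ?sqr_ge0// lerDr sqr_ge0.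
Qed.

Fact scaleV_subproof : {f : C -> V -> V | forall c u, f c u = ofM (c *: toM u)}.
Proof. by exists (fun c u => ofM (c *: toM u)). Qed.

Definition scaleV (c : C) u : V := sval scaleV_subproof c u.

Lemma scaleVE c u : scaleV c u = ofM (c *: toM u).
Proof. by rewrite /scaleV (svalP scaleV_subproof). Qed.

Lemma toM_scale c u : toM (scaleV c u) = c *: toM u.
Proof. by rewrite scaleVE ofMK. Qed.

Lemma scaleV_linear c : linear (scaleV c).
Proof.
move=> a u v; apply: toM_inj.
rewrite [LHS]toM_scale [RHS]toMD [X in _ = X + _]toMZ !toM_scale toMD toMZ.
by rewrite scalerDr !scalerA [c * _]mulrC.
Qed.

(** The norm on pairs is a maximum over real and imaginary parts; it is a real norm only, and
    complex scaling costs a factor 2. *)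
Lemma scaleV_bound c u (r : R) : `|c| <= r%:C -> `|scaleV c u| <= (r + r) * `|u|.
Proof.
move=> cr.
have r0 : 0 <= r by rewrite -lecR; exact: le_trans (normr_ge0 _) cr.
have cR := Re_le_norm cr; have cI := Im_le_norm cr.
apply: pair_norm_le => [|i j]; first by rewrite mulr_ge0// addr_ge0.
have [u1 u2] := pair_entry_le u i j.
rewrite scaleVE !mxE; case: c cR cI {cr} => a b /= cR cI; rewrite mulrDl; split.
  by rewrite (le_trans (ler_normB _ _))// !normrM lerD// ler_pM.
by rewrite (le_trans (ler_normD _ _))// !normrM lerD// ler_pM.
Qed.

End PairMatrices.

Section PairAlgebra.
Context {R : realType} {q : nat}.
Local Notation V := ('M[R]_q * 'M[R]_q)%type.
Local Notation C := (cplx R).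
Implicit Types (u v : V) (A : 'M[C]_q).

Fact mulV_subproof : {f : V -> V -> V | forall u v,
  f u v = (u.1 *m v.1 - u.2 *m v.2, u.1 *m v.2 + u.2 *m v.1)}.
Proof. by exists (fun u v => (u.1 *m v.1 - u.2 *m v.2, u.1 *m v.2 + u.2 *m v.1)). Qed.

Definition mulV u v : V := sval mulV_subproof u v.

Lemma mulVE u v : mulV u v = (u.1 *m v.1 - u.2 *m v.2, u.1 *m v.2 + u.2 *m v.1).
Proof. by rewrite /mulV (svalP mulV_subproof). Qed.

Lemma Re_sum I (r : seq I) (f : I -> C) :
  complex.Re (\sum_(i <- r) f i) = \sum_(i <- r) complex.Re (f i).
Proof. by elim/big_rec2: _ => // i y1 y2 _ <-; case: (f i) y2 => [a b] [c d]. Qed.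

Lemma Im_sum I (r : seq I) (f : I -> C) :
  complex.Im (\sum_(i <- r) f i) = \sum_(i <- r) complex.Im (f i).
Proof. by elim/big_rec2: _ => // i y1 y2 _ <-; case: (f i) y2 => [a b] [c d]. Qed.

Lemma toM_mul u v : toM (mulV u v) = toM u *m toM v.
Proof.
rewrite mulVE; apply/matrixP => i j; rewrite !mxE.
apply/eqP; rewrite eq_complex; apply/andP; split; apply/eqP => /=.
  rewrite Re_sum -sumrB.
  by apply: eq_bigr => l _; rewrite !mxE.
rewrite Im_sum -big_split.
by apply: eq_bigr => l _; rewrite !mxE.
Qed.

Lemma mulV_bbil : bbil (mulV : V -> V -> V).
Proof.
split.
- by move=> v a x y; apply: toM_inj;
    rewrite toM_mul !toMD !toMZ !toM_mul mulmxDl scalemxAl.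
- by move=> v a x y; apply: toM_inj;
    rewrite toM_mul !toMD !toMZ !toM_mul mulmxDr scalemxAr.
exists (q%:R + q%:R) => u v.
apply: pair_norm_le => [|i j]; first by rewrite !mulr_ge0// addr_ge0.
have S (A B : 'M[R]_q) : `|A| <= `|u| -> `|B| <= `|v| ->
    `|(A *m B) i j| <= q%:R * `|u| * `|v|.
  move=> Au Bv; rewrite mxE (le_trans (ler_norm_sum _ _ _))//.
  apply: (@le_trans _ _ (\sum_(l < q) `|u| * `|v|)).
    apply: ler_sum => l _; rewrite normrM ler_pM//.
      exact: le_trans (mx_entry_le _ _ _) Au.
    exact: le_trans (mx_entry_le _ _ _) Bv.
  by rewrite sumr_const card_ord -mulrA mulr_natl.
have [u1 u2] : `|u.1| <= `|u| /\ `|u.2| <= `|u|.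
  by rewrite [X in _ <= X]prod_normE [X in _ /\ _ <= X]prod_normE !le_max !lexx orbT.
have [v1 v2] : `|v.1| <= `|v| /\ `|v.2| <= `|v|.
  by rewrite [X in _ <= X]prod_normE [X in _ /\ _ <= X]prod_normE !le_max !lexx orbT.
rewrite mulVE mulrDl mulrDl; split.
  rewrite (_ : _ i j = (u.1 *m v.1) i j - (u.2 *m v.2) i j); last by rewrite !mxE.
  by rewrite (le_trans (ler_normB _ _))// lerD// S.
rewrite (_ : _ i j = (u.1 *m v.2) i j + (u.2 *m v.1) i j); last by rewrite !mxE.
by rewrite (le_trans (ler_normD _ _))// lerD// S.
Qed.

End PairAlgebra.

(** For [q = n + (1 + k)] the space [l1 (PV R q)] is [wiener R n k] up to conversion. *)
Definition PV (R : realType) (q : nat) : normedModType R := ('M[R]_q * 'M[R]_q)%type.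

Lemma PV_abs_complete (R : realType) q : abs_complete (PV R q).
Proof. exact: pair_abs_complete. Qed.

Lemma mulPV_bbil (R : realType) q : bbil (mulV : PV R q -> PV R q -> PV R q).
Proof. exact: mulV_bbil. Qed.

(** * The convolution product *)

Section WienerAlgebra.
Context {R : realType} {q : nat}.
Local Notation V := (PV R q).
Local Notation W := (l1 V).
Local Notation C := (cplx R).
Implicit Types (u v : V) (X Y Z : W) (s : seq int) (z : C).

Lemma reindex_sum_le (f : int -> V -> V) (e : int -> int) (K : R) X s : 0 <= K ->
  (forall m v, `|f m v| <= K * `|v|) -> injective e -> uniq s ->
  \sum_(m <- s) `|f m (X (e m))| <= K * `|X|.
Proof.
move=> K0 fK ie us; apply: (@le_trans _ _ (\sum_(m <- s) K * `|X (e m)|)).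
  by apply: ler_sum => m _; exact: fK.
rewrite -mulr_sumr ler_wpM2l// -(big_map e xpredT (fun m => `|X m|)).
by apply: l1_sum_le; rewrite map_inj_uniq.
Qed.

(** Common shape of the coefficientwise operations: a reindexing by [e], then [f m] on the
    coefficient of index m. Shifts, projections, transposition, rotation, inversion and conjugation
    are instances. *)
Definition reop (f : int -> V -> V) (e : int -> int) X : W :=
  l1_of (fun m => f m (X (e m))).

Section Reop.
Variables (f : int -> V -> V) (e : int -> int) (K : R).
Hypotheses (K0 : 0 <= K) (fK : forall m v, `|f m v| <= K * `|v|) (ie : injective e).

Lemma reopE X m : reop f e X m = f m (X (e m)).
Proof. by rewrite /reop (@l1_ofE _ _ _ (K * `|X|))// => s us; exact: reindex_sum_le. Qed.

Lemma reop_norm X : `|reop f e X| <= K * `|X|.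
Proof.
apply: l1_norm_le => s us; under eq_bigr do rewrite reopE.
exact: reindex_sum_le.
Qed.

Lemma reop_blin : (forall m, linear (f m)) -> blin (reop f e).
Proof.
move=> lf; split; last by exists K => X; exact: reop_norm.
by move=> c X Y; apply: l1P => m; rewrite reopE (lf m c) -!reopE.
Qed.

End Reop.

(** The product of pairs need not be submultiplicative for the maximum norm. Some constant is fixed
    here; it enters only through its positivity and the estimate. *)
Definition mulK : R := xget 0 [set K : R | 0 < K /\ forall u v, `|mulV u v| <= K * `|u| * `|v|].

Lemma mulK_gt0 : 0 < mulK.
Proof.
have [K K0 hK] := bbil_bound (@mulPV_bbil R q).
by rewrite /mulK; case: xgetP => [x _ []//|/(_ K) []].
Qed.

Lemma mulK_bound u v : `|mulV u v| <= mulK * `|u| * `|v|.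
Proof.
have [K K0 hK] := bbil_bound (@mulPV_bbil R q).
by rewrite /mulK; case: xgetP => [x _ [_]//|/(_ K) []].
Qed.

Definition shiftmul (a : int) u X : W := reop (fun=> mulV u) (fun m => m - a) X.

Lemma shift_inj (a : int) : injective (fun m : int => m - a).
Proof. exact: addIr. Qed.

Lemma shiftmulE a u X m : shiftmul a u X m = mulV u (X (m - a)).
Proof.
apply: (@reopE _ _ (mulK * `|u|)); last exact: shift_inj.
  by rewrite mulr_ge0// ltW// mulK_gt0.
by move=> _ v; exact: mulK_bound.
Qed.

Lemma shiftmul_norm a u X : `|shiftmul a u X| <= mulK * `|X| * `|u|.
Proof.
rewrite mulrAC; apply: reop_norm; last exact: shift_inj.
  by rewrite mulr_ge0// ltW// mulK_gt0.
by move=> _ v; exact: mulK_bound.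
Qed.

Lemma shiftmul_linear a X : linear (fun u => shiftmul a u X).
Proof.
have [fl _ _] := @mulPV_bbil R q.
move=> c u v; apply: l1P => m; rewrite shiftmulE (fl _ c).
by rewrite -!shiftmulE.
Qed.

Lemma shiftmul_blin a u : blin (shiftmul a u).
Proof.
have [_ fr _] := @mulPV_bbil R q.
apply: (@reop_blin _ _ (mulK * `|u|)).
- by rewrite mulr_ge0// ltW// mulK_gt0.
- by move=> _ v; exact: mulK_bound.
- exact: shift_inj.
- by move=> _; exact: fr.
Qed.

Lemma W_abs_complete : abs_complete (W : normedModType R).
Proof. by apply: abs_complete_l1; exact: PV_abs_complete. Qed.

Fact wmul_subproof : {f : W -> W -> W | forall X Y,
  f X Y = l1lift (fun a u => shiftmul a u Y) X}.
Proof. by exists (fun X Y => l1lift (fun a u => shiftmul a u Y) X). Qed.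

Definition wmul X Y : W := sval wmul_subproof X Y.

Lemma wmulE X Y : wmul X Y = l1lift (fun a u => shiftmul a u Y) X.
Proof. by rewrite /wmul (svalP wmul_subproof). Qed.

Lemma wmul_blinl Y : blin (fun X => wmul X Y).
Proof.
rewrite (_ : (fun X => wmul X Y) = l1lift (fun a u => shiftmul a u Y)); last first.
  by apply/funext => X; rewrite wmulE.
apply: (l1lift_blin (C := mulK * `|Y|)) => [|m||m v].
- exact: W_abs_complete.
- exact: shiftmul_linear.
- by rewrite mulr_ge0// ltW// mulK_gt0.
- exact: shiftmul_norm.
Qed.

Lemma wmul_delta m v Y : wmul (delta m v) Y = shiftmul m v Y.
Proof. by rewrite wmulE l1lift_delta// => k; exact: shiftmul_linear. Qed.

Lemma wmul_norm X Y : `|wmul X Y| <= (mulK + mulK) * `|X| * `|Y|.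
Proof.
have := @l1lift_norm _ _ _ (fun a u => shiftmul a u Y) (mulK * `|Y|) W_abs_complete _ _ X.
rewrite wmulE -mulrDl [_ * `|X| * _]mulrAC; apply => [|m v].
- by rewrite mulr_ge0// ltW// mulK_gt0.
- exact: shiftmul_norm.
Qed.

(** Linearity on the left comes from [l1lift]; on the right it is checked on monomials in the left
    factor. *)
Lemma wmul_bbil : bbil (wmul : W -> W -> W).
Proof.
split; last by exists (mulK + mulK) => X Y; exact: wmul_norm.
  by move=> Y; have [] := wmul_blinl Y.
move=> X c Y Z; move: X; apply: blin_eq; first exact: wmul_blinl.
  by apply: blinD; [apply: blinZ|]; exact: wmul_blinl.
by move=> m v; rewrite !wmul_delta; exact: (shiftmul_blin m v).1.
Qed.

Lemma coef_wmul X Y m : wmul X Y m = l1lift (fun a u => mulV u (Y (m - a))) X.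
Proof.
have [fl _ _] := @mulPV_bbil R q.
have lT (a : int) : linear (fun u => mulV u (Y (m - a))) by exact: fl.
move: X; apply: (@blin_eq _ _ _ (fun X => wmul X Y m)).
- exact: (blin_comp (coef_blin m) (wmul_blinl Y)).
- apply: (@l1lift_blin _ _ _ _ (mulK * `|Y|)) => //.
  + exact: PV_abs_complete.
  + by rewrite mulr_ge0// ltW// mulK_gt0.
  + move=> a v; apply: (le_trans (mulK_bound _ _)).
    by rewrite mulrAC ler_wpM2r// ler_wpM2l ?l1_coef_le// ltW// mulK_gt0.
- by move=> a v; rewrite wmul_delta shiftmulE l1lift_delta.
Qed.

End WienerAlgebra.
Arguments mulK : clear implicits.

(** * Values on the unit circle and uniqueness of Fourier coefficients *)

Section Evaluation.
Context {R : realType} {q : nat}.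
Local Notation V := (PV R q).
Local Notation W := (l1 V).
Local Notation C := (cplx R).
Implicit Types (u v : V) (X Y Z : W) (s : seq int) (z : C).

Definition ev1 z X : V := l1lift (fun m v => scaleV (z ^ m) v) X.

Lemma norm_unit_expz z (m : int) : `|z| = 1 -> `|z ^ m| = 1.
Proof.
move=> z1; case: m => m; first by rewrite -exprnP normrX z1 expr1n.
by rewrite NegzE -exprnN normfV normrX z1 expr1n invr1.
Qed.

Lemma unit_neq0 z : `|z| = 1 -> z != 0.
Proof. by move=> z1; rewrite -normr_eq0 z1 oner_neq0. Qed.

Lemma ev1_scale_bound z : `|z| = 1 ->
  forall m v, `|scaleV (z ^ m) v| <= (1 + 1) * `|v|.
Proof. by move=> z1 m v; apply: scaleV_bound; rewrite norm_unit_expz. Qed.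

Lemma ev1_blin z : `|z| = 1 -> blin (ev1 z : W -> V).
Proof.
move=> z1; apply: (l1lift_blin (C := 1 + 1)).
- exact: PV_abs_complete.
- by move=> m; exact: scaleV_linear.
- by [].
- exact: ev1_scale_bound.
Qed.

Lemma ev1_delta z m v : ev1 z (delta m v) = scaleV (z ^ m) v.
Proof. by rewrite /ev1 l1lift_delta// => k; exact: scaleV_linear. Qed.

Lemma shiftmul_delta m v k u : shiftmul m v (delta k u) = delta (m + k) (mulV v u).
Proof.
have [_ fr _] := @mulPV_bbil R q.
apply: l1P => j.
rewrite shiftmulE.
rewrite deltaE.
rewrite [RHS]deltaE.
rewrite subr_eq.
rewrite addrC.
case: ifP => // _.
exact: lin0.
Qed.

Lemma ev1_mul z X Y : `|z| = 1 -> ev1 z (wmul X Y) = mulV (ev1 z X) (ev1 z Y).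
Proof.
move=> z1; have be := ev1_blin z1; have bm := @mulPV_bbil R q.
move: X; apply: blin_eq.
- exact: blin_comp be (wmul_blinl Y).
- exact: (blin_comp (bbil_blinl _ bm) be).
move=> m v.
rewrite wmul_delta.
rewrite ev1_delta.
move: Y.
apply: blin_eq.
- exact: blin_comp be (shiftmul_blin m v).
- exact: (blin_comp (bbil_blinr _ bm) be).
move=> k u; rewrite shiftmul_delta !ev1_delta; apply: toM_inj.
rewrite toM_scale !toM_mul !toM_scale expfzDr ?unit_neq0//.
by rewrite -scalemxAl -scalemxAr scalerA.
Qed.

Definition evM z X := toM (ev1 z X).

Lemma evM_mul z X Y : `|z| = 1 -> evM z (wmul X Y) = evM z X *m evM z Y.
Proof. by move=> z1; rewrite /evM ev1_mul// toM_mul. Qed.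

Lemma evM_delta z m v : evM z (delta m v) = z ^ m *: toM v.
Proof. by rewrite /evM ev1_delta toM_scale. Qed.

(** Averages a loop over z and -z and reads the result as a function of z^2. Iteration replaces
    integration over the circle: the constant term survives, while any given finite set of other
    frequencies is eventually discarded. *)
Definition dec X : W := reop (fun _ v => v) (fun m => 2%:Z * m) X.

Let id_bound (m : int) v : `|v| <= 1 * `|v|. Proof. by rewrite mul1r. Qed.
Let dbl_inj : injective (fun m : int => 2%:Z * m).
Proof. by move=> m k; lia. Qed.

Lemma decE X m : dec X m = X (2%:Z * m).
Proof. exact: (@reopE _ _ _ _ 1). Qed.

Lemma dec_blin : blin dec.
Proof. exact: (@reop_blin _ _ _ _ 1). Qed.

Lemma ev1_dec z X : `|z| = 1 -> ev1 z X + ev1 (- z) X = 2 *: ev1 (z ^+ 2) (dec X).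
Proof.
move=> z1; have mz1 : `|- z| = 1 by rewrite normrN.
have zz1 : `|z ^+ 2| = 1 by rewrite normrX z1 expr1n.
move: X; apply: blin_eq.
- by apply: blinD; exact: ev1_blin.
- by apply: blinZ; apply: (blin_comp _ dec_blin); exact: ev1_blin.
move=> m v.
rewrite ev1_delta.
rewrite ev1_delta.

(* Parity of the frequency: odd monomials cancel between z and -z, even ones double. *)
have [j [b mE]] : exists j : int, exists b : bool, m = 2%:Z * j + b%:Z.
  exists (m %/ 2)%Z, ((m %% 2)%Z == 1); rewrite {1}(divz_eq m 2) mulrC.
  by congr (_ + _); have := modz_ge0 m (isT : 2%:Z != 0);
    have := ltz_pmod m (isT : 0 < 2%:Z); case: eqP => //; lia.
have zE : (- z) ^ m = (-1) ^+ b * z ^ m.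
  have := expfzMl (-1 : C) z m; rewrite mulN1r => ->; congr (_ * _); rewrite mE expfzDr ?oppr_eq0 ?oner_neq0//.
  by rewrite -exprz_exp -exprnP sqrrN expr1n exp1rz mul1r -exprnP.
have -> : dec (delta m v) = if b then 0 else delta j v.
  apply: l1P => k; rewrite decE deltaE.
  case: b mE {zE} => mE; last by rewrite deltaE; congr (if _ then _ else _); lia.
  by have -> : (2%:Z * k == m) = false by lia.
rewrite zE; case: b mE {zE} => mE.
  rewrite expr1 (lin0 (ev1_blin zz1).1) scaler0.
  apply: toM_inj; rewrite toMD !toM_scale toM0 mulN1r scaleNr.
  exact: subrr.
rewrite expr0 mul1r mE addr0 -exprz_exp ev1_delta -exprnP.
by rewrite scalerDl !scale1r.
Qed.

Lemma unit_sqrt z : `|z| = 1 -> exists2 w : C, `|w| = 1 & w ^+ 2 = z.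
Proof.
move=> z1; exists (sqrtC z); last exact: sqrtCK.
by apply/eqP; rewrite -sqrp_eq1// -normrX sqrtCK z1.
Qed.

Definition evanish X := forall z, `|z| = 1 -> ev1 z X = 0.

Lemma evanish_dec X : evanish X -> evanish (dec X).
Proof.
move=> X0 z /unit_sqrt[w w1 <-].
have := ev1_dec X w1; rewrite !X0 ?normrN// addr0 => /esym/eqP.
by rewrite scaler_eq0 pnatr_eq0/= => /eqP.
Qed.

Lemma evanish_iter X p : evanish X -> evanish (iter p dec X).
Proof. by move=> X0; elim: p => //= p; exact: evanish_dec. Qed.

Lemma dec_iterE X p m : iter p dec X m = X (2%:Z ^+ p * m).
Proof.
elim: p m => [|p ih] m; first by rewrite expr0 mul1r.
by rewrite iterS decE ih mulrA exprSr.
Qed.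

Lemma evanish_coef0 X : evanish X -> X 0 = 0.
Proof.
move=> X0; have one1 : `|1 : C| = 1 by rewrite normr1.
have [K K0 hK] := blin_bound (ev1_blin one1).
apply/eqP; rewrite -normr_le0; apply/ler_addgt0Pl => e e0; rewrite addr0.
have eK : 0 < e / K by rewrite divr_gt0.
have [||s us hs] := @sum_sup_small _ (fun m => `|X m|) `|X| _ _ _ eK.
- by [].
- exact: l1_sum_le.
(* Since 2 ^ p exceeds every index in [s], a nonzero multiple of 2 ^ p lies outside [s]; the p-fold
   average therefore differs from its constant term by at most e / K. *)
pose p := \max_(m <- s) `|m|%N.
have ps m : m \in s -> (`|m| < 2 ^ p)%N.
  move=> ms; apply: leq_ltn_trans (ltn_expl p _) => //.
  exact: (@leq_bigmax_seq _ _ xpredT (fun m : int => `|m|%N)).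
pose Y := iter p dec X.
have YX : `|delta 0 (X 0) - Y| <= e / K.
  apply: l1_norm_le => s' us'.
  pose f := (fun m : int => 2%:Z ^+ p * m).
  have fi : injective f.
    by apply: mulfI; rewrite expf_neq0.
  have us2 : uniq (map f [seq m <- s' | m != 0]).
    by rewrite map_inj_uniq ?filter_uniq.
  apply: le_trans (hs _ us2); rewrite big_map big_filter_cond/= big_mkcond.
  rewrite [leRHS]big_mkcond/=; apply: ler_sum => m _.
  rewrite [X in `|X|](l1B (delta 0 (X 0)) Y m) deltaE dec_iterE.
  have [->|m0] /= := eqVneq m 0; first by rewrite mulr0 subrr normr0.
  rewrite sub0r normrN; have -> // : f m \notin s.
  apply/negP => /ps; rewrite /f abszM abszX ltnNge => /negP; apply.
  by rewrite leq_pmulr// absz_gt0.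
have ev0 : ev1 1 (delta 0 (X 0) - Y) = X 0.
  rewrite (linB (ev1_blin one1).1) ev1_delta (evanish_iter p X0) ?normr1// subr0.
  by apply: toM_inj; rewrite toM_scale expr0z scale1r.
by rewrite -ev0 (le_trans (hK _))// mulrC -ler_pdivlMr.
Qed.

Lemma evanish_eq0 X : evanish X -> X = 0.
Proof.
move=> X0; apply: l1P => m; rewrite l10.
pose Y := reop (fun _ v => v) (fun k => k + m) X.
have YE k : Y k = X (k + m) by apply: (@reopE _ _ _ _ 1) => //; exact: addIr.
rewrite -[m]add0r -YE; apply: evanish_coef0 => z z1.
have -> : Y = shiftmul (- m) (1%:M, 0) X.
  apply: l1P => k; rewrite YE shiftmulE opprK; apply: toM_inj.
  rewrite toM_mul; have -> : toM (1%:M, 0) = 1%:M :> 'M[C]_q.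
    by apply/matrixP => i j; rewrite !mxE; case: (i == j).
  by rewrite mul1mx.
by rewrite -wmul_delta ev1_mul// X0//; exact: (lin0 (bbil_blinr _ (@mulPV_bbil R q)).1).
Qed.

(** Identities between loops, the ring axioms included, are from here on verified as matrix
    identities at each point of the circle. *)
Lemma evM_inj X Y : (forall z, `|z| = 1 -> evM z X = evM z Y) -> X = Y.
Proof.
move=> XY; apply/eqP; rewrite -subr_eq0; apply/eqP; apply: evanish_eq0 => z z1.
by rewrite (linB (ev1_blin z1).1) (toM_inj (XY z z1)) subrr.
Qed.

End Evaluation.

Section WienerRing.
Context {R : realType} {q : nat}.
Local Notation V := (PV R q).
Local Notation W := (l1 V).
Local Notation C := (cplx R).
Implicit Types (u v : V) (X Y Z : W) (s : seq int) (z : C) (A : 'M[C]_q).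

Definition wcst A : W := delta 0 (ofM A : V).

Lemma evM_cst z A : evM z (wcst A) = A.
Proof. by rewrite /wcst evM_delta expr0z scale1r ofMK. Qed.

Lemma evMD z X Y : `|z| = 1 -> evM z (X + Y) = evM z X + evM z Y.
Proof. by move=> z1; rewrite /evM (linD (ev1_blin z1).1) toMD. Qed.

Lemma evMN z X : `|z| = 1 -> evM z (- X) = - evM z X.
Proof. by move=> z1; rewrite /evM (linN (ev1_blin z1).1) toMN. Qed.

Lemma evMZ z (a : R) X : `|z| = 1 -> evM z (a *: X) = a%:C *: evM z X.
Proof. by move=> z1; rewrite /evM (linZ (ev1_blin z1).1) toMZ. Qed.

Lemma wmulA : associative (wmul : W -> W -> W).
Proof. by move=> X Y Z; apply: evM_inj => z z1; rewrite !evM_mul// mulmxA. Qed.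

Lemma wmul1l : left_id (wcst 1%:M) wmul.
Proof. by move=> X; apply: evM_inj => z z1; rewrite !evM_mul// evM_cst mul1mx. Qed.

Lemma wmul1r : right_id (wcst 1%:M) wmul.
Proof. by move=> X; apply: evM_inj => z z1; rewrite !evM_mul// evM_cst mulmx1. Qed.

Lemma wmulDl : left_distributive (wmul : W -> W -> W) +%R.
Proof. by move=> X Y Z; apply: (linD ((wmul_blinl Z).1)). Qed.

Lemma wmulDr : right_distributive (wmul : W -> W -> W) +%R.
Proof. by move=> X Y Z; apply: (linD ((bbil_blinr X (@wmul_bbil R q)).1)). Qed.

End WienerRing.

HB.instance Definition _ (R : realType) (q : nat) :=
  GRing.Zmodule_isPzRing.Build (l1 (PV R q)) (@wmulA R q) wmul1l wmul1r wmulDl wmulDr.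

(** * Frequency supports, coefficientwise symmetries and rescaling *)

Section WienerRingTheory.
Context {R : realType} {q : nat}.
Local Notation V := (PV R q).
Local Notation W := (l1 V).
Local Notation C := (cplx R).
Implicit Types (u v : V) (X Y Z : W) (s : seq int) (z : C) (A : 'M[C]_q).

Lemma wmulrE X Y : X * Y = wmul X Y. Proof. by []. Qed.

Lemma evM1 z : evM z (1 : W) = 1%:M. Proof. exact: evM_cst. Qed.

Lemma evMM z X Y : `|z| = 1 -> evM z (X * Y) = evM z X *m evM z Y.
Proof. exact: evM_mul. Qed.

Lemma wmul_bil : bbil (fun X Y : W => X * Y).
Proof. exact: wmul_bbil. Qed.

(** Pointwise on the circle, a one-sided inverse of a square matrix is two-sided. *)
Lemma wmul1C X Y : X * Y = 1 -> Y * X = 1.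
Proof.
move=> XY; apply: evM_inj => z z1; rewrite evMM// evM1.
by apply: mulmx1C; rewrite -evMM// XY evM1.
Qed.

Lemma l1lift_eq {U : normedModType R} (T T' : int -> V -> U) X Y :
  (forall m, T m (X m) = T' m (Y m)) -> l1lift T X = l1lift T' Y.
Proof.
move=> XY; rewrite !l1liftE; congr (_ + _); congr (limn (series _));
  by apply/funext => i; rewrite XY.
Qed.

(** Fourier form of holomorphic extension: [supge 0] loops extend to the disc, [suple 0] loops to
    its complement. *)
Definition supge (a : int) X := forall m, m < a -> X m = 0.
Definition suple (a : int) X := forall m, a < m -> X m = 0.

Let mul0V v : mulV 0 v = 0 :> V.
Proof. by apply: toM_inj; rewrite toM_mul toM0 mul0mx. Qed.
Let mulV0 v : mulV v 0 = 0 :> V.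
Proof. by apply: toM_inj; rewrite toM_mul toM0 mulmx0. Qed.

Lemma coef_zero X Y m : (forall a, X a = 0 \/ Y (m - a) = 0) -> (X * Y) m = 0.
Proof.
move=> XY; rewrite wmulrE coef_wmul (@l1lift_eq _ _ (fun a u => mulV u (Y (m - a))) _ (delta 0 0)).
  by rewrite l1lift_delta// => a; have [fl _ _] := @mulPV_bbil R q; exact: fl.
by move=> a; rewrite deltaE if_same mul0V; have [->|->] := XY a; rewrite ?mul0V ?mulV0.
Qed.

Lemma coef_single X Y m b : (forall a, a != b -> X a = 0 \/ Y (m - a) = 0) ->
  (X * Y) m = mulV (X b) (Y (m - b)).
Proof.
move=> XY; rewrite wmulrE coef_wmul (@l1lift_eq _ _ (fun a u => mulV u (Y (m - a))) _ (delta b (X b))).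
  by rewrite l1lift_delta// => a; have [fl _ _] := @mulPV_bbil R q; exact: fl.
move=> a; rewrite deltaE; have [->//|ab] := eqVneq a b.
by rewrite mul0V; have [->|->] := XY a ab; rewrite ?mul0V ?mulV0.
Qed.

Lemma supgeM a b X Y : supge a X -> supge b Y -> supge (a + b) (X * Y).
Proof.
move=> Xa Yb m mab; apply: coef_zero => c.
have [ca|ac] := ltP c a; first by left; exact: Xa.
by right; apply: Yb; lia.
Qed.

Lemma supleM a b X Y : suple a X -> suple b Y -> suple (a + b) (X * Y).
Proof.
move=> Xa Yb m mab; apply: coef_zero => c.
have [ca|ac] := ltP a c; first by left; exact: Xa.
by right; apply: Yb; lia.
Qed.

(** In degree a + b only the two top coefficients can meet. This isolates the square of the loop
    parameter in the Maurer-Cartan equation. *)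
Lemma suple_leadM a b X Y : suple a X -> suple b Y ->
  (X * Y) (a + b) = mulV (X a) (Y b).
Proof.
move=> Xa Yb; rewrite (@coef_single _ _ _ a) => [|c ca].
  by rewrite addrAC subrr add0r.
have [ltca|] := ltP a c; first by left; exact: Xa.
by rewrite le_eqVlt (negPf ca)/= => ac; right; apply: Yb; lia.
Qed.

Lemma supge_suple_delta a X : supge a X -> suple a X -> X = delta a (X a).
Proof.
move=> Xa Xb; apply: l1P => m; rewrite deltaE; case: ltgtP => [/Xa|/Xb|->] //.
Qed.

Lemma supge_delta a v : supge a (delta a v).
Proof. by move=> m ma; rewrite deltaE lt_eqF. Qed.

Lemma suple_delta a v : suple a (delta a v).
Proof. by move=> m ma; rewrite deltaE gt_eqF. Qed.

Lemma supge_weaken a b X : b <= a -> supge a X -> supge b X.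
Proof. by move=> ba Xa m mb; apply: Xa; exact: lt_le_trans ba. Qed.

Lemma suple_weaken a b X : a <= b -> suple a X -> suple b X.
Proof. by move=> ba Xa m mb; apply: Xa; exact: le_lt_trans mb. Qed.

Lemma supgeD a X Y : supge a X -> supge a Y -> supge a (X + Y).
Proof. by move=> Xa Ya m ma; rewrite l1D Xa// Ya// addr0. Qed.

Lemma supleD a X Y : suple a X -> suple a Y -> suple a (X + Y).
Proof. by move=> Xa Ya m ma; rewrite l1D Xa// Ya// addr0. Qed.

Lemma one_coef : (1 : W) = delta 0 (ofM 1%:M : V). Proof. by []. Qed.

Let idb (m : int) v : `|v| <= 1 * `|v|. Proof. by rewrite mul1r. Qed.

Definition prle X : W := reop (fun m v => if m <= 0 then v else 0) id X.

Let prleb (m : int) v : `|if m <= 0 then v else 0| <= 1 * `|v|.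
Proof. by case: ifP => _; rewrite mul1r// normr0. Qed.

Lemma prleE X m : prle X m = if m <= 0 then X m else 0.
Proof. exact: (@reopE _ _ _ _ 1). Qed.

Lemma prle_norm X : `|prle X| <= `|X|.
Proof. by rewrite -[leRHS]mul1r; exact: reop_norm. Qed.

Lemma prle_blin : blin prle.
Proof.
apply: (@reop_blin _ _ _ _ 1) => // m a u v; case: ifP => // _.
by rewrite scaler0 addr0.
Qed.

Lemma suple_prle X : suple 0 (prle X).
Proof. by move=> m m0; rewrite prleE leNgt m0. Qed.

Definition pr0 X : W := delta 0 (X 0).

Lemma pr0_norm X : `|pr0 X| <= `|X|.
Proof. exact: le_trans (delta_norm _ _) (l1_coef_le _ _). Qed.

Lemma pr0_blin : blin pr0.
Proof. exact: blin_comp (delta_blin 0) (coef_blin 0). Qed.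

Definition wtr X : W := reop (fun _ v => (v.1^T, v.2^T) : V) id X.
Definition wrot (c : C) X : W := reop (fun m v => scaleV (c ^ m) v) id X.
Definition winv X : W := reop (fun _ v => v) (fun m => - m) X.
Definition wconj X : W := reop (fun _ v => (v.1, - v.2) : V) id X.

Let trb (m : int) v : `|(v.1^T, v.2^T) : V| <= 1 * `|v|.
Proof.
rewrite mul1r; apply: pair_norm_le => // i j; rewrite !mxE.
exact: pair_entry_le.
Qed.

Let conjb (m : int) v : `|(v.1, - v.2) : V| <= 1 * `|v|.
Proof.
rewrite mul1r; apply: pair_norm_le => // i j /=; rewrite [X in _ /\ `|X| <= _]mxE normrN.
exact: pair_entry_le.
Qed.

Lemma wtrE X m : wtr X m = ((X m).1^T, (X m).2^T).
Proof. exact: (@reopE _ _ _ _ 1). Qed.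

Lemma wrotE (c : C) X m : `|c| = 1 -> wrot c X m = scaleV (c ^ m) (X m).
Proof.
by move=> c1; apply: (@reopE _ _ _ _ (1 + 1)) => //; exact: ev1_scale_bound.
Qed.

Lemma winvE X m : winv X m = X (- m).
Proof. by apply: (@reopE _ _ _ _ 1) => //; exact: oppr_inj. Qed.

Lemma wconjE X m : wconj X m = ((X m).1, - (X m).2).
Proof. exact: (@reopE _ _ _ _ 1). Qed.

Lemma wtr_blin : blin wtr.
Proof.
apply: (@reop_blin _ _ _ _ 1) => // m a u v; congr (_, _);
  by apply/matrixP => i j; rewrite !mxE.
Qed.

Lemma wrot_blin (c : C) : `|c| = 1 -> blin (wrot c).
Proof.
move=> c1; apply: (@reop_blin _ _ _ _ (1 + 1)) => //.
  exact: ev1_scale_bound.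
by move=> m; exact: scaleV_linear.
Qed.

Lemma winv_blin : blin winv.
Proof. by apply: (@reop_blin _ _ _ _ 1) => //; exact: oppr_inj. Qed.

Lemma wconj_blin : blin wconj.
Proof.
apply: (@reop_blin _ _ _ _ 1) => // m a u v; congr (_, _);
  by apply/matrixP => i j; rewrite !mxE// mulrN opprD.
Qed.

Lemma conj_unit (z : C) : `|z| = 1 -> conjc z = z^-1.
Proof.
move=> z1; apply: (mulfI (unit_neq0 z1)); rewrite mulfV ?unit_neq0// -sqr_normc z1.
by rewrite expr1n.
Qed.

(** An operation on coefficients and one on values, both bounded, are compared on monomials; this
    identifies transposition, rotation, inversion and conjugation pointwise. *)
Lemma evM_eq (f : W -> W) (g : V -> V) (z w : C) : blin f -> blin g ->
  `|z| = 1 -> `|w| = 1 ->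
  (forall m v, evM z (f (delta m v)) = toM (g (scaleV (w ^ m) v))) ->
  forall X, evM z (f X) = toM (g (ev1 w X)).
Proof.
move=> bf bg z1 w1 h X; congr toM.
move: X; apply: blin_eq.
- exact: (blin_comp (ev1_blin z1) bf).
- exact: (blin_comp bg (ev1_blin w1)).
by move=> m v; rewrite ev1_delta; apply: toM_inj; rewrite -h.
Qed.

Lemma evM_tr z X : `|z| = 1 -> evM z (wtr X) = (evM z X)^T.
Proof.
move=> z1; pose g := fun v : V => (v.1^T, v.2^T) : V.
have gE v : toM (g v) = (toM v)^T by apply/matrixP => i j; rewrite !mxE.
rewrite -gE; apply: evM_eq => //; first exact: wtr_blin.
  split=> [a u v|]; last by exists 1 => v; exact: (trb 0).
  by congr (_, _); apply/matrixP => i j; rewrite !mxE.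
move=> m v; have -> : wtr (delta m v) = delta m (g v).
  apply: l1P => k; rewrite wtrE !deltaE; case: ifP => // _.
  by congr (_, _); apply/matrixP => i j; rewrite !mxE.
by rewrite evM_delta !gE toM_scale linearZ.
Qed.

Lemma evM_rot (c z : C) X : `|c| = 1 -> `|z| = 1 -> evM z (wrot c X) = evM (c * z) X.
Proof.
move=> c1 z1; have cz1 : `|c * z| = 1 by rewrite normrM c1 z1 mul1r.
apply: (@evM_eq (wrot c) id z (c * z)) => //.
- exact: wrot_blin.
- exact: blin_id.
move=> m v; have -> : wrot c (delta m v) = delta m (scaleV (c ^ m) v).
  apply: l1P => k; rewrite wrotE// !deltaE; case: eqP => [->//|_].
  by rewrite (lin0 (scaleV_linear _)).
by rewrite evM_delta !toM_scale scalerA expfzMl [_ * z ^ _]mulrC.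
Qed.

Lemma evM_inv z X : `|z| = 1 -> evM z (winv X) = evM z^-1 X.
Proof.
move=> z1; have w1 : `|z^-1| = 1 by rewrite normfV z1 invr1.
apply: (@evM_eq winv id z z^-1) => //.
- exact: winv_blin.
- exact: blin_id.
move=> m v; have -> : winv (delta m v) = delta (- m) v.
  by apply: l1P => k; rewrite winvE !deltaE eqr_oppLR.
by rewrite evM_delta toM_scale exprz_inv.
Qed.

Lemma evM_conj z X : `|z| = 1 -> evM z (wconj X) = map_mx (@conjc R) (evM (conjc z) X).
Proof.
move=> z1; have w1 : `|conjc z| = 1 by rewrite normcJ.
pose g := fun v : V => (v.1, - v.2) : V.
have gE v : toM (g v) = map_mx (@conjc R) (toM v) by apply/matrixP => i j; rewrite !mxE.
rewrite -gE; apply: evM_eq => //; first exact: wconj_blin.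
  split=> [a u v|]; last by exists 1 => v; exact: (conjb 0).
  by congr (_, _); apply/matrixP => i j; rewrite !mxE// mulrN opprD.
move=> m v; have -> : wconj (delta m v) = delta m (g v).
  apply: l1P => k; rewrite wconjE !deltaE; case: ifP => // _.
  by congr (_, _); apply/matrixP => i j; rewrite !mxE// oppr0.
rewrite evM_delta !gE toM_scale; apply/matrixP => i j; rewrite !mxE rmorphM/=.
congr (_ * _); rewrite (conj_unit z1) (@conj_unit (z^-1 ^ m)) ?norm_unit_expz//.
  by rewrite exprz_inv invr_expz opprK.
by rewrite normfV z1 invr1.
Qed.

Lemma wtrM X Y : wtr (X * Y) = wtr Y * wtr X.
Proof.
by apply: evM_inj => z z1; rewrite evM_tr// !evMM// !evM_tr// trmx_mul.
Qed.

Lemma wtr1 : wtr 1 = 1.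
Proof. by apply: evM_inj => z z1; rewrite evM_tr// evM1 trmx1. Qed.

Lemma wtrK X : wtr (wtr X) = X.
Proof. by apply: evM_inj => z z1; rewrite !evM_tr// trmxK. Qed.

Lemma wtr_supge a X : supge a X -> supge a (wtr X).
Proof. by move=> Xa m ma; rewrite wtrE Xa// !trmx0. Qed.

Lemma wtr_suple a X : suple a X -> suple a (wtr X).
Proof. by move=> Xa m ma; rewrite wtrE Xa// !trmx0. Qed.

(** Absolute convergence of the Laurent series on the circle of radius r; then [scl r X] is the loop
    z to X(r z). *)
Definition sclok (r : R) X :=
  exists B : R, forall s, uniq s -> \sum_(m <- s) `|r ^ m *: X m| <= B.

Definition scl (r : R) X : W := l1_of (fun m => r ^ m *: X m).

Lemma sclE r X m : sclok r X -> scl r X m = r ^ m *: X m.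
Proof. by case=> B XB; rewrite /scl (l1_ofE XB). Qed.

Lemma sclokP r X Y : (forall m, Y m = r ^ m *: X m) -> sclok r X /\ scl r X = Y.
Proof.
move=> YX; have ok : sclok r X.
  by exists `|Y| => s us; under eq_bigr do rewrite -YX; exact: l1_sum_le.
by split=> //; apply: l1P => m; rewrite sclE// YX.
Qed.

Lemma scl1 X : sclok 1 X /\ scl 1 X = X.
Proof. by apply: sclokP => m; rewrite exp1rz scale1r. Qed.

Lemma mulV_coef_bound v Y m : `|mulV v (Y m)| <= mulK R q * `|Y| * `|v|.
Proof.
apply: (le_trans (mulK_bound _ _)); rewrite mulrAC ler_wpM2r//.
by rewrite ler_wpM2l ?l1_coef_le// ltW// mulK_gt0.
Qed.

(** In each term of the convolution r ^ a and r ^ (m - a) multiply to r ^ m. The product of the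
    rescaled loops also certifies that the product can be rescaled. *)
Lemma sclM r X Y : r != 0 -> sclok r X -> sclok r Y ->
  sclok r (X * Y) /\ scl r (X * Y) = scl r X * scl r Y.
Proof.
move=> r0 Xr Yr; apply: sclokP => m; rewrite !wmulrE !coef_wmul.
have [fl fr _] := @mulPV_bbil R q.
transitivity (l1lift (fun a u => r ^ m *: mulV u (Y (m - a))) X).
  apply: l1lift_eq => a; rewrite !sclE// (linZ (fl _)) (linZ (fr _)) scalerA.
  by congr (_ *: _); rewrite -expfzDr// addrC subrK.
move: X {Xr}; apply: blin_eq.
- apply: (@l1lift_blin _ _ _ _ (`|r ^ m| * (mulK R q * `|Y|))).
  + exact: PV_abs_complete.
  + by move=> a c u v; rewrite (fl _ c) scalerDr !scalerA [_ * c]mulrC.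
  + by rewrite !mulr_ge0// ltW// mulK_gt0.
  + move=> a v; rewrite normrZ -mulrA ler_wpM2l// (le_trans (mulK_bound _ _))//.
    by rewrite -!mulrA ler_wpM2l ?(ltW mulK_gt0)// mulrC ler_wpM2r// l1_coef_le.
- apply: blinZ; apply: (@l1lift_blin _ _ _ _ (mulK R q * `|Y|)).
  + exact: PV_abs_complete.
  + by move=> a; exact: fl.
  + by rewrite !mulr_ge0// ltW// mulK_gt0.
  + move=> a v; exact: mulV_coef_bound.
- move=> a v; rewrite l1lift_delta => [|b c u w]; last first.
    by rewrite (fl _ c) scalerDr !scalerA [_ * c]mulrC.
  by rewrite l1lift_delta// => b; exact: fl.
Qed.

Lemma scl_delta r m v : sclok r (delta m v) /\ scl r (delta m v) = delta m (r ^ m *: v).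
Proof.
by apply: sclokP => k; rewrite !deltaE; case: eqP => [->|]; rewrite ?scaler0.
Qed.

Lemma sclD r X Y : sclok r X -> sclok r Y ->
  sclok r (X + Y) /\ scl r (X + Y) = scl r X + scl r Y.
Proof.
by move=> Xr Yr; apply: sclokP => m; rewrite !l1D !sclE// scalerDr.
Qed.

Lemma scl_tr r X : sclok r X -> sclok r (wtr X) /\ scl r (wtr X) = wtr (scl r X).
Proof.
move=> Xr; apply: sclokP => m; rewrite !wtrE sclE//.
by congr (_, _); apply/matrixP => i j; rewrite !mxE.
Qed.

Lemma scl_conj r X : sclok r X -> sclok r (wconj X) /\ scl r (wconj X) = wconj (scl r X).
Proof.
move=> Xr; apply: sclokP => m; rewrite !wconjE sclE//.
by congr (_, _); apply/matrixP => i j; rewrite !mxE ?mulrN.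
Qed.

Lemma scl_rot r c X : `|c| = 1 -> sclok r X ->
  sclok r (wrot c X) /\ scl r (wrot c X) = wrot c (scl r X).
Proof.
move=> c1 Xr; apply: sclokP => m; rewrite !wrotE// sclE//.
exact: (linZ (scaleV_linear _)).
Qed.

Lemma scl_inv r X : sclok r^-1 X -> sclok r (winv X) /\ scl r (winv X) = winv (scl r^-1 X).
Proof.
by move=> Xr; apply: sclokP => m; rewrite !winvE sclE// exprz_inv opprK.
Qed.

Lemma scl_cst r A : sclok r (wcst A) /\ scl r (wcst A) = wcst A.
Proof. by have [] := scl_delta r 0 (ofM A : V); rewrite expr0z scale1r. Qed.

(** For r >= 1 the factors r ^ m with m <= 0 are at most 1, so rescaling is a bounded operator on
    nonpositive frequencies and preserves smoothness in t. *)
Lemma scl_blin_le (r : R) : 1 <= r ->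
  exists2 f : W -> W, blin f & forall X, suple 0 X -> sclok r X /\ scl r X = f X.
Proof.
move=> r1; have r0 : 0 < r by apply: lt_le_trans r1.
pose g (m : int) (v : V) : V := if m <= 0 then r ^ m *: v else 0.
have gb m v : `|g m v| <= 1 * `|v|.
  rewrite /g; case: ifP => [m0|]; last by rewrite normr0 mul1r.
  rewrite normrZ ler_wpM2r// ger0_norm ?exprz_ge0// ?(ltW r0)//.
  rewrite -(opprK m); have : 0 <= - m by rewrite oppr_ge0.
  by case: (- m) => // j _; rewrite -exprnN invf_le1 ?exprn_gt0// exprn_ege1.
exists (reop g id).
  apply: (@reop_blin _ _ _ _ 1) => // m a u v; rewrite /g; case: ifP => _.
    by rewrite scalerDr !scalerA mulrC.
  by rewrite scaler0 addr0.
move=> X X0; apply: sclokP => m; rewrite (@reopE _ _ _ _ 1)// /g.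
by case: leP => // m0; rewrite X0// scaler0.
Qed.

End WienerRingTheory.

Section ComplexConvergence.
Context {R : realType}.
Local Notation C := (cplx R).

Lemma cplx_norm_le (x y : R) : `|x +i* y : C| <= (`|x| + `|y|)%:C.
Proof.
rewrite normc_def lecR -[leRHS]ger0_norm ?addr_ge0// -sqrtr_sqr ler_sqrt ?sqr_ge0//=.
rewrite -(real_normK (num_real x)) -(real_normK (num_real y)).
by have := normr_ge0 x; have := normr_ge0 y; nra.
Qed.

Lemma cplx_cvg (T : Type) (F : set_system T) (x y : T -> R) (a b : R) : Filter F ->
  x @ F --> a -> y @ F --> b -> (x t +i* y t : C) @[t --> F] --> (a +i* b : C).
Proof.
move=> FF xa yb; apply/cvgrPdist_le => /= -[e e'] /=; rewrite ltcE/= => /andP[/eqP -> e0].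
have e2 : 0 < e / 2 by rewrite divr_gt0.
have /cvgrPdist_le/(_ _ e2) h1 := xa; have /cvgrPdist_le/(_ _ e2) h2 := yb.
near=> t; apply: (@le_trans _ _ (`|a - x t| + `|b - y t|)%:C).
  exact: (cplx_norm_le (a - x t) (b - y t)).
by rewrite lecR (splitr e) lerD//; near: t.
Unshelve. all: by end_near. Qed.

Lemma toM_cvg p q (T : Type) (F : set_system T)
    (x : T -> ('M[R]_(p, q) * 'M[R]_(p, q))%type) l i j : Filter F ->
  x @ F --> l -> (toM (x t) i j : C) @[t --> F] --> (toM l i j : C).
Proof.
move=> FF xl; rewrite mxE; under eq_fun do rewrite mxE.
apply: cplx_cvg.
  apply: (@cvg_comp _ _ _ (fun t => (x t).1) (fun M : 'M[R]_(p, q) => M i j) F (nbhs l.1)).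
    by apply: (cvg_comp _ _ xl); exact: cvg_fst.
  exact: coord_continuous.
apply: (@cvg_comp _ _ _ (fun t => (x t).2) (fun M : 'M[R]_(p, q) => M i j) F (nbhs l.2)).
  by apply: (cvg_comp _ _ xl); exact: cvg_snd.
exact: coord_continuous.
Qed.

End ComplexConvergence.

(** * The evaluation [ev] of the definitions in terms of [evM] *)

Section EvLink.
Context {R : realType} {n k : nat}.
Local Notation N := (n + (1 + k))%N.
Local Notation V := (PV R N).
Local Notation W := (l1 V).
Local Notation C := (cplx R).
Implicit Types (X Y : W) (z : C).

Lemma toM_sum p q I (r : seq I) (f : I -> ('M[R]_(p, q) * 'M[R]_(p, q))%type) :
  toM (\sum_(i <- r) f i) = \sum_(i <- r) toM (f i).
Proof. by elim/big_rec2: _ => [|i x y _ <-]; rewrite ?toM0 ?toMD. Qed.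

Lemma ev_evM z X : `|z| = 1 -> ev (X : wiener R n k) z = evM z X.
Proof.
move=> z1; apply/matrixP => i j; rewrite mxE /evM /ev1 l1liftE toMD [RHS]mxE.
have C0 : 0 <= 1 + 1 :> R by [].
have E (f g : nat -> V) (h : nat -> C) : f = g -> cvgn (series g) ->
    (forall m, h m = toM (f m) i j) -> limn (series h) = toM (limn (series g)) i j.
  move=> -> cg hf; apply/cvg_lim => //.
  have -> : series h = (fun N0 => toM (series g N0) i j).
    apply/funext => N0; rewrite !seriesEord/= toM_sum summxE.
    by apply: eq_bigr => m _; rewrite hf.
  exact: toM_cvg.
congr (_ + _).
  apply: (E _ _ _ erefl) => [|m].
    exact: (@l1lift_cvg1 _ _ _ (fun m => scaleV (z ^ m)) _ (@PV_abs_complete R N) C0 (ev1_scale_bound z1)).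
  by rewrite toM_scale [RHS]mxE [RHS]mulrC -exprnP.
apply: (E _ _ _ erefl) => [|m].
  exact: (@l1lift_cvg2 _ _ _ (fun m => scaleV (z ^ m)) _ (@PV_abs_complete R N) C0 (ev1_scale_bound z1)).
by rewrite toM_scale [RHS]mxE [RHS]mulrC -exprnN.
Qed.

(** Termwise z ^ m is r ^ m times (z / r) ^ m, so a value off the circle becomes a value on it. *)
Lemma ev_scl z X (r : R) : `|z| = r%:C -> z != 0 -> sclok r X ->
  ev (X : wiener R n k) z = evM (z / r%:C) (scl r X).
Proof.
move=> zr z0 Xr.
have r0 : r%:C != 0 by rewrite -zr normr_eq0.
have u1 : `|z / r%:C| = 1 by rewrite normrM normfV zr ger0_norm ?mulfV// -zr.
rewrite -(ev_evM (scl r X) u1).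
 apply/matrixP => i j. rewrite [LHS]mxE.
 rewrite [RHS]mxE.
have F (m : int) : fcoef (scl r X : wiener R n k) m i j = r%:C ^ m * fcoef (X : wiener R n k) m i j.
  rewrite mxE (sclE _ Xr) [fcoef _ _ _ _]mxE; rewrite (_ : r%:C ^ m = (r ^ m)%:C).
    apply/eqP; rewrite eq_complex/= !mxE.
    by rewrite !mul0r subr0 addr0 !eqxx.
  case: m => m; rewrite ?NegzE -!(exprnP, exprnN) -?rmorphXn// -fmorphV//.
have E1 : (fun m : nat => fcoef (scl r X : wiener R n k) m i j * (z / r%:C) ^+ m) =
    (fun m : nat => fcoef (X : wiener R n k) m i j * z ^+ m).
  apply/funext => m; rewrite F -exprnP expr_div_n mulrCA -mulrA.
  by rewrite mulrC; congr (_ * _); rewrite mulrCA mulfV ?mulr1// expf_neq0.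
have E2 : (fun m : nat => fcoef (scl r X : wiener R n k) (- m.+1%:Z) i j * (z / r%:C) ^- m.+1) =
    (fun m : nat => fcoef (X : wiener R n k) (- m.+1%:Z) i j * z ^- m.+1).
  apply/funext => m; rewrite F -exprnN expr_div_n invf_div.
  rewrite mulrACA [X in X * _]mulrC mulrA -[X in X * _]mulrA.
  by rewrite mulVKf// expf_neq0.
by rewrite E1 E2.
Qed.

End EvLink.

(** * Smooth maps into Banach spaces *)

Section Contraction.
Context {R : realType} {W : normedModType R}.

(** Iteration from 0 moves by at most rho / 2 ^ p in step p. The increments form an absolutely
    summable series, whose limit [abs_complete] provides. *)
Lemma contraction_fix (Phi : W -> W) (rho : R) : abs_complete W -> 0 <= rho ->
  (forall u, `|u| <= rho -> `|Phi u| <= rho) ->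
  (forall u w, `|u| <= rho -> `|w| <= rho -> `|Phi u - Phi w| <= 2^-1 * `|u - w|) ->
  exists2 u, `|u| <= rho & Phi u = u.
Proof.
move=> cW rho0 Pb Pc; pose x p := iter p Phi 0.
have xb p : `|x p| <= rho by elim: p => [|p ih]; [rewrite normr0|exact: Pb].
have dx p : `|x p.+1 - x p| <= 2^-1 ^+ p * rho.
  elim: p => [|p ih]; first by rewrite subr0 expr0 mul1r; exact: (xb 1%N).
  apply: (le_trans (Pc (x p.+1) (x p) (xb _) (xb _))).
  by rewrite exprS -mulrA ler_wpM2l ?invr_ge0.
have sx N : \sum_(i < N) `|x i.+1 - x i| <= 2 * rho.
  have : \sum_(i < N) `|x i.+1 - x i| <= (2 - 2 * 2^-1 ^+ N) * rho.
    elim: N => [|N ih]; first by rewrite big_ord0 expr0 mulr1 subrr mul0r.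
    rewrite big_ord_recr/= (le_trans (lerD ih (dx N)))// exprS.
    by rewrite -mulrDl ler_wpM2r//; lra.
  move/le_trans; apply; rewrite ler_wpM2r// lerBlDr lerDl mulr_ge0// exprn_ge0.
have tel N : series (fun i => x i.+1 - x i) N = x N.
  rewrite seriesEord/=; elim: N => [|N ih]; first by rewrite big_ord0.
  by rewrite big_ord_recr/= ih addrC subrK.
have /cvg_ex[l xl] := cW (fun i => x i.+1 - x i) _ sx.
have {tel xl} xl : x @ \oo --> l.
  by apply: cvg_trans xl; apply: near_eq_cvg; apply: nearW => N; rewrite tel.
have lb : `|l| <= rho.
  by apply: (cvgr_to_le (cvg_norm xl)); exact: nearW.
exists l => //; apply/eqP; rewrite -subr_eq0 -normr_le0.
apply/ler_addgt0Pl => e e0; rewrite addr0.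
have e2 : 0 < e / 2 by rewrite divr_gt0.
have xl1 : (fun p => x p.+1) @ \oo --> l by rewrite -(cvg_shiftS x) in xl.
have /cvgrPdist_le/(_ _ e2) h1 := xl; have /cvgrPdist_le/(_ _ e2) h2 := xl1.
near \oo => p.
have -> : Phi l - l = (Phi l - Phi (x p)) - (l - x p.+1).
  by rewrite opprB addrA subrK.
rewrite (le_trans (ler_normB _ _))// (splitr e) lerD//; last by near: p.
rewrite (le_trans (Pc _ _ _ _))//.
apply: (@le_trans _ _ (`|l - x p|)); last by near: p.
by rewrite ler_piMl//; lra.
Unshelve. all: by end_near. Qed.

Lemma lin_fix (L : W -> W) (b : W) : abs_complete W -> linear L ->
  (forall w, `|L w| <= 2^-1 * `|w|) -> exists u, u = b + L u.
Proof.
(* The ball of radius 2 [|b|] is invariant because L halves norms. *)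
move=> cW lL Lb; have [] := @contraction_fix (fun u => b + L u) (2 * `|b|) cW.
- by rewrite mulr_ge0.
- move=> u ub; rewrite (le_trans (ler_normD _ _))//.
  by have := Lb u; lra.
- move=> u w _ _; rewrite opprD addrACA subrr add0r -(linB lL).
  exact: Lb.
by move=> u _ uE; exists u; rewrite uE.
Qed.

(** Subtracting the equations, [L t] absorbs half of [u0 - u t], and the rest is the error in the
    data. Convergence of [L t] enters at the single vector [u0]. Applied to difference quotients
    this proves differentiability. *)
Lemma lin_fix_cvg (T : Type) (F : set_system T) (L : T -> W -> W) (L0 : W -> W)
    (b u : T -> W) (b0 u0 : W) : Filter F ->
  (forall t, linear (L t)) ->
  (\forall t \near F, forall w, `|L t w| <= 2^-1 * `|w|) ->
  (\forall t \near F, u t = b t + L t (u t)) -> u0 = b0 + L0 u0 ->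
  b @ F --> b0 -> (fun t => L t u0) @ F --> L0 u0 -> u @ F --> u0.
Proof.
move=> FF lL Lb ub ub0 bb LL; apply/cvgrPdist_le => e e0.
have e4 : 0 < e / 4 by rewrite divr_gt0.
have /cvgrPdist_le/(_ _ e4) h1 := bb; have /cvgrPdist_le/(_ _ e4) h2 := LL.
near=> t.
have ut : u t = b t + L t (u t) by near: t.
have Lt w : `|L t w| <= 2^-1 * `|w| by move: w; near: t.
have b1 : `|b0 - b t| <= e / 4 by near: t.
have l1 : `|L0 u0 - L t u0| <= e / 4 by near: t.
have E : u0 - u t = (b0 - b t) + (L0 u0 - L t u0) + L t (u0 - u t).
  by rewrite (linB (lL t)) -addrA subrKA addrACA -opprD -ut -ub0.
have := ler_normD ((b0 - b t) + (L0 u0 - L t u0)) (L t (u0 - u t)); rewrite -E.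
have := ler_normD (b0 - b t) (L0 u0 - L t u0); have := Lt (u0 - u t).
lra.
Unshelve. all: by end_near. Qed.

End Contraction.

(** * Directional derivatives and the classes C^r *)

Section SmoothCalculus.
Context {R : realType} {n : nat}.
Implicit Types (A B V W : normedModType R) (U : set 'rV[R]_n).
Local Notation E := 'rV[R]_n.

(** Existence and value of a directional derivative as one limit, so that the rules for limits apply
    directly. *)
Definition has_derive {X V : normedModType R} (f : X -> V) (t v : X) (d : V) :=
  h^-1 *: (f (h *: v + t) - f t) @[h --> (0 : R)^'] --> d.

Lemma cvg_near {T : Type} {V} (F : set_system T) (f g : T -> V) (l : V) : Filter F ->
  (\forall t \near F, f t = g t) -> f @ F --> l -> g @ F --> l.
Proof. by move=> FF fg; apply: cvg_trans; exact: near_eq_cvg. Qed.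

Lemma has_deriveP {X V : normedModType R} (f : X -> V) t v d :
  has_derive f t v d <-> derivable f t v /\ 'D_v f t = d.
Proof.
split=> [h|[+ <-]]; last by [].
by split; [exact: (cvgP d)|exact/cvg_lim].
Qed.

Lemma derivable_has {X V : normedModType R} (f : X -> V) t v :
  derivable f t v -> has_derive f t v ('D_v f t).
Proof. by move=> fd; apply/has_deriveP. Qed.

Lemma has_derive_cvg {X V : normedModType R} (f : X -> V) t v d :
  has_derive f t v d -> f (h *: v + t) @[h --> (0 : R)^'] --> f t.
Proof.
move=> fd.
have : h *: (h^-1 *: (f (h *: v + t) - f t)) + f t @[h --> (0 : R)^'] --> 0 *: d + f t.
  apply: cvgD; last exact: cvg_cst.
  by apply: cvgZ => //; apply: cvg_within_filter; exact: cvg_id.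
rewrite scale0r add0r; apply: cvg_near; near=> h.
have h0 : h != 0 by near: h; exact: nbhs_dnbhs_neq.
by rewrite scalerA mulfV// scale1r subrK.
Unshelve. all: by end_near. Qed.

Lemma has_derive_blin {X V W : normedModType R} (L : V -> W) (f : X -> V) t v d : blin L ->
  has_derive f t v d -> has_derive (fun x => L (f x)) t v (L d).
Proof.
move=> bL fd; apply: (@cvg_near _ _ ((0 : R)^') _ _ _ _ _ (blin_cvg _ bL fd)).
by apply: nearW => h /=; rewrite (linZ bL.1) (linB bL.1).
Qed.

Lemma has_derive_bbil {X A V W : normedModType R} (B : A -> V -> W) (f : X -> A) (g : X -> V) t v d e :
  bbil B -> has_derive f t v d -> has_derive g t v e ->
  has_derive (fun x => B (f x) (g x)) t v (B d (g t) + B (f t) e).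
Proof.
move=> bB fd ge; have [fl fr _] := bB.
have : B (h^-1 *: (f (h *: v + t) - f t)) (g t) +
    B (f (h *: v + t)) (h^-1 *: (g (h *: v + t) - g t)) @[h --> (0 : R)^'] -->
    B d (g t) + B (f t) e.
  apply: cvgD; apply: (bbil_cvg _ bB) => //; first exact: cvg_cst.
  exact: has_derive_cvg fd.
apply: cvg_near; apply: nearW => h /=.
rewrite (linZ (fl _)) (linZ (fr _)) -scalerDr; congr (_ *: _).
by rewrite (linB (fl _)) (linB (fr _)) addrC addrA subrK.
Qed.

Lemma has_deriveD {X V : normedModType R} (f g : X -> V) t v d e :
  has_derive f t v d -> has_derive g t v e -> has_derive (fun x => f x + g x) t v (d + e).
Proof.
move=> fd ge; apply: (@cvg_near _ _ ((0 : R)^') _ _ _ _ _ (cvgD fd ge)).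
apply: nearW => h.
rewrite -[LHS]/(h^-1 *: (f (h *: v + t) - f t) + h^-1 *: (g (h *: v + t) - g t)).
by rewrite -scalerDr; congr (_ *: _); rewrite opprD addrACA.
Qed.

Lemma has_derive_cst {X V : normedModType R} (c : V) (t v : X) : has_derive (fun=> c) t v 0.
Proof.
rewrite /has_derive; under eq_fun do rewrite subrr scaler0; exact: cvg_cst.
Qed.

Lemma open_near U (P : E -> Prop) : open U -> (forall t, U t -> P t) ->
  forall t, U t -> \forall s \near t, P s.
Proof.
move=> oU UP t Ut; have : nbhs t U by apply: open_nbhs_nbhs; split.
exact: filterS.
Qed.

Lemma line_near U t v : open U -> U t -> \forall h \near (0 : R)^', U (h *: v + t).
Proof.
move=> oU Ut; have : h *: v + t @[h --> (0 : R)^'] --> 0 *: v + t.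
  apply: cvgD; last exact: cvg_cst.
  by apply: cvgZr_tmp; apply: cvg_within_filter; exact: cvg_id.
by rewrite scale0r add0r; apply; apply: open_nbhs_nbhs; split.
Qed.

Lemma Cr_cont r U V (f : E -> V) : Cr r U f -> forall t, U t -> {for t, continuous f}.
Proof. by case: r => [[]|r []]. Qed.

Lemma Cr_has r U V (f : E -> V) v : Cr r.+1 U f ->
  forall t, U t -> has_derive f t v ('D_v f t).
Proof. by move=> [_ /(_ v)[fd _]] t Ut; apply: derivable_has; exact: fd. Qed.

#[local] Arguments Cr_has [r U V f] v _ [t] _.

Lemma Cr_derive r U V (f : E -> V) v : Cr r.+1 U f -> Cr r U (fun t => 'D_v f t).
Proof. by move=> [_ /(_ v)[]]. Qed.

Lemma Cr_pred r U V (f : E -> V) : Cr r.+1 U f -> Cr r U f.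
Proof.
elim: r f => [|r ih] f [fc fd]; first by split.
by split=> // v; have [? ?] := fd v; split => //; exact: ih.
Qed.

Lemma Cr_le r s U V (f : E -> V) : (r <= s)%N -> Cr s U f -> Cr r U f.
Proof.
move=> /subnK <-; elim: (s - r)%N => // m ih h; apply: ih; exact: Cr_pred.
Qed.

Lemma Cr_eq r U V (f g : E -> V) : open U -> (forall t, U t -> f t = g t) ->
  Cr r U f -> Cr r U g.
Proof.
move=> oU; elim: r f g => [|r ih] f g fg [fc fd].
  split=> // t Ut; suff : g @ t --> g t by []; rewrite -[X in _ --> X](fg t Ut).
  by apply: cvg_near (fc t Ut); exact: open_near Ut.
split=> [t Ut|v].
  suff : g @ t --> g t by []; rewrite -[X in _ --> X](fg t Ut).
  by apply: cvg_near (fc t Ut); exact: open_near Ut.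
have [fv fD] := fd v; split=> [t Ut|].
  by apply: near_eq_derivable (fv t Ut); exact: open_near Ut.
by apply: ih fD => t Ut; apply: near_eq_derive; exact: open_near Ut.
Qed.

Lemma Cr_intro r U V (f : E -> V) (d : E -> E -> V) : open U ->
  (forall t, U t -> {for t, continuous f}) ->
  (forall v t, U t -> has_derive f t v (d v t)) -> (forall v, Cr r U (d v)) ->
  Cr r.+1 U f.
Proof.
move=> oU fc fd dr; split=> // v; split=> [t Ut|].
  by have /has_deriveP[] := fd v t Ut.
by apply: Cr_eq (dr v) => // t Ut; have /has_deriveP[_ ->] := fd v t Ut.
Qed.

Lemma Cr_cst r U V (c : V) : open U -> Cr r U (fun=> c).
Proof.
move=> oU; elim: r c => [|r ih] c; first by split=> // t _; exact: cst_continuous.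
apply: (@Cr_intro _ _ _ _ (fun _ _ => 0)) => //.
  by move=> t _; exact: cst_continuous.
by move=> v t _; exact: has_derive_cst.
Qed.

Lemma CrD r U V (f g : E -> V) : open U -> Cr r U f -> Cr r U g ->
  Cr r U (fun t => f t + g t).
Proof.
move=> oU; elim: r f g => [|r ih] f g fr gr.
  split=> // t Ut; exact: cvgD (Cr_cont fr Ut) (Cr_cont gr Ut).
apply: (@Cr_intro _ _ _ _ (fun v t => 'D_v f t + 'D_v g t)) => //.
- by move=> t Ut; exact: cvgD (Cr_cont fr Ut) (Cr_cont gr Ut).
- by move=> v t Ut; exact: has_deriveD (Cr_has v fr Ut) (Cr_has v gr Ut).
- by move=> v; apply: ih; exact: Cr_derive.
Qed.

Lemma Cr_blin r U V W (L : V -> W) (f : E -> V) : open U -> blin L ->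
  Cr r U f -> Cr r U (fun t => L (f t)).
Proof.
move=> oU bL; elim: r f => [|r ih] f fr.
  by split=> // t Ut; exact: (blin_cvg _ bL (Cr_cont fr Ut)).
apply: (@Cr_intro _ _ _ _ (fun v t => L ('D_v f t))) => //.
- by move=> t Ut; exact: (blin_cvg _ bL (Cr_cont fr Ut)).
- by move=> v t Ut; exact: has_derive_blin bL (Cr_has v fr Ut).
- by move=> v; apply: ih; exact: Cr_derive.
Qed.

Lemma Cr_bbil r U A V W (B : A -> V -> W) (f : E -> A) (g : E -> V) : open U -> bbil B ->
  Cr r U f -> Cr r U g -> Cr r U (fun t => B (f t) (g t)).
Proof.
move=> oU bB; elim: r f g => [|r ih] f g fr gr.
  by split=> // t Ut; exact: (bbil_cvg _ bB (Cr_cont fr Ut) (Cr_cont gr Ut)).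
apply: (@Cr_intro _ _ _ _ (fun v t => B ('D_v f t) (g t) + B (f t) ('D_v g t))) => //.
- by move=> t Ut; exact: (bbil_cvg _ bB (Cr_cont fr Ut) (Cr_cont gr Ut)).
- by move=> v t Ut; exact: has_derive_bbil bB (Cr_has v fr Ut) (Cr_has v gr Ut).
- move=> v; apply: CrD => //; apply: ih => //; try exact: Cr_derive; exact: Cr_pred.
Qed.

(** Induction on r: the derivative in direction v solves the equation with the same operator
    [M (a t)] and right-hand side ['D_v b t + M ('D_v a t) (u t)], which has the regularity of u and
    of the derivatives of the data. *)
Lemma Cr_lin_fix r U A W (M : A -> W -> W) (a : E -> A) (b u : E -> W) :
  abs_complete W -> open U -> bbil M ->
  (forall t, U t -> forall w, `|M (a t) w| <= 2^-1 * `|w|) ->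
  (forall t, U t -> u t = b t + M (a t) (u t)) ->
  Cr r U a -> Cr r U b -> Cr r U u.
Proof.
move=> cW oU bM; have [fl fr _] := bM.
elim: r a b u => [|r ih] a b u Mb ub ar br.
  split=> // t Ut; apply: (@lin_fix_cvg _ _ _ (nbhs t) (fun s => M (a s)) (M (a t)) b u (b t)).
  - by move=> s; exact: fr.
  - exact: open_near Ut.
  - exact: open_near Ut.
  - exact: ub.
  - exact: (Cr_cont br Ut).
  - by apply: (bbil_cvg _ bM (Cr_cont ar Ut)); exact: cvg_cst.
have ur : Cr r U u by apply: ih Mb ub _ _; exact: Cr_pred.
have ex v t : exists d, U t -> d = ('D_v b t + M ('D_v a t) (u t)) + M (a t) d.
  have [Ut|nUt] := pselect (U t); last by exists 0.
  have [d dE] := @lin_fix _ _ (M (a t)) ('D_v b t + M ('D_v a t) (u t)) cW (fr _) (Mb t Ut).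
  by exists d => _.
pose d v t := sval (cid (ex v t)).
have dE v t : U t -> d v t = ('D_v b t + M ('D_v a t) (u t)) + M (a t) (d v t).
  exact: (svalP (cid (ex v t))).
apply: (@Cr_intro _ _ _ _ d) => //; first exact: (Cr_cont ur).
- move=> v t Ut.
  (* The difference quotient of u solves a linear equation with the operator at the shifted point;
     its data converge to those of the equation for [d]. *)
  apply: (@lin_fix_cvg _ _ _ ((0 : R)^') (fun h => M (a (h *: v + t))) (M (a t))
    (fun h => h^-1 *: (b (h *: v + t) - b t) +
              M (h^-1 *: (a (h *: v + t) - a t)) (u t)) _
    ('D_v b t + M ('D_v a t) (u t))).
  + by move=> h; exact: fr.
  + near=> h => w; apply: Mb; near: h; exact: line_near.
  + near=> h.
    have Uh : U (h *: v + t) by near: h; exact: line_near.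
    rewrite {1}(ub _ Uh) {1}(ub _ Ut) (linZ (fl _)) (linZ (fr _)) -!scalerDr.
    congr (_ *: _); rewrite (linB (fl _)) (linB (fr _)) opprD addrACA -!addrA.
    by congr (_ + (_ + _)); rewrite [RHS]addrCA [X in _ = _ + X]addrC subrK addrC.
  + exact: dE.
  + apply: cvgD; first exact: (Cr_has v br Ut).
    by apply: (bbil_cvg _ bM); [exact: (Cr_has v ar Ut)|exact: cvg_cst].
  + by apply: (bbil_cvg _ bM); [exact: has_derive_cvg (Cr_has v ar Ut)|exact: cvg_cst].
- move=> v; apply: (ih a (fun t => 'D_v b t + M ('D_v a t) (u t))) => //.
  + exact: dE.
  + exact: Cr_pred.
  + apply: CrD => //; first exact: Cr_derive.
    by apply: Cr_bbil => //; exact: Cr_derive.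
Unshelve. all: by end_near. Qed.

(** At a solution the linearisation w to -(Q e w + Q w e) is a contraction, each term having factor
    at most K rho <= 1/8. Derivatives of e therefore solve a linear fixed-point equation, to which
    [Cr_lin_fix] applies. *)
Lemma Cr_quad_fix r U W (Q : W -> W -> W) (K rho : R) (b e : E -> W) :
  abs_complete W -> open U -> bbil Q -> 0 <= K ->
  (forall u v, `|Q u v| <= K * `|u| * `|v|) -> K * rho <= 8^-1 ->
  (forall t, U t -> `|e t| <= rho /\ e t = b t - Q (e t) (e t)) ->
  Cr r U b -> Cr r U e.
Proof.
move=> cW oU bQ K0 QK Kr ebE; have [fl fr _] := bQ.
have half (a : W) w : `|a| <= rho -> `|Q a w| <= 8^-1 * `|w|.
  move=> ar; rewrite (le_trans (QK _ _))// ler_wpM2r//.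
  by apply: le_trans Kr; rewrite ler_wpM2l.
have halfr (a : W) w : `|a| <= rho -> `|Q w a| <= 8^-1 * `|w|.
  move=> ar; rewrite (le_trans (QK _ _))// mulrAC ler_wpM2r//.
  by apply: le_trans Kr; rewrite ler_wpM2l.
have QB a c : Q a a - Q c c = Q a (a - c) + Q (a - c) c.
  by rewrite (linB (fl _)) (linB (fr _)) addrA subrK.
have econt : Cr 0 U b -> forall t, U t -> e @ t --> e t.
  move=> b0 t Ut; apply/(@cvgrPdist_le _ _ _ (nbhs t) _) => eps eps0.
  have eps2 : 0 < eps / 2 by rewrite divr_gt0.
  have /cvgrPdist_le/(_ _ eps2) h := Cr_cont b0 Ut.
  near=> s.
  have Us : U s by near: s; exact: open_near Ut.
  have bs : `|b t - b s| <= eps / 2 by near: s.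
  have [et Et] := ebE t Ut; have [es Es] := ebE s Us.
  have D : e t - e s = (b t - b s) - (Q (e t) (e t - e s) + Q (e t - e s) (e s)).
    by rewrite -QB opprB {1}Et {1}Es opprD opprK addrACA [_ + Q _ _]addrC.
  have := ler_normB (b t - b s) (Q (e t) (e t - e s) + Q (e t - e s) (e s)).
  have := ler_normD (Q (e t) (e t - e s)) (Q (e t - e s) (e s)).
  have := half _ (e t - e s) et; have := halfr _ (e t - e s) es.
  by rewrite -D; lra.
elim: r => [|r ih] br; first by split=> // t Ut; exact: econt.
have er : Cr r U e by apply: ih; exact: Cr_pred.
pose M (a w : W) : W := - (Q a w + Q w a).
have bM : bbil M.
  split=> [v c x y|v c x y|].
  - by rewrite /M (fl v c) (fr v c) addrACA -scalerDr opprD scalerN.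
  - by rewrite /M (fl v c) (fr v c) addrACA -scalerDr opprD scalerN.
  exists (K + K) => u v; rewrite normrN (le_trans (ler_normD _ _))// -mulrA mulrDl lerD//.
    by rewrite mulrA QK.
  by rewrite [`|u| * _]mulrC mulrA QK.
have Mb t : U t -> forall w, `|M (e t) w| <= 2^-1 * `|w|.
  move=> Ut w; have [et _] := ebE t Ut; rewrite normrN.
  have := ler_normD (Q (e t) w) (Q w (e t)).
  by have := half _ w et; have := halfr _ w et; have := normr_ge0 w; lra.
have ex v t : exists d, U t -> d = 'D_v b t + M (e t) d.
  have [Ut|nUt] := pselect (U t); last by exists 0.
  have [_ Mr _] := bM.
  have [d dE] := @lin_fix _ _ (M (e t)) ('D_v b t) cW (Mr _) (Mb t Ut).
  by exists d => _.
pose d v t := sval (cid (ex v t)).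
have dE v t : U t -> d v t = 'D_v b t + M (e t) (d v t).
  exact: (svalP (cid (ex v t))).
have b0 : Cr 0 U b by apply: Cr_le br.
apply: (@Cr_intro _ _ _ _ d) => //; first exact: econt.
- move=> v t Ut; have [et _] := ebE t Ut.
  have hcv : e (h *: v + t) @[h --> (0 : R)^'] --> e t.
    have : h *: v + t @[h --> (0 : R)^'] --> t.
      rewrite -[X in _ --> X]add0r -[X in _ --> X + _](scale0r v).
      apply: cvgD; last exact: cvg_cst.
      by apply: cvgZr_tmp; apply: cvg_within_filter; exact: cvg_id.
    by move/cvg_comp; apply; exact: econt.
  (* The difference of the quadratic terms factors exactly, with one coefficient at the shifted
     point and one at t, so the difference quotient again solves a linear equation. *)
  apply: (@lin_fix_cvg _ _ _ ((0 : R)^')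
    (fun h w => - (Q (e (h *: v + t)) w + Q w (e t))) (M (e t))
    (fun h => h^-1 *: (b (h *: v + t) - b t)) _ ('D_v b t)).
  + move=> h c x y; rewrite (fl _ c) (fr _ c) addrACA -scalerDr opprD scalerN.
    by [].
  + near=> h => w.
    have Uh : U (h *: v + t) by near: h; exact: line_near.
    have [eh _] := ebE _ Uh; rewrite normrN.
    have := ler_normD (Q (e (h *: v + t)) w) (Q w (e t)).
    by have := half _ w eh; have := halfr _ w et; have := normr_ge0 w; lra.
  + near=> h.
    have Uh : U (h *: v + t) by near: h; exact: line_near.
    have [_ Et] := ebE _ Ut; have [_ Eh] := ebE _ Uh.
    rewrite (linZ (fl _)) (linZ (fr _)) -scalerDr -scalerN -scalerDr.
    congr (_ *: _); rewrite -QB {1}Eh {1}Et opprB opprD opprK addrACA.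
    by rewrite [- Q _ _ - _]addrC addrACA [Q _ _ - _]addrC.
  + exact: dE.
  + exact: (Cr_has v br Ut).
  + apply: cvgN; apply: cvgD; last exact: cvg_cst.
    by apply: (bbil_cvg _ bQ hcv); exact: cvg_cst.
- move=> v; apply: (@Cr_lin_fix r U W W M e ('D_v b)) => //.
  + exact: dE.
  + exact: Cr_derive.
Unshelve. all: by end_near. Qed.

End SmoothCalculus.
Arguments Cr_has {R n r U V f} v _ {t} _.

(** On the ball of radius rho the quadratic term is at most rho / 8, which leaves room for |b| <=
    rho / 2. *)
Lemma quad_fix {R : realType} {W : normedModType R} (Q : W -> W -> W) (K rho : R) (b : W) :
  abs_complete W -> bbil Q -> 0 <= K -> 0 <= rho ->
  (forall u v, `|Q u v| <= K * `|u| * `|v|) -> K * rho <= 8^-1 ->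
  `|b| <= rho / 2 -> exists2 e, `|e| <= rho & e = b - Q e e.
Proof.
move=> cW bQ K0 r0 QK Kr br; have [fl fr _] := bQ.
have [||u w ur wr|e er eE] := @contraction_fix _ _ (fun e => b - Q e e) rho cW => //.
- move=> u ur; rewrite (le_trans (ler_normB _ _))//.
  have : `|Q u u| <= 8^-1 * rho.
    rewrite (le_trans (QK _ _))// ler_pM// ?mulr_ge0//.
    by apply: le_trans Kr; rewrite ler_wpM2l.
  lra.
- rewrite opprD opprK addrACA subrr add0r [X in `|X|]addrC.
  have -> : Q w w - Q u u = Q w (w - u) + Q (w - u) u.
    by rewrite (linB (fl _)) (linB (fr _)) addrA subrK.
  have h1 : `|Q w (w - u)| <= 8^-1 * `|w - u|.
    rewrite (le_trans (QK _ _))// ler_wpM2r//.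
    by apply: le_trans Kr; rewrite ler_wpM2l.
  have h2 : `|Q (w - u) u| <= 8^-1 * `|w - u|.
    rewrite (le_trans (QK _ _))// mulrAC ler_wpM2r//.
    by apply: le_trans Kr; rewrite ler_wpM2l.
  have := ler_normD (Q w (w - u)) (Q (w - u) u); rewrite distrC.
  by have := normr_ge0 (w - u); lra.
- by exists e => //; rewrite eE.
Qed.

(** * Mean value estimates tested by linear functionals *)

Section MeanValue.
Context {R : realType}.
Implicit Types (V W : normedModType R).

Lemma has_derive_is {X V : normedModType R} (f : X -> V) t v d :
  has_derive f t v d -> is_derive t v f d.
Proof. by move=> /has_deriveP[fd <-]; exact: derivableP. Qed.

Lemma has_derive_line {X V : normedModType R} (f : X -> V) t v (s : R) d :
  has_derive f (s *: v + t) v d -> has_derive (fun x : R^o => f (x *: v + t)) s (1 : R^o) d.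
Proof.
rewrite /has_derive; apply: cvg_near; apply: nearW => h.
congr (_ *: (f _ - _)); rewrite addrA -scalerDl; congr (_ *: _ + _).
by rewrite [h *: _]mulr1.
Qed.

Lemma MVT_has (f df : R -> R) (a b : R) : a <= b ->
  (forall x, a <= x <= b -> has_derive f x (1 : R) (df x)) ->
  exists2 c, a <= c <= b & f b - f a = df c * (b - a).
Proof.
move=> ab fd; have [c cab fE] : exists2 c, c \in `[a, b] & f b - f a = df c * (b - a).
  apply: MVT_segment => //.
    move=> x; rewrite in_itv/= => /andP[ax xb]; apply: has_derive_is; apply: fd.
    by rewrite !ltW.
  apply: derivable_within_continuous => x; rewrite in_itv/= => xab.
  by have /has_deriveP[] := fd x xab.
by exists c => //; move: cab; rewrite in_itv.
Qed.

Lemma line_MVT {X : normedModType R} (f : X -> R) (df : X -> R) (v t : X) (h : R) :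
  (forall s, `|s| <= `|h| -> has_derive f (s *: v + t) v (df (s *: v + t))) ->
  exists2 c, `|c| <= `|h| & f (h *: v + t) - f t = df (c *: v + t) * h.
Proof.
move=> fd; have [h0|h0] := leP 0 h.
  have [x /andP[x0 xh]|c /andP[c0 ch]] := @MVT_has (fun s => f (s *: v + t))
      (fun s => df (s *: v + t)) 0 h h0.
    by apply: has_derive_line; apply: fd; rewrite !ger0_norm.
  rewrite scale0r add0r subr0 => ->; exists c => //.
  by rewrite !ger0_norm.
have [x /andP[x0 xh]|c /andP[c0 ch]] := @MVT_has (fun s => f (s *: v + t))
    (fun s => df (s *: v + t)) h 0 (ltW h0).
  by apply: has_derive_line; apply: fd; rewrite !ler0_norm ?lerN2// ltW.
rewrite scale0r add0r sub0r => E; exists c; first by rewrite !ler0_norm ?lerN2// ltW.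
by rewrite -opprB E mulrN opprK.
Qed.

(** The mean value theorem is scalar. This condition and the next carry its consequences over to
    vector values; entries of matrices, composed with coefficients in the case of loops, supply the
    functionals. *)
Definition lin_separated V := forall w : V,
  (forall L : V -> R^o, blin L -> L w = 0) -> w = 0.

Definition weakly_normed V := forall (w : V) (B : R), 0 <= B ->
  (forall L : V -> R^o, blin L -> (forall v, `|L v| <= `|v|) -> `|L w| <= B) -> `|w| <= B.

(** Iterated integration: the bound for index i + 1 is the primitive vanishing at 0 of K times the
    bound for index i, and this is where the factorial comes from. *)
Lemma chain_bound V (phi dphi : nat -> R -> V) (M K : R) : weakly_normed V ->
  0 <= M -> 0 <= K ->
  (forall s, 0 <= s <= 1 -> `|phi 0%N s| <= M) ->
  (forall i s, 0 <= s <= 1 -> has_derive (phi i.+1) s (1 : R) (dphi i.+1 s)) ->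
  (forall i s, 0 <= s <= 1 -> `|dphi i.+1 s| <= K * `|phi i s|) ->
  (forall i, phi i.+1 0 = 0) ->
  forall i s, 0 <= s <= 1 -> `|phi i s| <= M * (K * s) ^+ i / i`!%:R.
Proof.
move=> nV M0 K0 p0 pd dpK pz; elim=> [|i ih] s s01.
  by rewrite expr0 mulr1 fact0 invr1 mulr1 p0.
have [s0 s1] := andP s01.
apply: nV => [|L bL Lv]; first by rewrite !mulr_ge0// ?invr_ge0// exprn_ge0// mulr_ge0.
pose kap x : R := M * (K * x) ^+ i.+1 / i.+1`!%:R.
pose dkap x : R := K * (M * (K * x) ^+ i / i`!%:R).
have kd x : has_derive kap x (1 : R) (dkap x).
  have -> : dkap x = (M * K ^+ i.+1 / i.+1`!%:R) * (i.+1%:R * x ^+ i).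
    have f0 : i`!%:R != 0 :> R by rewrite pnatr_eq0 -lt0n fact_gt0.
    have i0 : i.+1%:R != 0 :> R by rewrite pnatr_eq0.
    rewrite /dkap exprMn exprS factS natrM; field.
    by rewrite f0 nat1r i0.
  have -> : kap = (fun y : R^o => (M * K ^+ i.+1 / i.+1`!%:R) * (y ^+ i.+1)).
    by apply/funext => y; rewrite /kap exprMn; ring.
  apply: (@has_derive_blin _ _ _ R^o (fun y : R^o => (M * K ^+ i.+1 / i.+1`!%:R) * y : R^o)).
    split=> [a u w|]; last first.
      by exists `|M * K ^+ i.+1 / i.+1`!%:R| => w; rewrite normrM.
    by rewrite mulrDr [in RHS]/GRing.scale/= mulrCA.
  apply/has_deriveP; split; first exact: exprn_derivable.
  by rewrite exp_derive/= [LHS]mulr1.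
(* The mean value theorem is applied to the bound minus sg times a functional of phi; the signs 1
   and -1 together bound the absolute value. *)
have key (sg : R) : `|sg| = 1 -> sg * L (phi i.+1 s) <= kap s.
  move=> sg1.
  have [x xs|c /andP[c0 cs]] := @MVT_has (fun x => kap x - sg * L (phi i.+1 x))
      (fun x => dkap x - sg * L (dphi i.+1 x)) 0 s s0.
    have x01 : 0 <= x <= 1 by case/andP: xs => -> xs; rewrite (le_trans xs).
    apply: has_deriveD => //; apply: (@has_derive_blin _ _ _ R^o (fun y : R^o => - (sg * y) : R^o)).
      apply: blinN; split=> [a u w|]; last by exists `|sg| => w; rewrite normrM.
      by rewrite mulrDr /GRing.scale/= mulrCA.
    by apply: has_derive_blin => //; exact: pd.
  rewrite pz (lin0 bL.1) mulr0 subr0 subr0 {2}/kap mulr0 expr0n/= mulr0 mul0r subr0.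
  have c01 : 0 <= c <= 1 by rewrite c0 (le_trans cs).
  have : sg * L (dphi i.+1 c) <= dkap c.
    rewrite (le_trans (ler_norm _))// normrM sg1 mul1r (le_trans (Lv _))//.
    by rewrite (le_trans (dpK _ _ c01))// ler_wpM2l// ih.
  move=> h E; rewrite -subr_ge0 E mulr_ge0// subr_ge0//.
have h1 := key 1 (normr1 _); have := key (-1); rewrite normrN1 => /(_ erefl) h2.
rewrite mul1r in h1; rewrite mulN1r in h2.
by rewrite ler_norml -/(kap s) lerNl h2 h1.
Qed.

End MeanValue.

(** * Linearity in the direction and symmetry of second derivatives *)

Section DirectionalDerivatives.
Context {R : realType} {n : nat}.
Implicit Types (V W : normedModType R) (U : set 'rV[R]_n).
Local Notation E := 'rV[R]_n.

Lemma near_points U (g : E -> R) (t u v : E) (e : R) : open U -> U t ->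
  {for t, continuous g} -> 0 < e ->
  exists2 d, 0 < d & forall a b : R, `|a| <= d -> `|b| <= d ->
    U (a *: u + (b *: v + t)) /\ `|g t - g (a *: u + (b *: v + t))| <= e.
Proof.
move=> oU Ut gc e0.
have h1 : \forall s \near t, U s /\ `|g t - g s| <= e.
  have hU : \forall s \near t, U s by apply: open_nbhs_nbhs; split.
  have /(@cvgrPdist_le _ _ _ (nbhs t) _)/(_ _ e0) hg := gc.
  by apply: filterS2 hU hg.
have /nbhs_ballP[r /= r0 hr] := h1.
pose d := r / (`|u| + `|v| + 1).
have uv : 0 < `|u| + `|v| + 1 by rewrite ltr_wpDl// addr_ge0.
exists d => [|a b ad bd]; first by rewrite divr_gt0.
apply: hr; rewrite -ball_normE/=.
have -> : t - (a *: u + (b *: v + t)) = - (a *: u + b *: v).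
  by rewrite addrA opprD addrCA subrr addr0.
rewrite normrN (le_lt_trans (ler_normD _ _))// !normrZ.
have : `|a| * `|u| + `|b| * `|v| <= d * (`|u| + `|v|).
  by rewrite mulrDr lerD// ler_wpM2r.
move=> /le_lt_trans; apply; by rewrite /d mulrAC ltr_pdivrMr// ltr_pM2l// ltrDl ltr01.
Qed.

(** [Cr] speaks of directional derivatives only. The increment along u + v is split into one along v
    and one along u; each is a mean value, and continuity of the two derivatives gives the limit. *)
Lemma deriveD_scalar U (f : E -> R^o) t (u v : E) : open U -> Cr 1 U f -> U t ->
  has_derive f t (u + v) ('D_u f t + 'D_v f t).
Proof.
move=> oU fC Ut; apply/cvgrPdist_le => e e0.
have e2 : 0 < e / 2 by rewrite divr_gt0.
have [d1 d10 h1] := near_points u v oU Ut (Cr_cont (Cr_derive u fC) Ut) e2.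
have [d2 d20 h2] := near_points u v oU Ut (Cr_cont (Cr_derive v fC) Ut) e2.
near=> h.
have h0 : h != 0 by near: h; exact: nbhs_dnbhs_neq.
have hd1 : `|h| <= d1 by near: h; exact: dnbhs0_le.
have hd2 : `|h| <= d2 by near: h; exact: dnbhs0_le.
have [s sh|c1 c1h E1] := @line_MVT _ _ f (fun x => 'D_u f x) u (h *: v + t) h.
  apply: (Cr_has u fC); have [] := h1 s h; rewrite ?(le_trans sh) //.
have [s sh|c2 c2h E2] := @line_MVT _ _ f (fun x => 'D_v f x) v t h.
  apply: (Cr_has v fC); have [] := h1 0 s; rewrite ?(le_trans sh)//.
    by rewrite normr0 ltW.
  by rewrite scale0r add0r.
have -> : h *: (u + v) + t = h *: u + (h *: v + t) by rewrite scalerDr addrA.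
have -> : f (h *: u + (h *: v + t)) - f t =
    ('D_u f (c1 *: u + (h *: v + t)) + 'D_v f (c2 *: v + t)) * h.
  by rewrite mulrDl -E1 -E2; apply: esym; rewrite [LHS]addrA subrK.
rewrite /GRing.scale/= mulrC mulfK//.
have [_ b1] := h1 c1 h (le_trans c1h hd1) hd1.
have [|_ b2] := h2 0 c2 _ (le_trans c2h hd2); first by rewrite normr0 ltW.
rewrite scale0r add0r in b2.
by rewrite opprD addrACA (le_trans (ler_normD _ _))// (splitr e) lerD.
Unshelve. all: by end_near. Qed.

Arguments deriveD_scalar {U f t} u v _ _ _.

Lemma deriveZ_scalar U (f : E -> R^o) t (a : R) (v : E) : open U -> Cr 1 U f -> U t ->
  has_derive f t (a *: v) (a *: 'D_v f t).
Proof.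
move=> oU fC Ut; apply/cvgrPdist_le => e e0.
have ea : 0 < e / (`|a| + 1) by rewrite divr_gt0// ltr_wpDl.
have [d d0 hd] := near_points v v oU Ut (Cr_cont (Cr_derive v fC) Ut) ea.
near=> h.
have h0 : h != 0 by near: h; exact: nbhs_dnbhs_neq.
have had : `|h| <= d / (`|a| + 1).
  by near: h; apply: dnbhs0_le; rewrite divr_gt0// ltr_wpDl.
have hd1 : `|h * a| <= d.
  move: had; rewrite ler_pdivlMr ?ltr_wpDl// normrM; apply: le_trans.
  by rewrite ler_wpM2l// lerDl.
have [s sh|c ch E1] := @line_MVT _ _ f (fun x => 'D_v f x) v t (h * a).
  apply: (Cr_has v fC); have [] := hd 0 s; rewrite ?(le_trans sh)//.
    by rewrite normr0 ltW.
  by rewrite scale0r add0r.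
rewrite scalerA E1.
have [|_ b1] := hd 0 c _ (le_trans ch hd1); first by rewrite normr0 ltW.
rewrite scale0r add0r in b1.
have -> : a *: 'D_v f t - h^-1 *: ('D_v f (c *: v + t) * (h * a)) =
    a * ('D_v f t - 'D_v f (c *: v + t)).
  by rewrite /GRing.scale/= mulrBr; congr (_ - _); field.
rewrite normrM; move: b1; rewrite ler_pdivlMr ?ltr_wpDl// mulrC; apply: le_trans.
by rewrite ler_wpM2r// lerDl.
Unshelve. all: by end_near. Qed.

Arguments deriveZ_scalar {U f t} a v _ _ _.

Lemma subr_cross (A B C D x y : R) : A - B - (C - D) = x -> A - C - (B - D) = y -> x = y.
Proof. by move=> <- <-; ring. Qed.

Lemma dist_half (x y z e : R) : `|x - z| <= e / 2 -> `|y - z| <= e / 2 -> `|x - y| <= e.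
Proof.
by move=> xz yz; rewrite -(subrKA z) (le_trans (ler_normD _ _))// (splitr e) lerD// distrC.
Qed.

(** The second difference of f with steps h u and h v is h ^ 2 times a mixed derivative at a nearby
    point, for either order of differentiation; continuity of both mixed derivatives then identifies
    them at t. *)
Lemma schwarz_scalar U (f : E -> R^o) t (u v : E) : open U -> Cr 2 U f -> U t ->
  'D_u (fun x => 'D_v f x) t = 'D_v (fun x => 'D_u f x) t.
Proof.
move=> oU fC Ut; have fC1 := Cr_pred fC.
apply/eqP; rewrite -subr_eq0 -normr_le0; apply/ler_addgt0Pl => e e0; rewrite addr0.
have e2 : 0 < e / 2 by rewrite divr_gt0.
have [d1 d10 h1] := near_points u v oU Ut (Cr_cont (Cr_derive u (Cr_derive v fC)) Ut) e2.
have [d2 d20 h2] := near_points v u oU Ut (Cr_cont (Cr_derive v (Cr_derive u fC)) Ut) e2.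
pose h := Num.min d1 d2.
have h0 : 0 < h by rewrite lt_min d10.
have hn : `|h| = h by rewrite gtr0_norm.
have hd1 : h <= d1 by rewrite ge_min lexx.
have hd2 : h <= d2 by rewrite ge_min lexx orbT.
have key (a b : E) (d : R) : h <= d ->
    (forall x y : R, `|x| <= d -> `|y| <= d -> U (x *: b + (y *: a + t))) ->
    exists c1 c2 : R, [/\ `|c1| <= h, `|c2| <= h &
      f (h *: b + (h *: a + t)) - f (h *: a + t) - (f (h *: b + t) - f t) =
      'D_b (fun x => 'D_a f x) (c2 *: b + (c1 *: a + t)) * h * h].
  move=> hd Uab.
  have bd (s : R) : `|s| <= `|h| -> `|s| <= d by rewrite hn => /le_trans; exact.
  have hh : `|h| <= d by rewrite hn.
  have sw (s : R) : h *: b + (s *: a + t) = s *: a + (h *: b + t) by rewrite addrCA.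
  have [s sh|c1 c1h E1] := @line_MVT _ _ (fun x => f (h *: b + x) - f x : R^o)
     (fun x => 'D_a f (h *: b + x) - 'D_a f x) a t h.
    apply: has_deriveD.
      have := Cr_has a fC1 (Uab h s hh (bd _ sh)); apply: cvg_near; apply: nearW => x.
      by congr (_ *: (f _ - _)); rewrite addrCA.
    apply: (has_derive_blin (blinN blin_id)); apply: (Cr_has a fC1).
    have := Uab 0 s; rewrite scale0r add0r; apply; last exact: bd.
    by rewrite normr0 (le_trans _ hd)// ltW.
  have [s sh|c2 c2h E2] := @line_MVT _ _ (fun x => 'D_a f x : R^o)
     (fun x => 'D_b (fun x => 'D_a f x) x) b (c1 *: a + t) h.
    by apply: (Cr_has b (Cr_derive a fC)); apply: Uab; exact: bd.
  rewrite hn in c1h c2h; exists c1, c2; split=> //.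
  by rewrite -E2 -E1.
have [||c1 [c2 [c1h c2h E1]]] := key v u d1.
- by [].
- by move=> x y xd yd; have [] := h1 x y xd yd.
have [||c3 [c4 [c3h c4h E2]]] := key u v d2.
- by [].
- by move=> x y xd yd; have [] := h2 x y xd yd.
have EE : 'D_u (fun x => 'D_v f x) (c2 *: u + (c1 *: v + t)) =
          'D_v (fun x => 'D_u f x) (c4 *: v + (c3 *: u + t)).
  apply: (mulIf (lt0r_neq0 h0)); apply: (mulIf (lt0r_neq0 h0)).
  by rewrite addrCA in E2; exact: subr_cross E1 E2.
have [_ b1] := h1 c2 c1 (le_trans c2h hd1) (le_trans c1h hd1).
have [_ b2] := h2 c4 c3 (le_trans c4h hd2) (le_trans c3h hd2).
rewrite -EE in b2.
exact: dist_half b1 b2.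
Qed.

Arguments schwarz_scalar {U f t} u v _ _ _.

Lemma derive_blin {W} U r (f : E -> W) (L : W -> R^o) v t : blin L -> Cr r.+1 U f ->
  U t -> 'D_v (fun x => L (f x)) t = L ('D_v f t).
Proof.
move=> bL fC Ut; have /has_deriveP[] // := has_derive_blin bL (Cr_has v fC Ut).
Qed.

Arguments derive_blin {W U r f L} v {t} _ _ _.

Lemma deriveD_dir {W} U (f : E -> W) t (u v : E) : lin_separated W -> open U -> Cr 1 U f ->
  U t -> 'D_(u + v) f t = 'D_u f t + 'D_v f t.
Proof.
move=> sW oU fC Ut; apply/eqP; rewrite -subr_eq0; apply/eqP; apply: sW => L bL.
rewrite (linB bL.1) (linD bL.1) -(derive_blin (u + v) bL fC Ut)
  -(derive_blin u bL fC Ut) -(derive_blin v bL fC Ut); apply/eqP.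
rewrite subr_eq0; apply/eqP.
have LfC : Cr 1 U (fun x => L (f x)) by exact: Cr_blin.
by have /has_deriveP[] := deriveD_scalar u v oU LfC Ut.
Qed.

Lemma deriveZ_dir {W} U (f : E -> W) t (a : R) (v : E) : lin_separated W -> open U -> Cr 1 U f ->
  U t -> 'D_(a *: v) f t = a *: 'D_v f t.
Proof.
move=> sW oU fC Ut; apply/eqP; rewrite -subr_eq0; apply/eqP; apply: sW => L bL.
rewrite (linB bL.1) (linZ bL.1) -(derive_blin (a *: v) bL fC Ut)
  -(derive_blin v bL fC Ut); apply/eqP.
rewrite subr_eq0; apply/eqP.
have LfC : Cr 1 U (fun x => L (f x)) by exact: Cr_blin.
by have /has_deriveP[] := deriveZ_scalar a v oU LfC Ut.
Qed.

Lemma schwarz {W} U (f : E -> W) t (u v : E) : lin_separated W -> open U -> Cr 2 U f ->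
  U t -> 'D_u (fun x => 'D_v f x) t = 'D_v (fun x => 'D_u f x) t.
Proof.
move=> sW oU fC Ut; apply/eqP; rewrite -subr_eq0; apply/eqP; apply: sW => L bL.
rewrite (linB bL.1); apply/eqP; rewrite subr_eq0; apply/eqP.
transitivity ('D_u (fun x => L ('D_v f x)) t).
  by have := derive_blin u bL (Cr_derive v fC) Ut.
transitivity ('D_v (fun x => L ('D_u f x)) t); last first.
  by have := derive_blin v bL (Cr_derive u fC) Ut.
have LfC : Cr 2 U (fun x => L (f x)) by exact: Cr_blin.
have /= := schwarz_scalar u v oU LfC Ut.
have E1 w : forall s, U s -> 'D_w (fun x => L (f x)) s = L ('D_w f s).
  by move=> s Us; exact: derive_blin bL (Cr_pred fC) Us.
have e1 := near_eq_derive u (open_near oU (E1 v) Ut).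
by have e2 := near_eq_derive v (open_near oU (E1 u) Ut); rewrite e1 e2.
Qed.

(** Linearity in the direction reduces v to the standard basis, which makes the estimate uniform in
    v. *)
Lemma derive_bound {W} U (f : E -> W) t v : lin_separated W -> open U -> Cr 1 U f ->
  U t -> `|'D_v f t| <= `|v| * \sum_(i < n) `|'D_(delta_mx 0 i) f t|.
Proof.
move=> sW oU fC Ut; have E1 : 'D_v f t = \sum_(i < n) v 0 i *: 'D_(delta_mx 0 i) f t.
  rewrite {1}(row_sum_delta v).
  have : forall r : seq 'I_n, 'D_(\sum_(i <- r) v 0 i *: delta_mx 0 i) f t =
      \sum_(i <- r) v 0 i *: 'D_(delta_mx 0 i) f t.
    elim=> [|i r ih]; first by rewrite !big_nil derive0.
    by rewrite !big_cons (deriveD_dir _ _ sW oU fC Ut) ih (deriveZ_dir _ _ sW oU fC Ut).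
  exact.
rewrite E1 (le_trans (ler_norm_sum _ _ _))// mulr_sumr ler_sum// => i _.
rewrite normrZ ler_wpM2r// [leRHS]/Num.Def.normr/= mx_normrE.
exact: (le_bigmax _ (fun ij : 'I_1 * 'I_n => `|v ij.1 ij.2|) (0, i)).
Qed.

Lemma ball_convex (t0 t : E) (r s : R) : 0 <= s <= 1 -> ball t0 r t ->
  ball t0 r (s *: (t - t0) + t0).
Proof.
move=> /andP[s0 s1]; rewrite -ball_normE/= => tr.
rewrite opprD addrCA subrr addr0 normrN normrZ ger0_norm//.
by rewrite distrC in tr; apply: le_lt_trans tr; rewrite ler_piMl.
Qed.

(** Intermediate value theorem along the segment from the centre. It later fixes the sign of a
    determinant and the sheet of the hyperboloid. *)
Lemma ball_pos (g : E -> R) (t0 : E) (r : R) : 0 < r ->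
  (forall t, ball t0 r t -> {for t, continuous g}) ->
  (forall t, ball t0 r t -> g t != 0) -> 0 < g t0 ->
  forall t, ball t0 r t -> 0 < g t.
Proof.
move=> r0 gc g0 gt0 t tr; rewrite ltNge; apply/negP => gt.
pose phi (s : R) := g (s *: (t - t0) + t0).
have [||s] := @IVT R phi 0 1 0 ler01.
- apply: continuous_in_subspaceT => s; rewrite inE/= in_itv/= => s01.
  have : x *: (t - t0) + t0 @[x --> s] --> s *: (t - t0) + t0.
    by apply: cvgD; [apply: cvgZr_tmp; exact: cvg_id|exact: cvg_cst].
  move=> /cvg_comp; apply; apply: gc; exact: ball_convex.
- rewrite /phi scale0r add0r scale1r subrK ge_min le_max gt (ltW gt0) orbT//.
by rewrite in_itv/= => s01 /eqP; apply/negP; apply: g0; exact: ball_convex.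
Qed.

End DirectionalDerivatives.
Arguments deriveD_scalar {R n U f t} u v _ _ _.
Arguments schwarz {R n W U f t} u v _ _ _ _.

(** * Symmetries and loop groups *)

Section Automorphisms.
Context {R : realType} {q : nat}.
Local Notation V := (PV R q).
Local Notation W := (l1 V).
Local Notation C := (cplx R).
Implicit Types (X Y Z : W) (f g : W -> W) (z : C) (A B : 'M[C]_q).

(** The real-linear operations through which the twistings and reality conditions act; compatibility
    with transposition makes them preserve orthogonality. *)
Definition wauto f :=
  [/\ blin f, forall X Y, f (X * Y) = f X * f Y, f 1 = 1 &
      forall X, f (wtr X) = wtr (f X)].

(** Maps with [keeps] respect the two halves of a Birkhoff splitting, maps with [flips] exchange
    them. *)
Definition keeps f := forall a X,
  (supge a X -> supge a (f X)) /\ (suple a X -> suple a (f X)).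

Definition flips f := forall a X,
  (supge a X -> suple (- a) (f X)) /\ (suple a X -> supge (- a) (f X)).

Lemma wauto_comp f g : wauto f -> wauto g -> wauto (fun X => f (g X)).
Proof.
move=> [bf mf f1 tf] [bg mg g1 tg]; split=> [|X Y||X].
- exact: (blin_comp bf bg).
- by rewrite mg mf.
- by rewrite g1 f1.
- by rewrite tg tf.
Qed.

Lemma keeps_comp f g : keeps f -> keeps g -> keeps (fun X => f (g X)).
Proof.
move=> kf kg a X; have [g1 g2] := kg a X; have [f1 f2] := kf a (g X).
by split=> h; [apply: f1; exact: g1|apply: f2; exact: g2].
Qed.

Lemma flips_comp f g : keeps f -> flips g -> flips (fun X => f (g X)).
Proof.
move=> kf kg a X; have [g1 g2] := kg a X; have [f1 f2] := kf (- a) (g X).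
by split=> h; [apply: f2; exact: g1|apply: f1; exact: g2].
Qed.

Lemma flips_flips f g : flips f -> flips g -> keeps (fun X => f (g X)).
Proof.
move=> kf kg a X; have [g1 g2] := kg a X; have [f1 f2] := kf (- a) (g X).
rewrite opprK in f1 f2.
by split=> h; [apply: f2; exact: g1|apply: f1; exact: g2].
Qed.

(** All the symmetries have this shape on values: [e] moves the parameter and [th] acts on matrices,
    so the algebra is checked on matrices. *)
Lemma wauto_ev f (e : C -> C) (th : 'M[C]_q -> 'M[C]_q) : blin f ->
  (forall z, `|z| = 1 -> `|e z| = 1) ->
  (forall A B, th (A *m B) = th A *m th B) -> th 1%:M = 1%:M ->
  (forall A, th A^T = (th A)^T) ->
  (forall z X, `|z| = 1 -> evM z (f X) = th (evM (e z) X)) -> wauto f.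
Proof.
move=> bf e1 tM t1 tT fE; split=> // [X Y||X]; apply: evM_inj => z z1.
- by rewrite (fE _ (X * Y))// !(evMM _ _ (e1 _ z1)) (evMM _ _ z1) tM !fE.
- by rewrite (fE _ (1 : W))// !evM1 t1.
- by rewrite (fE _ (wtr X))// (evM_tr _ (e1 _ z1)) (evM_tr _ z1) tT fE.
Qed.

Lemma wrot_auto (c : C) : `|c| = 1 -> wauto (wrot c).
Proof.
move=> c1; apply: (@wauto_ev _ (fun z => c * z) id) => //.
- exact: wrot_blin.
- by move=> z z1; rewrite normrM c1 z1 mulr1.
- by move=> z X z1; exact: evM_rot.
Qed.

Lemma wrot_keeps (c : C) : `|c| = 1 -> keeps (wrot c).
Proof.
move=> c1 a X; split=> h m ma; rewrite (wrotE _ _ c1) (h _ ma);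
  exact: (lin0 (scaleV_linear _)).
Qed.

Lemma winv_auto : wauto winv.
Proof.
apply: (@wauto_ev _ (fun z => z^-1) id) => //.
- exact: winv_blin.
- by move=> z z1; rewrite normrV ?unitfE ?unit_neq0// z1 invr1.
- by move=> z X z1; exact: evM_inv.
Qed.

Lemma winv_flips : flips winv.
Proof.
by move=> a X; split=> h m ma; rewrite winvE h //; [rewrite ltrNl|rewrite ltrNr].
Qed.

Lemma wconj_auto : wauto wconj.
Proof.
apply: (@wauto_ev _ (fun z => conjc z) (map_mx (@conjc R))) => //.
- exact: wconj_blin.
- by move=> z z1; rewrite (conj_unit z1) normrV ?unitfE ?unit_neq0// z1 invr1.
- by move=> A B; rewrite map_mxM.
- by rewrite map_mx1.
- by move=> A; rewrite map_trmx.
- by move=> z X z1; exact: evM_conj.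
Qed.

Lemma wconj_keeps : keeps wconj.
Proof.
by move=> a X; split=> h m ma; rewrite wconjE (h _ ma) oppr0.
Qed.

Definition wad A B X : W := wcst A * X * wcst B.

Lemma evM_ad A B z X : `|z| = 1 -> evM z (wad A B X) = A *m evM z X *m B.
Proof. by move=> z1; rewrite !evMM// !evM_cst. Qed.

Lemma wad_blin A B : blin (wad A B).
Proof.
apply: (@blin_comp _ _ _ _ (fun Y => Y * wcst B) (fun X => wcst A * X)).
  exact: (bbil_blinl (wcst B) wmul_bil).
exact: (bbil_blinr (wcst A) wmul_bil).
Qed.

Lemma wcst_supge A : supge 0 (wcst A). Proof. exact: supge_delta. Qed.
Lemma wcst_suple A : suple 0 (wcst A). Proof. exact: suple_delta. Qed.

Lemma wad_keeps A B : keeps (wad A B).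
Proof.
move=> a X; split=> h.
  have := supgeM (supgeM (@wcst_supge A) h) (@wcst_supge B).
  by rewrite add0r addr0.
have := supleM (supleM (@wcst_suple A) h) (@wcst_suple B).
by rewrite add0r addr0.
Qed.

Lemma wadE A B X m : toM (wad A B X m) = A *m toM (X m) *m B.
Proof.
have := @coef_single _ _ (wcst A * X) (wcst B) m m.
rewrite /wad => ->; last first.
  move=> a am; right; rewrite /wcst deltaE; case: eqP => // /eqP.
  by rewrite subr_eq0 eq_sym (negbTE am).
have := @coef_single _ _ (wcst A) X m 0.
move=> ->; last by move=> a am; left; rewrite /wcst deltaE (negbTE am).
by rewrite subrr subr0 !toM_mul /wcst !deltaE eqxx !ofMK.
Qed.

Lemma wad_auto A : A^T = A -> A *m A = 1%:M -> wauto (wad A A).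
Proof.
move=> AT AA; apply: (@wauto_ev _ (fun z : C => z) (fun X : 'M[C]_q => A *m X *m A : 'M[C]_q)) => //.
- exact: wad_blin.
- by move=> X Y; rewrite !mulmxA -(mulmxA _ A A) AA mulmx1.
- by rewrite mulmx1.
- by move=> X; rewrite !trmx_mul AT mulmxA.
- by move=> z X z1; exact: evM_ad.
Qed.

End Automorphisms.

(** * The involutions on Fourier coefficients *)

Section Symmetries.
Context {R : realType} {n k : nat}.
Local Notation N := (n + (1 + k))%N.
Local Notation V := (PV R N).
Local Notation W := (l1 V).
Local Notation C := (cplx R).
Implicit Types (X Y Z K : W) (z : C) (j : reality).
Local Notation P := (Pmx C n k).
Local Notation Q := (Qmx C n k).
Local Notation J := (Jmx C n k).

Lemma Pmx_tr (F : nzRingType) : (Pmx F n k)^T = Pmx F n k.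
Proof. by rewrite /Pmx tr_block_mx !trmx0 !tr_scalar_mx. Qed.

Lemma Qmx_tr (F : nzRingType) : (Qmx F n k)^T = Qmx F n k.
Proof. by rewrite /Qmx !(tr_block_mx, trmx0, tr_scalar_mx). Qed.

Lemma block_diag_mul (F : nzRingType) p r (A A' : 'M[F]_p) (B B' : 'M[F]_r) :
  block_mx A 0 0 B *m block_mx A' 0 0 B' = block_mx (A *m A') 0 0 (B *m B').
Proof. by rewrite mulmx_block !(mul0mx, mulmx0, addr0, add0r). Qed.

Lemma block_scalar1 (F : nzRingType) p r : block_mx 1%:M 0 0 1%:M = 1%:M :> 'M[F]_(p + r).
Proof. by rewrite -scalar_mx_block. Qed.

Lemma PmxK (F : comNzRingType) : Pmx F n k *m Pmx F n k = 1%:M.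
Proof. by rewrite /Pmx block_diag_mul mulmx1 -scalar_mxM mulrNN mulr1 block_scalar1. Qed.

Lemma QmxK (F : comNzRingType) : Qmx F n k *m Qmx F n k = 1%:M.
Proof.
by rewrite /Qmx !block_diag_mul !mulmx1 -scalar_mxM mulrNN mulr1 !block_scalar1.
Qed.

Lemma JmxK (F : comNzRingType) : Jmx F n k *m Jmx F n k = 1%:M.
Proof.
by rewrite /Jmx !block_diag_mul !mulmx1 -scalar_mxM mulrNN mulr1 !block_scalar1.
Qed.

Lemma invmx_eq (F : comUnitRingType) p (A B : 'M[F]_p) : A *m B = 1%:M -> invmx B = A.
Proof.
move=> AB; have [_ Bu] := mulmx1_unit AB.
by rewrite -[A]mulmx1 -(mulmxV Bu) mulmxA AB mul1mx.
Qed.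

Definition wsig X : W := wad P P (wrot (-1) X).
Definition wtau X : W := wad Q Q (winv X).
Definition wrho j X : W :=
  match j with
  | R1 => wconj (wrot (-1) X) | R2 => wconj X | Rm1 => wconj (winv X)
  end.

(* In the presence of the symmetry [wtau] the reality condition [wrho j] may be
   replaced by this one, which respects the Birkhoff splitting. *)
Definition kap j X : W := if j is Rm1 then wtau (wrho Rm1 X) else wrho j X.

Lemma normN1 : `|-1 : C| = 1. Proof. by rewrite normrN1. Qed.

Lemma wsig_auto : wauto wsig.
Proof.
exact: wauto_comp (wad_auto (Pmx_tr _) (PmxK _)) (wrot_auto normN1).
Qed.

Lemma wsig_keeps : keeps wsig.
Proof. exact: keeps_comp (wad_keeps _ _) (wrot_keeps normN1). Qed.

Lemma wtau_auto : wauto wtau.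
Proof.
exact: wauto_comp (wad_auto (Qmx_tr _) (QmxK _)) winv_auto.
Qed.

Lemma wtau_flips : flips wtau.
Proof. exact: flips_comp (wad_keeps _ _) winv_flips. Qed.

Lemma kap_auto j : wauto (kap j).
Proof.
case: j.
- exact: wauto_comp wconj_auto (wrot_auto normN1).
- exact: wconj_auto.
- exact: wauto_comp wtau_auto (wauto_comp wconj_auto winv_auto).
Qed.

Lemma kap_keeps j : keeps (kap j).
Proof.
case: j.
- exact: keeps_comp wconj_keeps (wrot_keeps normN1).
- exact: wconj_keeps.
- exact: flips_flips wtau_flips (flips_comp wconj_keeps winv_flips).
Qed.

Lemma evM_sig z X : `|z| = 1 -> evM z (wsig X) = P *m evM (- z) X *m P.
Proof. by move=> z1; rewrite evM_ad// (evM_rot _ normN1 z1) mulN1r. Qed.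

Lemma evM_tau z X : `|z| = 1 -> evM z (wtau X) = Q *m evM z^-1 X *m Q.
Proof. by move=> z1; rewrite (evM_ad _ _ _ z1) (evM_inv _ z1). Qed.

Lemma norm_conjc z : `|z| = 1 -> `|conjc z : C| = 1.
Proof. by move=> z1; rewrite (conj_unit z1) normrV ?unitfE ?unit_neq0// z1 invr1. Qed.

Lemma norm_inv1 z : `|z| = 1 -> `|z^-1| = 1.
Proof. by move=> z1; rewrite normrV ?unitfE ?unit_neq0// z1 invr1. Qed.

Lemma wtauK X : wtau (wtau X) = X.
Proof.
apply: evM_inj => z z1; rewrite evM_tau// evM_tau ?norm_inv1// invrK.
by rewrite !mulmxA QmxK mul1mx -mulmxA QmxK mulmx1.
Qed.

Lemma evM_rho j z X : `|z| = 1 -> evM z (wrho j X) = rho j (fun z => evM z X) z.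
Proof.
move=> z1; have zc := norm_conjc z1; case: j => /=; rewrite evM_conj//.
- by rewrite (evM_rot _ normN1 zc) mulN1r.
- by rewrite evM_inv.
Qed.

Lemma circ_eqP X Y : circ_eq (ev (X : wiener R n k)) (ev (Y : wiener R n k)) <-> X = Y.
Proof.
split=> [h|-> //]; apply: evM_inj => z z1.
by have := h z z1; rewrite !ev_evM.
Qed.

Lemma sigma_circ X : circ_eq (sigma (ev (X : wiener R n k))) (ev (X : wiener R n k)) <->
  wsig X = X.
Proof.
rewrite -[wsig X = X]circ_eqP; split=> h z z1; rewrite -(h z z1).
  by rewrite /sigma !ev_evM ?normrN// evM_sig// (invmx_eq (PmxK _)).
by rewrite /sigma !ev_evM ?normrN// evM_sig// (invmx_eq (PmxK _)).
Qed.

Lemma tau_circ X : circ_eq (tau (ev (X : wiener R n k))) (ev (X : wiener R n k)) <->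
  wtau X = X.
Proof.
rewrite -[wtau X = X]circ_eqP; split=> h z z1; rewrite -(h z z1).
  by rewrite /tau !ev_evM ?norm_inv1// evM_tau// (invmx_eq (QmxK _)).
by rewrite /tau !ev_evM ?norm_inv1// evM_tau// (invmx_eq (QmxK _)).
Qed.

Lemma rho_circ j X : circ_eq (rho j (ev (X : wiener R n k))) (ev (X : wiener R n k)) <->
  wrho j X = X.
Proof.
have E z : `|z| = 1 -> rho j (ev (X : wiener R n k)) z = ev (wrho j X : wiener R n k) z.
  move=> z1; rewrite [RHS]ev_evM// evM_rho//.
  case: j => /=; rewrite ev_evM// ?normrN ?norm_conjc//.
  by rewrite norm_inv1 ?norm_conjc.
rewrite -[wrho j X = X]circ_eqP; split=> h z z1; rewrite -(h z z1).
  by rewrite E.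
by rewrite E.
Qed.

End Symmetries.

(** * Loop groups, constant loops and cosets *)

Section LoopGroups.
Context {R : realType} {n k : nat}.
Local Notation N := (n + (1 + k))%N.
Local Notation V := (PV R N).
Local Notation W := (l1 V).
Local Notation C := (cplx R).
Implicit Types (X Y Z K : W) (z : C) (j : reality) (A : 'M[C]_N).

Definition wdet1 X := forall z : C, `|z| = 1 -> \det (evM z X) = 1.

Lemma loop_groupP s X : loop_group s (X : wiener R n k) <->
  wtr X * wcst (Defs.form C n k s) * X = wcst (Defs.form C n k s) /\ wdet1 X.
Proof.
split=> [h|[XX dX] z z1].
  split=> [|z z1]; last by have [_] := h z z1; rewrite ev_evM.
  apply: evM_inj => z z1; have [+ _] := h z z1; rewrite ev_evM// => E.
  by rewrite (evMM _ _ z1) (evMM _ _ z1) (evM_tr _ z1) !evM_cst.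
split; rewrite ev_evM//; last exact: dX.
by rewrite -(evM_tr _ z1) -(evM_cst z (Defs.form C n k s)) -(evMM _ _ z1) -(evMM _ _ z1) XX.
Qed.

Definition wsym s j X := [/\ wtr X * wcst (Defs.form C n k s) * X = wcst (Defs.form C n k s),
  wdet1 X, wsig X = X & wrho j X = X].

Lemma loops_sigmaP s j X : loops_sigma s j (X : wiener R n k) <-> wsym s j X.
Proof.
split=> [[/loop_groupP[XX dX] /sigma_circ sX /rho_circ rX]|[XX dX sX rX]]; first by split.
by split; [apply/loop_groupP|apply/sigma_circ|apply/rho_circ].
Qed.

(** The membership conditions that survive the Birkhoff splitting: [tau] is left out, and the
    reality condition is [kap j]. *)
Definition worth j X := [/\ wtr X * X = 1, wdet1 X, wsig X = X & kap j X = X].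

Lemma wcst1 : wcst 1%:M = 1 :> W. Proof. by []. Qed.

Lemma loops_sigma_tauP j X : loops_sigma_tau Sphere j (X : wiener R n k) <->
  worth j X /\ wtau X = X.
Proof.
have krho : wtau X = X -> kap j X = X <-> wrho j X = X.
  by move=> tX; case: j => //; rewrite /kap; split=> [h|->//]; rewrite -[LHS]wtauK h tX.
split=> [[/loops_sigmaP[XX dX sX rX] /tau_circ tX]|[[XX dX sX kX] tX]].
  by split=> //; split=> //; [move: XX; rewrite wcst1 mulr1|apply/krho].
split; last exact/tau_circ.
apply/loops_sigmaP; split=> //; last exact/krho.
by rewrite /= wcst1 mulr1.
Qed.

Lemma wdet1M X Y : wdet1 X -> wdet1 Y -> wdet1 (X * Y).
Proof. by move=> dX dY z z1; rewrite evMM// det_mulmx dX// dY// mulr1. Qed.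

Lemma wdet1_tr X : wdet1 X -> wdet1 (wtr X).
Proof. by move=> dX z z1; rewrite evM_tr// det_tr dX. Qed.

Lemma wdet11 : wdet1 1.
Proof. by move=> z z1; rewrite evM1 det1. Qed.

Lemma worthM j X Y : worth j X -> worth j Y -> worth j (X * Y).
Proof.
move=> [XX dX sX kX] [YY dY sY kY]; split.
- by rewrite wtrM mulrA -(mulrA (wtr Y)) XX mulr1.
- exact: wdet1M.
- by have [_ -> _ _] := @wsig_auto R n k; rewrite sX sY.
- by have [_ -> _ _] := @kap_auto R n k j; rewrite kX kY.
Qed.

Lemma worth_tr j X : worth j X -> worth j (wtr X).
Proof.
move=> [XX dX sX kX]; split.
- by rewrite wtrK; exact: wmul1C.
- exact: wdet1_tr.
- by have [_ _ _ ->] := @wsig_auto R n k; rewrite sX.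
- by have [_ _ _ ->] := @kap_auto R n k j; rewrite kX.
Qed.

Lemma worth1 j : worth j 1.
Proof.
split; first by rewrite wtr1 mulr1.
- exact: wdet11.
- by have [_ _ -> _] := @wsig_auto R n k.
- by have [_ _ -> _] := @kap_auto R n k j.
Qed.

Definition wHt j X := worth j X /\ wtau X = X.

Lemma wHtM j X Y : wHt j X -> wHt j Y -> wHt j (X * Y).
Proof.
move=> [XX tX] [YY tY]; split; first exact: worthM.
by have [_ -> _ _] := @wtau_auto R n k; rewrite tX tY.
Qed.

Lemma wHt_tr j X : wHt j X -> wHt j (wtr X).
Proof.
move=> [XX tX]; split; first exact: worth_tr.
by have [_ _ _ ->] := @wtau_auto R n k; rewrite tX.
Qed.

Lemma wHt1 j : wHt j 1.
Proof.
split; first exact: worth1.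
by have [_ _ -> _] := @wtau_auto R n k.
Qed.

Lemma constant_loopsP (H : set (wiener R n k)) X :
  constant_loops H X <-> [/\ H X, supge 0 X & suple 0 X].
Proof.
split=> [[HX [A XA]]|[HX s1 s2]].
  have -> : X = wcst A.
    by apply: evM_inj => z z1; rewrite evM_cst -(XA z z1) ev_evM.
  move: HX; have -> : X = wcst A.
    by apply: evM_inj => z z1; rewrite evM_cst -(XA z z1) ev_evM.
  by move=> HX; split=> //; [exact: wcst_supge|exact: wcst_suple].
split=> //; exists (toM (X 0)) => z z1.
by rewrite ev_evM// (supge_suple_delta s1 s2) evM_delta expr0z scale1r !deltaE eqxx.
Qed.

Definition wconst j X := [/\ wHt j X, supge 0 X & suple 0 X].

Lemma wconstP j X : constant_loops (loops_sigma_tau Sphere j) (X : wiener R n k) <->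
  wconst j X.
Proof.
split=> [/constant_loopsP[/loops_sigma_tauP]|[h1 h2 h3]]; first by split.
by apply/constant_loopsP; split=> //; exact/loops_sigma_tauP.
Qed.

Lemma wconstM j X Y : wconst j X -> wconst j Y -> wconst j (X * Y).
Proof.
move=> [h1 h2 h3] [l1 l2 l3]; split; first exact: wHtM.
  by have := supgeM h2 l2; rewrite addr0.
by have := supleM h3 l3; rewrite addr0.
Qed.

Lemma wconst_tr j X : wconst j X -> wconst j (wtr X).
Proof.
move=> [h1 h2 h3]; split; [exact: wHt_tr|exact: wtr_supge|exact: wtr_suple].
Qed.

Lemma wconst1 j : wconst j 1.
Proof. by split; [exact: wHt1|exact: supge_delta|exact: suple_delta]. Qed.

Lemma cosetP j X Y : coset (loops_sigma_tau Sphere j) (X : wiener R n k) Y <->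
  exists2 K, wconst j K & Y = X * K.
Proof.
split=> [[K /wconstP KH YE]|[K KH ->]]; exists K => //.
- apply: evM_inj => z z1; have := YE z z1.
  by rewrite !ev_evM// -(evMM _ _ z1).
- exact/wconstP.
- by move=> z z1; rewrite !ev_evM// (evMM _ _ z1).
Qed.

Lemma coset_mulr j X K : wconst j K ->
  coset (loops_sigma_tau Sphere j) (X * K : wiener R n k) =
  coset (loops_sigma_tau Sphere j) (X : wiener R n k).
Proof.
move=> KH; apply/seteqP; split=> Y /cosetP[L LH ->]; apply/cosetP.
  by exists (K * L); [exact: wconstM|rewrite mulrA].
exists (wtr K * L); first by apply: wconstM => //; exact: wconst_tr.
have [[[KK _ _ _] _] _ _] := KH.
by rewrite mulrA -(mulrA X) (wmul1C KK) mulr1.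
Qed.

Lemma coset_self j X : coset (loops_sigma_tau Sphere j) (X : wiener R n k) X.
Proof. by apply/cosetP; exists 1; [exact: wconst1|rewrite mulr1]. Qed.

(** By uniqueness of Fourier coefficients, a Laurent polynomial on the circle is a loop of bounded
    frequency support. *)
Lemma laurentP (a b : int) X : a <= b ->
  (exists A : nat -> 'M[C]_N, forall z, `|z| = 1 ->
     evM z X = \sum_(m < `|b - a|.+1) z ^ (a + m%:Z) *: A m) <->
  supge a X /\ suple b X.
Proof.
move=> ab.
have bE : b = a + `|b - a|%N%:Z by rewrite gez0_abs ?subr_ge0// [RHS]addrC subrK.
have evS (A : nat -> 'M[C]_N) p z : `|z| = 1 ->
    evM z (\sum_(m < p) delta (a + m%:Z) (ofM (A m) : V)) =
    \sum_(m < p) z ^ (a + m%:Z) *: A m.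
  move=> z1; elim: p => [|p ih].
    by rewrite !big_ord0 -(scale0r (0 : W)) evMZ// scale0r.
  by rewrite !big_ord_recr/= evMD// ih evM_delta ofMK.
split=> [[A XA]|[s1 s2]].
  have -> : X = \sum_(m < `|b - a|.+1) delta (a + m%:Z) (ofM (A m) : V).
    by apply: evM_inj => z z1; rewrite XA// evS.
  split=> m ma; rewrite l1_sumE big1// => i _; rewrite deltaE; case: eqP => // E.
    by move: ma; rewrite E ltNge lerDl.
  move: ma; rewrite E ltNge; have := ltn_ord i; rewrite ltnS -lez_nat => ib.
  by have := ib; rewrite -(lerD2l a) -bE => ->.
pose s := [seq a + m%:Z | m <- iota 0 `|b - a|.+1].
have us : uniq s.
  by rewrite map_inj_uniq ?iota_uniq// => x y /addrI [].
exists (fun m => toM (X (a + m%:Z))) => z z1.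
rewrite -[RHS](evS (fun m => toM (X (a + m%:Z))) _ _ z1); congr evM.
transitivity (\sum_(m <- s) delta m (X m)).
  apply: l1P => m; rewrite truncE//; case: ifPn => // /negP ms.
  have [ma|am] := ltP m a; first exact: s1.
  have [bm|mb] := ltP b m; first exact: s2.
  case: ms; apply/mapP; exists `|m - a|%N.
    rewrite mem_iota add0n/= ltnS -lez_nat !gez0_abs ?subr_ge0//.
    exact: lerB.
  by rewrite gez0_abs ?subr_ge0// [RHS]addrC subrK.
rewrite /s big_map -[iota _ _]/(index_iota 0 `|b - a|.+1) big_mkord.
by apply: eq_bigr => i _; rewrite toMK.
Qed.

Lemma mc_laurentP (a b : int) X Xi Y : a <= b -> Xi * X = 1 ->
  (exists A : nat -> 'M[C]_N,
   circ_eq (fun z => invmx (ev (X : wiener R n k) z) *m ev (Y : wiener R n k) z)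
        (fun z => \sum_(m < `|b - a|.+1) z ^ (a + m%:Z) *: A m)) <->
  supge a (Xi * Y) /\ suple b (Xi * Y).
Proof.
move=> ab XiX; rewrite -laurentP//.
have E z : `|z| = 1 -> invmx (ev (X : wiener R n k) z) *m ev (Y : wiener R n k) z =
    evM z (Xi * Y).
  move=> z1; rewrite !ev_evM// (evMM _ _ z1); congr (_ *m _).
  by apply: invmx_eq; rewrite -(evMM _ _ z1) XiX evM1.
by split=> -[A h]; exists A => z z1; have := h z z1; rewrite E.
Qed.

End LoopGroups.

Section Frames.
Context {R : realType} {n k : nat}.
Local Notation N := (n + (1 + k))%N.
Local Notation V := (PV R N).
Local Notation W := (l1 V).
Local Notation C := (cplx R).
Local Notation E := 'rV[R]_n.
Implicit Types (F : E -> W) (U : set E) (j : reality).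

Definition mcform F (t v : E) : W := wtr (F t) * 'D_v F t.

Lemma framesP j U F :
  frames (loops_sigma_tau Sphere j) (-1) 1 U (F : E -> wiener R n k) <->
  [/\ smooth U (F : E -> W), forall t, U t -> wHt j (F t) &
      forall t v, U t -> supge (-1) (mcform F t v) /\ suple 1 (mcform F t v)].
Proof.
split=> [[sF HF MF]|[sF HF MF]]; split=> //.
- by move=> t Ut; apply/loops_sigma_tauP; exact: HF.
- move=> t v Ut; have /loops_sigma_tauP[[FF _ _ _] _] := HF t Ut.
  have h := MF t v Ut.
  by apply/(mc_laurentP _ _ FF).
- by move=> t Ut; apply/loops_sigma_tauP; exact: HF.
- move=> t v Ut; have [[FF _ _ _] _] := HF t Ut.
  by apply/(mc_laurentP _ _ FF) => //; exact: MF.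
Qed.

End Frames.

(** For x and y near 1 the left side is small compared with x - y, while the right side is twice as
    large: the source of uniqueness of square roots near 1. *)
Lemma sqrt_diff (A : pzRingType) (x y : A) : x * x = y * y ->
  (x - 1) * (x - y) + (x - y) * (y - 1) = - ((x - y) + (x - y)).
Proof.
move=> E; rewrite mulrBl mul1r [(x - y) * (y - 1)]mulrBr mulr1 addrACA -opprD.
by rewrite mulrBr mulrBl addrA subrK E subrr add0r.
Qed.

(** The substitution 1 + e turns the equation for a square root into a quadratic fixed-point
    equation. *)
Lemma square_1D (A : pzRingType) (e D : A) : e + e = D - 1 - e * e -> (1 + e) * (1 + e) = D.
Proof.
move=> h; have -> : D = e + e + e * e + 1 by rewrite h !subrK.
by rewrite mulrDl mul1r mulrDr mulr1 [RHS]addrC -!addrA.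
Qed.

Lemma double_le (F : realFieldType) (x : F) : 2 * x <= x -> x <= 0.
Proof. lra. Qed.

(** * Birkhoff splitting *)

Section BirkhoffAlgebra.
Context {R : realType} {q : nat}.
Local Notation V := (PV R q).
Local Notation W := (l1 V).
Local Notation C := (cplx R).
Implicit Types (X Y Z F G : W).

Definition orth X := wtr X * X = 1.
Definition plus1 X := supge 1 (X - 1).

Lemma orthM X Y : orth X -> orth Y -> orth (X * Y).
Proof.
by rewrite /orth => XX YY; rewrite wtrM mulrA -(mulrA (wtr Y)) XX mulr1.
Qed.

Lemma orth_tr X : orth X -> orth (wtr X).
Proof. by rewrite /orth => XX; rewrite wtrK; exact: wmul1C. Qed.

Lemma orth_auto f X : wauto f -> orth X -> orth (f X).
Proof. by rewrite /orth => -[_ fM f1 fT] XX; rewrite -fT -fM XX f1. Qed.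

Lemma supge1 : supge 0 (1 : W). Proof. exact: supge_delta. Qed.
Lemma suple1 : suple 0 (1 : W). Proof. exact: suple_delta. Qed.

Lemma plus1_supge X : plus1 X -> supge 0 X.
Proof.
move=> pX; rewrite -[X](subrK 1); apply: supgeD; last exact: supge1.
exact: supge_weaken pX.
Qed.

Lemma plus1M X Y : plus1 X -> plus1 Y -> plus1 (X * Y).
Proof.
move=> pX pY; have -> : X * Y = ((X - 1) * Y + (Y - 1)) + 1.
  by rewrite mulrBl mul1r addrA !subrK.
rewrite /plus1 addrK; apply: supgeD => //.
by have := supgeM pX (plus1_supge pY); rewrite addr0.
Qed.

Lemma wtrB X Y : wtr (X - Y) = wtr X - wtr Y.
Proof. exact: (linB wtr_blin.1). Qed.

Lemma plus1_tr X : plus1 X -> plus1 (wtr X).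
Proof. by move=> pX; rewrite /plus1 -wtr1 -wtrB; exact: wtr_supge. Qed.

Lemma plus1_auto f X : wauto f -> keeps f -> plus1 X -> plus1 (f X).
Proof.
move=> [bf _ f1 _] kf pX; rewrite /plus1 -f1 -(linB bf.1).
exact: (kf 1 _).1.
Qed.

(** Liouville's theorem in terms of frequencies: only the constant term is left. *)
Lemma plus1_minus X : plus1 X -> suple 0 X -> X = 1.
Proof.
move=> pX mX; apply/eqP; rewrite -subr_eq0; apply/eqP/l1P => m.
have [m0|m0] := ltP 0 m; last by rewrite pX// (le_lt_trans m0).
by rewrite l1B mX// one_coef deltaE gt_eqF// subr0.
Qed.

(** The loop [wtr X' * X = Y' * wtr Y] extends to both sides of the circle, hence is 1;
    orthogonality supplies the inverses. *)
Lemma birkhoff_uniq X Y X' Y' : plus1 X -> plus1 X' -> suple 0 Y -> suple 0 Y' ->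
  orth X' -> orth Y -> X * Y = X' * Y' -> X = X' /\ Y = Y'.
Proof.
move=> pX pX' mY mY' oX' oY E.
have oY' : Y * wtr Y = 1 by apply: wmul1C.
have E1 : wtr X' * X = Y' * wtr Y.
  have : wtr X' * (X * Y) * wtr Y = wtr X' * (X' * Y') * wtr Y by rewrite E.
  by rewrite mulrA -(mulrA _ Y) oY' mulr1 (mulrA _ X') oX' mul1r.
have {}E1' : wtr X' * X = 1.
  apply: (plus1_minus (plus1M (plus1_tr pX') pX)).
  by rewrite E1; have := supleM mY' (wtr_suple mY); rewrite addr0.
split.
  have : X' * (wtr X' * X) = X' by rewrite E1' mulr1.
  by rewrite mulrA (wmul1C oX') mul1r.
have : (Y' * wtr Y) * Y = Y by rewrite -E1 E1' mul1r.
by rewrite -mulrA oY mulr1.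
Qed.

(** By the equation F G - 1 is (F - 1) G minus its own nonpositive part. *)
Lemma birkhoff_plus1 F G : G = 1 - prle ((F - 1) * G) -> plus1 (F * G) /\ suple 0 G.
Proof.
move=> GE; split; last first.
  rewrite GE; apply: supleD; first exact: suple1.
  by move=> m m0; rewrite l1N (@suple_prle _ _ _ _ m0) oppr0.
have E : F * G - 1 = (F - 1) * G - prle ((F - 1) * G).
  have <- : G - 1 = - prle ((F - 1) * G) by rewrite {1}GE addrAC subrr add0r.
  by rewrite mulrBl mul1r addrA subrK.
rewrite /plus1 E => m m1; rewrite l1B prleE.
have -> : m <= 0 by lia.
by rewrite subrr.
Qed.

(** Apart from the constant term 1, [wtr (F * G) * (F * G)] has positive frequencies only; it equals
    [wtr G * G], which has none. So both are 1. *)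
Lemma birkhoff_orth F G : orth F -> G = 1 - prle ((F - 1) * G) ->
  orth G /\ orth (F * G).
Proof.
move=> oF GE; have [pX mG] := birkhoff_plus1 GE.
have E : wtr (F * G) * (F * G) = wtr G * G.
  by rewrite wtrM mulrA -(mulrA (wtr G)) oF mulr1.
have E1 : wtr (F * G) * (F * G) = 1.
  apply: (plus1_minus (plus1M (plus1_tr pX) pX)).
  by rewrite E; have := supleM (wtr_suple mG) mG; rewrite addr0.
by split=> //; rewrite /orth -E.
Qed.

(** A symmetry that respects the halves carries a splitting to a splitting of the same loop, and
    uniqueness applies. *)
Lemma birkhoff_auto f X Y : wauto f -> keeps f -> plus1 X -> suple 0 Y ->
  orth X -> orth Y -> f (X * Y) = X * Y -> f X = X /\ f Y = Y.
Proof.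
move=> af kf pX mY oX oY; have [_ fM _ _] := af; rewrite fM => E.
apply: (birkhoff_uniq _ pX _ mY oX _ E).
- exact: plus1_auto.
- exact: (kf 0 Y).2.
- exact: orth_auto.
Qed.

Local Notation c := (mulK R q + mulK R q).

Lemma mulK2_gt0 : 0 < c. Proof. by rewrite addr_gt0 ?mulK_gt0. Qed.

Lemma wmul_le X Y : `|X * Y| <= c * `|X| * `|Y|. Proof. exact: wmul_norm. Qed.

(** The smallness condition bounds the left side of [sqrt_diff] by the norm of X - Y, so twice this
    norm is at most the norm itself. *)
Lemma sqrt_uniq X Y : c * (`|X - 1| + `|Y - 1|) <= 1 -> X * X = Y * Y -> X = Y.
Proof.
move=> small E; pose u := X - Y.
have E0 : (X - 1) * u + u * (Y - 1) = - (u + u).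
  exact: sqrt_diff.
have h : `|u + u| <= `|u|.
  rewrite -normrN -E0 (le_trans (ler_normD _ _))//.
  have := wmul_le (X - 1) u; have := wmul_le u (Y - 1) => h1 h2.
  rewrite (le_trans (lerD h2 h1))// [c * `|u| * _]mulrAC -mulrDl.
  by rewrite ler_piMl// -mulrDr.
apply/eqP; rewrite -subr_eq0 -/u -normr_le0.
have E2 : `|u + u| = 2 * `|u|.
  rewrite (_ : u + u = 2 *: u); last by rewrite -[u in LHS]scale1r -scalerDl.
  by rewrite normrZ ger0_norm.
by apply: double_le; rewrite -E2.
Qed.

(* Both [X] and [D * wtr X] are square roots of [D]. *)
Lemma sqrt_orth D X : orth D -> X * X = D ->
  c * (`|X - 1| + `|D * wtr X - 1|) <= 1 -> orth X.
Proof.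
move=> oD XD small; have oD' := wmul1C oD.
have DX : D * X = X * D by rewrite -XD mulrA.
have DTX : wtr D * X = X * wtr D.
  have : wtr D * (D * X) * wtr D = wtr D * (X * D) * wtr D by rewrite DX.
  by rewrite mulrA oD mul1r -!mulrA oD' mulr1.
have DXT : D * wtr X = wtr X * D.
  by have := congr1 wtr DTX; rewrite !wtrM wtrK.
have E : X = D * wtr X.
  apply: sqrt_uniq => //; rewrite XD.
  have -> : D * wtr X * (D * wtr X) = D * (wtr X * D) * wtr X by rewrite !mulrA.
  have -> : D * (wtr X * D) * wtr X = D * (D * (wtr X * wtr X)) by rewrite -DXT !mulrA.
  by rewrite -wtrM XD oD' mulr1.
have : wtr D * X = wtr X by rewrite {1}E mulrA oD mul1r.
by rewrite /orth => <-; rewrite -mulrA XD oD.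
Qed.

End BirkhoffAlgebra.

(** * Splittings and square roots near the identity, smooth in t *)

Section BirkhoffNear.
Context {R : realType} {n q : nat}.
Local Notation V := (PV R q).
Local Notation W := (l1 V).
Local Notation C := (cplx R).
Local Notation E := 'rV[R]_n.
Implicit Types (X Y Z : W) (F G D : E -> W) (U : set E).
Local Notation c := (mulK R q + mulK R q).

Lemma ball_of_near (t0 : E) (P : E -> Prop) : (\forall t \near t0, P t) ->
  exists2 r : R, 0 < r & forall t, ball t0 r t -> P t.
Proof. by move=> /nbhs_ballP[r r0 h]; exists r. Qed.

Lemma smooth_sub (Z : normedModType R) U U' (f : E -> Z) : U' `<=` U -> smooth U f -> smooth U' f.
Proof.
move=> UU sf r; have := sf r; elim: r f {sf} => [|r ih] f [fc fd].
  by split=> // t /UU; exact: fc.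
split=> [t /UU|v]; first exact: fc.
by have [h1 h2] := fd v; split=> [t /UU|]; [exact: h1|exact: ih].
Qed.

Lemma Cr_subc (Z : normedModType R) s U (f : E -> Z) (x : Z) : open U -> Cr s U f ->
  Cr s U (fun t => f t - x).
Proof. by move=> oU sf; exact: CrD oU sf (Cr_cst _ _ oU). Qed.

Lemma Cr_scale (Z : normedModType R) s U (f : E -> Z) (a : R) : open U -> Cr s U f ->
  Cr s U (fun t => a *: f t).
Proof. by move=> oU sf; exact: (Cr_blin oU (blinZ a blin_id) sf). Qed.

Lemma cont_small (t0 : E) F X (e : R) : {for t0, continuous F} -> F t0 = X -> 0 < e ->
  \forall t \near t0, `|F t - X| <= e.
Proof.
move=> Fc <- e0; have /(@cvgrPdist_le _ _ _ (nbhs t0) _)/(_ _ e0) := Fc.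
by apply: filterS => t; rewrite distrC.
Qed.

(** The radius (2 c)^-1 for [F - 1] makes the operator Y to [- prle ((F - 1) * Y)] halve norms,
    since [prle] does not increase them. *)
Lemma birkhoff_near U F t0 : open U -> U t0 -> smooth U F -> F t0 = 1 ->
  exists G, exists2 r : R, 0 < r & [/\ ball t0 r `<=` U, smooth (ball t0 r) G, G t0 = 1 &
    forall t, ball t0 r t -> G t = 1 - prle ((F t - 1) * G t)].
Proof.
move=> oU Ut0 sF F1.
have c0 : 0 < c := mulK2_gt0.
pose M X Y := - prle (X * Y) : W.
have bM : bbil M.
  exact: (blin_bbil_comp (blinN prle_blin) wmul_bil).
have Mle X Y : `|X| <= (2 * c)^-1 -> `|M X Y| <= 2^-1 * `|Y|.
  move=> Xs; rewrite normrN (le_trans (prle_norm _))// (le_trans (wmul_le _ _))//.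
  rewrite ler_wpM2r//; apply: le_trans (ler_wpM2l (ltW c0) Xs) _.
  by rewrite invfM mulrCA mulfV ?gt_eqF// mulr1.
have [|r r0 hr] := @ball_of_near t0 (fun t => U t /\ `|F t - 1| <= (2 * c)^-1).
  have hU : \forall s \near t0, U s by apply: open_nbhs_nbhs; split.
  have hF := cont_small (Cr_cont (sF 0%N) Ut0) F1 (_ : 0 < (2 * c)^-1).
  by apply: (filterS2 _ _ hU (hF _)) => //; rewrite invr_gt0 mulr_gt0.
have oB : open (ball t0 r) by exact: ball_open.
have ex t : exists G : W, ball t0 r t -> G = 1 + M (F t - 1) G.
  have [Ut|nU] := pselect (ball t0 r t); last by exists 0.
  have [_ fr _] := bM; have [_ Fs] := hr t Ut.
  have [G GE] := @lin_fix _ _ (M (F t - 1)) 1 W_abs_complete (fr _) (fun Y => Mle _ Y Fs).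
  by exists G => _.
pose G t := sval (cid (ex t)).
have GE t : ball t0 r t -> G t = 1 + M (F t - 1) (G t) := svalP (cid (ex t)).
exists G, r => //; split.
- by move=> t /hr[].
- move=> s; apply: (@Cr_lin_fix _ _ s (ball t0 r) _ _ M (fun t => F t - 1) (fun=> 1)).
  + exact: W_abs_complete.
  + exact: ball_open.
  + exact: bM.
  + by move=> t /hr[_ Fs] Y; exact: Mle.
  + exact: GE.
  + apply: (@Cr_subc (l1 V : normedModType R) s (ball t0 r) _ 1 oB).
    by apply: (smooth_sub _ sF) => t /hr[].
  + exact: Cr_cst oB.
- rewrite GE; last exact: ballxx.
  by rewrite F1 subrr /M mul0r (lin0 prle_blin.1) oppr0 addr0.
- by move=> t /GE.
Qed.

(** The equation is e = (D - 1) / 2 - e ^ 2 / 2 with the quadratic term projected by [pr0]: e is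
    then a constant loop by its own equation, and on constant loops the projected product is the
    product. *)
Lemma sqrt_near U D t0 : open U -> U t0 -> smooth U D -> D t0 = 1 ->
  (forall t, U t -> supge 0 (D t) /\ suple 0 (D t)) ->
  exists X : E -> W, exists2 r : R, 0 < r & [/\ ball t0 r `<=` U, smooth (ball t0 r) X, X t0 = 1,
    forall t, ball t0 r t -> X t * X t = D t &
    forall t, ball t0 r t -> supge 0 (X t) /\ suple 0 (X t)].
Proof.
move=> oU Ut0 sD D1 Dc; have c0 : 0 < c := mulK2_gt0.
pose Q X Y := 2^-1 *: pr0 (X * Y) : W.
have bQ : bbil Q by exact: (blin_bbil_comp (blinZ _ pr0_blin) wmul_bil).
have QK X Y : `|Q X Y| <= c * `|X| * `|Y|.
  rewrite normrZ ger0_norm ?invr_ge0// (le_trans _ (wmul_le X Y))//.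
  rewrite (le_trans _ (pr0_norm (X * Y)))// ler_piMl//.
  by rewrite invf_le1// ler1n.
(* Chosen so that c rho = 1/8, the smallness required by [quad_fix] and [Cr_quad_fix]. *)
pose rho := (8 * c)^-1.
have rho0 : 0 < rho by rewrite invr_gt0 mulr_gt0.
have Kr : c * rho <= 8^-1 by rewrite /rho invfM mulrCA mulfV ?gt_eqF// mulr1.
have [|r r0 hr] := @ball_of_near t0 (fun t => U t /\ `|D t - 1| <= rho).
  have hU : \forall s \near t0, U s by apply: open_nbhs_nbhs; split.
  have hF := cont_small (Cr_cont (sD 0%N) Ut0) D1 rho0.
  by apply: (filterS2 _ _ hU hF).
have oB : open (ball t0 r) by exact: ball_open.
pose b t := 2^-1 *: (D t - 1) : W.
have ex t : exists e : W, ball t0 r t -> `|e| <= rho /\ e = b t - Q e e.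
  have [Ut|nU] := pselect (ball t0 r t); last by exists 0.
  have [_ Ds] := hr t Ut.
  have [|e er eE] := @quad_fix _ _ Q c rho (b t) W_abs_complete bQ (ltW c0) (ltW rho0) QK Kr.
    by rewrite normrZ ger0_norm ?invr_ge0// mulrC ler_wpM2r ?invr_ge0.
  by exists e => _.
pose e t := sval (cid (ex t)).
have eE t : ball t0 r t -> `|e t| <= rho /\ e t = b t - Q (e t) (e t) := svalP (cid (ex t)).
have br : ball t0 r `<=` U by move=> t /hr[].
have ec t : ball t0 r t -> supge 0 (e t) /\ suple 0 (e t).
  move=> Ut; have [_ ->] := eE t Ut; have [D0 D0'] := Dc t (br _ Ut).
  split=> m m0; rewrite l1B !l1Z l1B one_coef !deltaE.
    by rewrite D0// lt_eqF// subrr !scaler0 subrr.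
  by rewrite D0'// gt_eqF// subrr !scaler0 subrr.
have se : smooth (ball t0 r) e.
  move=> s; apply: (@Cr_quad_fix _ _ s (ball t0 r) _ Q c rho b) => //.
  - exact: W_abs_complete.
  - exact: ltW.
  - apply: (Cr_scale _ oB).
    apply: (@Cr_subc (l1 V : normedModType R) s (ball t0 r) _ 1 oB).
    by apply: (smooth_sub _ sD) => t /hr[].
exists (fun t => 1 + e t), r => //; split=> //.
- move=> s; apply: CrD; [exact: ball_open|exact: Cr_cst oB|exact: se].
- have [es eE0] := eE t0 (ballxx _ r0).
  suff -> : e t0 = 0 by rewrite addr0.
  apply/eqP; rewrite -normr_le0; apply: double_le.
  have : `|e t0| <= 8^-1 * `|e t0|.
    rewrite {1}eE0 /b D1 subrr scaler0 sub0r normrN (le_trans (QK _ _))// ler_wpM2r//.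
    by apply: le_trans Kr; rewrite ler_pM2l.
  by move=> h; have := normr_ge0 (e t0); move: h; move: `|e t0| => x; lra.
- move=> t Ut; have [_ eEt] := eE t Ut; have [e1 e2] := ec t Ut.
  have ee : pr0 (e t * e t) = e t * e t.
    by apply/esym; apply: supge_suple_delta;
      [have := supgeM e1 e1|have := supleM e2 e2]; rewrite addr0.
  have : 2 *: e t = D t - 1 - e t * e t.
    by rewrite {1}eEt scalerBr !scalerA mulfV// !scale1r ee.
  by rewrite scaler_nat mulr2n; exact: square_1D.
- move=> t Ut; have [e1 e2] := ec t Ut.
  by split; [apply: supgeD e1; exact: supge1|apply: supleD e2; exact: suple1].
Qed.

End BirkhoffNear.

Section DeterminantPath.
Context {R : realType} {n : nat}.
Local Notation C := (cplx R).
Local Notation E := 'rV[R]_n.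

Lemma csum_cvg (T I : Type) (F : set_system T) (r : seq I) (x : I -> T -> C) (l : I -> C) :
  Filter F -> (forall i, x i @ F --> l i) ->
  (\sum_(i <- r) x i t : C) @[t --> F] --> \sum_(i <- r) l i.
Proof.
move=> FF xl; elim: r => [|i r ih].
  by rewrite big_nil; under eq_fun do rewrite big_nil; exact: cvg_cst.
by rewrite big_cons; under eq_fun do rewrite big_cons; exact: cvgD (xl i) ih.
Qed.

Lemma cprod_cvg (T I : Type) (F : set_system T) (r : seq I) (x : I -> T -> C) (l : I -> C) :
  Filter F -> (forall i, x i @ F --> l i) ->
  (\prod_(i <- r) x i t : C) @[t --> F] --> \prod_(i <- r) l i.
Proof.
move=> FF xl; elim: r => [|i r ih].
  by rewrite big_nil; under eq_fun do rewrite big_nil; exact: cvg_cst.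
by rewrite big_cons; under eq_fun do rewrite big_cons; exact: cvgM (xl i) ih.
Qed.

Lemma det_cvg q (T : Type) (F : set_system T) (x : T -> PV R q) (l : PV R q) : Filter F ->
  x @ F --> l -> (\det (toM (x t)) : C) @[t --> F] --> (\det (toM l) : C).
Proof.
move=> FF xl; rewrite /determinant; apply: csum_cvg => s.
apply: cvgM; first exact: cvg_cst.
by apply: cprod_cvg => i; exact: toM_cvg.
Qed.

Lemma Re_cvg (T : Type) (F : set_system T) (x : T -> C) (l : C) : Filter F ->
  x @ F --> l -> complex.Re (x t) @[t --> F] --> complex.Re l.
Proof.
move=> FF /cvgrPdist_le xl; apply/cvgrPdist_le => e e0.
have e0' : 0 < e%:C :> C by rewrite ltcR.
have := xl _ e0'; apply: filterS => t h.
by have := Re_le_norm h; rewrite raddfB.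
Qed.

(** The determinant takes the values 1 and -1 and is continuous; its real part vanishes nowhere on
    the ball and is positive at the centre. *)
Lemma det_ball q (t0 : E) (r : R) (Y : E -> PV R q) : 0 < r ->
  (forall t, ball t0 r t -> {for t, continuous Y}) ->
  (forall t, ball t0 r t -> \det (toM (Y t)) ^+ 2 = 1 :> C) -> toM (Y t0) = 1%:M ->
  forall t, ball t0 r t -> \det (toM (Y t)) = 1 :> C.
Proof.
move=> r0 Yc Y2 Y1 t tr; pose g t := complex.Re (\det (toM (Y t)) : C).
have dE s : ball t0 r s -> (\det (toM (Y s)) : C) = 1 \/ (\det (toM (Y s)) : C) = -1.
  by move=> sr; have /eqP := Y2 s sr; rewrite sqrf_eq1 => /orP[]/eqP; [left|right].
have : 0 < g t.
  apply: (@ball_pos _ _ g t0 r r0 _ _ _ t tr).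
  - move=> s sr; apply: (@Re_cvg _ (nbhs s) (fun t => \det (toM (Y t)) : C)).
    exact: (@det_cvg q _ (nbhs s) Y (Y s) _ (Yc s sr)).
  - move=> s sr; rewrite /g; case: (dE s sr) => ->; rewrite ?raddfN/= ?oppr_eq0 oner_eq0//.
  - by rewrite /g Y1 det1/= ltr01.
by rewrite /g; case: (dE t tr) => -> //=; rewrite oppr_gt0 ltr10.
Qed.

End DeterminantPath.

Section SmoothLoops.
Context {R : realType} {n q : nat}.
Local Notation V := (PV R q).
Local Notation W := (l1 V).
Local Notation C := (cplx R).
Local Notation E := 'rV[R]_n.
Implicit Types (X Y : E -> W) (U : set E) (t v : E).

Lemma smooth_mul U X Y : open U -> smooth U X -> smooth U Y -> smooth U (fun t => X t * Y t).
Proof. by move=> oU sX sY r; exact: (Cr_bbil oU wmul_bil (sX r) (sY r)). Qed.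

Lemma smooth_blin (Z Z' : normedModType R) U (L : Z -> Z') (f : E -> Z) : open U -> blin L ->
  smooth U f -> smooth U (fun t => L (f t)).
Proof. by move=> oU bL sf r; exact: Cr_blin. Qed.

Lemma smooth_cont (Z : normedModType R) U (f : E -> Z) t : smooth U f -> U t ->
  {for t, continuous f}.
Proof. by move=> sf Ut; exact: (Cr_cont (sf 0%N) Ut). Qed.

Lemma smooth_derive (Z : normedModType R) U (f : E -> Z) v : smooth U f ->
  smooth U (fun t => 'D_v f t).
Proof. by move=> sf r; exact: Cr_derive (sf r.+1). Qed.

Lemma smooth_has (Z : normedModType R) U (f : E -> Z) v t : smooth U f -> U t ->
  has_derive f t v ('D_v f t).
Proof. by move=> sf Ut; exact: (@Cr_has _ _ 0 _ _ _ v (sf 1%N) t Ut). Qed.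

#[local] Arguments smooth_has [Z U f] v [t].

Lemma smooth_eq (Z : normedModType R) U (f g : E -> Z) : open U ->
  (forall t, U t -> f t = g t) -> smooth U f -> smooth U g.
Proof. by move=> oU fg sf r; exact: Cr_eq oU fg (sf r). Qed.

Lemma derive_mul U X Y v t : smooth U X -> smooth U Y -> U t ->
  'D_v (fun t => X t * Y t) t = 'D_v X t * Y t + X t * 'D_v Y t.
Proof.
move=> sX sY Ut.
by have /has_deriveP[_ ->] := has_derive_bbil wmul_bil (smooth_has v sX Ut) (smooth_has v sY Ut).
Qed.

Lemma derive_lin (Z Z' : normedModType R) U (L : Z -> Z') (f : E -> Z) v t : blin L ->
  smooth U f -> U t -> 'D_v (fun t => L (f t)) t = L ('D_v f t).
Proof.
by move=> bL sf Ut; have /has_deriveP[_ ->] := has_derive_blin bL (smooth_has v sf Ut).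
Qed.

Lemma derive_eqU (Z : normedModType R) U (f g : E -> Z) v t : open U -> U t ->
  (forall t, U t -> f t = g t) -> 'D_v f t = 'D_v g t.
Proof. by move=> oU Ut fg; apply: near_eq_derive; exact: open_near Ut. Qed.

Lemma derive_blin_cst (Z Z' : normedModType R) U (L : Z -> Z') (f : E -> Z) v t : open U ->
  blin L -> smooth U f -> U t -> (forall s, U s -> L (f s) = L (f t)) -> L ('D_v f t) = 0.
Proof.
move=> oU bL sf Ut fc; rewrite -(derive_lin v bL sf Ut).
rewrite (derive_eqU v oU Ut fc).
by have /has_deriveP[_ ->] := has_derive_cst (L (f t)) t v.
Qed.

Lemma derive_suple U X a v t : open U -> smooth U X -> U t ->
  (forall s, U s -> suple a (X s)) -> suple a ('D_v X t).
Proof.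
move=> oU sX Ut Xa m ma; apply: (derive_blin_cst v oU (coef_blin m) sX Ut) => s Us.
by rewrite !Xa.
Qed.

Lemma derive_plus1 U X v t : open U -> smooth U X -> U t ->
  (forall s, U s -> plus1 (X s)) -> supge 1 ('D_v X t).
Proof.
move=> oU sX Ut Xa m ma; apply: (derive_blin_cst v oU (coef_blin m) sX Ut) => s Us.
by have := Xa s Us m ma; have := Xa t Ut m ma; rewrite !l1B => /subr0_eq -> /subr0_eq ->.
Qed.

Lemma det_loop (t0 : E) r X : 0 < r -> smooth (ball t0 r) X ->
  (forall t, ball t0 r t -> orth (X t)) -> X t0 = 1 ->
  forall t, ball t0 r t -> forall z : C, `|z| = 1 -> \det (evM z (X t)) = 1.
Proof.
move=> r0 sX oX X1 t tr z z1.
apply: (@det_ball _ _ _ t0 r (fun t => ev1 z (X t)) r0) => //.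
- move=> s sr; exact: (blin_cvg _ (ev1_blin z1) (smooth_cont sX sr)).
- move=> s sr; rewrite -[toM _]/(evM z (X s)) expr2 -{1}(det_tr (evM z (X s))).
  by rewrite -det_mulmx -evM_tr// -(evMM _ _ z1) oX// evM1 det1.
- by rewrite X1; exact: evM1.
Qed.

End SmoothLoops.

Lemma halvesE (F : realFieldType) (d : F) : 0 < d -> d * ((2 * d)^-1 + (2 * d)^-1) = 1.
Proof. by move=> d0; field; rewrite gt_eqF. Qed.

(** * Splitting a curved frame, and recovering one from its plus part *)

Section BirkhoffFrames.
Context {R : realType} {n k : nat}.
Local Notation N := (n + (1 + k))%N.
Local Notation V := (PV R N).
Local Notation W := (l1 V).
Local Notation C := (cplx R).
Local Notation E := 'rV[R]_n.
Implicit Types (F G : E -> W) (U : set E) (j : reality).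
Local Notation c := (mulK R N + mulK R N).

Definition plus_frame j U (t0 : E) F :=
  [/\ smooth U F, forall t, U t -> worth j (F t) /\ plus1 (F t), F t0 = 1 &
    forall t v, U t -> supge 1 (mcform F t v) /\ suple 1 (mcform F t v)].

Definition curved_frame j U (t0 : E) F :=
  [/\ smooth U F, forall t, U t -> wHt j (F t), F t0 = 1 &
    forall t v, U t -> supge (-1) (mcform F t v) /\ suple 1 (mcform F t v)].

Definition minus_part j U (t0 : E) F :=
  [/\ smooth U F, forall t, U t -> worth j (F t) /\ suple 0 (F t) & F t0 = 1].

Lemma frame_split j U t0 F : open U -> U t0 -> curved_frame j U t0 F ->
  exists Fp Fm, exists2 r : R, 0 < r & [/\ ball t0 r `<=` U, plus_frame j (ball t0 r) t0 Fp,
    minus_part j (ball t0 r) t0 Fm & forall t, ball t0 r t -> F t = Fp t * Fm t].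
Proof.
move=> oU Ut0 [sF HF F1 MF].
have [G [r r0 [br sG G1 GE]]] := birkhoff_near oU Ut0 sF F1.
have oB : open (ball t0 r) by exact: ball_open.
have sF' := smooth_sub br sF.
have sP : smooth (ball t0 r) (fun t => F t * G t) by exact: smooth_mul.
have oF t : U t -> orth (F t) by move=> /HF[[]].
have GP t : ball t0 r t -> [/\ orth (G t), orth (F t * G t), plus1 (F t * G t) & suple 0 (G t)].
  move=> Bt; have [ow1 o2] := birkhoff_orth (oF t (br _ Bt)) (GE t Bt).
  by have [p1 p2] := birkhoff_plus1 (GE t Bt).
have FE t : ball t0 r t -> F t = F t * G t * wtr (G t).
  by move=> Bt; have [ow1 _ _ _] := GP t Bt; rewrite -mulrA (wmul1C ow1) mulr1.
have P1 : F t0 * G t0 = 1 by rewrite F1 G1 mulr1.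
have PF t (f : W -> W) : ball t0 r t -> wauto f -> keeps f -> f (F t) = F t ->
    f (F t * G t) = F t * G t /\ f (wtr (G t)) = wtr (G t).
  move=> Bt af kf fF; have [ow1 o2 p1 p2] := GP t Bt.
  apply: birkhoff_auto => //; [exact: wtr_suple|exact: orth_tr|].
  by rewrite -FE.
exists (fun t => F t * G t), (fun t => wtr (G t)), r => //; split=> //.
- split=> // [t Bt|t v Bt].
    have [ow1 o2 p1 p2] := GP t Bt; split=> //.
    have [[_ _ sgF kF] _] := HF t (br _ Bt).
    split=> //; first by apply: (det_loop r0 sP _ P1 Bt) => s /GP[].
      by have [] := PF t _ Bt wsig_auto wsig_keeps sgF.
    by have [] := PF t _ Bt (kap_auto j) (@kap_keeps _ _ _ j) kF.
  split.
    have h := derive_plus1 v oB sP Bt (fun s Bs => let: And4 _ _ p _ := GP s Bs in p).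
    have [_ _ p1 _] := GP t Bt.
    by have := supgeM (wtr_supge (plus1_supge p1)) h; rewrite add0r.
  have [ow1 _ _ mG] := GP t Bt.
  (* Gauge transformation: the form of F G is a conjugate of the form of F plus [wtr G * 'D_v G]. As
     G has nonpositive frequencies, nothing exceeds frequency 1. *)
  rewrite /mcform (derive_mul v sF' sG Bt) wtrM mulrDr.
  have -> : wtr (G t) * wtr (F t) * ('D_v F t * G t) = wtr (G t) * mcform F t v * G t.
    by rewrite /mcform !mulrA.
  have -> : wtr (G t) * wtr (F t) * (F t * 'D_v G t) = wtr (G t) * 'D_v G t.
    by rewrite mulrA -(mulrA (wtr (G t))) (oF t (br _ Bt)) mulr1.
  have [_ mF] := MF t v (br _ Bt).
  apply: supleD.
    have := supleM (supleM (wtr_suple mG) mF) mG; rewrite add0r addr0; exact.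
  have dG := derive_suple v oB sG Bt (fun s Bs => let: And4 _ _ _ p := GP s Bs in p).
  by have := supleM (wtr_suple mG) dG; rewrite add0r; exact: suple_weaken.
- have sT : smooth (ball t0 r) (fun t => wtr (G t)) by exact: smooth_blin wtr_blin sG.
  have T1 : wtr (G t0) = 1 by rewrite G1 wtr1.
  split=> // t Bt; have [ow1 o2 p1 p2] := GP t Bt; split; last exact: wtr_suple.
  have [[_ _ sgF kF] _] := HF t (br _ Bt).
  split; first exact: orth_tr.
  + apply: (det_loop r0 sT _ T1 Bt) => s Bs; have [ow _ _ _] := GP s Bs; exact: (orth_tr ow).
  + by have [] := PF t _ Bt wsig_auto wsig_keeps sgF.
  + by have [] := PF t _ Bt (kap_auto j) (@kap_keeps _ _ _ j) kF.
Qed.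

Lemma kap_tau j (X : W) : kap j (wtau X) = wtau (kap j X).
Proof.
have QmxC : map_mx (@conjc R) (Qmx C n k) = Qmx C n k.
  by rewrite /Qmx !(map_block_mx, map_mx0, map_scalar_mx); rewrite rmorph1 rmorphN1.
have inv1 z : `|z| = 1 -> `|z^-1 : C| = 1 by exact: norm_inv1.
have rt i (Y : W) : i <> R1 -> wrho i (wtau Y) = wtau (wrho i Y).
  move=> i1; apply: evM_inj => z z1; have zc := norm_conjc z1; have zi := inv1 _ z1.
  have zci := norm_conjc zi; have zic := inv1 _ zc; have := inv1 _ zic => zz.
  rewrite (evM_rho _ _ z1) (evM_tau _ z1) (evM_rho _ _ zi).
  case: i i1 => //= _; rewrite /conj_mx.
    by rewrite (evM_tau _ zc) !map_mxM QmxC fmorphV.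
  by rewrite (evM_tau _ zic) !map_mxM QmxC fmorphV.
case: j; last 2 first.
- exact: rt.
- by rewrite /kap rt.
apply: evM_inj => z z1; have zc := norm_conjc z1; have zi := inv1 _ z1.
have zn : `|- conjc z : C| = 1 by rewrite normrN.
rewrite /kap (evM_rho _ _ z1) (evM_tau _ z1) (evM_rho _ _ zi)/= /conj_mx.
by rewrite (evM_tau _ zn) !map_mxM QmxC invrN fmorphV.
Qed.

(** Both P and Q are diagonal, and negation and inversion of the parameter commute. *)
Lemma wsig_tau (X : W) : wsig (wtau X) = wtau (wsig X).
Proof.
have PQ : Pmx C n k *m Qmx C n k = Qmx C n k *m Pmx C n k.
  rewrite /Pmx /Qmx !block_diag_mul; congr block_mx.
  by rewrite mul_scalar_mx mul_mx_scalar.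
apply: evM_inj => z z1; have zi := norm_inv1 z1.
have zn : `|- z| = 1 by rewrite normrN.
rewrite (evM_sig _ z1) (evM_tau _ zn) (evM_tau _ z1) (evM_sig _ zi) invrN.
move: (evM _ X) => Y; rewrite !mulmxA PQ -(mulmxA _ (Qmx _ _ _) (Pmx _ _ _)) -PQ.
by rewrite !mulmxA.
Qed.

Lemma frame_unsplit j U t0 Fp : open U -> U t0 -> plus_frame j U t0 Fp ->
  exists F Fm, exists2 r : R, 0 < r & [/\ ball t0 r `<=` U, curved_frame j (ball t0 r) t0 F,
    minus_part j (ball t0 r) t0 Fm & forall t, ball t0 r t -> F t = Fp t * Fm t].
Proof.
move=> oU Ut0 [sP HP P1 MP].
have at_ := @wtau_auto R n k; have [bt tM t1 tT] := at_.
have taut X := @wtauK R n k X.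
pose Z t := wtr (wtau (Fp t)) * Fp t.
have sZ : smooth U Z.
  by apply: smooth_mul => //; apply: (smooth_blin oU wtr_blin); exact: smooth_blin bt sP.
have Z1 : Z t0 = 1 by rewrite /Z P1 t1 wtr1 mulr1.
have oP t : U t -> orth (Fp t) by move=> /HP[[]].
have oZ t : U t -> orth (Z t).
  by move=> Ut; apply: orthM; [apply: orth_tr; apply: orth_auto => //|]; exact: oP.
have [G [r1 r10 [br1 sG G1 GE]]] := birkhoff_near oU Ut0 sZ Z1.
have oB1 : open (ball t0 r1) by exact: ball_open.
have B10 : ball t0 r1 t0 by exact: ballxx.
have GP t : ball t0 r1 t -> [/\ orth (G t), orth (Z t * G t), plus1 (Z t * G t) & suple 0 (G t)].
  move=> Bt; have [u1 u2] := birkhoff_orth (oZ t (br1 _ Bt)) (GE t Bt).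
  by have [p1 p2] := birkhoff_plus1 (GE t Bt).
(* [Z = Zp * wtr G], and [D = Zm * wtau Zp] is a constant loop. *)
pose Zp t := Z t * G t; pose D t := wtr (G t) * wtau (Zp t).
have sZp : smooth (ball t0 r1) Zp by apply: smooth_mul => //; exact: smooth_sub br1 sZ.
have sD : smooth (ball t0 r1) D.
  by apply: smooth_mul => //; [exact: smooth_blin wtr_blin sG|exact: smooth_blin bt sZp].
have D1 : D t0 = 1 by rewrite /D /Zp Z1 G1 wtr1 mulr1 t1 mulr1.
have ZE t : ball t0 r1 t -> Z t = Zp t * wtr (G t).
  by move=> Bt; have [u1 _ _ _] := GP t Bt; rewrite /Zp -mulrA (wmul1C u1) mulr1.
have Ztau t : wtr (wtau (Z t)) = Z t.
  by rewrite /Z tM tT taut wtrM wtrK.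
(* [wtau] maps Z to its transpose. Splitting both sides of this identity gives a second expression
   for D, with nonnegative frequencies; its definition has nonpositive ones. *)
have DE t : ball t0 r1 t -> D t = wtr (Zp t) * wtau (G t).
  move=> Bt; have [u1 u2 _ _] := GP t Bt.
  have E1 : Zp t * wtr (G t) = wtau (G t) * wtr (wtau (Zp t)).
    by rewrite -ZE// -{1}Ztau {1}ZE// tM wtrM tT wtrK.
  have u3 : orth (wtau (Zp t)) by exact: orth_auto.
  have -> : D t = wtr (Zp t) * (Zp t * wtr (G t)) * wtau (Zp t).
    by rewrite mulrA u2 mul1r.
  by rewrite E1 -(mulrA (wtr (Zp t))) -(mulrA (wtau (G t))) u3 mulr1.
have Dc t : ball t0 r1 t -> supge 0 (D t) /\ suple 0 (D t).
  move=> Bt; have [_ _ p1 mG] := GP t Bt; split.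
    rewrite DE//; have := supgeM (wtr_supge (plus1_supge p1)) ((@wtau_flips R n k 0 _).2 mG).
    by rewrite oppr0 addr0.
  have := supleM (wtr_suple mG) ((@wtau_flips R n k 0 _).1 (plus1_supge p1)).
  by rewrite oppr0 addr0.
have oD t : ball t0 r1 t -> orth (D t).
  move=> Bt; have [u1 u2 _ _] := GP t Bt.
  by apply: orthM; [exact: orth_tr|exact: orth_auto].
have Dtau t : ball t0 r1 t -> wtau (D t) = wtr (D t).
  by move=> Bt; rewrite {1}/D tM taut tT DE// wtrM wtrK -tT.
have [X [r2 r20 [br2 sX X1 XD Xc]]] := sqrt_near oB1 B10 sD D1 Dc.
have B20 : ball t0 r2 t0 by exact: ballxx.
have oB2 : open (ball t0 r2) by exact: ball_open.
have br2U : ball t0 r2 `<=` U by move=> t /br2 /br1.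
(* Two loops within e of 1 meet the condition of [sqrt_uniq], as c (e + e) = 1. On a small ball X
   and its images under the symmetries are this close to 1. *)
pose e := (2 * c)^-1.
have c0 : 0 < c by exact: mulK2_gt0.
have e0 : 0 < e by rewrite invr_gt0 mulr_gt0.
have small (f : E -> W) : smooth (ball t0 r2) f -> f t0 = 1 ->
    \forall t \near t0, `|f t - 1| <= e.
  by move=> sf f1; exact: cont_small (smooth_cont sf B20) f1 e0.
have ce (x y : R) : x <= e -> y <= e -> c * (x + y) <= 1.
  move=> xe ye; apply: le_trans (ler_wpM2l (ltW c0) (lerD xe ye)) _.
  by rewrite /e halvesE.
have [as_ ak] := (@wsig_auto R n k, @kap_auto R n k j).
have sXT : smooth (ball t0 r2) (fun t => wtr (X t)) by exact: smooth_blin wtr_blin sX.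
have nearX : \forall t \near t0, [/\ ball t0 r2 t, `|X t - 1| <= e, `|D t * wtr (X t) - 1| <= e,
    `|wsig (X t) - 1| <= e & [/\ `|kap j (X t) - 1| <= e, `|wtau (X t) - 1| <= e &
    `|wtr (X t) - 1| <= e]].
  have n1 : \forall t \near t0, ball t0 r2 t by apply: open_nbhs_nbhs; split.
  have n2 := small X sX X1.
  have n3 : \forall t \near t0, `|D t * wtr (X t) - 1| <= e.
    apply: (small (fun t => D t * wtr (X t))); last by rewrite D1 X1 wtr1 mulr1.
    by apply: smooth_mul => //; exact: smooth_sub br2 sD.
  have n4 : \forall t \near t0, `|wsig (X t) - 1| <= e.
    have [b _ b1 _] := as_.
    by apply: (small (fun t => wsig (X t))); [exact: smooth_blin b sX|rewrite X1 b1].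
  have n5 : \forall t \near t0, `|kap j (X t) - 1| <= e.
    have [b _ b1 _] := ak.
    by apply: (small (fun t => kap j (X t))); [exact: smooth_blin b sX|rewrite X1 b1].
  have n6 : \forall t \near t0, `|wtau (X t) - 1| <= e.
    by apply: (small (fun t => wtau (X t))); [exact: smooth_blin bt sX|rewrite X1 t1].
  have n7 : \forall t \near t0, `|wtr (X t) - 1| <= e.
    by apply: (small (fun t => wtr (X t))); [exact: sXT|rewrite X1 wtr1].
  apply: filterS (filterI n1 (filterI n2 (filterI n3 (filterI n4 (filterI n5 (filterI n6 n7)))))).
  by move=> t [h1 [h2 [h3 [h4 [h5 [h6 h7]]]]]].
have [r r0 hr] := ball_of_near nearX.
have br : ball t0 r `<=` ball t0 r2 by move=> t /hr[].
have oB : open (ball t0 r) by exact: ball_open.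
have Zpinv t (f : W -> W) : ball t0 r t -> wauto f -> keeps f -> f (Fp t) = Fp t ->
    (forall Y, f (wtau Y) = wtau (f Y)) -> f (Zp t) = Zp t /\ f (wtr (G t)) = wtr (G t).
  move=> Bt af kf fP ft; have [u1 u2 p1 p2] := GP t (br2 _ (br _ Bt)).
  apply: birkhoff_auto => //; [exact: wtr_suple|exact: orth_tr|].
  rewrite -(ZE _ (br2 _ (br _ Bt))) /Z.
  by have [_ -> _ ->] := af; rewrite ft fP.
(* X and its image under f are both square roots of D, hence equal. *)
have Xinv t (f : W -> W) : ball t0 r t -> wauto f -> keeps f -> f (Fp t) = Fp t ->
    (forall Y, f (wtau Y) = wtau (f Y)) -> `|f (X t) - 1| <= e -> f (X t) = X t.
  move=> Bt af kf fP ft fe; have [f1 f2] := Zpinv t f Bt af kf fP ft.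
  have [_ xe _ _ _] := hr t Bt; apply: (sqrt_uniq (ce _ _ fe xe)).
  have [_ fM _ _] := af; rewrite -fM XD//; last exact: br.
  by rewrite /D fM ft f1 f2.
have oX t : ball t0 r t -> orth (X t).
  move=> Bt; have [B2 xe de _ _] := hr t Bt.
  exact: (sqrt_orth (oD t (br2 _ B2)) (XD t B2) (ce _ _ xe de)).
have Xtau t : ball t0 r t -> wtau (X t) = wtr (X t).
  move=> Bt; have [B2 _ _ _ [_ te tre]] := hr t Bt.
  apply: (sqrt_uniq (ce _ _ te tre)).
  by rewrite -tM -wtrM XD// Dtau//; exact: br2.
(* The factor [wtr X] is a constant loop: it leaves the minus factor in nonpositive frequencies and,
   as shown below, makes F invariant under [wtau]. *)
pose Fm t := wtau (Zp t) * wtr (X t); pose F t := Fp t * Fm t.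
have sFm : smooth (ball t0 r) Fm.
  apply: smooth_mul => //; last exact: smooth_sub br sXT.
  by apply: smooth_blin bt _ => //; apply: smooth_sub sZp => t /br /br2.
have Fm1 : Fm t0 = 1 by rewrite /Fm /Zp Z1 G1 X1 wtr1 !mulr1 t1.
have sPr : smooth (ball t0 r) Fp by apply: smooth_sub sP => t /br /br2U.
have sF : smooth (ball t0 r) F by exact: smooth_mul.
have HFm t : ball t0 r t -> worth j (Fm t) /\ suple 0 (Fm t).
  move=> Bt; have B1 := br2 _ (br _ Bt); have [u1 u2 p1 p2] := GP t B1.
  have oFm s : ball t0 r s -> orth (Fm s).
    move=> Bs; have [u3 u4 _ _] := GP s (br2 _ (br _ Bs)).
    by apply: orthM; [exact: orth_auto|apply: orth_tr; exact: oX].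
  have [[_ _ sgP kP] _] := HP t (br2U _ (br _ Bt)).
  have [_ _ _ xs [xk _ _]] := hr t Bt.
  have inv f : wauto f -> keeps f -> f (Fp t) = Fp t ->
      (forall Y, f (wtau Y) = wtau (f Y)) -> `|f (X t) - 1| <= e -> f (Fm t) = Fm t.
    move=> af kf fP ft fe; rewrite /Fm; have [_ -> _ fT] := af.
    by rewrite ft fT (Zpinv t f Bt af kf fP ft).1 (Xinv t f Bt af kf fP ft fe).
  split; last first.
    have := supleM ((@wtau_flips R n k 0 _).1 (plus1_supge p1)) (wtr_suple (Xc t (br _ Bt)).2).
    by rewrite oppr0 addr0.
  split; [exact: oFm|exact: (det_loop r0 sFm oFm Fm1 Bt)| |].
  - exact: inv as_ wsig_keeps sgP wsig_tau xs.
  - exact: inv ak (@kap_keeps _ _ _ j) kP (kap_tau j) xk.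
exists F, Fm, r => //; split; [by move=> t /br /br2U| |by split|by []].
- have HF t : ball t0 r t -> wHt j (F t).
    move=> Bt; have [hm _] := HFm t Bt; have [hp _] := HP t (br2U _ (br _ Bt)).
    split; first exact: worthM.
    have B1 := br2 _ (br _ Bt); have [u1 _ _ _] := GP t B1.
    have E : wtr (wtau (Fp t)) * (Fp t * wtau (Zp t)) = Zp t * (X t * X t).
      by rewrite mulrA -/(Z t) (ZE t B1) -mulrA -/(D t) XD//; exact: br.
    have op : orth (wtau (Fp t)) by apply: orth_auto => //; apply: oP; exact: br2U (br _ Bt).
    (* Hence F is also [wtau Fp * (Zp * X)], which is the image of [Fp * (wtau Zp * wtr X)] under
       [wtau] because [wtau] maps X to its transpose. *)
    have {}E : Fp t * wtau (Zp t) = wtau (Fp t) * (Zp t * (X t * X t)).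
      by rewrite -E mulrA (wmul1C op) mul1r.
    have FE : F t = wtau (Fp t) * (Zp t * X t).
      rewrite /F /Fm (mulrA (Fp t)) E -(mulrA (wtau (Fp t))) -(mulrA (Zp t)).
      by rewrite -(mulrA (X t)) (wmul1C (oX t Bt)) mulr1.
    by rewrite FE (tM (wtau (Fp t))) taut (tM (Zp t)) Xtau.
  split=> //; first by rewrite /F P1 Fm1 mulr1.
  move=> t v Bt; have Ut := br2U _ (br _ Bt).
  have [hm mFm] := HFm t Bt; have [hp pp] := HP t Ut.
  have le1 : suple 1 (mcform F t v).
    rewrite /mcform (derive_mul v sPr sFm Bt) wtrM mulrDr.
    have -> : wtr (Fm t) * wtr (Fp t) * ('D_v Fp t * Fm t) = wtr (Fm t) * mcform Fp t v * Fm t.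
      by rewrite /mcform !mulrA.
    have -> : wtr (Fm t) * wtr (Fp t) * (Fp t * 'D_v Fm t) = wtr (Fm t) * 'D_v Fm t.
      by rewrite mulrA -(mulrA (wtr (Fm t))) (oP t Ut) mulr1.
    have [_ mF] := MP t v Ut.
    apply: supleD.
      have := supleM (supleM (wtr_suple mFm) mF) mFm; rewrite add0r addr0; exact.
    have dG := derive_suple v oB sFm Bt (fun s Bs => (HFm s Bs).2).
    by have := supleM (wtr_suple mFm) dG; rewrite add0r; exact: suple_weaken.
  (* The product rule bounded the frequencies from above; [wtau] fixes the form and reverses
     frequencies, which bounds them from below. *)
  split=> //; have <- : wtau (mcform F t v) = mcform F t v.
    rewrite /mcform tM tT (HF t Bt).2; congr (_ * _).
    rewrite -(derive_lin v bt sF Bt); apply: (derive_eqU v oB Bt) => s Bs.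
    exact: (HF s Bs).2.
  exact: (@wtau_flips R n k 1 _).2.
Qed.

End BirkhoffFrames.

(** * Frames homogeneous in the loop parameter *)

Section ExponentialBounds.
Context {R : realType}.

(** M times the Taylor coefficients of exp(K z), extended by 0 to negative degrees: the majorant for
    coefficients of an entire loop. *)
Definition gbound (M K : R) (m : int) : R := if m is Posz i then M * K ^+ i / i`!%:R else 0.

Lemma gbound_ge0 M K m : 0 <= M -> 0 <= K -> 0 <= gbound M K m.
Proof. by move=> M0 K0; case: m => //= i; rewrite !mulr_ge0// ?exprn_ge0// invr_ge0. Qed.

Lemma sum_nonneg_le (b : int -> R) (B : R) : (forall m, 0 <= b m) ->
  (forall m, m < 0 -> b m = 0) -> (forall p, \sum_(i < p) b i%:Z <= B) ->
  forall s, uniq s -> \sum_(m <- s) b m <= B.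
Proof.
move=> b0 bneg bB s us.
have [p hp] : exists p : nat, forall m, m \in s -> m < p%:Z.
  elim: s {us} => [|m s [p ih]]; first by exists 0%N.
  exists (maxn p `|m|.+1) => x; rewrite inE => /orP[/eqP->|/ih]; lia.
apply: (le_trans _ (bB p)).
have -> : \sum_(i < p) b i%:Z = \sum_(m <- [seq i%:Z | i <- iota 0 p]) b m.
  have -> : iota 0 p = index_iota 0 p by rewrite /index_iota subn0.
  by rewrite big_map big_mkord.
set I := [seq _ | _ <- _].
have uI : uniq I by rewrite map_inj_uniq ?iota_uniq// => x y [].
rewrite (bigID (mem I)) /= [X in _ + X]big1_seq ?addr0; last first.
  move=> m /andP[mI ms]; apply: bneg; rewrite ltNge; apply/negP => m0.
  move/negP: mI; apply; apply/mapP; exists `|m|%N; last by rewrite gez0_abs.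
  by rewrite mem_iota; have := hp m ms; lia.
rewrite [leRHS](bigID (mem s))/= -[leLHS]addr0 lerD ?sumr_ge0//.
have pE : perm_eq [seq i <- s | i \in I] [seq i <- I | i \in s].
  by apply: uniq_perm; rewrite ?filter_uniq// => x; rewrite !mem_filter andbC.
by rewrite -[leLHS]big_filter -[leRHS]big_filter (perm_big _ pE).
Qed.

Lemma gbound_sum M K : 0 <= M -> 0 <= K ->
  exists B : R, forall s, uniq s -> \sum_(m <- s) gbound M K m <= B.
Proof.
move=> M0 K0; exists (M * expR K) => s.
apply: sum_nonneg_le => [m|m|p]; first exact: gbound_ge0.
  by case: m.
have -> : \sum_(i < p) gbound M K i%:Z = M * series (exp_coeff K) p.
  rewrite seriesEord/= mulr_sumr; apply: eq_bigr => i _.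
  by rewrite /= mulrA.
rewrite ler_wpM2l// /expR; apply: nondecreasing_cvgn_le.
  by apply: nondecreasing_series => i _ _; exact: exp_coeff_ge0.
exact: is_cvg_series_exp_coeff.
Qed.

(** The terms of the exponential series tend to 0. *)
Lemma gbound_small M K (x : R) : 0 <= M -> 0 <= K -> (forall i : nat, x <= gbound M K i) -> x <= 0.
Proof.
move=> M0 K0 h.
have : M * exp_coeff K i @[i --> \oo] --> M * 0.
  apply: cvgM; first exact: cvg_cst.
  apply: cvg_series_cvg_0; exact: is_cvg_series_exp_coeff.
rewrite mulr0 => l; apply: (cvgr_to_ge l).
by apply: nearW => i; have := h i; rewrite /= /exp_coeff/= mulrA.
Qed.

End ExponentialBounds.

Section Norming.
Context {R : realType} {q : nat}.
Local Notation V := (PV R q).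
Local Notation W := (l1 V).

Lemma entry_blin (b : bool) i j : blin (fun v : V => (if b then v.1 i j else v.2 i j) : R^o).
Proof.
split=> [a u v|]; first by case: b; rewrite !mxE.
by exists 1 => v; rewrite mul1r; have [h1 h2] := pair_entry_le v i j; case: b.
Qed.

Lemma PV_weakly_normed : weakly_normed V.
Proof.
move=> w B B0 h; apply: pair_norm_le => // i j; split.
  apply: (h _ (entry_blin true i j)) => v; exact: (pair_entry_le v i j).1.
apply: (h _ (entry_blin false i j)) => v; exact: (pair_entry_le v i j).2.
Qed.

Lemma l1_separated : lin_separated (W : normedModType R).
Proof.
move=> w h; apply: l1P => m; rewrite l10.
have e b i j : (if b then (w m).1 i j else (w m).2 i j) = 0.
  exact: (h _ (blin_comp (entry_blin b i j) (coef_blin m))).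
rewrite [w m]surjective_pairing; congr pair; apply/matrixP => i j; rewrite mxE.
  exact: e true i j.
exact: e false i j.
Qed.

End Norming.

(** * The coefficient recursion and entireness of homogeneous frames *)

Section Entire.
Context {R : realType} {n q : nat}.
Local Notation V := (PV R q).
Local Notation W := (l1 V).
Local Notation C := (cplx R).
Local Notation E := 'rV[R]_n.
Implicit Types (X Y : E -> W) (U : set E).
Local Notation c := (mulK R q + mulK R q).

Lemma mvt_bound (Z : normedModType R) (f df : E -> Z) (v t : E) (h B : R) : weakly_normed Z ->
  0 <= B ->
  (forall s, `|s| <= `|h| -> has_derive f (s *: v + t) v (df (s *: v + t))) ->
  (forall s, `|s| <= `|h| -> `|df (s *: v + t)| <= B) ->
  `|f (h *: v + t) - f t| <= B * `|h|.
Proof.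
move=> nZ B0 fd dB; apply: nZ => [|L bL Lv]; first by rewrite mulr_ge0.
have [s sh|s sh] := @line_MVT _ _ (fun x => L (f x)) (fun x => L (df x)) v t h.
  exact: (has_derive_blin bL (fd s sh)).
rewrite (linB bL.1) => ->; rewrite normrM ler_wpM2r//.
by apply: le_trans (Lv _) _; exact: dB.
Qed.

Lemma cont_bounded (Z : normedModType R) (f : E -> Z) (t0 : E) : {for t0, continuous f} ->
  exists B : R, \forall t \near t0, `|f t| <= B.
Proof.
move=> fc; exists (`|f t0| + 1).
have /(@cvgrPdist_le _ _ _ (nbhs t0) _)/(_ _ (@ltr01 R)) := fc.
apply: filterS => t h; have := ler_normD (f t0) (f t - f t0).
by rewrite addrC subrK => /le_trans; apply; rewrite lerD2l distrC.
Qed.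

Definition homog_frame U (t0 : E) X :=
  [/\ smooth U X, forall t, U t -> orth (X t), X t0 = 1 &
    forall t v, U t -> supge 1 (wtr (X t) * 'D_v X t) /\ suple 1 (wtr (X t) * 'D_v X t)].

(** The coefficient of the loop parameter in the Maurer-Cartan form, the only one that a homogeneous
    frame has. *)
Definition bet X (t v : E) : V := (wtr (X t) * 'D_v X t) 1.

Lemma homog_derive U t0 X t v : homog_frame U t0 X -> U t ->
  'D_v X t = X t * delta 1 (bet X t v).
Proof.
move=> [_ oX _ MX] Ut; have [s1 s2] := MX t v Ut.
rewrite -(supge_suple_delta s1 s2) mulrA (wmul1C (oX t Ut)) mul1r//.
Qed.

(** Comparing frequencies in dX = X (z b) turns the equation for the loop into a recursion on its
    coefficients. *)
Lemma homog_coef U t0 X t v m : homog_frame U t0 X -> U t ->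
  ('D_v X t) m = mulV (X t (m - 1)) (bet X t v).
Proof.
move=> hX Ut; rewrite (homog_derive v hX Ut).
have E1 : m - (m - 1) = 1 by lia.
rewrite (@coef_single _ _ (X t) (delta 1 (bet X t v)) m (m - 1)).
  by rewrite E1 deltaE eqxx.
move=> a am; right; rewrite deltaE; case: eqP => // ma; move/eqP: am; case; lia.
Qed.

Lemma homog_coef_has U t0 X t v m : homog_frame U t0 X -> U t ->
  has_derive (fun t => X t m) t v (mulV (X t (m - 1)) (bet X t v)).
Proof.
move=> hX Ut; rewrite -(homog_coef v m hX Ut); have [sX _ _ _] := hX.
exact: (has_derive_blin (coef_blin m) (@Cr_has _ _ 0 _ _ _ v (sX 1%N) t Ut)).
Qed.

Lemma homog_bounds U t0 X : open U -> U t0 -> homog_frame U t0 X ->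
  exists r M K : R, [/\ 0 < r, 0 <= M, 1 <= K, ball t0 r `<=` U &
    forall t, ball t0 r t -> `|X t| <= M /\
      forall v m, `|mulV (X t m) (bet X t v)| <= K * `|v| * `|X t m|].
Proof.
move=> oU Ut0 hX; have [sX oX X1 MX] := hX.
have [B1 h1] := cont_bounded (smooth_cont sX Ut0).
have [B2 h2] := cont_bounded (smooth_cont (smooth_blin oU wtr_blin sX) Ut0).
pose S t : R^o := \sum_(i < n) `|'D_(delta_mx 0 i) X t|.
have Sc : {for t0, continuous S}.
  apply: (@sum_cvg _ R^o _ _ (nbhs t0) _ (fun i t => `|'D_(delta_mx 0 i) X t| : R^o)) => i.
  by apply: cvg_norm; exact: smooth_cont (smooth_derive (delta_mx 0 i) sX) Ut0.
have [B3 h3] := cont_bounded Sc.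
have hU : \forall s \near t0, U s by apply: open_nbhs_nbhs; split.
have [r r0 hr] := ball_of_near (filterI hU (filterI h1 (filterI h2 h3))).
have B10 : 0 <= B1 by have [_ [h _]] := hr t0 (ballxx _ r0); exact: le_trans h.
have B20 : 0 <= B2 by have [_ [_ [h _]]] := hr t0 (ballxx _ r0); exact: le_trans h.
have B30 : 0 <= B3 by have [_ [_ [_ h]]] := hr t0 (ballxx _ r0); exact: le_trans h.
have k0 := ltW (@mulK_gt0 R q); have c0 : 0 <= c := ltW mulK2_gt0.
(* B1, B2 and B3 bound X, its transpose and its partial derivatives near t0; the summand 1 makes K
   at least 1. *)
exists r, B1, (1 + mulK R q * (c * B2 * B3)); split=> //.
- by rewrite lerDl !mulr_ge0.
- by move=> t /hr[].
move=> t /hr[Ut [x1 [x2 x3]]]; split=> // v m.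
rewrite (le_trans (mulK_bound _ _))//.
have bb : `|bet X t v| <= c * B2 * B3 * `|v|.
  rewrite (le_trans (l1_coef_le _ _))// (le_trans (wmul_le _ _))//.
  rewrite -!mulrA ler_wpM2l// ler_pM// (le_trans (derive_bound v (@l1_separated R q) oU (sX 1%N) Ut))//.
  rewrite mulrC ler_wpM2r//; move: x3; rewrite ger0_norm// sumr_ge0//.
rewrite mulrAC ler_wpM2r//; apply: le_trans (ler_wpM2l k0 bb) _.
by rewrite [leLHS]mulrA; apply: ler_wpM2r => //; rewrite lerDr.
Qed.

Lemma homog_line U t0 X r t m s : homog_frame U t0 X -> ball t0 r `<=` U -> ball t0 r t ->
  0 <= s <= 1 ->
  has_derive (fun x : R => X (x *: (t - t0) + t0) m) s (1 : R)
    (mulV (X (s *: (t - t0) + t0) (m - 1)) (bet X (s *: (t - t0) + t0) (t - t0))).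
Proof.
move=> hX br Bt s01; have Us := br _ (ball_convex s01 Bt).
exact: (has_derive_line (@homog_coef_has _ _ _ _ (t - t0) m hX Us)).
Qed.

Lemma ball_norm_le (t0 : E) (r : R) t : ball t0 r t -> `|t - t0| <= r.
Proof. by rewrite -ball_normE/= distrC => /ltW. Qed.

(* Along rays the coefficient of index [m] is a primitive of a multiple of the
   one of index [m - 1]. *)
Lemma chain_frame U t0 X (phi : nat -> E -> V) r M K : 0 < r -> 0 <= M -> 0 <= K ->
  ball t0 r `<=` U -> homog_frame U t0 X ->
  (forall t, ball t0 r t -> forall v m, `|mulV (X t m) (bet X t v)| <= K * `|v| * `|X t m|) ->
  (forall t, ball t0 r t -> `|phi 0%N t| <= M) ->
  (forall i, phi i.+1 t0 = 0) ->
  (forall i, (forall t, phi i.+1 t = 0) \/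
     exists m v, (forall t, phi i t = X t (m - 1)) /\ (forall t, phi i.+1 t = X t m - v)) ->
  forall t, ball t0 r t -> forall i, `|phi i t| <= gbound M (K * r) i%:Z.
Proof.
move=> r0 M0 K0 br hX HK p0 pz pS t Bt i.
pose ga s := s *: (t - t0) + t0.
have ex i' s : exists d : V, 0 <= s <= 1 ->
    has_derive (fun x : R => phi i'.+1 (ga x)) s (1 : R) d /\ `|d| <= K * r * `|phi i' (ga s)|.
  have [s01|ns] := boolP (0 <= s <= 1); last by exists 0.
  have [z|[m [v [e1 e2]]]] := pS i'.
    exists 0 => _; split; last by rewrite normr0 !mulr_ge0// ltW.
    have -> : (fun x : R => phi i'.+1 (ga x)) = (fun=> 0) by apply/funext => x; exact: z.
    exact: (@has_derive_cst _ R^o V 0 s 1).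
  exists (mulV (X (ga s) (m - 1)) (bet X (ga s) (t - t0))) => _; split.
    have -> : (fun x : R => phi i'.+1 (ga x)) = (fun x => X (ga x) m - v).
      by apply/funext => x; exact: e2.
    rewrite -[X in has_derive _ _ _ X]addr0.
    apply: (@has_deriveD _ R^o V); first exact: homog_line hX br Bt s01.
    exact: (@has_derive_cst _ R^o V (- v) s 1).
  rewrite e1 (le_trans (HK _ (ball_convex s01 Bt) _ _))// ler_wpM2r// ler_wpM2l//.
  exact: ball_norm_le.
pose dphi i' s := sval (cid (ex i'.-1 s)).
have dE i' s : 0 <= s <= 1 -> _ := svalP (cid (ex i' s)).
have := @chain_bound _ V (fun i s => phi i (ga s)) dphi M (K * r) PV_weakly_normed M0.
move=> /(_ _ _ _ _ _ i 1); rewrite mulr1 /ga scale1r subrK; apply.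
- by rewrite mulr_ge0// ltW.
- by move=> s s01; apply: p0; exact: ball_convex.
- by move=> i' s s01; have [] := dE i' s s01.
- by move=> i' s s01; have [] := dE i' s s01.
- by move=> i'; rewrite scale0r add0r pz.
- by rewrite lexx ler01.
Qed.

(** At t0 the coefficients of X - 1 vanish, so the recursion can be started arbitrarily far below m.
    After i steps the coefficient of index m is bounded by the i-th term of one exponential series,
    for every i. *)
Lemma homog_plus1 U t0 X : open U -> U t0 -> homog_frame U t0 X ->
  exists2 r, 0 < r & ball t0 r `<=` U /\ forall t, ball t0 r t -> plus1 (X t).
Proof.
move=> oU Ut0 hX; have [r [M [K [r0 M0 K1 br HB]]]] := homog_bounds oU Ut0 hX.
have K0 : 0 <= K by exact: le_trans K1.
exists r => //; split=> // t Bt m m1; have m0 : m <= 0 by lia.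
apply/eqP; rewrite -normr_le0.
apply: (@gbound_small _ (M + `|1 : W|) (K * r)).
- by rewrite addr_ge0.
- by rewrite mulr_ge0// ltW.
move=> i; pose a := m - i%:Z.
(* Truncated above index 0: X - 1 obeys the recursion up to index 0 only, since from index 1 on the
   constant term of X enters. *)
pose phi (j : nat) (t : E) : V := if a + j%:Z <= 0 then (X t - 1) (a + j%:Z) else 0.
have phiE : phi i t = (X t - 1) m by rewrite /phi /a subrK m0.
rewrite -phiE; apply: (@chain_frame U t0 X phi r) => //.
- by rewrite addr_ge0.
- by move=> s Bs v m'; exact: (HB s Bs).2.
- move=> s Bs; rewrite /phi; case: ifP => _; last by rewrite normr0 addr_ge0.
  rewrite (le_trans (l1_coef_le _ _))// (le_trans (ler_normB _ _))// lerD2r.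
  exact: (HB s Bs).1.
- by move=> j; rewrite /phi; have [_ _ -> _] := hX; rewrite subrr l10 if_same.
- move=> j; rewrite /phi; have [aj|aj] := boolP (a + j.+1%:Z <= 0); last by left.
  right; exists (a + j.+1%:Z), ((1 : W) (a + j.+1%:Z)); split=> s //.
  have -> : a + j%:Z = a + j.+1%:Z - 1 by lia.
  have -> : (a + j.+1%:Z - 1 <= 0) by lia.
  rewrite l1B one_coef deltaE; case: eqP => [E0|_]; last by rewrite subr0.
  by move: aj E0; lia.
Qed.

Lemma homog_entire U t0 X : open U -> U t0 -> homog_frame U t0 X ->
  (forall t, U t -> plus1 (X t)) ->
  exists r M K : R, [/\ 0 < r, 0 <= M, 1 <= K, ball t0 r `<=` U &
    forall t, ball t0 r t -> (forall m, `|X t m| <= gbound M K m) /\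
      (forall v m, `|mulV (X t (m - 1)) (bet X t v)| <= `|v| * gbound (K * M) (2 * K) m)].
Proof.
move=> oU Ut0 hX pX; have [r [M [K [r0 M0 K1 br HB]]]] := homog_bounds oU Ut0 hX.
have K0 : 0 <= K by exact: le_trans K1.
(* Serves both estimates: K r is the rate of growth along rays, K the factor in the bound on
   derivatives. *)
pose K' := K * r + K.
have K'1 : 1 <= K' by rewrite /K' (le_trans K1)// lerDr mulr_ge0// ltW.
have K'0 : 0 <= K' by exact: le_trans K'1.
have cb t : ball t0 r t -> forall i : nat, `|X t i%:Z| <= gbound M K' i%:Z.
  move=> Bt i; apply: (@le_trans _ _ (gbound M (K * r) i)); last first.
    have Kr0 : 0 <= K * r by rewrite mulr_ge0// ltW.
    by rewrite /gbound ler_wpM2r ?invr_ge0// ler_wpM2l// lerXn2r ?nnegrE// /K' lerDl.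
  apply: (@chain_frame U t0 X (fun i t => X t i%:Z) r) => //.
  - by move=> s Bs v m'; exact: (HB s Bs).2.
  - by move=> s Bs; rewrite (le_trans (l1_coef_le _ _))//; exact: (HB s Bs).1.
  - by move=> j; have [_ _ -> _] := hX; rewrite one_coef deltaE.
  - move=> j; right; exists j.+1%:Z, 0; split=> s; last by rewrite subr0.
    by congr (X s _); lia.
have cb' t : ball t0 r t -> forall m, `|X t m| <= gbound M K' m.
  move=> Bt [i|i]; first exact: cb.
  by rewrite (plus1_supge (pX t (br _ Bt))) ?normr0.
exists r, M, K'; split=> // t Bt; split; first exact: cb'.
move=> v m; apply: le_trans ((HB t Bt).2 _ _) _.
have pX0 := plus1_supge (pX t (br _ Bt)).
have r0' m' : 0 <= `|v| * gbound (K' * M) (2 * K') m'.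
  by rewrite mulr_ge0// gbound_ge0// mulr_ge0.
have neg m' : m' - 1 < 0 -> K * `|v| * `|X t (m' - 1)| <= `|v| * gbound (K' * M) (2 * K') m'.
  by move=> m0; rewrite (pX0 _ m0) normr0 mulr0.
case: m => [[|i]|i]; [exact: neg| |by apply: neg; lia].
have -> : i.+1%:Z - 1 = i%:Z by lia.
rewrite [K * _]mulrC -mulrA ler_wpM2l//.
have h1 : K * `|X t i| <= K' * gbound M K' i.
  by rewrite ler_pM// ?cb// /K' lerDr mulr_ge0// ltW.
apply: (le_trans h1); rewrite /gbound factS natrM invfM.
have f0 : 0 <= i`!%:R^-1 :> R by rewrite invr_ge0.
have -> : K' * (M * K' ^+ i / i`!%:R) = (K' * M * i`!%:R^-1) * K' ^+ i by ring.
have -> : K' * M * (2 * K') ^+ i.+1 * (i.+1%:R^-1 / i`!%:R) =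
  (K' * M * i`!%:R^-1) * ((2 * K') ^+ i.+1 / i.+1%:R) by ring.
(* The shift of the index costs a factor i + 1, absorbed by 2 ^ (i + 1). *)
rewrite ler_wpM2l ?mulr_ge0// ler_pdivlMr// exprMn.
rewrite [leLHS]mulrC ler_pM ?exprn_ge0 ?ler_weXn2l//.
by rewrite -natrX ler_nat ltnW// ltn_expl.
Qed.

Lemma gbound_scale (r M K : R) m : 0 <= r -> r ^ m * gbound M K m = gbound M (r * K) m.
Proof.
by move=> r0; case: m => [i|i]; rewrite /= ?mulr0// exprMn -exprnP; ring.
Qed.

Lemma gboundZ (a M K : R) m : a * gbound M K m = gbound (a * M) K m.
Proof. by case: m => [i|i]; rewrite /= ?mulr0//; ring. Qed.

Lemma cvg_scale_sub (Z : normedModType R) (T : Type) (F : set_system T) (f : T -> Z) l (a : R) :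
  Filter F -> f @ F --> l -> a *: (f x - l) @[x --> F] --> (0 : Z).
Proof.
move=> FF fl; have h : f x - l @[x --> F] --> l - l by apply: cvgB => //; exact: cvg_cst.
have := blin_cvg _ (blinZ a blin_id) h; rewrite subrr scaler0; exact.
Qed.

(** Factorial majorants survive multiplication by r ^ m, so continuity and differentiability of the
    rescaled map follow from those of the coefficients by dominated convergence. The majorants hold
    on a fixed ball, so one radius [rho] serves all r. *)
Lemma homog_scl U t0 X : open U -> U t0 -> homog_frame U t0 X ->
  (forall t, U t -> plus1 (X t)) ->
  exists2 rho : R, 0 < rho & ball t0 rho `<=` U /\ forall r : R, 0 < r ->
   [/\ forall t, ball t0 rho t -> sclok r (X t),
       smooth (ball t0 rho) (fun t => scl r (X t)) &
       forall t v, ball t0 rho t -> 'D_v (fun t => scl r (X t)) t =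
         scl r (X t) * delta 1 (r *: bet X t v)].
Proof.
move=> oU Ut0 hX pX; have [rho [M [K [rho0 M0 K1 br HB]]]] := homog_entire oU Ut0 hX pX.
have K0 : 0 <= K by exact: le_trans K1.
have [sX _ _ _] := hX; have oB : open (ball t0 rho) by exact: ball_open.
exists rho => //; split=> // r r0.
have rK0 : 0 <= r * K by rewrite mulr_ge0// ltW.
have rm0 m : 0 <= r ^ m by rewrite exprz_ge0// ltW.
have cb t m : ball t0 rho t -> `|r ^ m *: X t m| <= gbound M (r * K) m.
  move=> Bt; rewrite normrZ ger0_norm// -gbound_scale ?(ltW r0)// ler_wpM2l//.
  exact: (HB t Bt).1.
have [B hB] := gbound_sum M0 rK0.
have ok t : ball t0 rho t -> sclok r (X t).
  move=> Bt; exists B => s us; apply: le_trans (hB s us).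
  by apply: ler_sum => m _; exact: cb.
pose f t := scl r (X t).
have fE t m : ball t0 rho t -> f t m = r ^ m *: X t m by move=> Bt; exact: sclE (ok t Bt).
have f_cont t : ball t0 rho t -> {for t, continuous f}.
  move=> Bt.
  have M2 : 0 <= 2 * M by rewrite mulr_ge0.
  have [B2 hB2] := gbound_sum M2 rK0.
  have dz : f s - f t @[s --> t] --> (0 : W).
    apply: (@tannery _ _ _ (nbhs t) (fun s => f s - f t) (gbound (2 * M) (r * K)) B2) => //.
    - by move=> m; exact: gbound_ge0.
    - have h : \forall s \near t, ball t0 rho s by exact: open_near Bt.
      apply: filterS h => s Bs m; rewrite l1B !fE// -gboundZ mulr_natl mulr2n.
      by rewrite (le_trans (ler_normB _ _))// lerD// cb.
    - move=> m; have : r ^ m *: (X s m - X t m) @[s --> t] --> r ^ m *: (X t m - X t m).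
        have gc := @smooth_cont _ _ _ U (fun s => X s - X t) t
          (fun s => Cr_subc (X t) oU (sX s)) (br _ Bt).
        exact: (@blin_cvg _ _ _ _ _ (nbhs t) _ _ _ (blin_comp (blinZ (r ^ m) blin_id) (coef_blin m)) gc).
      rewrite subrr scaler0; apply: (@cvg_near _ _ _ (nbhs t)).
      have h : \forall s \near t, ball t0 rho s by exact: open_near Bt.
      by apply: filterS h => s Bs; rewrite l1B !fE// -scalerBr.
  have : (f s - f t) + f t @[s --> t] --> (0 : W) + f t.
    exact: (@cvgD _ _ _ (nbhs t) _ (fun s => f s - f t) (fun=> f t) 0 (f t) dz (cvg_cst _)).
  rewrite add0r => h; suff : f @ nbhs t --> f t by [].
  apply: (@cvg_near _ _ _ (nbhs t) _ f _ _ _ h).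
  by apply: nearW => s; rewrite subrK.
pose df v t := f t * delta 1 (r *: bet X t v).
have dfE v t m : ball t0 rho t -> df v t m = r ^ m *: mulV (X t (m - 1)) (bet X t v).
  move=> Bt; have E1 : m - (m - 1) = 1 by lia.
  rewrite /df (@coef_single _ _ (f t) (delta 1 (r *: bet X t v)) m (m - 1)).
    rewrite E1 deltaE eqxx fE//; have [fl fr _] := @mulPV_bbil R q.
    rewrite (linZ (fl _)) (linZ (fr _)) scalerA; congr (_ *: _).
    by rewrite -{2}[r]expr1z -expfzDr ?gt_eqF// subrK.
  move=> a am; right; rewrite deltaE; case: eqP => // ma; move/eqP: am; case; lia.
have f_has v t : ball t0 rho t -> has_derive f t v (df v t).
  move=> Bt.
  have cc : {for t, continuous (fun=> 0 : R)} by exact: cst_continuous.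
  (* For a constant function this says that a short segment through t in direction v stays in the
     ball. *)
  have [d d0 hd] := @near_points _ _ (ball t0 rho) (fun=> 0) t v v 1 oB Bt cc ltr01.
  (* By the mean value inequality difference quotients obey the same bound as derivatives; the
     factor 2 in A accounts for their difference. *)
  pose G := gbound (K * M) (2 * K).
  pose A := 2 * `|v| * (K * M).
  have A0 : 0 <= A by rewrite !mulr_ge0.
  have r2K : 0 <= r * (2 * K) by rewrite !mulr_ge0// ltW.
  have [B2 hB2] := gbound_sum A0 r2K.
  have xE h m : ball t0 rho (h *: v + t) -> (h^-1 *: (f (h *: v + t) - f t) - df v t) m =
      r ^ m *: (h^-1 *: (X (h *: v + t) m - X t m) - mulV (X t (m - 1)) (bet X t v)).
    move=> Bh; rewrite l1B l1Z l1B dfE// !fE// -scalerBr [in RHS]scalerBr.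
    by congr (_ - _); rewrite !scalerA mulrC.
  have nB : \forall h \near (0 : R)^', ball t0 rho (h *: v + t) by exact: line_near.
  have dz : h^-1 *: (f (h *: v + t) - f t) - df v t @[h --> (0 : R)^'] --> (0 : W).
    apply: (@tannery _ _ _ ((0 : R)^')
      (fun h => h^-1 *: (f (h *: v + t) - f t) - df v t) (gbound A (r * (2 * K))) B2) => //.
    - by move=> m; exact: gbound_ge0.
    - near=> h; move=> m.
      have Bh : ball t0 rho (h *: v + t) by near: h.
      have h0 : h != 0 by near: h; exact: nbhs_dnbhs_neq.
      have hd' : `|h| <= d by near: h; exact: dnbhs0_le.
      rewrite xE// normrZ ger0_norm// -gbound_scale ?(ltW r0)// ler_wpM2l// /A -gboundZ.
      have Bs s : `|s| <= `|h| -> ball t0 rho (s *: v + t).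
        move=> sh; have := (hd 0 s _ (le_trans sh hd')).1; rewrite scale0r add0r; apply.
        by rewrite normr0 ltW.
      have h1 : `|X (h *: v + t) m - X t m| <= `|v| * G m * `|h|.
        apply: (@mvt_bound _ (fun t => X t m) (fun t => mulV (X t (m - 1)) (bet X t v)) v t).
        + exact: PV_weakly_normed.
        + by rewrite mulr_ge0// gbound_ge0// !mulr_ge0.
        + by move=> s sh; exact: (@homog_coef_has _ _ _ _ v m hX (br _ (Bs s sh))).
        + by move=> s sh; exact: (HB _ (Bs s sh)).2.
      have h2 := (HB t Bt).2 v m.
      have dbl (x y : R) : 2 * x * y = x * y + x * y by ring.
      rewrite (le_trans (ler_normB _ _))// dbl lerD//.
      by rewrite normrZ normfV ler_pdivrMl ?normr_gt0// mulrC.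
    - move=> m.
      have h := @cvg_scale_sub _ _ _ _ _ (r ^ m) (dnbhs_filter (0 : R)) (@homog_coef_has _ _ _ _ v m hX (br _ Bt)).
      apply: (@cvg_near _ _ _ ((0 : R)^') _ _ _ _ _ h).
      by apply: filterS nB => x Bx; rewrite xE.
  have : h^-1 *: (f (h *: v + t) - f t) - df v t + df v t @[h --> (0 : R)^'] --> 0 + df v t.
    by apply: cvgD => //; exact: cvg_cst.
  by rewrite add0r; apply: cvg_near; apply: nearW => h; rewrite subrK.
split=> //.
(* The derivative is the product of the map itself with a smooth loop, so each order of smoothness
   yields the next. *)
- elim=> [|s ih]; first by split.
  apply: (@Cr_intro _ _ s _ _ f df oB) => // v.
  apply: (Cr_bbil oB wmul_bil ih).
  apply: (Cr_blin oB (blin_comp (delta_blin 1) (blinZ r (coef_blin 1)))).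
  apply: (smooth_sub br) => //; apply: smooth_mul => //.
    exact: smooth_blin wtr_blin sX.
  exact: smooth_derive.
- by move=> t v Bt; have /has_deriveP[_ ->] := f_has v t Bt.
Unshelve. all: by end_near. Qed.

End Entire.

(** * Constant curvature families *)

Section MatrixMaps.
Context {R : realType}.

Lemma mx_norm_le p q (A : 'M[R]_(p, q)) (B : R) : 0 <= B ->
  (forall i j, `|A i j| <= B) -> `|A| <= B.
Proof.
move=> B0 h; rewrite [leLHS]/Num.Def.normr/= mx_normrE.
by apply: bigmax_le => // -[i j] _; exact: h.
Qed.

Lemma mx_lin_blin p q p' q' (L : 'M[R]_(p, q) -> 'M[R]_(p', q')) :
  linear L -> blin (L : ('M[R]_(p, q) : normedModType R) -> ('M[R]_(p', q') : normedModType R)).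
Proof.
move=> lL; split=> //; exists (\sum_(i < p) \sum_(j < q) `|L (delta_mx i j)|) => A.
rewrite {1}(matrix_sum_delta A) (lin_sum lL) (le_trans (ler_norm_sum _ _ _))// mulr_suml.
apply: ler_sum => i _; rewrite (lin_sum lL) (le_trans (ler_norm_sum _ _ _))// mulr_suml.
apply: ler_sum => j _; rewrite (linZ lL) normrZ mulrC ler_wpM2l//.
exact: mx_entry_le.
Qed.

Lemma col_blin p q (j : 'I_q) : blin (col j : 'M[R]_(p, q) -> 'cV[R]_p).
Proof. by apply: mx_lin_blin => a A B; apply/matrixP => i l; rewrite !mxE. Qed.

Lemma ulsubmx_blin p1 p2 q1 q2 : blin (ulsubmx : 'M[R]_(p1 + p2, q1 + q2) -> 'M[R]_(p1, q1)).
Proof. by apply: mx_lin_blin => a A B; apply/matrixP => i l; rewrite !mxE. Qed.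

Lemma drsubmx_blin p1 p2 q1 q2 : blin (drsubmx : 'M[R]_(p1 + p2, q1 + q2) -> 'M[R]_(p2, q2)).
Proof. by apply: mx_lin_blin => a A B; apply/matrixP => i l; rewrite !mxE. Qed.

Lemma fst_blin q : blin (fst : PV R q -> 'M[R]_q).
Proof.
split=> [a u v|]; first by [].
exists 1 => v; rewrite mul1r; apply: mx_norm_le => // i j.
exact: (pair_entry_le v i j).1.
Qed.

Lemma snd_blin q : blin (snd : PV R q -> 'M[R]_q).
Proof.
split=> [a u v|]; first by [].
exists 1 => v; rewrite mul1r; apply: mx_norm_le => // i j.
exact: (pair_entry_le v i j).2.
Qed.

End MatrixMaps.

(** * Reduction of the curvature conditions to the connection form *)

Section RealFrames.
Context {R : realType} {n k : nat}.
Local Notation N := (n + (1 + k))%N.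
Local Notation M := 'M[R]_N.
Local Notation E := 'rV[R]_n.
Implicit Types (X : E -> M) (mu : E -> E -> M) (U : set E) (s : Defs.space) (c : R).

Lemma col_trmx_mul p (A B : 'M[R]_p) i j :
  (col i A)^T *m B *m col j A = ((A^T *m B *m A) i j)%:M.
Proof.
apply/matrixP => a b; rewrite !ord1 [RHS]mxE eqxx mulr1n.
rewrite !colE trmx_mul trmx_delta -!mulmxA -rowE mxE !mulmxA -colE mxE.
by rewrite -!mulmxA.
Qed.

(** A vector without middle component is spacelike; hence the middle component of a column on the
    hyperboloid never vanishes and keeps its sign. *)
Lemma Jmx_mid0 (x : 'cV[R]_N) : x (mid n k) 0 = 0 -> Jmx R n k *m x = x.
Proof.
move=> x0; have b0 : usubmx (dsubmx x) = 0.
  by apply/matrixP => i j; rewrite !ord1 !mxE -[RHS]x0.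
rewrite -[x]vsubmxK -[dsubmx x]vsubmxK b0 /Jmx !mul_block_col.
by rewrite !(mul0mx, mulmx0, mul1mx, addr0, add0r).
Qed.

Lemma model_col s t0 r X : 0 < r -> smooth (ball t0 r) X ->
  (forall t, ball t0 r t -> SO s (X t)) -> X t0 = 1%:M ->
  forall t, ball t0 r t -> model s (col (mid n k) (X t)).
Proof.
move=> r0 sX SX X1 t Bt; case: s SX => SX /=.
  have [XX _] := SX t Bt; have := col_trmx_mul (X t) 1%:M (mid n k) (mid n k).
  by rewrite mulmx1 => ->; rewrite -[1%:M]/(Defs.form R n k Sphere) XX mxE eqxx.
have JE y : ball t0 r y -> (col (mid n k) (X y))^T *m Jmx R n k *m col (mid n k) (X y) = (-1)%:M.
  move=> By; have [XX _] := SX y By.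
  rewrite col_trmx_mul -[Jmx R n k in LHS]/(Defs.form R n k Hyperbolic) XX/=.
  congr (_%:M); rewrite /Jmx /mid block_mxEdr.
  by rewrite block_mxEul mxE eqxx.
split; first exact: JE.
apply: (@ball_pos _ _ (fun y => col (mid n k) (X y) (mid n k) 0) t0 r r0) => //.
- move=> y By.
  have := smooth_cont sX By => cX.
  apply/(@cvgrPdist_le _ _ _ (nbhs y) _) => e e0.
  have /(@cvgrPdist_le _ _ _ (nbhs y) _)/(_ _ e0) := cX.
  apply: filterS => x; apply: le_trans.
  by have := mx_entry_le (X y - X x) (mid n k) (mid n k); rewrite !mxE.
- move=> y By; apply/negP => /eqP x0; have := JE y By.
  rewrite -mulmxA Jmx_mid0//; move/matrixP/(_ 0 0).
  rewrite [RHS]mxE eqxx mulr1n mxE => E1.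
  suff : 0 <= -1 :> R by rewrite oppr_ge0 ler10.
  by rewrite -E1 sumr_ge0// => i _; rewrite [X in X * _]mxE -expr2 sqr_ge0.
- by rewrite X1 !mxE eqxx.
Qed.

(** [mu] is an expression for the Maurer-Cartan form that is known to be smooth, so that [invmx] is
    never differentiated. The vanishing first column of its lower right block is adaptedness,
    because the (n+1)'st column of the form represents df. *)
Lemma const_curvature_frame s c t0 r X mu : 0 < r -> smooth (ball t0 r) X ->
  (forall t, ball t0 r t -> SO s (X t)) -> X t0 = 1%:M ->
  (forall v, smooth (ball t0 r) (mu^~ v)) ->
  (forall t v, ball t0 r t -> maurer_cartan X t v = mu t v) ->
  (forall t v, ball t0 r t -> lsubmx (drsubmx (mu t v)) = 0) ->
  (forall t u v, ball t0 r t ->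
     ulsubmx ('D_u (mu^~ v) t - 'D_v (mu^~ u) t) +
     (ulsubmx (mu t u) *m ulsubmx (mu t v) - ulsubmx (mu t v) *m ulsubmx (mu t u)) =
     c *: (lsubmx (ursubmx (mu t u)) *m (lsubmx (ursubmx (mu t v)))^T -
           lsubmx (ursubmx (mu t v)) *m (lsubmx (ursubmx (mu t u)))^T)) ->
  (forall t u v, ball t0 r t ->
     drsubmx ('D_u (mu^~ v) t - 'D_v (mu^~ u) t) +
     (drsubmx (mu t u) *m drsubmx (mu t v) - drsubmx (mu t v) *m drsubmx (mu t u)) = 0) ->
  const_curvature s c (ball t0 r) (fun t => col (mid n k) (X t)) /\
  col (mid n k) (X t0) = base_point R n k.
Proof.
move=> r0 sX SX X1 smu MC eta0 Ho He; have oB : open (ball t0 r) by exact: ball_open.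
split; last by rewrite X1 col1.
have Dsub p q (L : M -> 'M[R]_(p, q)) t u v : blin L -> ball t0 r t ->
    'D_u (fun x => L (maurer_cartan X x v)) t = L ('D_u (mu^~ v) t).
  move=> bL Bt; rewrite -(derive_lin u bL (smu v) Bt).
  by apply: (derive_eqU u oB Bt) => x Bx; rewrite MC.
split; first exact: model_col.
exists X; split.
- split=> // t v Bt.
  rewrite (derive_lin v (col_blin _ (mid n k)) sX Bt).
  have -> : invmx (X t) *m col (mid n k) ('D_v X t) = col (mid n k) (mu t v).
    by rewrite -MC// /maurer_cartan !colE mulmxA.
  have /matrixP h := eta0 t v Bt; apply/matrixP => i j; have := h i 0.
  by rewrite !mxE.
- move=> t u v Bt; rewrite /ext_d /omega /wedge.
  have D1 := Dsub _ _ _ t u v (ulsubmx_blin _ _ _ _) Bt.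
  have D2 := Dsub _ _ _ t v u (ulsubmx_blin _ _ _ _) Bt.
  have th w : theta X t w = lsubmx (ursubmx (mu t w)) by rewrite /theta /beta_hat MC.
  have B := linB (@ulsubmx_blin R n (1 + k) n (1 + k)).1 ('D_u (mu^~ v) t) ('D_v (mu^~ u) t).
  rewrite !th; apply: etrans (Ho t u v Bt); rewrite (etrans B (congr2 _ (esym D1) (congr1 _ (esym D2)))).
  congr (_ + _); by rewrite (MC t u Bt) (MC t v Bt).
- move=> t u v Bt; rewrite /ext_d /eta /wedge.
  have D1 := Dsub _ _ _ t u v (drsubmx_blin _ _ _ _) Bt.
  have D2 := Dsub _ _ _ t v u (drsubmx_blin _ _ _ _) Bt.
  have B := linB (@drsubmx_blin R n (1 + k) n (1 + k)).1 ('D_u (mu^~ v) t) ('D_v (mu^~ u) t).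
  apply: etrans (He t u v Bt); rewrite (etrans B (congr2 _ (esym D1) (congr1 _ (esym D2)))).
  congr (_ + _); by rewrite (MC t u Bt) (MC t v Bt).
Qed.

End RealFrames.

(** * The Maurer-Cartan equation and real values of loops *)

Section MaurerCartan.
Context {R : realType} {n q : nat}.
Local Notation V := (PV R q).
Local Notation W := (l1 V).
Local Notation C := (cplx R).
Local Notation E := 'rV[R]_n.
Implicit Types (U : set E).

(** Product rule, derivative of an inverse and symmetry of second derivatives. The inverse [Yi] is a
    parameter because it is a transpose in the orthogonal case and a conjugate of a transpose in the
    hyperbolic one. *)
Lemma maurer_cartan_eq U (Y Yi : E -> W) t u v : open U -> smooth U Y -> smooth U Yi ->
  (forall t, U t -> Yi t * Y t = 1) -> U t ->
  'D_u (fun x => Yi x * 'D_v Y x) t - 'D_v (fun x => Yi x * 'D_u Y x) t =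
  Yi t * 'D_v Y t * (Yi t * 'D_u Y t) - Yi t * 'D_u Y t * (Yi t * 'D_v Y t).
Proof.
move=> oU sY sYi YY Ut; have YY' := wmul1C (YY t Ut).
have dYi a : 'D_a Yi t = - (Yi t * 'D_a Y t * Yi t).
  have h : 'D_a Yi t * Y t + Yi t * 'D_a Y t = 0.
    rewrite -(derive_mul a sYi sY Ut) (derive_eqU a oU Ut YY).
    by have /has_deriveP[_ ->] := has_derive_cst (1 : W) t a.
  have h2 : 'D_a Yi t * Y t = - (Yi t * 'D_a Y t).
    by apply/eqP; rewrite -addr_eq0; apply/eqP.
  by rewrite -mulNr -h2 -mulrA YY' mulr1.
have D a b : 'D_a (fun x => Yi x * 'D_b Y x) t =
    - (Yi t * 'D_a Y t * (Yi t * 'D_b Y t)) + Yi t * 'D_a (fun x => 'D_b Y x) t.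
  rewrite (derive_mul a sYi (smooth_derive b sY) Ut) dYi mulNr.
  by rewrite -(mulrA (Yi t * 'D_a Y t)).
have gen (x1 x2 y y' : W) : y = y' -> - x1 + Yi t * y - (- x2 + Yi t * y') = x2 - x1.
  by move=> ->; rewrite opprD opprK addrACA subrr addr0 addrC.
apply: etrans (congr2 (fun x y => x - y) (D u v) (D v u)) _.
exact: gen (schwarz u v (@l1_separated R q) oU (sY 2%N) Ut).
Qed.

(** The value at w whenever that value is real, which is the condition [(ev1 w X).2 = 0] in the
    lemmas below. *)
Definition RF (w : C) (X : W) : 'M[R]_q := (ev1 w X).1.

Lemma RF_blin w : `|w| = 1 -> blin (RF w : W -> 'M[R]_q).
Proof. by move=> w1; exact: (blin_comp (fst_blin q) (ev1_blin w1)). Qed.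

Lemma ev_snd_blin w : `|w| = 1 -> blin ((fun X => (ev1 w X).2) : W -> 'M[R]_q).
Proof. by move=> w1; exact: (blin_comp (snd_blin q) (ev1_blin w1)). Qed.

Lemma RF_real w X : (ev1 w X).2 = 0 -> map_mx (real_complex R) (RF w X) = evM w X.
Proof. by move=> X0; apply/matrixP => i j; rewrite !mxE X0 mxE. Qed.

Lemma RF_mul w X Y : `|w| = 1 -> (ev1 w Y).2 = 0 -> RF w (X * Y) = RF w X *m RF w Y.
Proof. by move=> w1 Y0; rewrite /RF wmulrE ev1_mul// mulVE Y0 mulmx0 subr0. Qed.

Lemma snd_mul w X Y : `|w| = 1 -> (ev1 w Y).2 = 0 ->
  (ev1 w (X * Y)).2 = (ev1 w X).2 *m RF w Y.
Proof. by move=> w1 Y0; rewrite /RF wmulrE ev1_mul// mulVE Y0/= mulmx0 add0r. Qed.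

Lemma RF_commutator w (X Y A B : W) : `|w| = 1 -> (ev1 w X).2 = 0 -> (ev1 w Y).2 = 0 ->
  X - Y = A * B - B * A -> map_mx (real_complex R) (RF w X - RF w Y) =
  evM w A *m evM w B - evM w B *m evM w A.
Proof.
move=> w1 X0 Y0 E0; rewrite map_mxB (RF_real X0) (RF_real Y0) -!(evMM _ _ w1).
by rewrite -(evMN (B * A) w1) -(evMD _ (- (B * A)) w1) -E0 (evMD _ (- Y) w1) (evMN Y w1).
Qed.

Lemma toM_real (v : V) : map_mx (@conjc R) (toM v) = toM v -> v.2 = 0.
Proof.
move=> /matrixP h; apply/matrixP => i j; have := h i j; rewrite !mxE => -[].
by move=> /eqP; rewrite eq_sym -addr_eq0 -mulr2n mulrn_eq0/= => /eqP.
Qed.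

End MaurerCartan.

(** * Block matrix algebra behind flatness and constant curvature *)

Section BlockProducts.
Context {F : comNzRingType} {p q : nat}.
Implicit Types (A B : 'M[F]_(p + q)).

Lemma ulsubmx_mul A B : ulsubmx (A *m B) = ulsubmx A *m ulsubmx B + ursubmx A *m dlsubmx B.
Proof. by rewrite -{1}[A]submxK -{1}[B]submxK mulmx_block block_mxKul. Qed.

Lemma drsubmx_mul A B : drsubmx (A *m B) = dlsubmx A *m ursubmx B + drsubmx A *m drsubmx B.
Proof. by rewrite -{1}[A]submxK -{1}[B]submxK mulmx_block block_mxKdr. Qed.

Lemma ulsubmxB A B : ulsubmx (A - B) = ulsubmx A - ulsubmx B.
Proof. by apply/matrixP => i j; rewrite !mxE. Qed.

Lemma drsubmxB A B : drsubmx (A - B) = drsubmx A - drsubmx B.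
Proof. by apply/matrixP => i j; rewrite !mxE. Qed.

Lemma cross_terms (Z : zmodType) (a b x y : Z) :
  b + y - (a + x) + (a - b) = - (x - y).
Proof.
by rewrite addrC addrA subrKA [a + y]addrC addrKA opprB.
Qed.

End BlockProducts.

Section CommutingBlocks.
Context {F : fieldType} {n k : nat}.
Local Notation N := (n + (1 + k))%N.
Local Notation P := (Pmx F n k).
Local Notation Q := (Qmx F n k).
Implicit Types (A B : 'M[F]_N) (b : 'M[F]_(n, 1 + k)) (z : F).
Hypothesis two : 2%:R != 0 :> F.

Lemma opp_fixed0 p q (X : 'M[F]_(p, q)) : - X = X -> X = 0.
Proof.
move=> /eqP; rewrite eq_sym -addr_eq0 -mulr2n -scaler_nat scaler_eq0 (negbTE two)/=.
by move/eqP.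
Qed.

Lemma Pmx_conj A : P *m A *m P =
  block_mx (ulsubmx A) (- ursubmx A) (- dlsubmx A) (drsubmx A).
Proof.
rewrite -{1}[A]submxK /Pmx !mulmx_block !(mul0mx, mulmx0, addr0, add0r, mul1mx, mulmx1).
by rewrite !mul_scalar_mx !mul_mx_scalar !scaleN1r opprK.
Qed.

Lemma P_odd A : P *m A *m P = - A -> ulsubmx A = 0 /\ drsubmx A = 0.
Proof.
rewrite Pmx_conj => h; split; apply: opp_fixed0.
  have := congr1 ulsubmx h; rewrite block_mxKul => e.
  by rewrite [RHS]e; apply/matrixP => i j; rewrite !mxE.
have := congr1 drsubmx h; rewrite block_mxKdr => e.
by rewrite [RHS]e; apply/matrixP => i j; rewrite !mxE.
Qed.

Lemma P_even A : P *m A *m P = A -> ursubmx A = 0 /\ dlsubmx A = 0.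
Proof.
rewrite Pmx_conj => h; split; apply: opp_fixed0.
  by have := congr1 ursubmx h; rewrite block_mxKur.
by have := congr1 dlsubmx h; rewrite block_mxKdl.
Qed.

(** For off-diagonal matrices the diagonal blocks of A B = B A are exactly the two equations. *)
Lemma flat_blocks A B : ulsubmx A = 0 -> drsubmx A = 0 -> ulsubmx B = 0 -> drsubmx B = 0 ->
  A *m B = B *m A ->
  [/\ lsubmx (drsubmx A) = 0, ursubmx A *m dlsubmx B - ursubmx B *m dlsubmx A = 0 &
      dlsubmx A *m ursubmx B - dlsubmx B *m ursubmx A = 0].
Proof.
move=> A1 A2 B1 B2 AB; split.
- by rewrite A2; apply/matrixP => i j; rewrite !mxE.
- have := congr1 ulsubmx AB; rewrite !ulsubmx_mul A1 B1 !mul0mx !add0r => ->.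
  by rewrite subrr.
- have := congr1 drsubmx AB; rewrite !drsubmx_mul A2 B2 !mul0mx !addr0 => ->.
  by rewrite subrr.
Qed.

Definition Qb : 'M[F]_(1 + k) := block_mx 1%:M 0 0 (-1)%:M.

Lemma Qmx_conj A : Q *m A *m Q =
  block_mx (ulsubmx A) (ursubmx A *m Qb) (Qb *m dlsubmx A) (Qb *m drsubmx A *m Qb).
Proof.
rewrite -{1}[A]submxK /Qmx -/Qb.
by rewrite !mulmx_block !(mul0mx, mulmx0, addr0, add0r, mul1mx, mulmx1).
Qed.

(** The matrix is diagonal with entries z + z^-1 and z - z^-1, whose squares differ by 4. *)
Lemma Qb_sq z : z != 0 ->
  (z%:M + z^-1 *: Qb) *m (z%:M + z^-1 *: Qb) =
  ((z - z^-1) ^+ 2)%:M + 4%:R *: block_mx 1%:M 0 0 0.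
Proof.
move=> z0; have sD (x y : F) p : (x%:M : 'M[F]_p) + y%:M = (x + y)%:M.
  by apply/matrixP => i j; rewrite !mxE mulrnDl.
have -> : z%:M + z^-1 *: Qb = block_mx (z + z^-1)%:M 0 0 (z - z^-1)%:M.
  rewrite (scalar_mx_block 1 k z) /Qb scale_block_mx add_block_mx !scaler0 !addr0.
  by rewrite !scale_scalar_mx mulr1 mulrN1 !sD.
rewrite block_diag_mul -!scalar_mxM (scalar_mx_block 1 k ((z - z^-1) ^+ 2)).
rewrite scale_block_mx add_block_mx !scaler0 !addr0 scale_scalar_mx mulr1 sD.
by congr block_mx; congr (_%:M); field.
Qed.

(* With [b] the upper right block of the coefficient of [z], that of the
   connection form is [b *m (z%:M + z^-1 *: Qb)], and
   [(z + z^-1) ^+ 2 - (z - z^-1) ^+ 2 = 4]. *)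
Lemma curved_blocks (b b' : 'M[F]_(n, 1 + k)) z (c : F) : z != 0 -> c * (z + z^-1) ^+ 2 = 4%:R ->
  b *m b'^T = b' *m b^T -> b^T *m b' = b'^T *m b ->
  let D := z%:M + z^-1 *: Qb in
  (b *m D) *m - (b' *m D)^T - (b' *m D) *m - (b *m D)^T =
     - (c *: (lsubmx (b *m D) *m (lsubmx (b' *m D))^T - lsubmx (b' *m D) *m (lsubmx (b *m D))^T)) /\
  - (b *m D)^T *m (b' *m D) - (- (b' *m D)^T *m (b *m D)) = 0.
Proof.
move=> z0 cz h1 h2 D.
have DT : D^T = D.
  by rewrite /D linearD linearZ /= tr_scalar_mx /Qb !(tr_block_mx, trmx0, tr_scalar_mx).
split; last first.
  by rewrite !trmx_mul DT !mulNmx opprK -!mulmxA (mulmxA b^T) h2 (mulmxA b'^T) addNr.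
have ls (x : 'M[F]_(n, 1 + k)) : lsubmx (x *m D) = (z + z^-1) *: lsubmx x.
  rewrite -{1}[x]hsubmxK /D (scalar_mx_block 1 k z) /Qb scale_block_mx add_block_mx.
  rewrite !scaler0 !addr0 mul_row_block !mulmx0 addr0 add0r row_mxKl.
  by rewrite mulmxDr mul_mx_scalar -scalemxAr mulmx1 -scalerDl.
have ee (x y : 'M[F]_(n, 1 + k)) :
    x *m block_mx 1%:M 0 0 0 *m y^T = lsubmx x *m (lsubmx y)^T.
  rewrite -{1}[x]hsubmxK -{1}[y]hsubmxK mul_row_block !mulmx0 mulmx1 !addr0.
  by rewrite tr_row_mx mul_row_col mul0mx addr0.
have key (x y : 'M[F]_(n, 1 + k)) : (x *m D) *m - (y *m D)^T =
    - ((z - z^-1) ^+ 2 *: (x *m y^T) + 4%:R *: (lsubmx x *m (lsubmx y)^T)).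
  rewrite mulmxN trmx_mul DT -mulmxA (mulmxA D) Qb_sq// mulmxDl mulmxDr.
  by rewrite mul_scalar_mx -scalemxAr -scalemxAl -scalemxAr mulmxA ee.
rewrite !key !ls h1; set y := _ *: (b' *m b^T).
have sc (u v : 'cV[F]_n) : (z + z^-1) *: u *m ((z + z^-1) *: v)^T = (z + z^-1) ^+ 2 *: (u *m v^T).
  by rewrite linearZ /= -scalemxAl -scalemxAr scalerA expr2.
rewrite !sc -scalerBr scalerA cz scalerBr.
by rewrite opprK [- (y + _)]opprD addrC addrACA subrr add0r opprB addrC.
Qed.

End CommutingBlocks.

Section RealCurvature.
Context {R : realType} {n k : nat}.
Local Notation M := 'M[R]_(n + (1 + k)).
Local Notation "A ^C" := (map_mx (real_complex R) A).

Lemma map_real_inj p q (A B : 'M[R]_(p, q)) : A^C = B^C -> A = B.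
Proof. by move/matrixP => h; apply/matrixP => i l; have := h i l; rewrite !mxE => -[]. Qed.

(** D stands for the exterior derivative of the form. In the upper left block of the commutator the
    products of diagonal blocks cancel against the wedge, and the products of off-diagonal blocks
    remain. The hypotheses are complex because the values of loops are. *)
Lemma real_curvature_ul (c : R) (D A B : M) (A' B' : 'M[cplx R]_(n + (1 + k))) :
  A^C = A' -> B^C = B' -> D^C = B' *m A' - A' *m B' ->
  ursubmx A' *m dlsubmx B' - ursubmx B' *m dlsubmx A' =
    - (c%:C *: (lsubmx (ursubmx A') *m (lsubmx (ursubmx B'))^T -
                lsubmx (ursubmx B') *m (lsubmx (ursubmx A'))^T)) ->
  ulsubmx D + (ulsubmx A *m ulsubmx B - ulsubmx B *m ulsubmx A) =
    c *: (lsubmx (ursubmx A) *m (lsubmx (ursubmx B))^T -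
          lsubmx (ursubmx B) *m (lsubmx (ursubmx A))^T).
Proof.
move=> <- <- DE h; apply: map_real_inj.
rewrite map_mxD map_ulsubmx DE map_mxZ !map_mxB !map_mxM.
rewrite -!map_trmx !map_ulsubmx !map_lsubmx !map_ursubmx.
by rewrite -[RHS]opprK -h ulsubmxB !ulsubmx_mul cross_terms.
Qed.

Lemma real_curvature_dr (D A B : M) (A' B' : 'M[cplx R]_(n + (1 + k))) :
  A^C = A' -> B^C = B' -> D^C = B' *m A' - A' *m B' ->
  dlsubmx A' *m ursubmx B' - dlsubmx B' *m ursubmx A' = 0 ->
  drsubmx D + (drsubmx A *m drsubmx B - drsubmx B *m drsubmx A) = 0.
Proof.
move=> <- <- DE h; apply: map_real_inj.
rewrite map_mxD map_drsubmx DE map_mx0 !map_mxB !map_mxM !map_drsubmx.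
rewrite -[RHS]oppr0 -h drsubmxB !drsubmx_mul.
by rewrite [X in X - _ + _]addrC [X in _ - X + _]addrC cross_terms.
Qed.

End RealCurvature.

(** * The map given by a loop-valued frame at a fixed parameter *)

Section LoopFamilies.
Context {R : realType} {n k : nat}.
Local Notation N := (n + (1 + k))%N.
Local Notation V := (PV R N).
Local Notation W := (l1 V).
Local Notation C := (cplx R).
Local Notation E := 'rV[R]_n.
Implicit Types (X Y Yi F : E -> W) (U : set E) (s : Defs.space) (j : reality) (z w : C).

Lemma form_real s : map_mx (real_complex R) (Defs.form R n k s) = Defs.form C n k s.
Proof.
case: s; rewrite /Defs.form ?map_mx1// /Jmx.
by rewrite !(map_block_mx, map_mx0, map_scalar_mx); rewrite rmorph1 rmorphN1.
Qed.

Lemma form_square (F : comNzRingType) s : Defs.form F n k s *m Defs.form F n k s = 1%:M.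
Proof. by case: s; [exact: mulmx1|exact: JmxK]. Qed.

(** The form identity gives a determinant of square 1; its sign is the one at t0. *)
Lemma SO_ball s t0 r w Y : 0 < r -> `|w| = 1 -> smooth (ball t0 r) Y -> Y t0 = 1 ->
  (forall t, ball t0 r t ->
     wtr (Y t) * wcst (Defs.form C n k s) * Y t = wcst (Defs.form C n k s)) ->
  forall t, ball t0 r t -> SO s (evM w (Y t)).
Proof.
move=> r0 w1 sY Y1 YF t Bt.
have YE x : ball t0 r x -> (evM w (Y x))^T *m Defs.form C n k s *m evM w (Y x) =
    Defs.form C n k s.
  move=> Bx; have := congr1 (evM w) (YF x Bx).
  by rewrite (evMM _ _ w1) (evMM _ _ w1) (evM_tr _ w1) !evM_cst.
split; first exact: YE.
apply: (@det_ball _ _ _ t0 r (fun t => ev1 w (Y t)) r0) => //.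
- by move=> x Bx; exact: (blin_cvg _ (ev1_blin w1) (smooth_cont sY Bx)).
- move=> x Bx; have := congr1 determinant (YE x Bx); rewrite !det_mulmx det_tr => h.
  have f0 : \det (Defs.form C n k s) != 0.
    apply/eqP => f0; have := congr1 determinant (form_square C s).
    by rewrite det_mulmx f0 mul0r det1 => /eqP; rewrite eq_sym oner_eq0.
  apply: (mulIf f0); rewrite mul1r -[RHS]h -/(evM w (Y x)) expr2.
  by rewrite mulrAC.
- by rewrite Y1; exact: evM1.
Qed.

(** The analysis common to the flat and the curved case: what remains afterwards is algebra with the
    values at w of the connection form. *)
Lemma family_curvature s (c : R) t0 r w Y Yi : 0 < r -> `|w| = 1 ->
  smooth (ball t0 r) Y -> smooth (ball t0 r) Yi ->
  (forall t, ball t0 r t -> Yi t * Y t = 1) -> Y t0 = 1 ->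
  (forall t, ball t0 r t -> (ev1 w (Y t)).2 = 0) ->
  (forall t, ball t0 r t ->
     wtr (Y t) * wcst (Defs.form C n k s) * Y t = wcst (Defs.form C n k s)) ->
  (forall t u v, ball t0 r t ->
    let A := evM w (Yi t * 'D_u Y t) in let B := evM w (Yi t * 'D_v Y t) in
    [/\ lsubmx (drsubmx A) = 0,
        ursubmx A *m dlsubmx B - ursubmx B *m dlsubmx A =
          - (c%:C *: (lsubmx (ursubmx A) *m (lsubmx (ursubmx B))^T -
              lsubmx (ursubmx B) *m (lsubmx (ursubmx A))^T)) &
        dlsubmx A *m ursubmx B - dlsubmx B *m ursubmx A = 0]) ->
  const_curvature s c (ball t0 r) (fun t => col (mid n k) (RF w (Y t))) /\
  col (mid n k) (RF w (Y t0)) = base_point R n k.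
Proof.
move=> r0 w1 sY sYi YY Y1 Y2 YF HA.
have oB : open (ball t0 r) by exact: ball_open.
have toC := @map_real_inj R N N.
have YR t : ball t0 r t -> map_mx (real_complex R) (RF w (Y t)) = evM w (Y t).
  by move=> Bt; apply: RF_real; exact: Y2.
have X1 : RF w (Y t0) = 1%:M.
  by apply: toC; rewrite YR ?map_mx1 ?Y1 ?evM1//; exact: ballxx.
have sX : smooth (ball t0 r) (fun t => RF w (Y t)) by exact: smooth_blin (RF_blin w1) sY.
have DX v t : ball t0 r t -> 'D_v (fun t => RF w (Y t)) t = RF w ('D_v Y t).
  by move=> Bt; exact: derive_lin (RF_blin w1) sY Bt.
have DY2 v t : ball t0 r t -> (ev1 w ('D_v Y t)).2 = 0.
  move=> Bt; apply: (derive_blin_cst v oB (ev_snd_blin w1) sY Bt) => x Bx.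
  by rewrite !Y2.
have Yi1 t : ball t0 r t -> RF w (Yi t) *m RF w (Y t) = 1%:M /\ (ev1 w (Yi t)).2 = 0.
  move=> Bt; have e1 : (ev1 w (1 : W)).2 = 0.
    by apply: toM_real; rewrite -[toM _]/(evM w 1) evM1 map_mx1.
  have E1 : RF w (Yi t) *m RF w (Y t) = 1%:M.
    by rewrite -RF_mul// ?Y2// YY//; apply: toC; rewrite RF_real// evM1 map_mx1.
  split=> //; have := snd_mul (Yi t) w1 (Y2 t Bt); rewrite YY// e1 => h.
  by rewrite -[LHS]mulmx1 -(mulmx1C E1) mulmxA -h mul0mx.
pose a t v := Yi t * 'D_v Y t.
have a2 t v : ball t0 r t -> (ev1 w (a t v)).2 = 0.
  by move=> Bt; rewrite snd_mul ?DY2//; have [_ ->] := Yi1 t Bt; rewrite mul0mx.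
have aR t v : ball t0 r t -> map_mx (real_complex R) (RF w (a t v)) = evM w (a t v).
  by move=> Bt; apply: RF_real; exact: a2.
have sa v : smooth (ball t0 r) (a^~ v) by apply: smooth_mul => //; exact: smooth_derive.
have DaE t u v : ball t0 r t -> map_mx (real_complex R)
    ('D_u (fun t => RF w (a t v)) t - 'D_v (fun t => RF w (a t u)) t) =
    evM w (a t v) *m evM w (a t u) - evM w (a t u) *m evM w (a t v).
  move=> Bt; have e1 := derive_lin u (RF_blin w1) (sa v) Bt.
  have e2 := derive_lin v (RF_blin w1) (sa u) Bt.
  have s1 : (ev1 w ('D_u (a^~ v) t)).2 = 0.
    by apply: (derive_blin_cst u oB (ev_snd_blin w1) (sa v) Bt) => x Bx; rewrite !a2.
  have s2 : (ev1 w ('D_v (a^~ u) t)).2 = 0.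
    by apply: (derive_blin_cst v oB (ev_snd_blin w1) (sa u) Bt) => x Bx; rewrite !a2.
  have MCE := maurer_cartan_eq u v oB sY sYi YY Bt.
  apply: etrans (congr2 (fun x y => map_mx (real_complex R) (x - y)) e1 e2) _.
  exact: RF_commutator w1 s1 s2 MCE.
apply: (@const_curvature_frame _ _ _ s c t0 r (fun t => RF w (Y t)) (fun t v => RF w (a t v))) => //.
- move=> t Bt; have [h1 h2] := SO_ball r0 w1 sY Y1 YF Bt; split.
    by apply: toC; rewrite !map_mxM -map_trmx form_real YR.
  by have := h2; rewrite -YR// det_map_mx => -[].
- by move=> v; exact: smooth_blin (RF_blin w1) (sa v).
- move=> t v Bt; rewrite /maurer_cartan DX// (invmx_eq (Yi1 t Bt).1).
  by rewrite -RF_mul// DY2.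
- move=> t v Bt; have [h _ _] := HA t v v Bt.
  move/matrixP: h => h; apply/matrixP => i l; have := h i l.
  by rewrite -[Yi t * _]/(a t v) -aR// !mxE => -[].
- move=> t u v Bt; have [_ h _] := HA t u v Bt.
  exact: (real_curvature_ul (aR t u Bt) (aR t v Bt) (DaE t u v Bt) h).
- move=> t u v Bt; have [_ _ h] := HA t u v Bt.
  exact: (real_curvature_dr (aR t u Bt) (aR t v Bt) (DaE t u v Bt) h).
Qed.

End LoopFamilies.

(** * Polar coordinates of the parameter and the real locus *)

Section Polar.
Context {R : realType}.
Local Notation C := (cplx R).
Implicit Types (z w : C) (j : reality).

(** The value of a loop at z is the value at [zarg z], on the circle, of the loop rescaled by
    [zrad z]. *)
Definition zrad z : R := complex.Re (`|z| : C).
Definition zarg z : C := z / (zrad z)%:C.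

Lemma radE z : `|z| = (zrad z)%:C.
Proof. by rewrite /zrad RRe_real// normr_real. Qed.

Lemma rad_gt0 z : z != 0 -> 0 < zrad z.
Proof. by move=> z0; have : 0 < `|z| by [rewrite normr_gt0]; rewrite radE ltcR. Qed.

Lemma arg_norm z : z != 0 -> `|zarg z| = 1.
Proof.
move=> z0; have r0 := rad_gt0 z0; rewrite normf_div radE normc_def /=.
rewrite expr0n/= addr0 sqrtr_sqr gtr0_norm// divff//.
by rewrite -[0]/(0%:C) (inj_eq (@complexI R)) gt_eqF.
Qed.

Lemma radC_neq0 z : z != 0 -> (zrad z)%:C != 0 :> C.
Proof. by move=> z0; rewrite -radE normr_eq0. Qed.

Lemma arg_rad z : z != 0 -> zarg z * (zrad z)%:C = z.
Proof. by move=> z0; rewrite divfK// radC_neq0. Qed.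

Lemma conj_real (r : R) : conjc (r%:C) = r%:C :> C.
Proof. by rewrite /= oppr0. Qed.

Lemma locus_neq0 j z : real_locus j z -> z != 0.
Proof.
case: j => /= [[_ ]|[_ ]|z1] //.
by rewrite -normr_eq0 z1 oner_eq0.
Qed.

(** Fixed points of the antiholomorphic map in the reality condition; there invariance under
    [wrho j] says that the value is a real matrix. *)
Definition fixed_at j z := match j with
  | R1 => - conjc z = z | R2 => conjc z = z | Rm1 => (conjc z)^-1 = z end.

Lemma locus_fixed j z : real_locus j z -> fixed_at j z.
Proof.
case: j => /=.
- by case: z => x y /= [-> _]; rewrite /= -[LHS]/((- 0) +i* (- - y)) oppr0 opprK.
- by case: z => x y /= [-> _]; rewrite oppr0.
- by move=> z1; rewrite conj_unit// invrK.
Qed.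

Lemma arg_fixed j z : real_locus j z -> fixed_at j (zarg z).
Proof.
move=> zj; have := locus_fixed zj; have z0 := locus_neq0 zj.
have E : conjc (zarg z) = conjc z / (zrad z)%:C.
  rewrite /zarg rmorphM fmorphV; congr (_ * _^-1); exact: conj_real.
case: j zj => /= zj; rewrite ?E.
- by rewrite -mulNr => ->.
- by move=> ->.
- move=> _; have : zrad z = 1 by rewrite /zrad zj.
  by move=> r1; rewrite /zarg r1 !divr1 conj_unit// invrK.
Qed.

Lemma conj_fixed_real z : conjc z = z -> (complex.Re z)%:C = z.
Proof.
case: z => x y [/eqP]; rewrite eq_sym -addr_eq0 -mulr2n mulrn_eq0/= => /eqP ->//.
Qed.

(** On the real locus (z + z^-1)^2 is real, so taking the real part in [curvature] loses nothing. It
    is nonzero, since otherwise the curvature would be 0, which lies in no range. *)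
Lemma curvature_fixed j z : real_locus j z -> curvature_range j (curvature z) ->
  (curvature z)%:C * (z + z^-1) ^+ 2 = 4%:R.
Proof.
move=> zj cj; have z0 := locus_neq0 zj; have fz := locus_fixed zj.
have c0 : curvature z != 0.
  apply/eqP => c0; move: cj; rewrite c0; case: (j) => /=; rewrite ?ltxx//.
  by rewrite ltNge ler01.
have y0 : z + z^-1 != 0.
  apply: contraNneq c0 => y0; by rewrite /curvature y0 expr2 mul0r invr0 mulr0.
have cE : conjc ((z + z^-1) ^+ 2) = (z + z^-1) ^+ 2.
  rewrite rmorphXn rmorphD fmorphV; case: j zj cj fz => /= _ _.
  - move=> /eqP; rewrite eqr_oppLR => /eqP ->.
    by rewrite invrN -opprD sqrrN.
  - by move=> ->.
  - by move=> /(congr1 GRing.inv); rewrite invrK => ->; rewrite invrK addrC.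
rewrite /curvature conj_fixed_real ?divfK ?expf_neq0//.
by rewrite rmorphM fmorphV; congr (_ * _^-1); [exact: rmorph_nat|exact: cE].
Qed.

End Polar.

Section ScaledSymmetries.
Context {R : realType} {n k : nat}.
Local Notation N := (n + (1 + k))%N.
Local Notation V := (PV R N).
Local Notation W := (l1 V).
Local Notation C := (cplx R).
Implicit Types (X Y : W) (z w : C) (j : reality) (r : R) (T Ti A : 'M[C]_N).

Lemma scl_wad r A B X : r != 0 -> sclok r X ->
  sclok r (wad A B X) /\ scl r (wad A B X) = wad A B (scl r X).
Proof.
move=> r0 X0; have [a1 a2] := @scl_cst R N r A; have [b1 b2] := @scl_cst R N r B.
have [p1 p2] := sclM r0 a1 X0; have [s1 s2] := sclM r0 p1 b1.
by split=> //; rewrite s2 p2 a2 b2.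
Qed.

Lemma wadM A B X Y : B *m A = 1%:M -> wad A B X * wad A B Y = wad A B (X * Y).
Proof.
move=> BA; apply: evM_inj => z z1; rewrite (evMM _ _ z1) !(evM_ad _ _ _ z1) (evMM _ _ z1).
by rewrite !mulmxA -(mulmxA _ B A) BA mulmx1.
Qed.

Lemma wad1 A B : A *m B = 1%:M -> wad A B 1 = 1 :> W.
Proof.
by move=> AB; apply: evM_inj => z z1; rewrite (evM_ad _ _ _ z1) !evM1 mulmx1.
Qed.

Lemma wrho_scl j r X : j <> Rm1 -> sclok r X -> wrho j X = X ->
  wrho j (scl r X) = scl r X.
Proof.
have m1 : `|-1 : C| = 1 := @normN1 R.
case: j => // _ X0 h; rewrite -{2}h.
  have [h1 h2] := scl_rot m1 X0; have [h3 h4] := scl_conj h1.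
  by rewrite [in RHS]/wrho h4 h2.
by have [h3 h4] := scl_conj X0; rewrite [in RHS]/wrho h4.
Qed.

Lemma fixed_real j w X : `|w| = 1 -> fixed_at j w -> wrho j X = X -> (ev1 w X).2 = 0.
Proof.
move=> w1 fw h; apply: toM_real; rewrite -/(evM w X) -{2}h (evM_rho _ _ w1).
by case: j fw {h} => /= ->.
Qed.

(** For R_{-1} the locus is the unit circle and there is no rescaling; for R_1 and R_2 the reality
    condition commutes with rescaling by a real factor. *)
Lemma real_at j z X : real_locus j z -> sclok (zrad z) X -> wrho j X = X ->
  (ev1 (zarg z) (scl (zrad z) X)).2 = 0.
Proof.
move=> zj X0 h; have z0 := locus_neq0 zj.
apply: (@fixed_real j); [exact: arg_norm|exact: arg_fixed|].
case: j zj h => zj h; [exact: wrho_scl|exact: wrho_scl|].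
by have -> : zrad z = 1; [rewrite /zrad zj|have [_ ->] := scl1 X].
Qed.

Lemma scl_orth r A X : r != 0 -> sclok r X -> wtr X * wcst A * X = wcst A ->
  wtr (scl r X) * wcst A * scl r X = wcst A.
Proof.
move=> r0 X0 h; have [t1 t2] := scl_tr X0; have [a1 a2] := @scl_cst R N r A.
have [p1 p2] := sclM r0 t1 a1; have [_ s2] := sclM r0 p1 X0.
by rewrite -t2 -{1}a2 -p2 -s2 h a2.
Qed.

Lemma scl_one r : scl r (1 : W) = 1.
Proof. exact: (@scl_cst R N r 1%:M).2. Qed.

Lemma wsigE X m : toM (wsig X m) = Pmx C n k *m ((-1) ^ m *: toM (X m)) *m Pmx C n k.
Proof. by rewrite /wsig wadE (wrotE _ _ (@normN1 R)) toM_scale. Qed.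

Lemma wtauE X m : toM (wtau X m) = Qmx C n k *m toM (X (- m)) *m Qmx C n k.
Proof. by rewrite /wtau wadE winvE. Qed.

Lemma col_real w X : (ev1 w X).2 = 0 ->
  map_mx (real_complex R) (col (mid n k) (RF w X)) = col (mid n k) (evM w X).
Proof. by move=> h; rewrite map_col RF_real. Qed.

End ScaledSymmetries.

Section Domains.
Context {R : realType} {n : nat}.
Local Notation E := 'rV[R]_n.

Lemma ball_based (t0 : E) (r : R) : 0 < r -> based_domain t0 (ball t0 r).
Proof.
move=> r0; split; [exact: ball_open| |exact: ballxx].
exists (fun p : R * E => (1 - p.1) *: (p.2 - t0) + t0), t0; split.
- exact: ballxx.
- apply: continuous_subspaceT => -[s t].
  apply: cvgD; last exact: cvg_cst.
  apply: cvgZ; first by apply: cvgB; [exact: cvg_cst|exact: cvg_fst].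
  by apply: cvgB; [exact: cvg_snd|exact: cvg_cst].
- move=> t Bt; split; first by rewrite subr0 scale1r subrK.
    by rewrite subrr scale0r add0r.
  move=> s /andP[s0 s1]; apply: ball_convex => //.
  by rewrite subr_ge0 s1 gerBl.
Qed.

Lemma ball_sub (t0 : E) (r r' : R) : r' <= r -> ball t0 r' `<=` ball t0 r.
Proof. exact: le_ball. Qed.

End Domains.

(** * Homogeneous frames give flat families *)

Section FlatFamilies.
Context {R : realType} {n k : nat}.
Local Notation N := (n + (1 + k))%N.
Local Notation V := (PV R N).
Local Notation W := (l1 V).
Local Notation C := (cplx R).
Local Notation E := 'rV[R]_n.
Implicit Types (F : E -> W) (U : set E) (z w : C) (j : reality) (r : R) (T Ti A : 'M[C]_N).
Local Notation P := (Pmx C n k).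

Lemma two_neq0 : 2%:R != 0 :> C. Proof. by rewrite pnatr_eq0. Qed.

Lemma conj_odd T Ti A : P *m T = T *m P -> P *m Ti = Ti *m P -> P *m A *m P = - A ->
  P *m (T *m A *m Ti) *m P = - (T *m A *m Ti).
Proof.
move=> PT PTi h; rewrite !mulmxA PT -(mulmxA _ Ti P) -PTi !mulmxA.
by rewrite -(mulmxA T P A) -(mulmxA T _ P) h mulmxN mulNmx.
Qed.

Lemma conj_comm T Ti A B (c : C) : Ti *m T = 1%:M -> A *m B = B *m A ->
  T *m (c *: A) *m Ti *m (T *m (c *: B) *m Ti) = T *m (c *: B) *m Ti *m (T *m (c *: A) *m Ti).
Proof.
move=> TiT AB; have cc (X Y : 'M[C]_N) : T *m X *m Ti *m (T *m Y *m Ti) = T *m (X *m Y) *m Ti.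
  by rewrite !mulmxA -(mulmxA _ Ti T) TiT mulmx1.
have cE : (c *: A) *m (c *: B) = (c *: B) *m (c *: A).
  by rewrite -scalemxAl -scalemxAr AB scalemxAl scalemxAr.
exact: etrans (cc _ _) (etrans (congr1 (fun X => T *m X *m Ti) cE) (esym (cc _ _))).
Qed.

Lemma suple_comm (X Y : W) : suple 1 X -> suple 1 Y -> (Y * X) (1 + 1) = (X * Y) (1 + 1) ->
  toM (X 1) *m toM (Y 1) = toM (Y 1) *m toM (X 1).
Proof.
move=> sX sY; rewrite (suple_leadM sX sY) (suple_leadM sY sX).
by move: (X 1) (Y 1) => x y h; rewrite -!toM_mul h.
Qed.

(** Coefficient of the square of the loop parameter in the Maurer-Cartan equation: the derivatives
    have frequencies at most 1, so the commutator of the top coefficients vanishes. *)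
Lemma mc_commute U F t u v : open U -> smooth U F -> (forall t, U t -> orth (F t)) -> U t ->
  (forall t v, U t -> suple 1 (mcform F t v)) ->
  toM (mcform F t u 1) *m toM (mcform F t v 1) =
  toM (mcform F t v 1) *m toM (mcform F t u 1).
Proof.
move=> oU sF oF Ut MF.
have sT : smooth U (fun t => wtr (F t)) by exact: smooth_blin wtr_blin sF.
have E0 := maurer_cartan_eq u v oU sF sT oF Ut.
have sa a : smooth U (mcform F^~ a) by apply: smooth_mul => //; exact: smooth_derive.
have le1 a b : ('D_a (mcform F^~ b) t) 2 = 0.
  by apply: (derive_suple a oU (sa b) Ut (fun s Us => MF s b Us)).
have : (mcform F t v * mcform F t u) (1 + 1) = (mcform F t u * mcform F t v) (1 + 1).
  apply/eqP; rewrite -subr_eq0 -l1B; apply/eqP.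
  apply: etrans (congr1 (fun X : W => X (1 + 1)) (esym E0)) _.
  by rewrite l1B; apply: etrans (congr2 (fun x y => x - y) (le1 u v) (le1 v u)) _; rewrite subrr.
exact: suple_comm (MF t u Ut) (MF t v Ut).
Qed.

Lemma mc_auto U F (f : W -> W) t v : wauto f -> open U -> smooth U F -> U t ->
  (forall t, U t -> f (F t) = F t) -> f (mcform F t v) = mcform F t v.
Proof.
move=> [bf fM _ fT] oU sF Ut fF; rewrite /mcform fM fT fF// -(derive_lin v bf sF Ut).
by congr (_ * _); exact: (@derive_eqU _ _ _ U (fun t => f (F t)) F v t oU Ut fF).
Qed.

(** The pair T, Ti covers both target spaces: the identity for the sphere, [Tmx] and its inverse for
    hyperbolic space. The rotation of the parameter for R_1 is already contained in F. *)
Lemma flat_family_of s j T Ti U t0 F : j <> Rm1 -> open U -> U t0 -> homog_frame U t0 F ->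
  (forall t, U t -> plus1 (F t)) -> T *m Ti = 1%:M -> P *m T = T *m P -> P *m Ti = Ti *m P ->
  (forall t, U t -> wsig (F t) = F t) -> (forall t, U t -> wsym s j (wad T Ti (F t))) ->
  exists2 rho : R, 0 < rho & forall r, 0 < r <= rho ->
    flat_family k s j t0 (ball t0 r) (fun t => wad T Ti (F t) : wiener R n k).
Proof.
move=> jm oU Ut0 hF pF TTi PT PTi sigF symF.
have [rho rho0 [brho HS]] := homog_scl oU Ut0 hF pF.
have TiT : Ti *m T = 1%:M by exact: mulmx1C.
exists rho => // r /andP[r0 rrho].
have br : ball t0 r `<=` ball t0 rho by exact: ball_sub.
have brU : ball t0 r `<=` U by move=> t /br /brho.
have oB : open (ball t0 r) by exact: ball_open.
have [sF oF F1 MF] := hF.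
have sFr := smooth_sub brU sF.
have sF0 : smooth (ball t0 r) (fun t => wad T Ti (F t)) by exact: smooth_blin (wad_blin T Ti) sFr.
have F01 : wad T Ti (F t0) = 1 by rewrite F1 wad1.
split; first exact: ball_based.
- split=> //; first by move=> t Bt; apply/loops_sigmaP; exact: symF (brU _ Bt).
  move=> t v Bt.
  have I1 : wad T Ti (wtr (F t)) * wad T Ti (F t) = 1.
    by rewrite wadM// (oF t (brU _ Bt)) wad1.
  apply/(mc_laurentP _ _ I1) => //.
  rewrite (derive_lin v (wad_blin T Ti) sFr Bt) wadM//.
  have [m1 m2] := MF t v (brU _ Bt).
  by split; [exact: (wad_keeps T Ti 1 _).1|exact: (wad_keeps T Ti 1 _).2].
- by move=> z z1; rewrite F01 ev_evM// evM1.
- exists (fun z t => col (mid n k) (RF (zarg z) (scl (zrad z) (wad T Ti (F t))))) => z zj.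
  have z0 := locus_neq0 zj; have w1 := arg_norm z0; have x0 := rad_gt0 z0.
  have x0' : zrad z != 0 by rewrite gt_eqF.
  have [okF sS DS] := HS (zrad z) x0.
  have ok t : ball t0 r t -> sclok (zrad z) (wad T Ti (F t)) /\
      scl (zrad z) (wad T Ti (F t)) = wad T Ti (scl (zrad z) (F t)).
    by move=> Bt; exact: scl_wad (okF t (br _ Bt)).
  have symw t : ball t0 r t -> wrho j (wad T Ti (F t)) = wad T Ti (F t).
    by move=> Bt; have [_ _ _] := symF t (brU _ Bt).
  have sSr := smooth_sub br sS.
  pose Y t := scl (zrad z) (wad T Ti (F t)).
  have sW : smooth (ball t0 r) (fun t => wad T Ti (scl (zrad z) (F t))).
    exact: smooth_blin (wad_blin T Ti) sSr.
  have sY : smooth (ball t0 r) Y.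
    by apply: smooth_eq sW => // t Bt; rewrite /Y (ok t Bt).2.
  pose Yi t := wad T Ti (wtr (scl (zrad z) (F t))).
  have sYi : smooth (ball t0 r) Yi.
    by apply: smooth_blin (wad_blin T Ti) _ => //; exact: smooth_blin wtr_blin sSr.
  have oS t : ball t0 r t -> orth (scl (zrad z) (F t)).
    move=> Bt; have := @scl_orth R n k (zrad z) 1%:M (F t) x0' (okF t (br _ Bt)).
    by rewrite wcst1 !mulr1; apply; exact: oF (brU _ Bt).
  have real t : ball t0 r t -> (ev1 (zarg z) (Y t)).2 = 0.
    by move=> Bt; apply: (@real_at _ _ _ j) => //; [exact: (ok t Bt).1|exact: symw].
  have mcE t u : ball t0 r t -> Yi t * 'D_u Y t =
      wad T Ti (delta 1 (zrad z *: bet F t u)).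
    move=> Bt; have -> : 'D_u Y t = wad T Ti ('D_u (fun t => scl (zrad z) (F t)) t).
      rewrite -(derive_lin u (wad_blin T Ti) sSr Bt); apply: (derive_eqU u oB Bt) => x Bx.
      exact: (ok x Bx).2.
    by rewrite wadM// (DS t u (br _ Bt)) mulrA (oS t Bt) mul1r.
  have [| | | |cc base] := @family_curvature R n k s 0 t0 r (zarg z) Y Yi r0 w1 sY sYi _ _ real _ _.
  + by move=> t Bt; rewrite /Yi /Y (ok t Bt).2 wadM// (oS t Bt) wad1.
  + by rewrite /Y F01 scl_one.
  + move=> t Bt; apply: scl_orth => //; first exact: (ok t Bt).1.
    by have [] := symF t (brU _ Bt).
  + move=> t u v Bt A B.
    pose cz := zarg z ^ 1 * (zrad z)%:C; pose b a := toM (mcform F t a 1).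
    have evE a : evM (zarg z) (Yi t * 'D_a Y t) = T *m (cz *: b a) *m Ti.
      apply: etrans (congr1 (evM (zarg z)) (mcE t a Bt)) _.
      rewrite (evM_ad _ _ _ w1) evM_delta /cz -scalerA.
      have sb : toM (zrad z *: bet F t a) = (zrad z)%:C *: b a by exact: toMZ.
      by rewrite sb.
    have {A}-> : A = _ := evE u; have {B}-> : B = _ := evE v.
    rewrite scale0r oppr0.
    (* The twisting makes the coefficient of an odd power anti-invariant under conjugation by P,
       hence off-diagonal. *)
    have Bodd a : P *m (T *m (cz *: b a) *m Ti) *m P = - (T *m (cz *: b a) *m Ti).
      apply: conj_odd => //.
      have := congr1 (fun X : W => toM (X 1)) (mc_auto a (@wsig_auto R n k) oU sF (brU _ Bt) sigF).
      rewrite wsigE expr1z scaleN1r mulmxN mulNmx => /eqP; rewrite eqr_oppLR => /eqP h.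
      by rewrite -scalemxAr -scalemxAl h scalerN.
    have [A1 A2] := P_odd two_neq0 (Bodd u); have [B1 B2] := P_odd two_neq0 (Bodd v).
    apply: (flat_blocks A1 A2 B1 B2); apply: (conj_comm _ TiT).
    exact: mc_commute u v oU sF oF (brU _ Bt) (fun t v Ut => (MF t v Ut).2).
  split=> // t Bt; rewrite /column_at (ev_scl (radE z) z0 (ok t Bt).1) col_real//.
  exact: real.
Qed.

End FlatFamilies.

(** * Twisted frames give curved families *)

Section CurvedFamilies.
Context {R : realType} {n k : nat}.
Local Notation N := (n + (1 + k))%N.
Local Notation V := (PV R N).
Local Notation W := (l1 V).
Local Notation C := (cplx R).
Local Notation E := 'rV[R]_n.
Implicit Types (F : E -> W) (U : set E) (z w : C) (j : reality) (r : R) (A : 'M[C]_N).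
Local Notation P := (Pmx C n k).
Local Notation Q := (Qmx C n k).

Lemma laurent3 r w (X : W) : 0 < r -> `|w| = 1 -> supge (-1) X -> suple 1 X ->
  evM w (scl r X) = (w * r%:C)^-1 *: toM (X (-1)) + toM (X 0) + (w * r%:C) *: toM (X 1).
Proof.
move=> r0 w1 X1 X2; have w0 := unit_neq0 w1.
have E0 : X = delta (-1) (X (-1)) + delta 0 (X 0) + delta 1 (X 1).
  apply: l1P => m; rewrite !l1D !deltaE.
  have [->|m1] := eqVneq m (-1); first by rewrite !addr0.
  have [->|m2] := eqVneq m 0; first by rewrite add0r addr0.
  have [->|m3] := eqVneq m 1; first by rewrite !add0r.
  rewrite !addr0; have [mm|mm] := leP m 0; first by apply: X1; lia.
  by apply: X2; lia.
have [a1 a2] := @scl_delta R N r (-1) (X (-1)); have [b1 b2] := @scl_delta R N r 0 (X 0).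
have [c1 c2] := @scl_delta R N r 1 (X 1).
have [d1 d2] := sclD a1 b1; have [e1 e2] := sclD d1 c1.
rewrite {1}E0 e2 d2 a2 b2 c2 (evMD _ _ w1) (evMD _ _ w1) !evM_delta.
rewrite (toMZ (r ^ -1)) (toMZ (r ^ 0)) (toMZ (r ^ 1)) !scalerA.
have -> : w ^ (-1) * (r ^ (-1))%:C = (w * r%:C)^-1.
  rewrite -[w ^ (-1)]/(w^-1) -[r ^ (-1)]/(r^-1) invfM; congr (_ * _); exact: fmorphV.
by rewrite !expr0z mulr1 scale1r !expr1z.
Qed.

(** Invariance under [Qb] kills the first column below the diagonal, skewness its diagonal entry.
    Applied to the constant coefficient this yields adaptedness. *)
Lemma Qb_skew (d : 'M[C]_(1 + k)) : @Qb C k *m d *m @Qb C k = d -> d^T = - d -> lsubmx d = 0.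
Proof.
move=> h T; rewrite -[d]submxK block_mxEh row_mxKl.
have -> : ulsubmx d = 0.
  apply: (opp_fixed0 two_neq0); apply/matrixP => i l; rewrite !ord1.
  have := congr1 (fun A : 'M[C]_(1 + k) => A (lshift k 0) (lshift k 0)) T.
  by rewrite !mxE => {1}->; rewrite opprK.
have -> : dlsubmx d = 0; last by rewrite col_mx0.
apply: (opp_fixed0 two_neq0); have := congr1 dlsubmx h.
rewrite -{1}[d]submxK /Qb !mulmx_block !(mul0mx, mulmx0, addr0, add0r, mul1mx, mulmx1).
by rewrite block_mxKdl mul_scalar_mx scaleN1r.
Qed.

(** Invariance under [tau] makes the coefficient of z^-1 equal to [Q *m A1 *m Q], so the connection
    form is determined by A1 and A0. *)
Lemma curved_form (A1 A0 : 'M[C]_N) z : z != 0 -> P *m A1 *m P = - A1 -> P *m A0 *m P = A0 ->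
  Q *m A0 *m Q = A0 -> A1^T = - A1 -> A0^T = - A0 ->
  let A := z^-1 *: (Q *m A1 *m Q) + A0 + z *: A1 in
  let D := z%:M + z^-1 *: @Qb C k in
  [/\ lsubmx (drsubmx A) = 0, ursubmx A = ursubmx A1 *m D & dlsubmx A = - (ursubmx A1 *m D)^T].
Proof.
move=> z0 P1 P0 Q0 T1 T0 A D.
have [u1 d1] := P_odd two_neq0 P1; have [u0 l0] := P_even two_neq0 P0.
have urE : ursubmx A = ursubmx A1 *m D.
  have -> : ursubmx A = z^-1 *: ursubmx (Q *m A1 *m Q) + ursubmx A0 + z *: ursubmx A1.
    by apply/matrixP => i l; rewrite !mxE.
  rewrite Qmx_conj block_mxKur u0 addr0 /D mulmxDr mul_mx_scalar -scalemxAr addrC//.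
have QT : (Q *m A1 *m Q)^T = - (Q *m A1 *m Q).
  by rewrite !trmx_mul T1 !Qmx_tr mulmxA mulmxN mulNmx.
have AT : A^T = - A.
  rewrite /A; move: (Q *m A1 *m Q) QT => Am QT.
  by rewrite !linearD !linearZ/= T1 T0 QT.
split=> //; last first.
  by rewrite -urE trmx_ursub AT; apply/matrixP => i l; rewrite !mxE opprK.
have -> : drsubmx A = drsubmx A0.
  have -> : drsubmx A = z^-1 *: drsubmx (Q *m A1 *m Q) + drsubmx A0 + z *: drsubmx A1.
    by apply/matrixP => i l; rewrite !mxE.
  by rewrite Qmx_conj block_mxKdr d1 mulmx0 mul0mx !scaler0 addr0 add0r.
apply: Qb_skew.
  by have := congr1 drsubmx Q0; rewrite Qmx_conj block_mxKdr.
by rewrite trmx_drsub T0; apply/matrixP => i l; rewrite !mxE.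
Qed.

(** The coefficients of z satisfy the block equations of the flat case by [flat_blocks];
    [curved_blocks] then inserts the diagonal factor depending on z. *)
Lemma curved_algebra (Au Av u1 u0 v1 v0 : 'M[C]_N) z (c : C) : z != 0 ->
  c * (z + z^-1) ^+ 2 = 4%:R ->
  [/\ P *m u1 *m P = - u1, P *m u0 *m P = u0, Q *m u0 *m Q = u0, u1^T = - u1 & u0^T = - u0] ->
  [/\ P *m v1 *m P = - v1, P *m v0 *m P = v0, Q *m v0 *m Q = v0, v1^T = - v1 & v0^T = - v0] ->
  u1 *m v1 = v1 *m u1 ->
  Au = z^-1 *: (Q *m u1 *m Q) + u0 + z *: u1 ->
  Av = z^-1 *: (Q *m v1 *m Q) + v0 + z *: v1 ->
  [/\ lsubmx (drsubmx Au) = 0,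
      ursubmx Au *m dlsubmx Av - ursubmx Av *m dlsubmx Au =
        - (c *: (lsubmx (ursubmx Au) *m (lsubmx (ursubmx Av))^T -
                 lsubmx (ursubmx Av) *m (lsubmx (ursubmx Au))^T)) &
      dlsubmx Au *m ursubmx Av - dlsubmx Av *m ursubmx Au = 0].
Proof.
move=> z0 cz [Pu1 Pu0 Qu0 Tu1 Tu0] [Pv1 Pv0 Qv0 Tv1 Tv0] cm AuE AvE.
have [Cu1 Cu2 Cu3] := curved_form z0 Pu1 Pu0 Qu0 Tu1 Tu0.
have [Cv1 Cv2 Cv3] := curved_form z0 Pv1 Pv0 Qv0 Tv1 Tv0.
rewrite -AuE in Cu1 Cu2 Cu3; rewrite -AvE in Cv1 Cv2 Cv3.
have [Au1 Au2] := P_odd two_neq0 Pu1; have [Av1 Av2] := P_odd two_neq0 Pv1.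
have [_ b1 b2] := flat_blocks Au1 Au2 Av1 Av2 cm.
have dl (a : 'M[C]_N) : a^T = - a -> dlsubmx a = - (ursubmx a)^T.
  by move=> Ta; rewrite trmx_ursub Ta; apply/matrixP => i l; rewrite !mxE opprK.
have h1 : ursubmx u1 *m (ursubmx v1)^T = ursubmx v1 *m (ursubmx u1)^T.
  by move/eqP: b1; rewrite (dl u1)// (dl v1)// !mulmxN subr_eq0 => /eqP/oppr_inj.
have h2 : (ursubmx u1)^T *m ursubmx v1 = (ursubmx v1)^T *m ursubmx u1.
  by move/eqP: b2; rewrite (dl u1)// (dl v1)// !mulNmx subr_eq0 => /eqP/oppr_inj.
have [k1 k2] := curved_blocks z0 cz h1 h2.
have fin (X X' : 'M[C]_(n, 1 + k)) (Y Y' : 'M[C]_(1 + k, n)) :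
    X = ursubmx u1 *m (z%:M + z^-1 *: @Qb C k) -> X' = ursubmx v1 *m (z%:M + z^-1 *: @Qb C k) ->
    Y = - (ursubmx u1 *m (z%:M + z^-1 *: @Qb C k))^T ->
    Y' = - (ursubmx v1 *m (z%:M + z^-1 *: @Qb C k))^T ->
    X *m Y' - X' *m Y = - (c *: (lsubmx X *m (lsubmx X')^T - lsubmx X' *m (lsubmx X)^T)) /\
    Y *m X' - Y' *m X = 0.
  by move=> -> -> -> ->; split; [exact: k1|exact: k2].
have [f1 f2] := fin _ _ _ _ Cu2 Cv2 Cu3 Cv3.
by split; [exact: Cu1|exact: f1|exact: f2].
Qed.

Lemma toM_wtr (X : W) m : toM (wtr X m) = (toM (X m))^T.
Proof. by rewrite wtrE; apply/matrixP => i l; rewrite !mxE. Qed.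

Lemma mc_skew U F t v : open U -> smooth U F -> (forall t, U t -> orth (F t)) -> U t ->
  wtr (mcform F t v) = - mcform F t v.
Proof.
move=> oU sF oF Ut; have sT : smooth U (fun t => wtr (F t)) by exact: smooth_blin wtr_blin sF.
have h : 'D_v (fun t => wtr (F t)) t * F t + wtr (F t) * 'D_v F t = 0.
  rewrite -(derive_mul v sT sF Ut) (derive_eqU v oU Ut oF).
  by have /has_deriveP[_ ->] := has_derive_cst (1 : W) t v.
rewrite (derive_lin v wtr_blin sF Ut) in h.
rewrite /mcform wtrM wtrK; apply/eqP; rewrite -addr_eq0; apply/eqP.
exact: h.
Qed.

Lemma plus_homog j U t0 F : plus_frame j U t0 F -> homog_frame U t0 F.
Proof. by move=> [sF HF F1 MF]; split=> // t Ut; have [[]] := HF t Ut. Qed.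

(** Inverting the parameter exchanges the radii r and r^-1. *)
Lemma scl_tau r (X : W) : r != 0 -> sclok r^-1 X ->
  sclok r (wtau X) /\ scl r (wtau X) = wtau (scl r^-1 X).
Proof.
by move=> r0 X0; have [h1 h2] := scl_inv X0; have [h3 h4] := @scl_wad R n k r Q Q _ r0 h1;
  split=> //; rewrite [LHS]h4 h2.
Qed.

(** For r >= 1 the plus part is entire and rescaling the minus part is bounded; for r < 1 invariance
    under [wtau] reduces to r^-1. *)
Lemma scl_frame j t0 rho Fp Fm F : 0 < rho -> (let U := ball t0 rho in
  [/\ curved_frame j U t0 F, plus_frame j U t0 Fp, minus_part j U t0 Fm &
      forall t, U t -> F t = Fp t * Fm t]) ->
  exists2 rho' : R, 0 < rho' <= rho & forall r, 0 < r ->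
    [/\ forall t, ball t0 rho' t -> sclok r (F t),
        smooth (ball t0 rho') (fun t => scl r (F t)) &
        forall t v, ball t0 rho' t -> sclok r ('D_v F t) /\
          'D_v (fun t => scl r (F t)) t = scl r ('D_v F t)].
Proof.
move=> rho0 [cF pF mF FE]; have oU : open (ball t0 rho) by exact: ball_open.
have Ut0 : ball t0 rho t0 by exact: ballxx.
have hF := plus_homog pF; have [sP HP P1 MP] := pF; have [sM HM M1] := mF.
have [sF HF F1 MF] := cF.
have [rho1 rho10 [br1 HS]] := homog_scl oU Ut0 hF (fun t Ut => (HP t Ut).2).
exists (Num.min rho rho1); first by rewrite lt_min rho0 rho10 ge_min lexx.
have br : ball t0 (Num.min rho rho1) `<=` ball t0 rho by apply: ball_sub; rewrite ge_min lexx.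
have br' : ball t0 (Num.min rho rho1) `<=` ball t0 rho1.
  by apply: ball_sub; rewrite ge_min lexx orbT.
have oB : open (ball t0 (Num.min rho rho1)).
  by apply: ball_open; rewrite lt_min rho0 rho10.
have ge1 r : 1 <= r ->
  [/\ forall t, ball t0 (Num.min rho rho1) t -> sclok r (F t),
      smooth (ball t0 (Num.min rho rho1)) (fun t => scl r (F t)) &
      forall t v, ball t0 (Num.min rho rho1) t -> sclok r ('D_v F t) /\
        'D_v (fun t => scl r (F t)) t = scl r ('D_v F t)].
  move=> r1; have r0 : 0 < r by exact: lt_le_trans r1.
  have r0' : r != 0 by rewrite gt_eqF.
  have [okP sSP DSP] := HS r r0; have [f bf fE] := @scl_blin_le R N r r1.
  have okF t : ball t0 (Num.min rho rho1) t ->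
      sclok r (F t) /\ scl r (F t) = scl r (Fp t) * f (Fm t).
    move=> Bt; have [m1 m2] := fE _ (HM t (br _ Bt)).2.
    rewrite FE; last exact: br.
    by have [h1 h2] := sclM r0' (okP t (br' _ Bt)) m1; split=> //; rewrite h2 m2.
  have sSP' := smooth_sub br' sSP; have sM' := smooth_sub br sM.
  have sfM : smooth (ball t0 (Num.min rho rho1)) (fun t => f (Fm t)).
    exact: smooth_blin oB bf sM'.
  have sS : smooth (ball t0 (Num.min rho rho1)) (fun t => scl r (Fp t) * f (Fm t)).
    exact: smooth_mul.
  split; first by move=> t /okF[].
    by apply: (smooth_eq oB _ sS) => t Bt; rewrite (okF t Bt).2.
  move=> t v Bt; have Ut := br _ Bt.
  have DF : 'D_v F t = 'D_v Fp t * Fm t + Fp t * 'D_v Fm t.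
    rewrite -(derive_mul v sP sM Ut); exact: (derive_eqU v oU Ut FE).
  have [d1 d2] := @scl_delta R N r 1 (bet Fp t v).
  have [p1 p2] := sclM r0' (okP t (br' _ Bt)) d1.
  rewrite -(homog_derive v hF Ut) d2 expr1z -(DSP t v (br' _ Bt)) in p1 p2.
  have [m1 m2] := fE _ (HM t Ut).2.
  have [n1 n2] := fE _ (derive_suple v oU sM Ut (fun s Us => (HM s Us).2)).
  have [a1 a2] := sclM r0' p1 m1; have [b1 b2] := sclM r0' (okP t (br' _ Bt)) n1.
  have [c1 c2] := sclD a1 b1; rewrite DF; split=> //.
  have -> : 'D_v (fun t => scl r (F t)) t = 'D_v (fun t => scl r (Fp t) * f (Fm t)) t.
    by apply: (derive_eqU v oB Bt) => x Bx; exact: (okF x Bx).2.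
  rewrite (derive_mul v sSP' sfM Bt) (derive_lin v bf sM' Bt) c2 a2 b2 p2 m2 n2//.
move=> r r0; have [r1|r1] := leP 1 r; first exact: ge1.
have ri1 : 1 <= r^-1 by rewrite invf_ge1// ltW.
have r0' : r != 0 by rewrite gt_eqF.
have [okF sS DS] := ge1 _ ri1; have [bt _ _ _] := @wtau_auto R n k.
have FT t : ball t0 rho t -> wtau (F t) = F t by move=> Ut; exact: (HF t Ut).2.
have okT t : ball t0 (Num.min rho rho1) t -> sclok r (F t) /\ scl r (F t) = wtau (scl r^-1 (F t)).
  by move=> Bt; have := scl_tau r0' (okF t Bt); rewrite FT; last exact: br.
split; first by move=> t /okT[].
  by apply: (smooth_eq oB _ (smooth_blin oB bt sS)) => t Bt; rewrite (okT t Bt).2.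
move=> t v Bt; have Ut := br _ Bt; have [d1 d2] := DS t v Bt.
have DT : wtau ('D_v F t) = 'D_v F t.
  rewrite -(derive_lin v bt sF Ut); exact: (derive_eqU v oU Ut FT).
have := scl_tau r0' d1; rewrite DT => -[h1 h2]; split=> //.
rewrite h2 -d2 -(derive_lin v bt sS Bt); apply: (derive_eqU v oB Bt) => x Bx.
exact: (okT x Bx).2.
Qed.

Lemma curved_family_of j t0 rho Fp Fm F : 0 < rho -> (let U := ball t0 rho in
  [/\ curved_frame j U t0 F, plus_frame j U t0 Fp, minus_part j U t0 Fm &
      forall t, U t -> F t = Fp t * Fm t]) ->
  exists2 rho' : R, 0 < rho' & forall r, 0 < r <= rho' ->
    curved_family k j t0 (ball t0 r)
      (fun t => coset (loops_sigma_tau Sphere j) (F t : wiener R n k)).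
Proof.
move=> rho0 hyp; have [rho' /andP[rho'0 rho'le] HS] := scl_frame rho0 hyp.
have [cF _ _ _] := hyp; have [sF HF F1 MF] := cF.
exists rho' => // r /andP[r0 rr].
have br : ball t0 r `<=` ball t0 rho' by exact: ball_sub.
have brU : ball t0 r `<=` ball t0 rho by move=> t /br; exact: ball_sub.
have oU : open (ball t0 rho) by exact: ball_open.
have oB : open (ball t0 r) by exact: ball_open.
have sFr := smooth_sub brU sF.
have oF t : ball t0 rho t -> orth (F t) by move=> Bt; have [[]] := HF t Bt.
split; first exact: ball_based.
- move=> t Bt; exists (ball t0 r), F; split=> //.
  apply/framesP; split=> //; first by move=> s /brU; exact: HF.
  by move=> s v /brU Us; exact: MF.
- rewrite /quotient_based; apply/seteqP; split=> X.
    move=> /cosetP[K KH ->]; rewrite F1 mul1r; exact/wconstP.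
  move=> /wconstP KH; apply/cosetP; exists X => //.
  by rewrite F1 mul1r.
- exists (fun z t => col (mid n k) (RF (zarg z) (scl (zrad z) (F t)))).
  have real z t : real_locus j z -> ball t0 r t ->
      (ev1 (zarg z) (scl (zrad z) (F t))).2 = 0.
    move=> zj Bt; have x0 := rad_gt0 (locus_neq0 zj); have [okF _ _] := HS _ x0.
    apply: (@real_at _ _ _ j) => //; first exact: okF (br _ Bt).
    by have /loops_sigma_tauP[/loops_sigmaP[_ _ _]] := HF t (brU _ Bt).
  split; last first.
    move=> t Bt; exists (F t); first exact: coset_self.
    move=> z zj cj; have z0 := locus_neq0 zj; have [okF _ _] := HS _ (rad_gt0 z0).
    rewrite /column_at (ev_scl (radE z) z0 (okF t (br _ Bt))) col_real//.
    exact: real.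
  move=> z zj cj; have z0 := locus_neq0 zj; have w1 := arg_norm z0; have x0 := rad_gt0 z0.
  have x0' : zrad z != 0 by rewrite gt_eqF.
  have [okF sS DS] := HS _ x0; have sSr := smooth_sub br sS.
  pose Y t := scl (zrad z) (F t); pose Yi t := wtr (Y t).
  have sYi : smooth (ball t0 r) Yi by exact: smooth_blin wtr_blin sSr.
  have oS t : ball t0 r t -> orth (Y t).
    move=> Bt; have := @scl_orth R n k (zrad z) 1%:M (F t) x0' (okF t (br _ Bt)).
    by rewrite wcst1 !mulr1; apply; exact: oF (brU _ Bt).
  have cz := curvature_fixed zj cj.
  have aE t u : ball t0 r t -> evM (zarg z) (Yi t * 'D_u Y t) =
      z^-1 *: toM (mcform F t u (-1)) + toM (mcform F t u 0) + z *: toM (mcform F t u 1).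
    move=> Bt; have [d1 d2] := DS t u (br _ Bt).
    have [m1 m2] := MF t u (brU _ Bt).
    have <- : scl (zrad z) (mcform F t u) = Yi t * 'D_u Y t.
      have [t1 t2] := scl_tr (okF t (br _ Bt)); have [_ p2] := sclM x0' t1 d1.
      by rewrite /mcform p2 t2 -d2.
    by rewrite (laurent3 x0 w1 m1 m2) arg_rad.
  apply: (@family_curvature R n k Sphere (curvature z) t0 r (zarg z) Y Yi) => //.
  + by rewrite /Y F1 scl_one.
  + by move=> t Bt; exact: real.
  + move=> t Bt; have := oS t Bt; rewrite /= wcst1 mulr1; exact.
  + move=> t u v Bt A B.
    have Ut := brU _ Bt.
    (* Invariance of the form under [wsig] and [wtau], and its skewness, read off on the three
       coefficients. *)
    have sym a : [/\ P *m toM (mcform F t a 1) *m P = - toM (mcform F t a 1),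
        P *m toM (mcform F t a 0) *m P = toM (mcform F t a 0),
        Q *m toM (mcform F t a 0) *m Q = toM (mcform F t a 0),
        toM (mcform F t a (-1)) = Q *m toM (mcform F t a 1) *m Q &
        forall m, (toM (mcform F t a m))^T = - toM (mcform F t a m)].
      have hs := mc_auto a (@wsig_auto R n k) oU sF Ut (fun s Us => let: conj (And4 _ _ p _) _ := HF s Us in p).
      have ht := mc_auto a (@wtau_auto R n k) oU sF Ut (fun s Us => (HF s Us).2).
      split.
      - have := congr1 (fun X : W => toM (X 1)) hs.
        by rewrite wsigE expr1z scaleN1r mulmxN mulNmx => /eqP; rewrite eqr_oppLR => /eqP.
      - by have := congr1 (fun X : W => toM (X 0)) hs; rewrite wsigE expr0z scale1r.
      - by have := congr1 (fun X : W => toM (X 0)) ht; rewrite wtauE oppr0.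
      - by have := congr1 (fun X : W => toM (X (-1))) ht; rewrite wtauE opprK.
      - have : wtr (mcform F t a) = - mcform F t a.
          exact: mc_skew oU sF oF Ut.
        by move=> h m; rewrite -toM_wtr h toMN.
    have [Pu1 Pu0 Qu0 Qu Tu] := sym u; have [Pv1 Pv0 Qv0 Qv Tv] := sym v.
    have cm := mc_commute u v oU sF oF Ut (fun t v Ut => (MF t v Ut).2).
    apply: (curved_algebra z0 cz _ _ cm).
    + by split; [exact: Pu1|exact: Pu0|exact: Qu0|exact: Tu|exact: Tu].
    + by split; [exact: Pv1|exact: Pv0|exact: Qv0|exact: Tv|exact: Tv].
    + by rewrite /A (aE t u Bt) Qu.
    + by rewrite /B (aE t v Bt) Qv.
Qed.

End CurvedFamilies.

(** * Extension to the disc *)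

Section DiscExtension.
Context {R : realType} {n k : nat}.
Local Notation N := (n + (1 + k))%N.
Local Notation V := (PV R N).
Local Notation W := (l1 V).
Local Notation C := (cplx R).
Implicit Types (X Y : W) (z h : C) (c d : int -> C).

Lemma cplx_pos (e : C) : 0 < e -> e = (complex.Re e)%:C /\ 0 < complex.Re e.
Proof.
case: e => a b; rewrite ltcE /= => /andP[/eqP b0 a0]; split=> //.
by rewrite b0.
Qed.

Lemma toM_entry_le (v : V) i j : `|toM v i j| <= (2 * `|v|)%:C.
Proof.
rewrite mxE (le_trans (cplx_norm_le _ _))// lecR mulr_natl mulr2n.
by have [h1 h2] := pair_entry_le v i j; exact: lerD.
Qed.

Lemma toM_cvgC (T : Type) (F : set_system T) (x : T -> V) (l : V) : Filter F ->
  x @ F --> l -> (toM (x t) : 'M[C]_N) @[t --> F] --> (toM l : 'M[C]_N).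
Proof.
move=> FF /cvgrPdist_lt xl; apply/cvg_ballP => e e0.
have [-> r0] := cplx_pos e0; set r := complex.Re e in r0 *.
have r2 : 0 < r / 2 by rewrite divr_gt0.
apply: filterS (xl _ r2) => t h; split=> [|i j]; first by rewrite ltcR.
rewrite -ball_normE /=.
have -> : toM l i j - toM (x t) i j = toM (l - x t) i j by rewrite toMD toMN !mxE.
by rewrite (le_lt_trans (toM_entry_le _ _ _))// ltcR mulrC -ltr_pdivlMr.
Qed.

Lemma scaleV_cvg0 (T : Type) (F : set_system T) (c : T -> C) (v : V) : Filter F ->
  c @ F --> (0 : C) -> scaleV (c t) v @[t --> F] --> (0 : V).
Proof.
move=> FF /cvgrPdist_le c0; apply/cvgrPdist_le => e e0.
have e1 : 0 < e / (2 * (`|v| + 1)) by rewrite divr_gt0// mulr_gt0// ltr_wpDl.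
have e1' : 0 < (e / (2 * (`|v| + 1)))%:C :> C by rewrite ltcR.
apply: filterS (c0 _ e1') => t; rewrite !sub0r !normrN => h.
rewrite (le_trans (scaleV_bound _ h))//.
have v1 : 0 < `|v| + 1 by rewrite ltr_wpDl.
have -> : e / (2 * (`|v| + 1)) + e / (2 * (`|v| + 1)) = e / (`|v| + 1) by field; rewrite gt_eqF.
by rewrite mulrAC ler_pdivrMr// ler_pM2l// lerDl ler01.
Qed.

(** Together with [wsum] this writes a power series and its difference quotients as one bounded map
    applied to varying multipliers, so that limits in z become limits of multipliers. *)
Definition wmult c X : W := l1_of (fun m => scaleV (c m) (X m)).

Section Bounded.
Variable b : R.
Hypothesis b0 : 0 <= b.

Lemma wmultE c X m : (forall m, `|c m| <= b%:C) -> wmult c X m = scaleV (c m) (X m).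
Proof.
move=> cb; rewrite /wmult (@l1_ofE _ _ _ ((b + b) * `|X|))// => s us.
apply: (@le_trans _ _ (\sum_(m <- s) (b + b) * `|X m|)).
  by apply: ler_sum => i _; exact: scaleV_bound (cb i).
by rewrite -mulr_sumr ler_wpM2l ?addr_ge0// l1_sum_le.
Qed.

End Bounded.

Definition wsum X : V := l1lift (fun _ v => v) X.

Lemma wsum_blin : blin (wsum : W -> V).
Proof.
apply: (@l1lift_blin _ _ _ (fun _ v => v) 1) => //.
- exact: PV_abs_complete.
- by move=> m v; rewrite mul1r.
Qed.

Lemma wsum_delta m (v : V) : wsum (delta m v) = v.
Proof.
apply: l1lift_delta.
all: try by [].
all: try exact: PV_abs_complete.
all: try exact: ler01.
all: by move=> i u; rewrite mul1r.
Qed.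

(** Zero in negative degree, also at z = 0, so that the resulting sum is a power series. *)
Definition pw z (m : int) : C := if m is Posz i then z ^+ i else 0.

(** The polynomial ((z + h)^i - z^i) / h, which also has a value at h = 0. *)
Fixpoint dq z h (i : nat) : C := if i is i'.+1 then (z + h) * dq z h i' + z ^+ i' else 0.

Definition dqz z h (m : int) : C := if m is Posz i then dq z h i else 0.

Lemma dqE z h i : (z + h) ^+ i - z ^+ i = h * dq z h i.
Proof.
elim: i => [|i ih]; first by rewrite !expr0 subrr mulr0.
rewrite /= mulrDr mulrCA -ih !exprS; ring.
Qed.

Lemma dq_cvg z i (F : set_system C) : Filter F -> (fun h : C => h) @ F --> (0 : C) ->
  dq z h i @[h --> F] --> dq z 0 i.
Proof.
move=> FF h0; have cst0 : (fun=> 0 : C) @ F --> (0 : C) by exact: cvg_cst.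
elim: i => [|i ih] /=; first exact: cst0.
have zi : (fun=> z ^+ i : C) @ F --> z ^+ i by exact: cvg_cst.
have z1 : (fun=> z : C) @ F --> z by exact: cvg_cst.
exact: cvgD (cvgM (cvgD z1 h0) ih) zi.
Qed.

Lemma pw_cvg z m (F : set_system C) : Filter F -> (fun h : C => h) @ F --> z ->
  pw h m @[h --> F] --> pw z m.
Proof.
move=> FF hz; have cst0 : (fun=> 0 : C) @ F --> (0 : C) by exact: cvg_cst.
case: m => [i|i] /=; last exact: cst0.
have cst1 : (fun=> 1 : C) @ F --> (1 : C) by exact: cvg_cst.
elim: i => [|i ih]; first by under eq_fun do rewrite expr0; rewrite expr0; exact: cst1.
by under eq_fun do rewrite exprS; rewrite exprS; exact: cvgM hz ih.
Qed.

(** Uniform in i, because (1 - q)^-1 is the fixed point of x to q x + 1. *)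
Lemma dq_bound z h (q : R) i : 0 <= q < 1 -> `|z| <= q%:C -> `|z + h| <= q%:C ->
  `|dq z h i| <= ((1 - q)^-1)%:C.
Proof.
move=> /andP[q0 q1] zq zhq; have q1' : 0 < 1 - q by rewrite subr_gt0.
elim: i => [|i ih] /=; first by rewrite normr0 -[0]/(0%:C) lecR invr_ge0 ltW.
rewrite (le_trans (ler_normD _ _))//.
have -> : ((1 - q)^-1)%:C = q%:C * ((1 - q)^-1)%:C + 1 :> C.
  have E0 : (1 - q)^-1 = q * (1 - q)^-1 + 1 by field; rewrite gt_eqF.
  by rewrite [in LHS]E0 rmorphD rmorphM rmorph1.
rewrite lerD//; first by rewrite normrM ler_pM.
rewrite normrX exprn_ile1//.
by rewrite (le_trans zq)// -[1]/(1%:C) lecR ltW.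
Qed.

Lemma pw_bound z m : `|z| <= 1 -> `|pw z m| <= 1%:C.
Proof.
by move=> z1; case: m => [i|i] /=; rewrite ?normr0 ?ler01// normrX exprn_ile1.
Qed.

Lemma dqz_bound z h (q : R) m : 0 <= q < 1 -> `|z| <= q%:C -> `|z + h| <= q%:C ->
  `|dqz z h m| <= ((1 - q)^-1)%:C.
Proof.
move=> q01 zq zh; case: m => [i|i] /=; first exact: dq_bound.
by rewrite normr0 -[0]/(0%:C) lecR invr_ge0; have /andP[_ /ltW] := q01; rewrite subr_ge0.
Qed.

Lemma wmult_cvg (T : Type) (F : set_system T) (c : T -> int -> C) d X (b : R) : Filter F ->
  0 <= b -> (\forall t \near F, forall m, `|c t m| <= b%:C) -> (forall m, `|d m| <= b%:C) ->
  (forall m, c t m @[t --> F] --> d m) -> wmult (c t) X @[t --> F] --> wmult d X.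
Proof.
move=> FF b0 cb db cd.
have dz : wmult (c t) X - wmult d X @[t --> F] --> (0 : W).
  apply: (@tannery _ _ _ F (fun t => wmult (c t) X - wmult d X)
    (fun m => ((b + b) + (b + b)) * `|X m|) (((b + b) + (b + b)) * `|X|)) => //.
  - by move=> m; rewrite mulr_ge0// !addr_ge0.
  - by move=> s us; rewrite -mulr_sumr ler_wpM2l ?addr_ge0// l1_sum_le.
  - apply: filterS cb => t cb m; rewrite l1B !(wmultE b0)// mulrDl.
    by rewrite (le_trans (ler_normB _ _))// lerD// scaleV_bound.
  - move=> m.
    have cm : c t m - d m @[t --> F] --> (0 : C).
      by rewrite -(subrr (d m)); apply: cvgB; [exact: cd|exact: cvg_cst].
    have := scaleV_cvg0 (X m) FF cm; apply: cvg_near.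
    apply: filterS cb => t cb; rewrite l1B !(wmultE b0)//.
    by rewrite !scaleVE; apply: toM_inj; rewrite toMD toMN !ofMK scalerBl.
have : wmult (c t) X - wmult d X + wmult d X @[t --> F] --> (0 : W) + wmult d X.
  exact: cvgD dz (cvg_cst _).
by rewrite add0r; apply: cvg_near; apply: nearW => t; rewrite subrK.
Qed.

Definition hext X z : 'M[C]_N := toM (wsum (wmult (pw z) X)).

Lemma scaleV_blin (a : C) : blin (scaleV a : V -> V).
Proof.
split; first exact: scaleV_linear.
by exists (zrad a + zrad a) => v; apply: scaleV_bound; rewrite radE.
Qed.

Lemma wsum_scale (a : C) X : wsum (wmult (fun=> a) X) = scaleV a (wsum X).
Proof.
have r0 : 0 <= zrad a by have : 0 <= `|a| by []; rewrite radE -[0]/(0%:C) lecR.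
have ab (m : int) : `|a| <= (zrad a)%:C by rewrite radE.
have bm : blin (wmult (fun=> a) : W -> W).
  apply: (@reop_blin R N (fun _ => scaleV a) id (zrad a + zrad a)) => //.
  - by rewrite addr_ge0.
  - by move=> m v; apply: scaleV_bound; exact: ab.
  - by move=> m; exact: scaleV_linear.
apply: (blin_eq (blin_comp wsum_blin bm) (blin_comp (scaleV_blin a) wsum_blin)) => m v /=.
have -> : wmult (fun=> a) (delta m v) = delta m (scaleV a v).
  apply: l1P => i; rewrite (wmultE r0)// !deltaE; case: eqP => // _.
  exact: (lin0 (scaleV_linear a)).
by rewrite !wsum_delta.
Qed.

Lemma hext_diff (h : C) (c d e : int -> C) (b b' : R) X : h != 0 -> 0 <= b -> 0 <= b' ->
  (forall m, `|c m| <= b%:C) -> (forall m, `|d m| <= b%:C) -> (forall m, `|e m| <= b'%:C) ->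
  (forall m, c m - d m = h * e m) ->
  toM (wsum (wmult e X)) = h^-1 *: (toM (wsum (wmult c X)) - toM (wsum (wmult d X))).
Proof.
move=> h0 b0 b0' cb db eb E0.
rewrite -toMN -toMD -(linB wsum_blin.1).
have r0 : 0 <= zrad h by have : 0 <= `|h| by []; rewrite radE -[0]/(0%:C) lecR.
have -> : wmult c X - wmult d X = wmult (fun=> h) (wmult e X).
  apply: l1P => m; rewrite l1B (wmultE b0)// (wmultE b0)//.
  rewrite (wmultE r0); last by move=> i; rewrite radE.
  rewrite (wmultE b0')//; apply: toM_inj.
  by rewrite toMD toMN !toM_scale -scalerBl E0 scalerA.
by rewrite wsum_scale toM_scale scalerA mulVf// scale1r.
Qed.

Lemma extends_hext X : supge 0 X -> extends_to_disc (ev (X : wiener R n k)) (hext X).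
Proof.
move=> X0; split.
- apply/subspace_continuousP => z /= z1.
  apply: toM_cvgC; apply: (blin_cvg _ wsum_blin).
  apply: (@wmult_cvg _ _ (fun z => pw z) (pw z) X 1) => //.
  + by apply: filterS (withinT _ _) => y y1 m; exact: pw_bound.
  + by move=> m; exact: pw_bound.
  + by move=> m; apply: pw_cvg; apply: cvg_within_filter; exact: cvg_id.
- move=> z z1; apply: (cvgP (toM (wsum (wmult (dqz z 0) X)))).
  (* A radius strictly between |z| and 1 that also bounds |z + h| for small h makes the difference
     quotients a uniformly bounded family of multipliers. *)
  have [q q01 zq] : exists2 q : R, 0 <= q < 1 & `|z| < q%:C.
    move: z1; rewrite radE -[1]/(1%:C) ltcR => r1; exists ((zrad z + 1) / 2).
      have r0 : 0 <= zrad z.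
        by have : 0 <= `|z| by []; rewrite radE -[0]/(0%:C) lecR.
      by apply/andP; split; lra.
    by rewrite ltcR; lra.
  have q0 : 0 <= (1 - q)^-1 by rewrite invr_ge0 subr_ge0 ltW//; case/andP: q01.
  have nq : \forall h \near (0 : C)^', `|z + h| <= q%:C.
    have d0 : 0 < q%:C - `|z| by rewrite subr_gt0.
    have := @dnbhs0_le C C _ d0; apply: filterS => h hd.
    by rewrite (le_trans (ler_normD _ _))// addrC -lerBrDr.
  have : toM (wsum (wmult (dqz z h) X)) @[h --> (0 : C)^'] -->
      (toM (wsum (wmult (dqz z 0) X)) : 'M[C]_N).
    apply: toM_cvgC; apply: (blin_cvg _ wsum_blin).
    apply: (@wmult_cvg _ _ (fun h => dqz z h) (dqz z 0) X (1 - q)^-1) => //.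
    + by apply: filterS nq => h hq m; apply: dqz_bound => //; exact: ltW.
    + by move=> m; apply: dqz_bound => //; rewrite ?addr0 ltW.
    + have cst0 : (fun=> 0 : C) @ (0 : C)^' --> (0 : C) by exact: cvg_cst.
      case=> [i|i] /=; last exact: cst0.
      by apply: dq_cvg; apply: cvg_within_filter; exact: cvg_id.
  apply: cvg_trans; apply: near_eq_cvg; near=> h.
  have h0 : h != 0 by near: h; exact: nbhs_dnbhs_neq.
  have hq : `|z + h| <= q%:C by near: h.
  have q1 : q%:C <= 1 :> C by rewrite -[1]/(1%:C) lecR ltW//; case/andP: q01.
  have -> : (hext X \o shift z) (h%:A) = hext X (z + h).
    by congr (hext X _); rewrite /shift/= -[h%:A]/(h * 1) mulr1 addrC.
  have cz m : `|pw z m| <= 1%:C by apply: pw_bound; exact: ltW.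
  have czh m : `|pw (z + h) m| <= 1%:C by apply: pw_bound; exact: le_trans hq q1.
  have cd m : `|dqz z h m| <= ((1 - q)^-1)%:C by apply: dqz_bound => //; exact: ltW.
  have dE m : pw (z + h) m - pw z m = h * dqz z h m.
    by case: m => [i|i] /=; [exact: dqE|rewrite subrr mulr0].
  have e0 := hext_diff X h0 ler01 q0 czh cz cd dE.
  exact: e0.
- move=> z z1; rewrite ev_evM//; congr toM; rewrite /wsum /ev1; apply: l1lift_eq => m.
  rewrite (@wmultE 1)//; last by move=> i; apply: pw_bound; rewrite z1.
  case: m => [i|i] //=; rewrite X0// !scaleVE; congr ofM.
  by rewrite -[X in _ *: X]/(toM (0 : V)) toM0 !scaler0.
Unshelve. all: by end_near. Qed.

Lemma hext0 X : hext X 0 = toM (X 0).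
Proof.
rewrite /hext; congr toM.
have -> : wmult (pw 0) X = delta 0 (X 0).
  apply: l1P => m; rewrite (@wmultE 1)//; last first.
    by move=> i; apply: pw_bound; rewrite normr0 ler01.
  apply: toM_inj; rewrite toM_scale deltaE; case: m => [[|i]|i] /=.
  - by rewrite expr0 scale1r.
  - by rewrite exprS mul0r scale0r toM0.
  - by rewrite scale0r toM0.
exact: wsum_delta.
Qed.

End DiscExtension.

(** * Bijections of germs *)

Section Conversion.
Context {R : realType} {n k : nat}.
Local Notation N := (n + (1 + k))%N.
Local Notation V := (PV R N).
Local Notation W := (l1 V).
Local Notation C := (cplx R).
Local Notation M := 'M[C]_N.
Local Notation P := (Pmx C n k).
Local Notation Q := (Qmx C n k).
Local Notation J := (Jmx C n k).
Local Notation T := (Tmx R n k).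
Implicit Types (X Y : W) (j : reality) (z : C) (A B : M).

Lemma Ci_sq : ('i : C) * 'i = -1.
Proof. by rewrite -expr2 sqrCi. Qed.

Lemma Ci_conj : conjc ('i : C) = - 'i.
Proof. exact: conjCi. Qed.

Lemma Ci_norm : `|'i : C| = 1.
Proof. exact: normCi. Qed.

Definition Tmx_inv : M := block_mx (- 'i)%:M 0 0 (block_mx 1%:M 0 0 (- 'i)%:M).

Lemma Tmx_tr : T^T = T.
Proof. by rewrite /Tmx !(tr_block_mx, trmx0, tr_scalar_mx). Qed.

Lemma Tmx_inv_tr : Tmx_inv^T = Tmx_inv.
Proof. by rewrite /Tmx_inv !(tr_block_mx, trmx0, tr_scalar_mx). Qed.

(** [P], [Q], [J], [T] and the inverse of [T] are all of this form, so they commute and their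
    products are computed on three scalars. *)
Definition blk (a b c : C) : M := block_mx a%:M 0 0 (block_mx b%:M 0 0 c%:M).

Lemma blkM a b c a' b' c' : blk a b c *m blk a' b' c' = blk (a * a') (b * b') (c * c').
Proof. by rewrite /blk !block_diag_mul -!scalar_mxM. Qed.

Lemma blkC a b c a' b' c' : blk a b c *m blk a' b' c' = blk a' b' c' *m blk a b c.
Proof. by rewrite !blkM (mulrC a) (mulrC b) (mulrC c). Qed.

Lemma blk1 : blk 1 1 1 = 1%:M.
Proof. by rewrite /blk !block_scalar1. Qed.

Lemma blkN a b c : - blk a b c = blk (- a) (- b) (- c).
Proof. by rewrite /blk !opp_block_mx !oppr0 -!raddfN. Qed.

Lemma blk_conj a b c : map_mx (@conjc R) (blk a b c) = blk (conjc a) (conjc b) (conjc c).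
Proof. by rewrite /blk !(map_block_mx, map_mx0, map_scalar_mx). Qed.

Lemma PblkE : P = blk 1 (-1) (-1).
Proof. by rewrite /Pmx /blk -scalar_mx_block. Qed.

Lemma QblkE : Q = blk 1 1 (-1). Proof. by []. Qed.
Lemma JblkE : J = blk 1 (-1) 1. Proof. by []. Qed.
Lemma TblkE : T = blk 'i 1 'i. Proof. by []. Qed.
Lemma TiblkE : Tmx_inv = blk (- 'i) 1 (- 'i). Proof. by []. Qed.

Lemma blk_eq a b c a' b' c' : a = a' -> b = b' -> c = c' -> blk a b c = blk a' b' c'.
Proof. by move=> -> -> ->. Qed.

(** Conjugation by T trades the P coming from [sigma] for the Q in [kap Rm1]. The two signs cancel
    around the matrix in between. *)
Lemma conj_TPQ (i : C) : conjc i = - i ->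
  map_mx (@conjc R) (blk i 1 i) *m map_mx (@conjc R) (blk 1 (-1) (-1)) =
    - (blk i 1 i *m blk 1 1 (-1)) /\
  map_mx (@conjc R) (blk 1 (-1) (-1)) *m map_mx (@conjc R) (blk (- i) 1 (- i)) =
    - (blk 1 1 (-1) *m blk (- i) 1 (- i)).
Proof.
have c1 : conjc (1 : C) = 1 by exact: rmorph1.
have cN (x : C) : conjc (- x) = - conjc x by exact: rmorphN.
move=> ci; rewrite (blk_conj i 1 i) (blk_conj 1 (-1) (-1)) (blk_conj (- i) 1 (- i)).
rewrite !cN !c1 ci !blkM !blkN; split; apply: blk_eq;
  by rewrite ?(mulr1, mul1r, mulrN, mulNr, opprK).
Qed.

Lemma tr_conj_form (F : comNzRingType) p (U Ui B A : 'M[F]_p) (e : F) :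
  U^T = U -> Ui^T = Ui -> U *m B *m U = e%:M ->
  (U *m A *m Ui)^T *m B *m (U *m A *m Ui) = e *: (Ui *m (A^T *m A) *m Ui).
Proof.
move=> hU hUi UBU; rewrite !trmx_mul hU hUi !mulmxA -(mulmxA _ U B) -(mulmxA _ (U *m B) U) UBU.
by rewrite mul_mx_scalar -!scalemxAl.
Qed.

Lemma sandwich1 (F : comNzRingType) p (U Ui A : 'M[F]_p) :
  U *m Ui = 1%:M -> Ui *m A *m Ui = Ui *m Ui -> A = 1%:M.
Proof.
move=> UV h; have VU := mulmx1C UV; have := congr1 (fun B : 'M[F]_p => U *m B *m U) h.
by rewrite /= !mulmxA UV !mul1mx -!mulmxA VU mulmx1.
Qed.

Definition target_space j := if j is Rm1 then Hyperbolic else Sphere.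
Definition target_reality j := if j is Rm1 then R1 else R2.
Definition conv_mx j : M := if j is Rm1 then T else 1%:M.
Definition conv_mxi j : M := if j is Rm1 then Tmx_inv else 1%:M.
Definition conv_rot j X : W := if j is R1 then wrot 'i X else X.
Definition conv_rotV j X : W := if j is R1 then wrot (- 'i) X else X.
Definition conv_pt j z : C := if j is R1 then 'i * z else z.
(** The sign in [T *m J *m T = -1]. It enters [conv_orth] twice and cancels there. *)
Definition form_sign j : C := if j is Rm1 then -1 else 1.

(* The passage from the plus part to the flat frame: [z |-> 'i * z] for [R1],
   conjugation by [T] for [Rm1]. *)
Definition conv_flat j X : W := wad (conv_mx j) (conv_mxi j) (conv_rot j X).
Definition unconv_flat j X : W := conv_rotV j (wad (conv_mxi j) (conv_mx j) X).

Lemma TTi : T *m Tmx_inv = 1%:M.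
Proof. by rewrite TblkE TiblkE blkM mulrN Ci_sq opprK mulr1 blk1. Qed.

Lemma conv_mxV j : conv_mx j *m conv_mxi j = 1%:M.
Proof. by case: j; rewrite /= ?mulmx1//; exact: TTi. Qed.

Lemma conv_mxVl j : conv_mxi j *m conv_mx j = 1%:M.
Proof. exact: mulmx1C (conv_mxV j). Qed.

Lemma P_conv_mx j : P *m conv_mx j = conv_mx j *m P.
Proof.
have e : P *m T = T *m P.
  by rewrite TblkE PblkE; exact: blkC.
by case: j; [rewrite (mulmx1 P) (mul1mx P)|rewrite (mulmx1 P) (mul1mx P)|exact: e].
Qed.

Lemma P_conv_mxi j : P *m conv_mxi j = conv_mxi j *m P.
Proof.
have e : P *m Tmx_inv = Tmx_inv *m P.
  by rewrite TiblkE PblkE; exact: blkC.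
by case: j; [rewrite (mulmx1 P) (mul1mx P)|rewrite (mulmx1 P) (mul1mx P)|exact: e].
Qed.

Lemma Ni_norm : `|- 'i : C| = 1. Proof. by rewrite normrN Ci_norm. Qed.

Lemma conv_pt_norm j z : `|z| = 1 -> `|conv_pt j z| = 1.
Proof. by move=> z1; case: j => //=; rewrite normrM Ci_norm z1 mulr1. Qed.

Lemma evM_conv_rot j z X : `|z| = 1 -> evM z (conv_rot j X) = evM (conv_pt j z) X.
Proof. by move=> z1; case: j => //=; rewrite (evM_rot _ Ci_norm z1). Qed.

Lemma evM_conv j z X : `|z| = 1 -> evM z (conv_flat j X) = conv_mx j *m evM (conv_pt j z) X *m conv_mxi j.
Proof. by move=> z1; rewrite /conv_flat (evM_ad _ _ _ z1) evM_conv_rot. Qed.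

Lemma conv_pt_surj j z : `|z| = 1 -> exists2 w, `|w| = 1 & conv_pt j w = z.
Proof.
case: j => z1; [exists (- 'i * z)|by exists z|by exists z].
  by rewrite normrM Ni_norm z1 mulr1.
by rewrite /= mulrA mulrN Ci_sq opprK mul1r.
Qed.

Lemma conv_rotK j X : conv_rotV j (conv_rot j X) = X.
Proof.
case: j => //=; apply: evM_inj => z z1; have zi : `|- 'i * z| = 1 by rewrite normrM Ni_norm z1 mulr1.
by rewrite (evM_rot _ Ni_norm z1) (evM_rot _ Ci_norm zi) mulrA mulrN Ci_sq opprK mul1r.
Qed.

Lemma conv_rotVK j X : conv_rot j (conv_rotV j X) = X.
Proof.
case: j => //=; apply: evM_inj => z z1; have zi : `|'i * z| = 1 by rewrite normrM Ci_norm z1 mulr1.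
by rewrite (evM_rot _ Ci_norm z1) (evM_rot _ Ni_norm zi) mulrA mulNr Ci_sq opprK mul1r.
Qed.

Lemma wadK A B X : A *m B = 1%:M -> wad A B (wad B A X) = X.
Proof.
move=> AB; apply: evM_inj => z z1; rewrite !(evM_ad _ _ _ z1) !mulmxA AB mul1mx.
by rewrite -mulmxA AB mulmx1.
Qed.

Lemma conv_flatK j X : unconv_flat j (conv_flat j X) = X.
Proof. by rewrite /unconv_flat /conv_flat wadK ?conv_mxVl// conv_rotK. Qed.

Lemma unconv_flatK j X : conv_flat j (unconv_flat j X) = X.
Proof. by rewrite /unconv_flat /conv_flat conv_rotVK wadK ?conv_mxV. Qed.

Lemma conv_rot_auto j : wauto (conv_rot j : W -> W).
Proof.
case: j; [exact: wrot_auto Ci_norm| |];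
by split=> //; exact: blin_id.
Qed.

Lemma conv_rot_keeps j : keeps (conv_rot j : W -> W).
Proof. by case: j => //; exact: wrot_keeps Ci_norm. Qed.

Lemma unconv_blin j : blin (unconv_flat j : W -> W).
Proof.
case: j; rewrite /unconv_flat /conv_rotV; try exact: wad_blin.
exact: blin_comp (wrot_blin Ni_norm) (wad_blin _ _).
Qed.

Lemma unconv_keeps j : keeps (unconv_flat j : W -> W).
Proof.
case: j; rewrite /unconv_flat /conv_rotV; try exact: wad_keeps.
exact: keeps_comp (wrot_keeps Ni_norm) (wad_keeps _ _).
Qed.

Lemma conv_mul j X Y : conv_flat j (X * Y) = conv_flat j X * conv_flat j Y.
Proof. by rewrite /conv_flat wadM ?conv_mxVl//; have [_ -> _ _] := conv_rot_auto j. Qed.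

Lemma conv_one j : conv_flat j 1 = 1 :> W.
Proof. by rewrite /conv_flat; have [_ _ -> _] := conv_rot_auto j; rewrite wad1 ?conv_mxV. Qed.

Lemma conv_sig j X : wsig (conv_flat j X) = conv_flat j (wsig X).
Proof.
apply: evM_inj => z z1; have zn : `|- z| = 1 by rewrite normrN.
rewrite (evM_sig _ z1) (evM_conv _ _ z1) (evM_conv _ _ zn) (evM_sig _ (conv_pt_norm j z1)).
have -> : conv_pt j (- z) = - conv_pt j z by case: (j) => //=; rewrite mulrN.
move: (evM _ X) => A; rewrite !mulmxA P_conv_mx -!mulmxA; congr (_ *m (_ *m (_ *m _))).
by rewrite P_conv_mxi.
Qed.

(** For R_1 the substitution z to i z turns the map z to -conj z into z to conj z. For R_{-1} the
    argument is moved from -conj z to conj z by [sigma], whence the assumption on X. *)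
Lemma conv_rho j X : wsig X = X -> wrho (target_reality j) (conv_flat j X) = conv_flat j (kap j X).
Proof.
move=> sX; apply: evM_inj => z z1; have zc := norm_conjc z1.
have zn : `|- conjc z : C| = 1 by rewrite normrN.
rewrite (evM_rho _ _ z1) (evM_conv _ _ z1); case: j => /=; rewrite /conj_mx.
- rewrite (evM_conv R1 _ zc) !mul1mx !mulmx1 /= (evM_rho R1 _ (conv_pt_norm R1 z1))/= /conj_mx.
  have -> : - conjc ('i * z : C) = 'i * conjc z; last by [].
  apply: (etrans (congr1 -%R (rmorphM (@conjc R) 'i z))).
  apply: (etrans (congr1 (fun x => - (x * conjc z)) Ci_conj)).
  by rewrite mulNr opprK.
- by rewrite (evM_conv R2 _ zc) !mul1mx !mulmx1 (evM_conj _ z1).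
- have zi := norm_inv1 z1; have zic := norm_conjc zi.
  rewrite (evM_conv Rm1 _ zn) /= (evM_tau _ z1) (evM_rho Rm1 _ zi)/= /conj_mx.
  have -> : (conjc z^-1)^-1 = conjc z by rewrite fmorphV invrK.
  have -> : evM (- conjc z) X = P *m evM (conjc z) X *m P.
    by rewrite -{1}sX (evM_sig _ zn) opprK.
  rewrite !map_mxM; move: (map_mx _ (evM _ X)) => A.
  have [c1 c2] := conj_TPQ Ci_conj; rewrite -TblkE -PblkE -QblkE -TiblkE in c1 c2.
  by rewrite !mulmxA c1 -(mulmxA _ (map_mx _ P)) c2 !mulNmx mulmxN opprK !mulmxA.
Qed.

Lemma conv_det j X : wdet1 (conv_flat j X) <-> wdet1 X.
Proof.
have dT : \det (conv_mx j) * \det (conv_mxi j) = 1 by rewrite -det_mulmx conv_mxV det1.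
have E0 z : `|z| = 1 -> \det (evM z (conv_flat j X)) = \det (evM (conv_pt j z) X).
  by move=> z1; rewrite evM_conv// !det_mulmx mulrAC dT mul1r.
split=> h z z1; last by rewrite E0// h// conv_pt_norm.
by have [w w1 <-] := conv_pt_surj j z1; rewrite -(E0 _ w1); exact: h.
Qed.

Lemma conv_orth j X : wtr (conv_flat j X) * wcst (Defs.form C n k (target_space j)) * conv_flat j X =
    wcst (Defs.form C n k (target_space j)) <-> orth X.
Proof.
have TT : (conv_mx j)^T = conv_mx j by case: (j); rewrite /= ?trmx1//; exact: Tmx_tr.
have TiT' : (conv_mxi j)^T = conv_mxi j by case: (j); rewrite /= ?trmx1//; exact: Tmx_inv_tr.
have TFT : conv_mx j *m Defs.form C n k (target_space j) *m conv_mx j = (form_sign j)%:M.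
  case: (j); rewrite /= ?mulmx1// JblkE TblkE !blkM mulr1 Ci_sq mul1r mulr1.
  by rewrite raddfN /= -blk1 blkN.
have TiTi : conv_mxi j *m conv_mxi j = form_sign j *: Defs.form C n k (target_space j).
  case: (j); rewrite /= ?mulmx1 ?scale1r// JblkE TiblkE !blkM mulrNN Ci_sq scaleN1r blkN.
  by rewrite mulr1 opprK.
have ee : form_sign j * form_sign j = 1 by case: (j); rewrite /= ?mulr1// mulrNN mulr1.
have E0 z : `|z| = 1 ->
    evM z (wtr (conv_flat j X) * wcst (Defs.form C n k (target_space j)) * conv_flat j X) =
    form_sign j *: (conv_mxi j *m ((evM (conv_pt j z) X)^T *m evM (conv_pt j z) X) *m conv_mxi j).
  move=> z1; have := evM_conv j X z1; move: (conv_flat j X) => Y EY.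
  rewrite (evMM (wtr Y * _) Y z1) (evMM (wtr Y) _ z1) (evM_tr Y z1) evM_cst EY.
  exact: tr_conj_form.
split=> [h|oX]; last first.
  apply: evM_inj => z z1; rewrite E0// -(evM_tr _ (conv_pt_norm j z1)) -(evMM _ _ (conv_pt_norm j z1)) oX evM1.
  by rewrite mulmx1 TiTi scalerA ee scale1r evM_cst.
have key z : `|z| = 1 -> (evM (conv_pt j z) X)^T *m evM (conv_pt j z) X = 1%:M.
  move=> z1; have := congr1 (evM z) h; rewrite E0// evM_cst => h1.
  by apply: (sandwich1 (conv_mxV j)); rewrite TiTi -h1 scalerA ee scale1r.
apply: evM_inj => w w1; rewrite (evMM _ _ w1) (evM_tr _ w1) evM1.
by have [v v1 <-] := conv_pt_surj j w1; exact: key.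
Qed.

Lemma wsym_conv j X : wsym (target_space j) (target_reality j) (conv_flat j X) <-> worth j X.
Proof.
have inj Y Z : conv_flat j Y = conv_flat j Z -> Y = Z.
  by move=> h; rewrite -(conv_flatK j Y) h conv_flatK.
split=> [[/conv_orth oX /conv_det dX]|[oX dX sX kX]].
  rewrite conv_sig => /inj sX; rewrite conv_rho// => /inj kX; by split.
by split; [exact/conv_orth|exact/conv_det|rewrite conv_sig sX|rewrite conv_rho// kX].
Qed.

End Conversion.

(** * The correspondence on representatives and on germs *)

Section Assembly.
Context {R : realType} {n k : nat}.
Local Notation N := (n + (1 + k))%N.
Local Notation E := 'rV[R]_n.
Local Notation V := (PV R N).
Local Notation W := (l1 V).
Local Notation C := (cplx R).
Local Notation T := (Tmx R n k).
Local Notation HH j := (loops_sigma_tau Sphere j : set (wiener R n k)).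
Implicit Types (X Y K : W) (j : reality) (z : C) (U : set E) (F Fp Fm : E -> W).
Implicit Types (Phi : E -> set (wiener R n k)) (t v : E).

Lemma germP (Z : Type) t0 (f g : E -> Z) :
  germ t0 f = germ t0 g <-> \forall t \near t0, f t = g t.
Proof.
split=> [h|fg].
  have : germ t0 g g by rewrite /germ /=; apply: filterE.
  by rewrite -h /germ /=; apply: filterS => t ->.
by apply/seteqP; split=> h /= hf; apply: filterS (filterI fg hf) => t [e ->]; rewrite e.
Qed.

Definition split_data j t0 (r : R) F Fp Fm := let U := ball t0 r in
  [/\ curved_frame j U t0 F, plus_frame j U t0 Fp, minus_part j U t0 Fm &
      forall t, U t -> F t = Fp t * Fm t].

Lemma plus_frame_sub j U U' t0 Fp : U' `<=` U -> plus_frame j U t0 Fp -> plus_frame j U' t0 Fp.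
Proof.
move=> UU [s h e m]; split=> // [|t /UU|t v /UU]; [exact: smooth_sub s|exact: h|exact: m].
Qed.

Lemma ball_based_open t0 (r : R) : 0 < r -> open (ball t0 r) /\ ball t0 r t0.
Proof. by move=> r0; have [] := ball_based t0 r0. Qed.

Lemma split_sub j t0 r r' F Fp Fm : r' <= r -> split_data j t0 r F Fp Fm ->
  split_data j t0 r' F Fp Fm.
Proof.
move=> rr; have UU : ball t0 r' `<=` ball t0 r by exact: ball_sub rr.
move=> [[s1 h1 e1 m1] pF [s3 h3 e3] FE]; split.
- by split=> // [|t /UU|t v /UU]; [exact: smooth_sub s1|exact: h1|exact: m1].
- exact: plus_frame_sub pF.
- by split=> // [|t /UU]; [exact: smooth_sub s3|exact: h3].
- by move=> t /UU; exact: FE.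
Qed.

Lemma flat_homog j t0 U F0 : flat_family k (target_space j) (target_reality j) t0 U F0 ->
  homog_frame U t0 (fun t => unconv_flat j (F0 t)) /\
  forall t, U t -> worth j (unconv_flat j (F0 t)).
Proof.
case=> -[oU _ Ut0] [sF HF MF] bF _.
have HW t : U t -> worth j (unconv_flat j (F0 t)).
  by move=> Ut; apply/wsym_conv; rewrite unconv_flatK; apply/loops_sigmaP; exact: HF.
have bu : blin (unconv_flat j : W -> W) by exact: unconv_blin.
have sX := smooth_blin oU bu sF.
split=> //; split=> // [t /HW[]//||t v Ut].
  have -> : F0 t0 = 1.
    by apply: evM_inj => z z1; rewrite evM1 -(ev_evM _ z1); exact: bF.
  by have := conv_flatK j (1 : W); rewrite conv_one.
have [FF _ _ _] := HW t Ut; rewrite (derive_lin v bu sF Ut).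
pose Xi := conv_flat j (wtr (unconv_flat j (F0 t))).
have XiX : Xi * F0 t = 1 by rewrite -{1}(unconv_flatK j (F0 t)) -conv_mul FF conv_one.
have [h1 h2] := (mc_laurentP _ (lexx 1) XiX).1 (MF t v Ut).
have -> : wtr (unconv_flat j (F0 t)) * unconv_flat j ('D_v F0 t) = unconv_flat j (Xi * 'D_v F0 t).
  by rewrite -[LHS](conv_flatK j) conv_mul unconv_flatK.
by split; [exact: (unconv_keeps j 1 _).1|exact: (unconv_keeps j 1 _).2].
Qed.

(** The definition of a flat family does not say that its frame is a plus loop; this follows from
    homogeneity of the form and the value at t0. *)
Lemma flat_plus j t0 U F0 : flat_family k (target_space j) (target_reality j) t0 U F0 ->
  exists Fp, exists2 r : R, 0 < r & [/\ ball t0 r `<=` U, plus_frame j (ball t0 r) t0 Fp &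
    forall t, F0 t = conv_flat j (Fp t)].
Proof.
move=> fF; have [hF wF] := flat_homog fF; have [[oU _ Ut0] _ _ _] := fF.
have [r r0 [BU P1]] := homog_plus1 oU Ut0 hF.
exists (fun t => unconv_flat j (F0 t)), r => //; split=> // [|t]; last by rewrite unconv_flatK.
have [s1 _ e1 m1] := hF.
split=> // [|t Bt|t v /BU]; [exact: smooth_sub s1| |exact: m1].
by split; [exact/wF/BU|exact: P1].
Qed.

Lemma mul_blinl K : blin (fun X => X * K).
Proof. exact: (bbil_blinl K wmul_bil). Qed.

Lemma curved_split j t0 U Phi : curved_family k j t0 U Phi ->
  exists F Fp Fm, exists2 r : R, 0 < r & [/\ ball t0 r `<=` U, split_data j t0 r F Fp Fm &
    forall t, ball t0 r t -> Phi t = coset (HH j) (F t)].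
Proof.
case=> -[oU _ Ut0] qF qb _.
have [U' [F' [oW Wt0 WU /framesP[sF HF MF] PhiE]]] := qF t0 Ut0.
(* The class at t0 is that of 1, so right multiplication by a constant loop K turns the local lift
   into one with value 1 at t0 and the same classes. *)
have : coset (HH j) (F' t0) (1 : W) by rewrite -PhiE// qb; apply/wconstP; exact: wconst1.
move=> /cosetP[K KH E1].
pose F t := F' t * K.
have cF : curved_frame j U' t0 F.
  have [hK K0 K0'] := KH.
  split=> [|t Ut||t v Ut].
  - exact: smooth_blin oW (mul_blinl K) sF.
  - by apply: wHtM => //; exact: HF.
  - by rewrite /F -E1.
  - rewrite /mcform (derive_lin v (mul_blinl K) sF Ut) wtrM.
    have [m1 m2] := MF t v Ut.
    have -> : wtr K * wtr (F' t) * ('D_v F' t * K) = wtr K * mcform F' t v * K.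
      by rewrite /mcform !mulrA.
    split; [have := supgeM (supgeM (wtr_supge K0) m1) K0|have := supleM (supleM (wtr_suple K0') m2) K0'].
      by rewrite add0r addr0.
    by rewrite add0r addr0.
have [Fp [Fm [r r0 [BU pF mF FE]]]] := frame_split oW Wt0 cF.
exists F, Fp, Fm, r => //; split.
- exact: subset_trans BU WU.
- split=> //; have [s1 h1 e1 m1] := cF.
  by split=> // [|t /BU|t v /BU]; [exact: smooth_sub s1|exact: h1|exact: m1].
- by move=> t /BU Wt; rewrite PhiE// /F coset_mulr.
Qed.

Lemma conv_rot_sig j X : wsig (conv_rot j X) = conv_rot j (wsig X).
Proof.
apply: evM_inj => z z1; have zn : `|- z| = 1 by rewrite normrN.
rewrite (evM_sig _ z1) (evM_conv_rot j _ z1) (evM_conv_rot j _ zn) (evM_sig _ (conv_pt_norm j z1)).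
by have -> : conv_pt j (- z) = - conv_pt j z by case: (j) => //=; rewrite mulrN.
Qed.

Lemma plus_flat j t0 U Fp : open U -> U t0 -> plus_frame j U t0 Fp ->
  exists2 rho : R, 0 < rho & forall r, 0 < r <= rho ->
    flat_family k (target_space j) (target_reality j) t0 (ball t0 r) (fun t => conv_flat j (Fp t)).
Proof.
move=> oU Ut0 [sP HP P1 MP]; have ca := @conv_rot_auto R n k j; have [cb cM c1 cT'] := ca.
have ck := @conv_rot_keeps R n k j.
have H := @flat_family_of R n k (target_space j) (target_reality j) (conv_mx j) (conv_mxi j) U t0 (fun t => conv_rot j (Fp t)).
apply: H.
- by case: (j).
- by [].
- by [].
- split=> [|t /HP[[hO _ _ _] _]||t v Ut].
  + exact: smooth_blin oU cb sP.
  + exact: orth_auto ca hO.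
  + by rewrite P1.
  + rewrite (derive_lin v cb sP Ut) -cT' -cM; have [m1 m2] := MP t v Ut.
    by split; [exact: (ck _ _).1|exact: (ck _ _).2].
- by move=> t /HP[_ p1]; exact: plus1_auto ca ck p1.
- exact: conv_mxV.
- exact: P_conv_mx.
- exact: P_conv_mxi.
- by move=> t /HP[[_ _ hs _] _]; rewrite conv_rot_sig hs.
- by move=> t /HP[wP _]; exact/wsym_conv.
Qed.

Lemma plus_curved j t0 U Fp : open U -> U t0 -> plus_frame j U t0 Fp ->
  exists F Fm, exists2 r : R, 0 < r & [/\ ball t0 r `<=` U, split_data j t0 r F Fp Fm &
    curved_family k j t0 (ball t0 r) (fun t => coset (HH j) (F t))].
Proof.
move=> oU Ut0 pF; have [F [Fm [r r0 [BU cF mF FE]]]] := frame_unsplit oU Ut0 pF.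
have sd : split_data j t0 r F Fp Fm by split=> //; exact: plus_frame_sub pF.
have [r' r'0 h] := curved_family_of r0 sd.
exists F, Fm, (Num.min r r'); first by rewrite lt_min r0.
have le1 : Num.min r r' <= r by rewrite ge_min lexx.
split; [exact: subset_trans (ball_sub le1) BU|exact: split_sub le1 sd|].
by apply: h; rewrite lt_min r0 r'0 ge_min lexx orbT.
Qed.

Definition split_at j X Xp Xm :=
  [/\ wHt j X, worth j Xp /\ plus1 Xp, worth j Xm /\ suple 0 Xm & X = Xp * Xm].

Lemma split_data_at j t0 r F Fp Fm t : split_data j t0 r F Fp Fm -> ball t0 r t ->
  split_at j (F t) (Fp t) (Fm t).
Proof.
by move=> [[_ h1 _ _] [_ h2 _ _] [_ h3 _] FE] Bt; split; [exact: h1|exact: h2|exact: h3|exact: FE].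
Qed.

(* If the plus parts agree then [wtr X * X'] is both [suple 0] and fixed by
   [wtau], hence a constant loop. *)
Lemma coset_split j X Xp Xm X' Xp' Xm' : split_at j X Xp Xm -> split_at j X' Xp' Xm' ->
  coset (HH j) X = coset (HH j) X' <-> Xp = Xp'.
Proof.
move=> [hX [wp pp] [wm mm] XE] [hX' [wp' pp'] [wm' mm'] XE'].
have [[oXp _ _ _] [oXp' _ _ _] [oXm _ _ _]] := And3 wp wp' wm.
split=> [h|pE].
  have : coset (HH j) X X' by rewrite h; exact: coset_self.
  move=> /cosetP[K [[[oK _ _ _] _] _ K0] E1].
  have mK : suple 0 (Xm * K) by have := supleM mm K0; rewrite addr0.
  apply: (birkhoff_uniq pp pp' mK mm' oXp' _ _).1; first exact: orthM.
  by rewrite mulrA -XE -E1.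
pose K := wtr X * X'.
have hK : wHt j K by apply: wHtM => //; exact: wHt_tr.
have KE : K = wtr Xm * Xm'.
  by rewrite /K XE XE' wtrM -pE -mulrA (mulrA (wtr Xp)) oXp mul1r.
have K0 : suple 0 K by rewrite KE; have := supleM (wtr_suple mm) mm'; rewrite addr0.
have KH : wconst j K.
  split=> //; rewrite -hK.2; have := (@wtau_flips R n k 0 K).2 K0.
  by rewrite oppr0.
have [[oX _ _ _] _] := hX.
by rewrite -(coset_mulr X KH) /K mulrA (wmul1C oX) mul1r.
Qed.

(** The graph of the correspondence on representatives: it allows any splitting, so that the germ
    map does not depend on one. *)
Definition related j t0 Phi (F0 : E -> W) := exists F Fp Fm, exists2 r : R, 0 < r &
  split_data j t0 r F Fp Fm /\
  forall t, ball t0 r t -> Phi t = coset (HH j) (F t) /\ F0 t = conv_flat j (Fp t).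

(** One direction makes the map on germs well defined, the other makes it injective. *)
Lemma related_near j t0 Phi F0 Phi' F0' : related j t0 Phi F0 -> related j t0 Phi' F0' ->
  (\forall t \near t0, Phi t = Phi' t) <-> (\forall t \near t0, F0 t = F0' t).
Proof.
move=> [F [Fp [Fm [r r0 [sd h]]]]] [F' [Fp' [Fm' [r' r'0 [sd' h']]]]].
have nr (s : R) : 0 < s -> \forall t \near t0, ball t0 s t.
  by move=> s0; exact: nbhsx_ballx.
have iff t : ball t0 r t -> ball t0 r' t -> Phi t = Phi' t <-> F0 t = F0' t.
  move=> Bt Bt'; have [[-> ->] [-> ->]] := (h t Bt, h' t Bt').
  have [c1 c2] := coset_split (split_data_at sd Bt) (split_data_at sd' Bt').
  split=> [/c1 -> //|e]; apply: c2.
  by rewrite -(conv_flatK j (Fp t)) e conv_flatK.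
split=> e; apply: filterS (filterI (nr r r0) (filterI (nr r' r'0) e)) => t [B [B' et]].
  exact/(iff t).
exact/(iff t).
Qed.

(** The default [set0] is the value on sets that are not germs of related representatives. *)
Definition germ_map j t0 (g : set (E -> set (wiener R n k))) : set (E -> wiener R n k) :=
  xget set0 [set h | exists Phi F0,
    [/\ g = germ t0 Phi, related j t0 Phi F0 & h = germ t0 F0]].

Lemma germ_mapE j t0 Phi F0 : related j t0 Phi F0 -> germ_map j t0 (germ t0 Phi) = germ t0 F0.
Proof.
move=> rel; rewrite /germ_map; set S := [set _ | _].
have : S (xget set0 S) by apply: xgetPex; exists (germ t0 F0), Phi, F0.
move=> [Phi' [F0' [/germP e rel' ->]]]; apply/germP.
apply/(related_near rel' rel); apply: filterS e => t ->; by [].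
Qed.

Lemma curved_flat j t0 U Phi : curved_family k j t0 U Phi ->
  exists F Fp Fm, exists2 r : R, 0 < r & [/\ split_data j t0 r F Fp Fm,
    forall t, ball t0 r t -> Phi t = coset (HH j) (F t) &
    flat_family k (target_space j) (target_reality j) t0 (ball t0 r) (fun t => conv_flat j (Fp t))].
Proof.
move=> /curved_split[F [Fp [Fm [r r0 [_ sd PhiE]]]]].
have [_ pF _ _] := sd; have [oB B0] := ball_based_open t0 r0.
have [r' r'0 h] := plus_flat oB B0 pF.
exists F, Fp, Fm, (Num.min r r'); first by rewrite lt_min r0.
have le1 : Num.min r r' <= r by rewrite ge_min lexx.
split; [exact: split_sub le1 sd|by move=> t /(ball_sub le1); exact: PhiE|].
by apply: h; rewrite lt_min r0 r'0 ge_min lexx orbT.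
Qed.

Lemma germ_map_bij j t0 : set_bij (germs t0 (curved_family k j t0))
  (germs t0 (flat_family k (target_space j) (target_reality j) t0)) (germ_map j t0).
Proof.
have rl U Phi : curved_family k j t0 U Phi -> exists2 F0, related j t0 Phi F0 &
    exists U', flat_family k (target_space j) (target_reality j) t0 U' F0.
  move=> /curved_flat[F [Fp [Fm [r r0 [sd PhiE fF]]]]].
  exists (fun t => conv_flat j (Fp t)); last by exists (ball t0 r).
  by exists F, Fp, Fm, r => //; split=> // t Bt; split=> //; exact: PhiE.
split.
- move=> g [U [Phi [/rl[F0 rel [U' fF]] ->]]]; rewrite /= (germ_mapE rel).
  by exists U', F0.
- move=> g g' /set_mem[U [Phi [/rl[F0 rel _] ->]]] /set_mem[U' [Phi' [/rl[F0' rel' _] ->]]].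
  rewrite (germ_mapE rel) (germ_mapE rel') => /germP e.
  by apply/germP/(related_near rel rel').
(* Surjectivity: the plus frame underlying the flat family is completed to a curved frame by
   [frame_unsplit]. *)
- move=> h [U [F0 [fF ->]]]; have [Fp [r r0 [BU pF F0E]]] := flat_plus fF.
  have [oB B0] := ball_based_open t0 r0.
  have [F [Fm [r' r'0 [_ sd cP]]]] := plus_curved oB B0 pF.
  exists (germ t0 (fun t => coset (HH j) (F t))).
    by exists (ball t0 r'), (fun t => coset (HH j) (F t)).
  by apply: germ_mapE; exists F, Fp, Fm, r'.
Qed.

Lemma plus1_0 X : plus1 X -> toM (X 0) = 1%:M.
Proof.
move=> /(_ 0 ltr01); rewrite l1B => /subr0_eq ->.
have -> : (1 : W) = wcst 1%:M by rewrite wcst1.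
by rewrite /wcst deltaE eqxx ofMK.
Qed.

Lemma worth_loop j X : worth j X -> loop_group Sphere (X : wiener R n k).
Proof. by move=> [XX dX _ _]; apply/loop_groupP; split=> //; rewrite wcst1 mulr1. Qed.

(** Frequency supports are turned into holomorphic extensions; for the minus factor the coordinate
    is first inverted by [winv]. *)
Lemma split_right_birkhoff j X Xp Xm : split_at j X Xp Xm ->
  right_birkhoff (X : wiener R n k) (Xp : wiener R n k) (Xm : wiener R n k).
Proof.
move=> [_ [wp pp] [wm mm] ->]; split.
- by split; [exact: worth_loop wp|exact: worth_loop wm].
- by move=> z z1; rewrite (ev_evM _ z1) (ev_evM _ z1) (ev_evM _ z1) (evMM _ _ z1).
- by exists (hext Xp); [exact/extends_hext/plus1_supge|rewrite hext0; exact: plus1_0].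
- have m0 : supge 0 (winv Xm) by have := (winv_flips 0 Xm).2 mm; rewrite oppr0.
  exists (hext (winv Xm)); have [c1 d1 e1] := extends_hext m0; split; [exact: c1|exact: d1|move=> z z1].
  rewrite (e1 z z1) (ev_evM _ z1) (evM_inv _ z1) -ev_evM//; exact: norm_inv1.
Qed.

Lemma split_birkhoff_plus j t0 r Phi F Fp Fm : split_data j t0 r F Fp Fm ->
  (forall t, ball t0 r t -> Phi t = coset (HH j) (F t)) ->
  birkhoff_plus j t0 Phi (ball t0 r) (Fp : E -> wiener R n k).
Proof.
move=> sd PhiE; exists F, Fm; split.
- by have [[s1 h1 _ m1] _ _ _] := sd; apply/framesP.
- by have [[_ _ e1 _] _ _ _] := sd; move=> z z1; rewrite e1 (ev_evM _ z1) evM1.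
- exact: PhiE.
- by move=> t Bt; exact: (split_right_birkhoff (split_data_at sd Bt)).
Qed.

(** For R_1 and R_2 the condition [kap j] is [wrho j] itself. *)
Lemma plus_frames j U t0 Fp : j <> Rm1 -> plus_frame j U t0 Fp ->
  frames (loops_sigma Sphere j) 1 1 U (Fp : E -> wiener R n k).
Proof.
move=> jR [sP HP _ MP]; split=> // [t Ut|t v Ut]; have [[hO hD hS hK] _] := HP t Ut.
  apply/loops_sigmaP; split=> //; first by rewrite wcst1 mulr1.
  by case: (j) jR hK.
exact/(mc_laurentP _ (lexx 1) hO)/MP.
Qed.

Lemma germ_map_flat j t0 : j <> Rm1 -> canonical_flat (k := k) j t0 (germ_map j t0).
Proof.
move=> jR U Phi /curved_flat[F [Fp [Fm [r r0 [sd PhiE fF]]]]].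
exists (ball t0 r), Fp, (fun t => conv_flat j (Fp t)); split.
- exact: split_birkhoff_plus sd PhiE.
- by have [_ pF _ _] := sd; exact: plus_frames jR pF.
- by case: (j) jR fF.
- move=> t Bt z z1; rewrite (ev_evM _ z1) (evM_conv _ _ z1).
  have z2 := conv_pt_norm j z1; rewrite -(ev_evM _ z2).
  by case: (j) jR => // _; rewrite /= mul1mx mulmx1.
- by apply: germ_mapE; exists F, Fp, Fm, r => //; split=> // t Bt; split=> //; exact: PhiE.
Qed.

Lemma germ_map_hyperbolic t0 : canonical_hyperbolic (k := k) t0 (germ_map Rm1 t0).
Proof.
move=> U Phi /curved_flat[F [Fp [Fm [r r0 [sd PhiE fF]]]]].
exists (ball t0 r), Fp, (fun t => conv_flat Rm1 (Fp t)); split.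
- exact: split_birkhoff_plus sd PhiE.
- exact: fF.
- move=> t Bt z z1; rewrite (ev_evM _ z1) (evM_conv _ _ z1) (ev_evM _ z1).
  by rewrite (invmx_eq (mulmx1C TTi)).
- by apply: germ_mapE; exists F, Fp, Fm, r => //; split=> // t Bt; split=> //; exact: PhiE.
Qed.

End Assembly.

Theorem theorem7p5 (R : realType) (n k : nat) (t0 : 'rV[R]_n)
    (hk : (n <= k.+1)%N) :
  (exists Bneg Bpos,
    [/\ set_bij (germs t0 (curved_family k R1 t0))
          (germs t0 (flat_family k Sphere R2 t0)) Bneg,
        canonical_flat R1 t0 Bneg,
        set_bij (germs t0 (curved_family k R2 t0))
          (germs t0 (flat_family k Sphere R2 t0)) Bpos &
        canonical_flat R2 t0 Bpos]) /\
  (exists Bhyp,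
    set_bij (germs t0 (curved_family k Rm1 t0))
      (germs t0 (flat_family k Hyperbolic R1 t0)) Bhyp /\
    canonical_hyperbolic t0 Bhyp).
Proof.
split.
  exists (germ_map R1 t0), (germ_map R2 t0); split.
  - exact: germ_map_bij R1 t0.
  - exact: germ_map_flat.
  - exact: germ_map_bij R2 t0.
  - exact: germ_map_flat.
exists (germ_map Rm1 t0); split; [exact: germ_map_bij Rm1 t0|exact: germ_map_hyperbolic].
Qed.
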